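(* Let $c\ge2$, $t\ge2$, and let $\mathcal{A}$ be a $t\times(t+c-1)$ homogeneous matrix whose entries are general forms of positive degree, defining a standard determinantal scheme $X\subset\mathbb{P}^n$ of codimension $c$. Let $I=I_t(\mathcal{A})=I(X)$, $A=R/I$, and let $K_A$ be the canonical module of $A$. Then: (i) $H^k_{\mathfrak{m}}(I/I^2)=0$ for $k<n-2c+2$ or, equivalently, $\operatorname{Ext}^j_A(I/I^2,K_A)=0$ for $c\le j\le n-c+1$. (ii) $H^k_{\mathfrak{m}}(I/I^2)=0$ for $\max(3,n-2c+2)<k<n-c+1$.
   Context: $K$ is an algebraically closed field of characteristic $0$, $R=K[x_0,\dots,x_n]$ with its standard grading, $\mathfrak{m}=(x_0,\dots,x_n)$, $\mathbb{P}^n=\operatorname{Proj}(R)$; $H^k_{\mathfrak{m}}$ is local cohomology. For a homogeneous matrix $\mathcal{A}$, $I_j(\mathcal{A})$ is the ideal of $R$ generated by its $j\times j$ minors. A codimension $c$ subscheme $X\subset\mathbb{P}^n$ is standard determinantal if its saturated ideal is $I(X)=I_t(\mathcal{A})$ for some $t\times(t+c-1)$ homogeneous matrix $\mathcal{A}$ (a matrix representing a graded degree $0$ morphism $\bigoplus_{j=1}^{t+c-1}R(-a_j)\to\bigoplus_{i=1}^tR(-b_i)$, with entry degrees $a_j-b_i$). ''General forms'' means that the matrix belongs to a suitable non-empty Zariski open subset of the space of matrices with the given entry degrees. $K_A=\operatorname{Ext}^c_R(A,R)(-n-1)$. *)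

(* Defs.v *)
From HB Require Import structures.
From mathcomp Require Import all_boot all_order all_algebra.
From mathcomp Require Import ring_quotient generic_quotient.
From mathcomp Require Import boolp.
From mathcomp Require Import mpoly.

Set Implicit Arguments.
Unset Strict Implicit.
Unset Printing Implicit Defensive.

Import GRing.Theory.
Local Open Scope ring_scope.
Local Open Scope quotient_scope.

Section Ideals.
Variable R : comNzRingType.
Implicit Types (S J : R -> Prop) (p r x : R).

Definition ideal_gen S p : Prop :=
  exists2 s : seq (R * R),
    (forall u, u \in s -> S u.2) & p = \sum_(u <- s) u.1 * u.2.

Definition ideal_pow J (k : nat) : R -> Prop :=
  ideal_gen (fun p => exists2 f : 'I_k -> R,
                        (forall i, J (f i)) & p = \prod_(i < k) f i).

Definition saturated (m J : R -> Prop) : Prop :=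
  forall p, (exists k, forall r, ideal_pow m k r -> J (r * p)) -> J p.

(* A strictly increasing chain of h + 1 primes ending at P, i.e. ht P >= h. *)
Definition prime_chain (h : nat) (P : prime_idealr R) : Prop :=
  exists2 C : nat -> prime_idealr R,
    (forall i, (i < h)%N ->
       {subset (C i : {pred R}) <= (C i.+1 : {pred R})} /\
       exists2 x, x \in (C i.+1 : {pred R}) & x \notin (C i : {pred R}))
    & (C h : {pred R}) =i (P : {pred R}).

Definition has_height J (h : nat) : Prop :=
  (forall P : prime_idealr R,
     (forall x, J x -> x \in (P : {pred R})) -> prime_chain h P) /\
  (exists2 P : prime_idealr R,
     (forall x, J x -> x \in (P : {pred R})) & ~ prime_chain h.+1 P).

Lemma ideal_gen0 S : ideal_gen S 0.
Proof. by exists [::]; rewrite ?big_nil. Qed.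

Lemma ideal_genD S p q : ideal_gen S p -> ideal_gen S q -> ideal_gen S (p + q).
Proof.
move=> [s hs ->] [s' hs' ->]; exists (s ++ s'); rewrite ?big_cat // => u.
by rewrite mem_cat => /orP[/hs|/hs'].
Qed.

Lemma ideal_genM S r p : ideal_gen S p -> ideal_gen S (r * p).
Proof.
move=> [s hs ->]; exists [seq (r * u.1, u.2) | u <- s].
  by move=> u /mapP[v /hs Sv ->].
by rewrite big_map mulr_sumr; apply: eq_bigr => u _; rewrite mulrA.
Qed.

End Ideals.

Definition restr (R A : nzRingType) (f : {rmorphism R -> A}) (M : lmodType A) :
  Type := M.

Section RestrictionOfScalars.
Variables (R A : nzRingType) (f : {rmorphism R -> A}) (M : lmodType A).
Local Notation restr := (restr f M).

HB.instance Definition _ := GRing.Zmodule.copy restr M.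

Let scale (r : R) (x : restr) : restr := f r *: (x : M).

Fact restr_scalerA r s x : scale r (scale s x) = scale (r * s) x.
Proof. by rewrite /scale rmorphM scalerA. Qed.
Fact restr_scale1r : left_id 1 scale.
Proof. by move=> x; rewrite /scale rmorph1 scale1r. Qed.
Fact restr_scalerDr : right_distributive scale +%R.
Proof. by move=> r x y; rewrite /scale scalerDr. Qed.
Fact restr_scalerDl x : {morph scale^~ x : r s / r + s}.
Proof. by move=> r s; rewrite /scale rmorphD scalerDl. Qed.
HB.instance Definition _ := GRing.Zmodule_isLmodule.Build R restr
  restr_scalerA restr_scale1r restr_scalerDr restr_scalerDl.

End RestrictionOfScalars.

(* The conormal module I/I^2 as a module over R/I. *)
Section Conormal.
Variables (R : comNzRingType) (I : idealr R).

Definition ideal_sub : Type := {x : R | x \in (I : {pred R})}.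
HB.instance Definition _ := SubChoice.on ideal_sub.
HB.instance Definition _ := [SubChoice_isSubZmodule of ideal_sub by <:].

Definition in_square : {pred ideal_sub} :=
  fun x => `[< ideal_pow (fun p => p \in (I : {pred R})) 2 (val x) >].

Fact in_square_zmod_closed : zmod_closed in_square.
Proof.
split=> [|x y /asboolP x2 /asboolP y2]; apply/asboolP; first exact: ideal_gen0.
by rewrite raddfB /= -mulN1r; apply: ideal_genD x2 (ideal_genM _ y2).
Qed.
HB.instance Definition _ := GRing.isZmodClosed.Build ideal_sub in_square
  in_square_zmod_closed.

Definition conormal : Type := Quotient.quot in_square.
HB.instance Definition _ := EqQuotient.on conormal.
HB.instance Definition _ := GRing.Zmodule.on conormal.

Definition ideal_sub_scale (r : R) (x : ideal_sub) : ideal_sub :=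
  Sub (r * val x) (idealMr r (valP x)).

Let scale (a : {ideal_quot I}) (x : conormal) : conormal :=
  \pi_conormal (ideal_sub_scale (repr a) (repr x)).

Let conormal_piP (x y : ideal_sub) :
  (\pi_conormal x = \pi_conormal y) <-> (x - y \in in_square).
Proof. by rewrite Quotient.idealrBE; split=> [/eqP|/eqP]. Qed.

Fact conormal_scaleE (r : R) (x : ideal_sub) :
  scale (\pi r) (\pi_conormal x) = \pi_conormal (ideal_sub_scale r x).
Proof.
apply/conormal_piP/asboolP; rewrite raddfB /=.
set r' := repr _; set x' := repr _.
have r'r : r' - r \in (I : {pred R}).
  by rewrite (Quotient.idealrBE I) reprK.
have /conormal_piP/asboolP : \pi_conormal x' = \pi_conormal x by rewrite reprK.
rewrite raddfB /= => x'x.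
have -> : r' * val x' - r * val x = (r' - r) * val x' + r * (val x' - val x).
  by rewrite mulrBl mulrBr addrA subrK.
apply: ideal_genD (ideal_genM _ x'x).
exists [:: (1, (r' - r) * val x')]; last by rewrite big_seq1 mul1r.
move=> u; rewrite inE => /eqP -> /=.
exists (fun i : 'I_2 => if i == ord0 then r' - r else val x').
  by move=> i; case: ifP => // _; apply: valP.
by rewrite big_ord_recl big_ord1.
Qed.

Fact conormal_scalerA a b x : scale a (scale b x) = scale (a * b) x.
Proof.
rewrite -[a]reprK -[b]reprK -[x]reprK (conormal_scaleE (repr b)).
rewrite (conormal_scaleE (repr a)).
rewrite -rmorphM conormal_scaleE; congr (\pi _).
by apply: val_inj; rewrite /= mulrA.
Qed.

Fact conormal_scale1r : left_id 1 scale.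
Proof.
move=> x; rewrite -[x]reprK -(rmorph1 \pi_({ideal_quot I})) conormal_scaleE.
by congr (\pi _); apply: val_inj; rewrite /= mul1r.
Qed.

Fact conormal_scalerDr : right_distributive scale +%R.
Proof.
move=> a x y; rewrite -[a]reprK -[x]reprK -[y]reprK -raddfD !conormal_scaleE.
by rewrite -raddfD; congr (\pi _); apply: val_inj; rewrite /= mulrDr.
Qed.

Fact conormal_scalerDl x : {morph scale^~ x : a b / a + b}.
Proof.
move=> a b /=; rewrite -[a]reprK -[b]reprK -[x]reprK -raddfD !conormal_scaleE.
by rewrite -raddfD; congr (\pi _); apply: val_inj; rewrite /= mulrDl.
Qed.

HB.instance Definition _ := GRing.Zmodule_isLmodule.Build {ideal_quot I}
  conormal conormal_scalerA conormal_scale1r conormal_scalerDr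
  conormal_scalerDl.

End Conormal.

Section HomologicalAlgebra.
Variable R : comNzRingType.
Implicit Types M N : lmodType R.

Definition projective (P : lmodType R) : Prop :=
  forall M N (g : {linear M -> N}) (f : {linear P -> N}),
    (forall y, exists x, g x = y) ->
    exists h : {linear P -> M}, forall x, g (h x) = f x.

Definition injective_module (E : lmodType R) : Prop :=
  forall M N (g : {linear M -> N}) (f : {linear M -> E}),
    injective g -> exists h : {linear N -> E}, forall x, h (g x) = f x.

Record proj_resolution M := ProjResolution {
  pres_mod :> nat -> lmodType R;
  pres_d : forall i, {linear pres_mod i.+1 -> pres_mod i};
  pres_aug : {linear pres_mod 0 -> M};
  pres_projective : forall i, projective (pres_mod i);
  pres_surj : forall m, exists x, pres_aug x = m;
  pres_exact0 : forall x, pres_aug x = 0 <-> exists y, pres_d 0 y = x;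
  pres_exact : forall i x, pres_d i x = 0 <-> exists y, pres_d i.+1 y = x
}.

Record inj_resolution M := InjResolution {
  ires_mod :> nat -> lmodType R;
  ires_d : forall i, {linear ires_mod i -> ires_mod i.+1};
  ires_aug : {linear M -> ires_mod 0};
  ires_injective : forall i, injective_module (ires_mod i);
  ires_inj : injective ires_aug;
  ires_exact0 : forall x, ires_d 0 x = 0 <-> exists m, ires_aug m = x;
  ires_exact : forall i x, ires_d i.+1 x = 0 <-> exists y, ires_d i y = x
}.

Definition ext_cocycle M N (P : proj_resolution M) j (f : {linear P j -> N}) :=
  forall y, f (pres_d P j y) = 0.

Definition ext_coboundary M N (P : proj_resolution M) j :
    {linear P j -> N} -> Prop :=
  match j return {linear P j -> N} -> Prop with
  | 0 => fun f => forall x, f x = 0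
  | i.+1 => fun f =>
      exists g : {linear P i -> N}, forall x, f x = g (pres_d P i x)
  end.

(* Ext^j_R(M, N) = 0, i.e. H^j(Hom_R(P, N)) = 0; as this does not depend on
   the projective resolution P, all of them are quantified over. *)
Definition Ext_zero M N (j : nat) : Prop :=
  forall (P : proj_resolution M) (f : {linear P j -> N}),
    ext_cocycle f -> ext_coboundary f.

(* The A-module E is Ext^j_R(M, N) = H^j(Hom_R(P, N)), where R acts on E
   through pi : R -> A; cl maps a cocycle to its cohomology class. *)
Definition Ext_class (A : nzRingType) (pi : {rmorphism R -> A}) M N
    (P : proj_resolution M) j (E : lmodType A) (cl : {linear P j -> N} -> E) :=
  [/\ forall (r : R) (f g h : {linear P j -> N}),
        ext_cocycle f -> ext_cocycle g ->
        (forall x, h x = r *: f x + g x) -> cl h = pi r *: cl f + cl g,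
      forall e : E, exists2 f, ext_cocycle f & cl f = e
    & forall f, ext_cocycle f -> (cl f = 0 <-> ext_coboundary f)].

Definition is_Ext (A : nzRingType) (pi : {rmorphism R -> A}) M N j
    (E : lmodType A) : Prop :=
  exists (P : proj_resolution M) (cl : {linear P j -> N} -> E),
    Ext_class pi cl.

(* Gamma_J(M) *)
Definition torsion (J : R -> Prop) M (x : M) : Prop :=
  exists e, forall r, ideal_pow J e r -> r *: x = 0.

Definition torsion_boundary (J : R -> Prop) M (E : inj_resolution M) k :
    E k -> Prop :=
  match k return E k -> Prop with
  | 0 => fun x => x = 0
  | i.+1 => fun x => exists2 y : E i, torsion J y & ires_d E i y = x
  end.

(* H^k_J(M) = 0, where H^k_J is the k-th right derived functor of Gamma_J: it is
   computed by any injective resolution of M. *)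
Definition local_cohomology_zero (J : R -> Prop) M (k : nat) : Prop :=
  forall (E : inj_resolution M) (x : E k),
    torsion J x -> ires_d E k x = 0 -> torsion_boundary J x.

End HomologicalAlgebra.

Section CanonicalModule.
Variables (R : comNzRingType) (I : idealr R).

Definition quot_pi : {rmorphism R -> {ideal_quot I}} := \pi_{ideal_quot I}.

(* K_A = Ext^c_R(A, R) for A = R/I of codimension c; the degree shift of the
   graded module is dropped, as only the underlying module is used. *)
Definition canonical_module (c : nat) (KA : lmodType {ideal_quot I}) : Prop :=
  is_Ext quot_pi (restr quot_pi {ideal_quot I}^o) R^o c KA.

End CanonicalModule.

Section Determinantal.
Variables (K : fieldType) (n : nat).
Local Notation R := {mpoly K[n.+1]}.

Definition irrelevant_ideal : R -> Prop :=
  ideal_gen (fun p => exists i : 'I_n.+1, p = 'X_i).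

Section Matrices.
Variables (t s : nat).

Definition minor (j : nat) (M : 'M[R]_(t, s)) (p : R) : Prop :=
  exists (f : 'I_j -> 'I_t) (g : 'I_j -> 'I_s),
    [/\ {homo f : i k / (i < k)%N}, {homo g : i k / (i < k)%N}
      & p = \det (mxsub f g M)].

Definition minor_ideal (j : nat) (M : 'M[R]_(t, s)) : R -> Prop :=
  ideal_gen (minor j M).

Variable d : 'I_t -> 'I_s -> nat.

Definition homogeneous_mx (M : 'M[R]_(t, s)) : Prop :=
  forall i j, M i j \is (d i j).-homog.

(* The homogeneous matrices with entry degrees d form an affine space, with one
   coordinate for each entry and each monomial of the degree of that entry. *)
Definition mx_coord : finType :=
  {x : 'I_t * 'I_s * 'X_{1..n.+1 < (\max_i \max_j d i j).+1}
     | mdeg x.2 == d x.1.1 x.1.2}.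

Definition mx_coords (M : 'M[R]_(t, s)) (k : 'I_#|mx_coord|) : K :=
  let x := val (enum_val k) in (M x.1.1 x.1.2)@_(x.2).

Definition zariski_open (U : 'M[R]_(t, s) -> Prop) : Prop :=
  exists F : {mpoly K[#|mx_coord|]} -> Prop,
    forall M, homogeneous_mx M ->
      (U M <-> exists2 f, F f & f.@[mx_coords M] != 0).

Definition for_general_mx (Q : 'M[R]_(t, s) -> Prop) : Prop :=
  exists U : 'M[R]_(t, s) -> Prop,
    [/\ zariski_open U, exists2 M, homogeneous_mx M & U M
      & forall M, homogeneous_mx M -> U M -> Q M].

End Matrices.

(* I = I_t(M) is the saturated ideal of a scheme of codimension c in P^n. *)
Definition standard_determinantal (t c : nat) (M : 'M[R]_(t, t + c - 1))
    (I : idealr R) : Prop :=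
  [/\ forall p, p \in (I : {pred R}) <-> minor_ideal t M p,
      saturated irrelevant_ideal (fun p => p \in (I : {pred R}))
    & has_height (fun p => p \in (I : {pred R})) c].

End Determinantal.

(* Submission.v *)
Require Import Defs.
From HB Require Import structures.
From mathcomp Require Import functions.
From mathcomp Require Import all_boot all_order all_algebra.
From mathcomp Require Import ring_quotient generic_quotient perm.
From mathcomp Require Import boolp.
From mathcomp Require classical_sets.
From mathcomp Require Import mpoly.
From mathcomp Require Import ring zify.

(** Let X be the matrix, I = I_t(X), and let L be the exterior algebra on the
    columns, so that the rows become anticommuting operators om_k on L. Over
    polynomials in two sets of variables y, z the strands of the Koszul operators
    sum_k om_k d/dy_k and sum_k om_k d/dz_k are the Eagon-Northcott and
    Buchsbaum-Rim complexes. They are exact after inverting a t-minor (resp. a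
    (t-1)-minor) because a contraction dual to the rows is a homotopy up to a
    diagonalisable operator; a depth argument (Koszul homology and graded
    Nakayama) turns exactness on such open sets into exactness. A complex
    resolving I/I^2 by modules over R/(I + al.z) follows, where the sl_2 action
    on (y, z) splits the relevant cone; this bounds the depth of I/I^2 and makes
    Ext_R^i(I/I^2, R) vanish for i >= 2c, whence (i) by shifting dimensions along
    the I-torsion of an injective resolution of R. For (ii), the complex
    I/I^2 -> L0^s -> L0^t -> R/I, with L0 the cokernel of om on L^c, has homology
    killed by powers of the (t-1)-minors, whose locus has codimension 2c + 2.
    The depth arguments only need the radicals of the ideals generated by c
    consecutive t-minors, resp. by all (t-1)-minors, together with the remaining
    variables, to be irrelevant; this is a rank condition on a coefficient
    matrix, hence open, and a banded matrix of powers of linear forms satisfies it. *)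

(** The two ranges have three sources. Adjoining the column z to the matrix turns I into I + al.z,
    for which resolutions of length c + 1 are expected. In z-degrees below c, however, the last map
    of the cone is sum_k z_k d/dy_k acting where the y-degree exceeds the z-degree; there sl_2 makes
    it split injective and the length drops to c. A complex of c such modules makes I/I^2 behave as
    a module of projective dimension at most 2c - 1, which is the bound behind (i). Since A is
    Cohen-Macaulay of codimension c, the I-torsion of an injective resolution of R has cohomology in
    degree c only, namely K_A, so Ext_A^j(-, K_A) is controlled by Ext_R^(c+j)(-, R): hence j >= c.
    In (ii) each of the three arrows costs one degree above the dimension of the locus of the
    (t-1)-minors, whence both 3 and n - 2c + 2. Modules occur as subquotients Z/B of an ambient
    module, and vanishing is a predicate on pairs (Z, B); kernels, images and cokernels then need no
    new types. A minor De is never inverted: a class vanishes on its chart when a power of De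
    carries it into B. *)

Set Implicit Arguments.
Unset Strict Implicit.
Unset Printing Implicit Defensive.

Import GRing.Theory.
Local Open Scope ring_scope.

(* Decision procedure for the identities of abelian groups, by reflection. *)
Inductive zexp := Zzero | Zvar of nat | Zadd of zexp & zexp | Zopp of zexp.

Fixpoint zeval (V : zmodType) (env : seq V) (e : zexp) : V :=
  match e with
  | Zzero => 0
  | Zvar n => env`_n
  | Zadd a b => zeval env a + zeval env b
  | Zopp a => - zeval env a
  end.

Fixpoint zcoef (e : zexp) (i : nat) : int :=
  match e with
  | Zzero => 0
  | Zvar n => (n == i)%:Z
  | Zadd a b => zcoef a i + zcoef b i
  | Zopp a => - zcoef a i
  end.

Lemma zevalE (V : zmodType) (env : seq V) e :
  zeval env e = \sum_(i < size env) env`_i *~ zcoef e i.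
Proof.
elim: e => [|n|a IHa b IHb|a IHa] /=.
- by rewrite big1.
- have [lt_n|ge_n] := ltnP n (size env); last first.
    by rewrite nth_default // big1 // => i _; rewrite gtn_eqF // (leq_trans _ ge_n).
  rewrite (bigD1 (Ordinal lt_n)) //= eqxx mulr1z big1 ?addr0 // => i ne_in.
  by rewrite -val_eqE /= eq_sym in ne_in; rewrite (negPf ne_in).
- by rewrite IHa IHb -big_split; apply: eq_bigr => i _; rewrite mulrzDr.
- by rewrite IHa -sumrN; apply: eq_bigr => i _; rewrite mulrNz.
Qed.

Lemma zevalP (V : zmodType) (env : seq V) e1 e2 :
  all (fun i => zcoef e1 i == zcoef e2 i) (iota 0 (size env)) ->
  zeval env e1 = zeval env e2.
Proof.
move/allP=> h; rewrite !zevalE; apply: eq_bigr => i _.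
by rewrite (eqP (h i _)) // mem_iota /=.
Qed.

Ltac zsame x y := first [constr_eq x y | unify x y].
Ltac zmem x env :=
  lazymatch env with
  | nil => constr:(false)
  | cons ?y ?l => match constr:(Set) with
      | _ => let _ := match constr:(Set) with _ => zsame x y end in constr:(true)
      | _ => zmem x l end
  end.
Ltac zindex x env :=
  lazymatch env with
  | cons ?y ?l => match constr:(Set) with
      | _ => let _ := match constr:(Set) with _ => zsame x y end in constr:(O)
      | _ => let n := zindex x l in constr:(S n) end
  end.
Ltac zatoms t env :=
  lazymatch t with
  | 0%R => env
  | (?a + ?b)%R => let env' := zatoms a env in zatoms b env'
  | (- ?a)%R => zatoms a env
  | _ => lazymatch zmem t env with true => env | false => constr:(cons t env) end
  end.
Ltac zreify t env :=
  lazymatch t with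
  | 0%R => constr:(Zzero)
  | (?a + ?b)%R => let x := zreify a env in let y := zreify b env in constr:(Zadd x y)
  | (- ?a)%R => let x := zreify a env in constr:(Zopp x)
  | _ => let n := zindex t env in constr:(Zvar n)
  end.
Ltac abel :=
  lazymatch goal with
  | |- @eq ?T ?a ?b =>
    let env0 := zatoms a (@nil T) in let env := zatoms b env0 in
    let x := zreify a env in let y := zreify b env in
    refine (@zevalP _ env x y _); vm_compute; reflexivity
  end.
Ltac modr := rewrite ?(scalerDr, scalerDl, scalerN, scaleNr, scaler0, scale0r, scale1r, scalerA); abel.

(** * Koszul complexes of subquotients and local cohomology *)

Definition submod (R : pzRingType) (M : lmodType R) (Z : M -> Prop) : Prop :=
  Z 0 /\ forall a u v, Z u -> Z v -> Z (a *: u + v).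

Section SubmodTheory.
Variables (R : pzRingType) (M : lmodType R) (Z : M -> Prop).
Hypothesis sZ : submod Z.

Lemma submod0 : Z 0. Proof. by case: sZ. Qed.
Lemma submodD u v : Z u -> Z v -> Z (u + v).
Proof. by case: sZ => _ h hu hv; rewrite -[u]scale1r; apply: h. Qed.
Lemma submodZ a u : Z u -> Z (a *: u).
Proof. by case: sZ => h0 h hu; rewrite -[_ *: _]addr0; apply: h. Qed.
Lemma submodN u : Z u -> Z (- u).
Proof. by move=> hu; rewrite -scaleN1r; exact: submodZ hu. Qed.
Lemma submodB u v : Z u -> Z v -> Z (u - v).
Proof. by move=> hu /submodN hv; exact: submodD hu hv. Qed.
Lemma submod_sum (I : Type) (r : seq I) (P : pred I) (F : I -> M) :
  (forall i, P i -> Z (F i)) -> Z (\sum_(i <- r | P i) F i).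
Proof. by move=> h; apply: (big_ind Z submod0 submodD h). Qed.
Lemma submodDr u v : Z v -> Z (u + v) -> Z u.
Proof. by move=> hv /submodB /(_ hv); rewrite addrK. Qed.
Lemma submodBr u v : Z v -> Z (u - v) -> Z u.
Proof. by move=> hv /submodD /(_ hv); rewrite subrK. Qed.
End SubmodTheory.

Lemma submodT (R : pzRingType) (M : lmodType R) : submod (fun _ : M => True).
Proof. by []. Qed.
Lemma submod00 (R : pzRingType) (M : lmodType R) : submod (fun u : M => u = 0).
Proof. by split=> // a u v -> ->; rewrite scaler0 addr0. Qed.
Lemma submod_ker (R : pzRingType) (M N : lmodType R) (f : {linear M -> N})
  (B : N -> Prop) : submod B -> submod (fun u => B (f u)).
Proof.
move=> sB; split=> [|a u v hu hv]; first by rewrite linear0; exact: submod0 sB.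
by rewrite linearP; apply: (submodD sB) => //; apply: (submodZ sB).
Qed.
Lemma submodI (R : pzRingType) (M : lmodType R) (A B : M -> Prop) :
  submod A -> submod B -> submod (fun u => A u /\ B u).
Proof.
move=> [a0 aD] [b0 bD]; split=> // a u v [? ?] [? ?].
by split; [apply: aD|apply: bD].
Qed.
(* f Z + B *)
Definition imP (R : pzRingType) (M N : lmodType R) (f : M -> N) (Z : M -> Prop)
  (B : N -> Prop) (v : N) : Prop := exists2 u, Z u & B (v - f u).
Lemma submod_im (R : pzRingType) (M N : lmodType R) (f : {linear M -> N})
  (Z : M -> Prop) (B : N -> Prop) : submod Z -> submod B -> submod (imP f Z B).
Proof.
move=> sZ sB; split.
  exists 0; first exact: submod0 sZ.
  rewrite linear0 subr0. exact: (submod0 sB).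
move=> a u v [u' hu' bu] [v' hv' bv]; exists (a *: u' + v').
  by apply: (submodD sZ) => //; apply: (submodZ sZ).
have -> : a *: u + v - f (a *: u' + v') = a *: (u - f u') + (v - f v').
  by rewrite linearP scalerBr opprD addrACA.
by apply: (submodD sB) => //; apply: (submodZ sB).
Qed.

(* The Koszul complex is iterated as a mapping cone, all degrees together. *)
Fixpoint KT (R : comNzRingType) (l : seq R) (M : lmodType R) : lmodType R :=
  if l is _ :: l' then (KT l' M * KT l' M)%type : lmodType R else M.

Section Koszul.
Variables (R : comNzRingType) (M : lmodType R).

(** The cochain differential of the Koszul complex on the [e]-th powers of [l]: the cone of
    multiplication by [x ^+ e], the second component being shifted by one degree. *)
Fixpoint Kd (e : nat) (l : seq R) : KT l M -> KT l M :=
  match l return KT l M -> KT l M with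
  | [::] => fun _ => 0
  | x :: l' => fun u => (Kd e u.1, x ^+ e *: u.1 - Kd e u.2)
  end.

(** The transition from exponents [e] to [e + f] (see [Kdt]). Local cohomology is the colimit of
    Koszul cohomology along these maps. *)
Fixpoint Kt (f : nat) (l : seq R) : KT l M -> KT l M :=
  match l return KT l M -> KT l M with
  | [::] => fun u => u
  | x :: l' => fun u => (Kt f u.1, x ^+ f *: Kt f u.2)
  end.

Fixpoint Kin (Z : M -> Prop) (l : seq R) : KT l M -> Prop :=
  match l return KT l M -> Prop with
  | [::] => Z
  | x :: l' => fun u => Kin Z u.1 /\ Kin Z u.2
  end.

(* Kdg k.+1 u : u has cohomological degree k; Kdg 0 u : u = 0 *)
Fixpoint Kdg (k : nat) (l : seq R) : KT l M -> Prop :=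
  match l return KT l M -> Prop with
  | [::] => fun u => k = 1%N \/ u = 0
  | x :: l' => fun u => Kdg k u.1 /\ Kdg k.-1 u.2
  end.

Lemma Kd_linear e l : linear (@Kd e l).
Proof.
elim: l => [|x l IHl] a u v /=; first by rewrite scaler0 addr0.
rewrite !IHl /=; congr pair => /=.
by rewrite scalerDr scalerBr opprD addrACA !scalerA mulrC.
Qed.
HB.instance Definition _ e l :=
  GRing.isLinear.Build R (KT l M) (KT l M) _ (@Kd e l) (@Kd_linear e l).

Lemma Kt_linear e l : linear (@Kt e l).
Proof.
elim: l => [|x l IHl] a u v //=.
rewrite !IHl /=; congr pair => /=.
by rewrite scalerDr !scalerA mulrC.
Qed.
HB.instance Definition _ e l :=
  GRing.isLinear.Build R (KT l M) (KT l M) _ (@Kt e l) (@Kt_linear e l).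

Lemma Kdd e l (u : KT l M) : Kd e (Kd e u) = 0.
Proof.
elim: l u => [|x l IHl] //= [a b] /=; congr pair => //=.
by rewrite linearB linearZ /= !IHl subr0 subrr.
Qed.

Lemma Kt0 l (u : KT l M) : Kt 0 u = u.
Proof. by elim: l u => [|x l IHl] //= [a b]; rewrite /= !IHl expr0 scale1r. Qed.

Lemma KtD e f l (u : KT l M) : Kt e (Kt f u) = Kt (e + f) u.
Proof.
elim: l u => [|x l IHl] //= [a b]; rewrite /= !IHl; congr pair => /=.
by rewrite linearZ /= scalerA IHl -exprD.
Qed.

Lemma Kdt e f l (u : KT l M) : Kd (e + f) (Kt f u) = Kt f (Kd e u).
Proof.
elim: l u => [|x l IHl] /= => [|[a b]] //=; rewrite !IHl; congr pair => /=.
rewrite linearB !linearZ /= !IHl scalerBr !scalerA.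
by rewrite scalerN -exprD addnC.
Qed.

Lemma submod_Kin Z l : submod Z -> submod (@Kin Z l).
Proof.
move=> sZ; elim: l => [|x l [IH0 IHl]] //=; split=> //= a u v [? ?] [? ?].
by split; apply: IHl.
Qed.

Lemma submod_Kdg k l : submod (@Kdg k l).
Proof.
elim: l k => [|x l IHl] k /=.
  by split=> [|a u v [h|->] [h'|->]]; rewrite ?scaler0 ?addr0; auto.
split=> [|a u v [? ?] [? ?]]; first by split; apply: (submod0 (IHl _)).
by split=> /=; apply: (submodD (IHl _)) => //; apply: (submodZ (IHl _)).
Qed.

Lemma Kin_d Z e l u : submod Z -> Kin Z u -> Kin Z (@Kd e l u).
Proof.
move=> sZ; elim: l u => [|x l IHl] u /=; first by move=> _; apply: submod0.
move=> [h1 h2]; split; first exact: IHl.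
by apply: (submodB (submod_Kin l sZ)); [apply: (submodZ (submod_Kin l sZ))|apply: IHl].
Qed.

Lemma Kin_t Z e l u : submod Z -> Kin Z u -> Kin Z (@Kt e l u).
Proof.
move=> sZ; elim: l u => [|x l IHl] u //= [h1 h2]; split; first exact: IHl.
by apply: (submodZ (submod_Kin l sZ)); apply: IHl.
Qed.

Lemma Kin_sub (Z Z' : M -> Prop) l u : (forall v, Z v -> Z' v) -> Kin Z u -> @Kin Z' l u.
Proof. by move=> h; elim: l u => [|x l IHl] u /=; [apply: h|case; split; apply: IHl]. Qed.

Lemma Kdg0 l (u : KT l M) : Kdg 0 u <-> u = 0.
Proof.
elim: l u => [|x l IHl] u /=; first by split=> [[]|]; auto.
by case: u => a b /=; rewrite !IHl; split=> [[-> ->]|[-> ->]].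
Qed.

Lemma Kdg_d k e l u : Kdg k u -> Kdg k.+1 (@Kd e l u).
Proof.
elim: l k u => [|x l IHl] k u /=; first by auto.
move=> [h1 h2]; split; first exact: IHl.
apply: (submodB (submod_Kdg k l)); first exact: (submodZ (submod_Kdg k l)).
case: k h2 {h1} => [|k] /=; last exact: IHl.
by move/Kdg0 ->; rewrite linear0; apply: (submod0 (submod_Kdg _ l)).
Qed.

Lemma Kdg_t k e l u : Kdg k u -> Kdg k (@Kt e l u).
Proof.
elim: l k u => [|x l IHl] k u //= [h1 h2]; split; first exact: IHl.
by apply: (submodZ (submod_Kdg _ l)); apply: IHl.
Qed.

Lemma Kdg_big l k (u : KT l M) : ((size l).+1 < k)%N -> Kdg k u -> u = 0.
Proof.
elim: l k u => [|x l IHl] k u /= hk.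
  by case=> [k1|//]; move: hk; rewrite k1.
case: u => a b /= [ha hb]; rewrite (IHl _ _ _ ha) ?(ltnW hk) // (IHl _ _ _ hb) //.
by case: k hk {ha hb}.
Qed.

End Koszul.
Arguments submod_Kdg {R M} k l.

Section CVanish.
Variables (R : comNzRingType) (l : seq R).

(** Vanishing of the k-th local cohomology of Z/B: a cocycle modulo [B] becomes a coboundary modulo
    [B] once the exponents are raised. Degrees are shifted by one as in [Kdg], so that k = 0 needs
    no separate case. *)
Definition CV (M : lmodType R) (k : nat) (Z B : M -> Prop) : Prop :=
  forall e (u : KT l M), Kin Z u -> Kdg k.+1 u -> Kin B (Kd e u) ->
  exists f, exists2 w, Kin Z w /\ Kdg k w & Kin B (Kt f u - Kd (e + f) w).

Variables (M : lmodType R) (Z Z' B : M -> Prop).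
Hypotheses (sZ : submod Z) (sZ' : submod Z') (sB : submod B).
Hypotheses (BZ' : forall u, B u -> Z' u) (Z'Z : forall u, Z' u -> Z u).
Let kZ := submod_Kin l sZ.
Let kZ' := submod_Kin l sZ'.
Let kB := submod_Kin l sB.

(** With [CV_quot] and [CV_sub], the three uses of the long exact sequence of 0 -> Z'/B -> Z/B ->
    Z/Z' -> 0, one for each of the modules that can be the unknown. *)
Lemma CV_ext k : CV k Z' B -> CV k Z Z' -> CV k Z B.
Proof.
move=> h1 h2 e u zu du bu.
have [f [w [zw dw] bw]] := h2 e u zu du (Kin_sub BZ' bu).
have [||f' [w' [zw' dw'] bw']] := h1 (e + f)%N _ bw.
- apply: (submodB (submod_Kdg _ l)); first exact: Kdg_t.
  exact: Kdg_d.
- by rewrite linearB /= Kdd subr0 Kdt; apply: Kin_t.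
exists (f' + f)%N; exists (Kt f' w + w').
  split; first by apply: (submodD kZ); [apply: Kin_t|apply: Kin_sub zw'].
  by apply: (submodD (submod_Kdg _ l)); first apply: Kdg_t.
by move: bw'; rewrite linearB /= KtD linearD /= [(f' + f)%N]addnC addnA Kdt opprD addrA.
Qed.

Lemma CV_quot k : CV k Z B -> CV k.+1 Z' B -> CV k Z Z'.
Proof.
move=> h1 h2 e u zu du bu.
have [||f [w [zw dw] bw]] := h2 e (Kd e u) bu; first exact: Kdg_d.
  by rewrite Kdd; apply: submod0.
have [|||f' [w' [zw' dw'] bw']] := h1 (e + f)%N (Kt f u - w).
- by apply: (submodB kZ); [apply: Kin_t|apply: Kin_sub zw].
- by apply: (submodB (submod_Kdg _ l)) => //; apply: Kdg_t.
- by rewrite linearB /= Kdt.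
exists (f' + f)%N, w' => //.
rewrite -KtD [(f' + f)%N]addnC addnA.
have -> : Kt f' (Kt f u) - Kd (e + f + f') w' =
   Kt f' (Kt f u - w) - Kd (e + f + f') w' + Kt f' w.
  by rewrite linearB /= addrAC subrK.
by apply: (submodD kZ'); [apply: Kin_sub bw'|apply: Kin_t].
Qed.

Lemma CV_sub k : CV k Z B -> ((0 < k)%N -> CV k.-1 Z Z') -> CV k Z' B.
Proof.
move=> h1 h2 e u zu du bu.
have [f [w [zw dw] bw]] := h1 e u (Kin_sub Z'Z zu) du bu.
have hw : Kin Z' (Kd (e + f) w).
  have -> : Kd (e + f) w = Kt f u - (Kt f u - Kd (e + f) w) by rewrite opprB addrC subrK.
  by apply: (submodB kZ'); [apply: Kin_t|apply: Kin_sub bw].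
case: k h2 h1 dw du => [|k] h2 h1 dw du.
  exists f, 0; first by split; [apply: submod0|apply: (submod0 (submod_Kdg _ l))].
  by move: bw; move/Kdg0: dw => ->.
have [f' [w' [zw' dw'] bw']] := h2 isT _ _ zw dw hw.
exists (f' + f)%N, (Kt f' w - Kd (e + f + f') w').
  split=> //; apply: (submodB (submod_Kdg _ l)); first exact: Kdg_t.
  exact: Kdg_d.
by rewrite [(f' + f)%N]addnC addnA linearB /= Kdd subr0 Kdt [(f + f')%N]addnC -KtD -linearB; apply: Kin_t.
Qed.

End CVanish.

Section KMap.
Variables (R : comNzRingType) (M N : lmodType R) (f : M -> N) (Z : M -> Prop).
Hypothesis sZ : submod Z.
Hypothesis fL : forall a u v, Z u -> Z v -> f (a *: u + v) = a *: f u + f v.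

(** The map is linear on [Z] only: the class map from I to I/I^2, extended by a default value
    outside I, has to be an instance. *)
Fixpoint Kmap (l : seq R) : KT l M -> KT l N :=
  match l return KT l M -> KT l N with
  | [::] => f
  | x :: l' => fun u => (Kmap u.1, Kmap u.2)
  end.

Lemma Kmap_lin l a (u v : KT l M) : Kin Z u -> Kin Z v ->
  Kmap (a *: u + v) = a *: Kmap u + Kmap v.
Proof.
elim: l u v => [|x l IHl] u v /=; first exact: fL.
by move=> [? ?] [? ?]; rewrite !IHl.
Qed.

Lemma on0 : f 0 = 0.
Proof.
have := fL 1 (submod0 sZ) (submod0 sZ); rewrite scale1r addr0 scale1r.
by move/(congr1 (fun x => x - f 0)); rewrite addrK subrr.
Qed.

Lemma Kmap0 l : Kmap (0 : KT l M) = 0.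
Proof. by elim: l => [|x l IHl] /=; [exact: on0|rewrite IHl]. Qed.

Lemma KmapZ l a (u : KT l M) : Kin Z u -> Kmap (a *: u) = a *: Kmap u.
Proof.
move=> zu; rewrite -[a *: u]addr0 Kmap_lin ?Kmap0 ?addr0 //.
exact: submod0 (submod_Kin l sZ).
Qed.

Lemma KmapD l (u v : KT l M) : Kin Z u -> Kin Z v -> Kmap (u + v) = Kmap u + Kmap v.
Proof. by move=> zu zv; rewrite -[u]scale1r Kmap_lin // !scale1r. Qed.

Lemma KmapB l (u v : KT l M) : Kin Z u -> Kin Z v -> Kmap (u - v) = Kmap u - Kmap v.
Proof.
move=> zu zv; rewrite KmapD //; last exact: (submodN (submod_Kin l sZ)).
by rewrite -scaleN1r KmapZ // scaleN1r.
Qed.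

Lemma Kmapd e l (u : KT l M) : Kin Z u -> Kmap (Kd e u) = Kd e (Kmap u).
Proof.
elim: l u => [|x l IHl] u /=; first by move=> _; exact: on0.
move=> [z1 z2]; rewrite KmapB ?KmapZ ?IHl //.
  exact: (submodZ (submod_Kin l sZ)).
exact: Kin_d.
Qed.

Lemma Kmapt e l (u : KT l M) : Kin Z u -> Kmap (Kt e u) = Kt e (Kmap u).
Proof.
elim: l u => [|x l IHl] u //= [z1 z2]; rewrite KmapZ ?IHl //.
exact: Kin_t.
Qed.

Lemma Kmap_dg k l (u : KT l M) : Kdg k u -> Kdg k (Kmap u).
Proof.
elim: l k u => [|x l IHl] k u /=; first by case=> [->|->]; [left|right; exact: on0].
by move=> [? ?]; split; apply: IHl.
Qed.

Lemma Kmap_in (B : M -> Prop) (B' : N -> Prop) l (u : KT l M) :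
  (forall z, Z z -> (B z <-> B' (f z))) -> Kin Z u -> (Kin B u <-> Kin B' (Kmap u)).
Proof.
move=> h; elim: l u => [|x l IHl] u /=; first exact: h.
by move=> [z1 z2]; split=> -[? ?]; split; apply/IHl.
Qed.

Lemma Klift (Z' B' : N -> Prop) k l (u : KT l N) : submod B' ->
  (forall v, Z' v -> exists2 z, Z z & B' (v - f z)) ->
  Kin Z' u -> Kdg k u -> exists2 v, Kin Z v /\ Kdg k v & Kin B' (u - Kmap v).
Proof.
move=> sB h; elim: l k u => [|x l IHl] k u /=.
  move=> zu [->|->]; first by have [z ? ?] := h u zu; exists z => //; split=> //; left.
  by exists 0; rewrite ?on0 ?subr0; first split; [exact: submod0 sZ|right|exact: submod0 sB].
move=> [z1 z2] [d1 d2].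
have [v1 [? ?] ?] := IHl _ _ z1 d1; have [v2 [? ?] ?] := IHl _ _ z2 d2.
by exists (v1, v2).
Qed.

End KMap.

Section CVMap.
Variables (R : comNzRingType) (l : seq R) (M N : lmodType R) (f : M -> N).
Variables (Z B : M -> Prop) (Z' B' : N -> Prop).
Hypotheses (sZ : submod Z) (sB' : submod B').
Hypothesis fL : forall a u v, Z u -> Z v -> f (a *: u + v) = a *: f u + f v.
Hypothesis fZ : forall z, Z z -> Z' (f z).
Hypothesis fS : forall v, Z' v -> exists2 z, Z z & B' (v - f z).
Hypothesis fB : forall z, Z z -> (B z <-> B' (f z)).

Lemma Kmap_Z (u : KT l M) : Kin Z u -> Kin Z' (Kmap f u).
Proof.
by move=> zu; apply/(Kmap_in (Z := Z) (B := Z) _ zu) => // z zz; split=> // _; apply: fZ.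
Qed.

Lemma CV_map k : CV l k Z B -> CV l k Z' B'.
Proof.
move=> h e u zu du bu.
have [v [zv dv] bv] := Klift sZ fL sB' fS zu du.
have sK := submod_Kin l sB'.
have [|f1 [w [zw dw] bw]] := h e v zv dv.
  apply/(Kmap_in fB (Kin_d e sZ zv)); rewrite (Kmapd sZ fL) //.
  apply: (submodBr sK bu); rewrite -opprB -linearB.
  by apply: (submodN sK); apply: Kin_d.
exists f1, (Kmap f w); first by split; [apply: Kmap_Z|apply: (Kmap_dg sZ fL)].
rewrite -(Kmapd sZ fL) //.
have -> : Kt f1 u - Kmap f (Kd (e + f1) w) =
  Kt f1 (u - Kmap f v) + Kmap f (Kt f1 v - Kd (e + f1) w).
  rewrite (KmapB sZ fL) ?(Kmapt sZ fL) //; [|exact: Kin_t|exact: Kin_d].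
  by rewrite linearB /= addrA subrK.
apply: (submodD sK); first exact: Kin_t.
apply/(Kmap_in fB _) => //.
by apply: (submodB (submod_Kin l sZ)); [apply: Kin_t|apply: Kin_d].
Qed.

Lemma CV_pull k : CV l k Z' B' -> CV l k Z B.
Proof.
move=> h e u zu du bu.
have sK := submod_Kin l sB'.
have [|||f1 [w [zw dw] bw]] := h e (Kmap f u).
- exact: Kmap_Z.
- exact: (Kmap_dg sZ fL).
- by rewrite -(Kmapd sZ fL) //; apply/(Kmap_in fB (Kin_d e sZ zu)).
have [v [zv dv] bv] := Klift sZ fL sB' fS zw dw.
exists f1, v => //.
have zz : Kin Z (Kt f1 u - Kd (e + f1) v).
  by apply: (submodB (submod_Kin l sZ)); [apply: Kin_t|apply: Kin_d].
apply/(Kmap_in fB zz); rewrite (KmapB sZ fL); [|exact: Kin_t|exact: Kin_d].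
rewrite (Kmapt sZ fL) // (Kmapd sZ fL) //.
have -> : Kt f1 (Kmap f u) - Kd (e + f1) (Kmap f v) =
   (Kt f1 (Kmap f u) - Kd (e + f1) w) + Kd (e + f1) (w - Kmap f v).
  by rewrite linearB /= addrA subrK.
by apply: (submodD sK) => //; apply: Kin_d.
Qed.
End CVMap.

(** The endomorphism [r] kills [B] and is the identity modulo [B], so it induces a section of Z ->
    Z/B: the quotient is a direct summand of [Z]. *)
Lemma CV_retract (R : comNzRingType) (l : seq R) (M : lmodType R)
  (r : {linear M -> M}) (Z B : M -> Prop) k : submod B ->
  (forall z, Z z -> Z (r z)) -> (forall b, B b -> r b = 0) ->
  (forall z, Z z -> B (z - r z)) ->
  CV l k Z (fun u => u = 0) -> CV l k Z B.
Proof.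
move=> sB rZ rB rr h e u zu du bu.
have sT := submodT M; have rL : forall a u v, True -> True -> r (a *: u + v) = a *: r u + r v.
  by move=> a x y _ _; rewrite linearP.
have inT (v : KT l M) : Kin (fun _ : M => True) v.
  by elim: (l) v => [|x l' IH] v //=.
have [|||f [w ? bw]] := h e (Kmap r u).
- elim: (l) u zu {du bu} => [|x l' IH] u /=; first exact: rZ.
  by move=> [? ?]; split; apply: IH.
- exact: (Kmap_dg sT rL).
- rewrite -(Kmapd sT rL) //; elim: (l) (Kd e u) bu => [|x l' IH] v /=; first exact: rB.
  by move=> [? ?]; split; apply: IH.
exists f, w => //.
have -> : Kt f u - Kd (e + f) w = Kt f (u - Kmap r u) + (Kt f (Kmap r u) - Kd (e + f) w).
  by rewrite linearB /= addrA subrK.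
apply: (submodD (submod_Kin l sB)); last by apply: Kin_sub bw => v ->; exact: submod0 sB.
apply: (Kin_t _ sB); elim: (l) u zu {du bu bw} => [|x l' IH] v /=; first exact: rr.
by move=> [? ?]; split; apply: IH.
Qed.

Section CVTorsion.
Variables (R : comNzRingType) (M : lmodType R) (Z B : M -> Prop).
Hypotheses (sZ : submod Z) (sB : submod B).

(** Multiplication by one of the Koszul parameters is null-homotopic. At the head of the list the
    homotopy is (u1, u2) |-> (u2, 0); further down it is carried through the cone with a sign. *)
Lemma Khomot e l y : y \in l -> exists s : {linear KT l M -> KT l M},
  [/\ forall k u, Kdg k.+1 u -> Kdg k (s u),
      forall Z0 u, submod Z0 -> Kin Z0 u -> Kin Z0 (s u)
    & forall u, y ^+ e *: u = Kd e (s u) + s (Kd e u)].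
Proof.
elim: l => [|x l IHl] //; rewrite inE.
have [-> _|_ /= /IHl[s [s1 s2 s3]]] := eqVneq y x.
  have sL : linear (fun u : KT (x :: l) M => (u.2, 0) : KT (x :: l) M).
    by move=> a u v; congr pair; rewrite /= ?scaler0 ?addr0.
  pose s : {linear KT (x :: l) M -> KT (x :: l) M} :=
    HB.pack (fun u : KT (x :: l) M => (u.2, 0) : KT (x :: l) M)
     (GRing.isLinear.Build R _ _ _ _ sL).
  exists s; split=> [k u [h1 h2]|Z0 u s0 [h1 h2]|[a b]] /=.
  - by split=> //; exact: submod0 (submod_Kdg _ _).
  - by split=> //; exact: submod0 (submod_Kin _ _).
  - by congr pair => /=; [rewrite addrC subrK|rewrite linear0 subr0 addr0].
have sL : linear (fun u : KT (x :: l) M => (s u.1, - s u.2) : KT (x :: l) M).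
  by move=> a u v /=; congr pair; rewrite linearP //= opprD scalerN.
pose s' : {linear KT (x :: l) M -> KT (x :: l) M} :=
    HB.pack (fun u : KT (x :: l) M => (s u.1, - s u.2) : KT (x :: l) M)
     (GRing.isLinear.Build R _ _ _ _ sL).
exists s'; split=> [k u [h1 h2]|Z0 u s0 [h1 h2]|[a b]] /=.
- split; first exact: s1.
  apply: (submodN (submod_Kdg _ _)); case: k h2 {h1} => [|k] /=; last exact: s1.
  by move/Kdg0=> ->; rewrite linear0; exact: submod0 (submod_Kdg _ _).
- by split; [apply: s2|apply: (submodN (submod_Kin _ s0)); apply: s2].
- congr pair => /=; first exact: s3.
  by rewrite (linearB s) (linearZ_LR s) linearN /= opprK opprB addrC addrA subrK addrC s3.
Qed.

(** The localisation at [x] of the k-th local cohomology with support in [l] vanishes, with all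
    exponents explicit. *)
Definition Ktors x l k := forall e (u : KT l M), Kin Z u -> Kdg k.+1 u -> Kin B (Kd e u) ->
  exists f a, exists2 w, Kin Z w /\ Kdg k w & Kin B (x ^+ a *: Kt f u - Kd (e + f) w).

(** Exact sequence of the cone on [x]: the cohomology with support in [x :: l] lies between
    H^(k-1)_l localised at [x] and H^k_l. *)
Lemma CV_cons x l k : CV l k Z B -> ((0 < k)%N -> Ktors x l k.-1) -> CV (x :: l) k Z B.
Proof.
move=> h1 h2 e [a b] /= [za zb] [da db] [ba bb].
have [kZ kB] := (submod_Kin l sZ, submod_Kin l sB).
have [f [w [zw dw] bw]] := h1 e a za da ba.
(* What is left of the second component once the first one is a coboundary. It is a cocycle of
   degree k - 1, which a power of [x] kills by [h2]; for k = 0 it is zero. *)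
pose b' := x ^+ f *: Kt f b - x ^+ (e + f) *: w.
have zb' : Kin Z b' by apply: (submodB kZ); apply: (submodZ kZ) => //; apply: Kin_t.
have db' : Kdg k b'.
  by apply: (submodB (submod_Kdg _ _)); apply: (submodZ (submod_Kdg _ _)) => //; apply: Kdg_t.
have bb' : Kin B (Kd (e + f) b').
  have -> : Kd (e + f) b' = x ^+ (e + f) *: (Kt f a - Kd (e + f) w) -
      x ^+ f *: Kt f (x ^+ e *: a - Kd e b).
    by rewrite !linearB !linearZ /= Kdt scalerA -exprD [(f + e)%N]addnC; modr.
  by apply: (submodB kB); apply: (submodZ kB) => //; apply: Kin_t.
case: k h1 h2 da db dw db' => [|k] h1 h2 da db dw db'.
  exists f, (w, 0) => /=.
    do 2!split=> //; [exact: submod0 kZ|exact: submod0 (submod_Kdg _ _)].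
  split=> //; rewrite linear0 subr0 -/b'.
  by move/Kdg0: db' => ->; exact: submod0 kB.
have [f2 [a2 [w2 [zw2 dw2] bw2]]] := h2 isT _ _ zb' db' bb'.
pose g := (a2 + f2)%N.
exists (g + f)%N, (Kt g w, - (x ^+ f2 *: Kt a2 w2)) => /=.
  split; split=> //; first exact: Kin_t.
  - by apply: (submodN kZ); apply: (submodZ kZ); apply: Kin_t.
  - exact: Kdg_t.
  - by apply: (submodN (submod_Kdg _ _)); apply: (submodZ (submod_Kdg _ _)); apply: Kdg_t.
have eg : (e + (g + f) = e + f + g)%N by lia.
split; first by rewrite -KtD eg Kdt -linearB; apply: Kin_t.
have -> : x ^+ (g + f) *: Kt (g + f) b - (x ^+ (e + (g + f)) *: Kt g w -
     Kd (e + (g + f)) (- (x ^+ f2 *: Kt a2 w2))) =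
   x ^+ f2 *: Kt a2 (x ^+ a2 *: Kt f2 b' - Kd (e + f + f2) w2).
  rewrite linearN linearZ /= -KtD.
  have -> : Kd (e + (g + f)) (Kt a2 w2) = Kt a2 (Kd (e + f + f2) w2).
    have -> : (e + (g + f) = e + f + f2 + a2)%N by rewrite /g; lia.
    by rewrite Kdt.
  rewrite /b' !linearB !linearZ /= ?linearB ?linearZ /= !KtD -/g ?scalerA -?exprD.
  have -> : (f + f2 + a2 = g + f)%N by rewrite /g; lia.
  have -> : (a2 + (e + f) + f2 = e + (g + f))%N by rewrite /g; lia.
  by modr.
by apply: (submodZ kB); apply: Kin_t.
Qed.

(** Each power of a parameter acts trivially on Koszul cohomology by [Khomot], hence so does
    [x ^+ a], a combination of such powers up to an element [r] carrying [Z] into [B]. *)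
Lemma Ktors_ideal l l2 x k : {subset l2 <= l} ->
  (forall e, exists a r (g : nat -> R),
     x ^+ a = r + \sum_(i < size l2) g i * l2`_i ^+ e /\ forall z, Z z -> B (r *: z)) ->
  Ktors x l k.
Proof.
move=> sub h e u zu du bu.
have [a [r [g [xa hr]]]] := h e.
have kB := submod_Kin l sB.
have hom (i : 'I_(size l2)) : exists w : KT l M,
    [/\ Kin Z w, Kdg k w & Kin B (l2`_i ^+ e *: u - Kd e w)].
  have [|s [s1 s2 s3]] := @Khomot e l l2`_i; first by apply/sub/mem_nth.
  exists (s u); split; [exact: s2|exact: s1|].
  by rewrite s3 addrAC subrr add0r; exact: s2.
have [w hw] := choice hom.
exists 0%N, a, (\sum_(i < size l2) g i *: w i).
  split; [apply: (submod_sum (submod_Kin _ sZ))|apply: (submod_sum (submod_Kdg _ _))] => i _.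
    by apply: (submodZ (submod_Kin _ sZ)); case: (hw i).
  by apply: (submodZ (submod_Kdg _ _)); case: (hw i).
rewrite Kt0 addn0 xa scalerDl linear_sum -addrA.
apply: (submodD kB).
  by elim: (l) u zu {du bu hom w hw} => [|y l' IH] v /=; [exact: hr|case; split; apply: IH].
rewrite scaler_suml -sumrB; apply: (submod_sum kB) => i _.
by rewrite linearZ /= -scalerA -scalerBr; apply: (submodZ kB); case: (hw i).
Qed.

(* Grothendieck vanishing: the cohomological dimension is bounded by the number
   of elements of l2 when l1 lies in the radical of l2 modulo the annihilator. *)
Lemma CV_dim l1 l2 k :
  (forall x e, x \in l1 -> exists a r (g : nat -> R),
     x ^+ a = r + \sum_(i < size l2) g i * l2`_i ^+ e /\ forall z, Z z -> B (r *: z)) ->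
  (size l2 < k)%N -> CV (l1 ++ l2) k Z B.
Proof.
elim: l1 k => [|x l1 IHl] k h hk.
  move=> e u zu du bu; exists 0%N, 0.
    by split; [exact: submod0 (submod_Kin _ sZ)|exact: submod0 (submod_Kdg _ _)].
  rewrite (Kdg_big _ du) ?ltnS // linear0 linear0 subr0.
  exact: submod0 (submod_Kin _ sB).
apply: (@CV_cons x (l1 ++ l2)).
  by apply: IHl => // y e yl; apply: h; rewrite inE yl orbT.
move=> _; apply: (@Ktors_ideal _ l2) => [y yl|e]; first by rewrite mem_cat yl orbT.
exact: h (mem_head _ _).
Qed.
End CVTorsion.

(** * Extension of linear forms, and vanishing predicates on subquotients *)

Section SubMod.
Variables (R : nzRingType) (M : lmodType R) (P : M -> Prop).

Definition subp of submod P : {pred M} := fun x => `[< P x >].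
Variable sP : submod P.
Fact subp_closed : submod_closed (subp sP).
Proof.
split=> [|a u v /asboolP hu /asboolP hv]; apply/asboolP; first exact: submod0 sP.
by apply: (submodD sP) => //; apply: (submodZ sP).
Qed.
HB.instance Definition _ := GRing.isSubmodClosed.Build R M (subp sP) subp_closed.

Definition sub_mod : Type := {x : M | x \in subp sP}.
HB.instance Definition _ := SubChoice.on sub_mod.
HB.instance Definition _ := [SubChoice_isSubLmodule of sub_mod by <:].

Lemma sub_modP (x : sub_mod) : P (val x).
Proof. by case: x => x /= /asboolP. Qed.
Definition to_sub x (hx : P x) : sub_mod := Sub x (asboolT hx).
Lemma to_subK x (hx : P x) : val (to_sub hx) = x.
Proof. by rewrite SubK. Qed.
End SubMod.

Definition mklinear (R : nzRingType) (M N : lmodType R) (f : M -> N) (fL : linear f) :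
  {linear M -> N} := HB.pack f (GRing.isLinear.Build R M N _ f fL).

(** On the submodule f Z + B' of N the rule f z + b |-> g z is well defined by the last hypothesis;
    injectivity of [E] extends it to N. *)
Lemma extend_linear (R : comNzRingType) (E : lmodType R) (M N : lmodType R)
    (f : {linear M -> N}) (Z : M -> Prop) (B' : N -> Prop) (g : M -> E) :
  injective_module E -> submod Z -> submod B' ->
  (forall a u v, Z u -> Z v -> g (a *: u + v) = a *: g u + g v) ->
  (forall z, Z z -> B' (f z) -> g z = 0) ->
  exists2 g' : {linear N -> E}, (forall b, B' b -> g' b = 0) &
    forall z, Z z -> g' (f z) = g z.
Proof.
move=> iE sZ sB gL gB.
have sI := submod_im f sZ sB.
have h (x : sub_mod sI) : exists z, Z z /\ B' (val x - f z).
  by case: (sub_modP x) => z ? ?; exists z.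
have [k hk] := choice h.
have gN u v : Z u -> Z v -> g (u - v) = g u - g v.
  by move=> zu zv; rewrite addrC -scaleN1r gL // scaleN1r addrC.
have kL : linear (g \o k : sub_mod sI -> E).
  move=> a u v /=; have [[zu bu] [zv bv]] := (hk u, hk v).
  have [zw bw] := hk (a *: u + v).
  have zz : Z (a *: k u + k v) by apply: (submodD sZ) => //; apply: (submodZ sZ).
  apply/eqP; rewrite -subr_eq0 -gL // -gN //; apply/eqP/gB; first exact: (submodB sZ).
  rewrite linearB linearP /=.
  have -> : f (k (a *: u + v)) - (a *: f (k u) + f (k v)) =
     a *: (val u - f (k u)) + (val v - f (k v)) - (val (a *: u + v) - f (k (a *: u + v))).
    have -> : val (a *: u + v) = a *: val u + val v by [].
    by modr.
  by apply: (submodB sB) => //; apply: (submodD sB) => //; apply: (submodZ sB).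
have [|g' hg'] := iE (sub_mod sI) N (mklinear (GRing.linearP val)) (mklinear kL).
  exact: val_inj.
exists g' => [b hb|z hz].
  have pb : imP f Z B' b by exists 0; [exact: submod0 sZ|rewrite linear0 subr0].
  have -> : g' b = g (k (to_sub sI pb)) := hg' (to_sub sI pb).
  have [zz bb] := hk (to_sub sI pb); apply: gB => //.
  have {}bb : B' (b - f (k (to_sub sI pb))) := bb.
  have -> : f (k (to_sub sI pb)) = b - (b - f (k (to_sub sI pb))) by abel.
  exact: (submodB sB).
have pb : imP f Z B' (f z) by exists z => //; rewrite subrr; exact: submod0 sB.
have -> : g' (f z) = g (k (to_sub sI pb)) := hg' (to_sub sI pb).
have [zz bb] := hk (to_sub sI pb); have {}bb : B' (f z - f (k (to_sub sI pb))) := bb.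
apply/eqP; rewrite -subr_eq0 -gN //; apply/eqP/gB; first exact: (submodB sZ).
by rewrite linearB -opprB; apply: (submodN sB).
Qed.

(** What [CV], [XR] and [pdc] share as properties of Z/B: invariance under isomorphism of
    subquotients, stability under extension, and passage from [Z] to a direct summand Z/B. Transport
    and finite direct sums are then proved once for all three. *)
Record vtheory (R : comNzRingType)
  (V : forall M : lmodType R, (M -> Prop) -> (M -> Prop) -> Prop) : Prop := VTheory {
  vtriv : forall (M : lmodType R) (Z B : M -> Prop), submod Z -> submod B ->
    (forall z, Z z -> B z) -> V M Z B;
  vext : forall (M : lmodType R) (Z Z' B : M -> Prop), submod Z -> submod Z' -> submod B ->
    (forall u, B u -> Z' u) -> (forall u, Z' u -> Z u) -> V M Z' B -> V M Z Z' -> V M Z B;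
  vmap : forall (M N : lmodType R) (f : {linear M -> N}) (Z B : M -> Prop) (Z' B' : N -> Prop),
    submod Z -> submod Z' -> submod B -> submod B' -> (forall z, Z z -> Z' (f z)) ->
    (forall v, Z' v -> exists2 z, Z z & B' (v - f z)) ->
    (forall z, Z z -> (B z <-> B' (f z))) -> V M Z B -> V N Z' B';
  vpull : forall (M N : lmodType R) (f : {linear M -> N}) (Z B : M -> Prop) (Z' B' : N -> Prop),
    submod Z -> submod Z' -> submod B -> submod B' -> (forall z, Z z -> Z' (f z)) ->
    (forall v, Z' v -> exists2 z, Z z & B' (v - f z)) ->
    (forall z, Z z -> (B z <-> B' (f z))) -> V N Z' B' -> V M Z B;
  vretract : forall (M : lmodType R) (r : {linear M -> M}) (Z B : M -> Prop), submod Z -> submod B ->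
    (forall z, Z z -> Z (r z)) -> (forall b, B b -> r b = 0) ->
    (forall z, Z z -> B (z - r z)) -> V M Z (fun u => u = 0) -> V M Z B
}.

Section XR.
Variables (R : comNzRingType) (Q : lmodType R) (E : inj_resolution Q).

(* Ext^{i+1}(Z/B, Q) = 0; linear forms on Z/B are represented by linear forms on
   the ambient module, which is harmless as each E i is injective. *)
Definition XR (i : nat) (M : lmodType R) (Z B : M -> Prop) : Prop :=
  forall g : {linear M -> E i.+1}, (forall b, Z b -> B b -> g b = 0) ->
    (forall z, Z z -> ires_d E i.+1 (g z) = 0) ->
  exists2 h : {linear M -> E i}, (forall b, Z b -> B b -> h b = 0) &
    forall z, Z z -> g z = ires_d E i (h z).

Lemma ires_dd i x : ires_d E i.+1 (ires_d E i x) = 0.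
Proof. by apply/ires_exact; exists x. Qed.

Section Ses.
Variables (M : lmodType R) (Z Z' B : M -> Prop).
Hypotheses (sZ : submod Z) (sZ' : submod Z') (sB : submod B).
Hypotheses (BZ' : forall u, B u -> Z' u) (Z'Z : forall u, Z' u -> Z u).

Lemma XR_ext i : XR i Z' B -> XR i Z Z' -> XR i Z B.
Proof.
move=> h1 h2 g gB gZ.
have [|h hB hZ] := h1 g _ (fun z hz => gZ z (Z'Z hz)).
  by move=> b /Z'Z zb bb; apply: gB.
have [||h' hB' hZ'] := h2 (g \- (ires_d E i \o h)).
- by move=> b _ /hZ /= ->; rewrite subrr.
- by move=> z zz; rewrite /= linearB ires_dd gZ // subr0.
exists (h \+ h') => [b zb bb|z zz] /=; first by rewrite hB ?hB' ?addr0 //; exact: BZ'.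
by rewrite linearD -hZ' //= addrC subrK.
Qed.

(** Contravariant long exact sequence: Ext^(i+2) of Z/Z' lies between Ext^(i+1) of Z'/B and
    Ext^(i+2) of Z/B. *)
Lemma XR_quot i : XR i.+1 Z B -> XR i Z' B -> XR i.+1 Z Z'.
Proof.
move=> h1 h2 g gB gZ.
have [h hB hZ] := h1 g (fun b hb hb' => gB b hb (BZ' hb')) gZ.
have [||k kB kZ] := h2 h.
- by move=> b /Z'Z; apply: hB.
- by move=> z zz; rewrite -hZ ?gB //; exact: Z'Z.
exists (h \- (ires_d E i \o k)) => [b zb bb|z zz] /=; first by rewrite kZ // subrr.
by rewrite linearB ires_dd subr0 hZ.
Qed.

Lemma XR_sub i : XR i Z B -> XR i.+1 Z Z' -> XR i Z' B.
Proof.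
move=> h1 h2 g gB gZ.
have [||k kB kZ] := h2 (ires_d E i.+1 \o g).
- by move=> b zb bb /=; exact: gZ.
- by move=> z zz /=; exact: ires_dd.
have [||h hB hZ] := h1 (g \- k).
- by move=> b zb bb /=; rewrite gB ?kB ?subrr //; exact: BZ'.
- by move=> z zz /=; rewrite linearB -[X in _ - X]kZ //= subrr.
exists h => [b /Z'Z|z zz]; first exact: hB.
by rewrite -hZ /= ?kB ?subr0 //; exact: Z'Z.
Qed.
End Ses.

Lemma linear_cst0 (M N : lmodType R) : linear (fun _ : M => 0 : N).
Proof. by move=> a u v; rewrite scaler0 addr0. Qed.

Lemma XR_vtheory i : vtheory (XR i).
Proof.
split.
- move=> M Z B sZ sB ZB g gB gZ.
  exists (mklinear (@linear_cst0 M (E i))) => //= z zz.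
  by rewrite linear0 gB //; exact: ZB.
- by move=> M Z Z' B sZ sZ' sB h1 h2; apply: XR_ext.
- move=> M N f Z B Z' B' sZ sZ' sB sB' fZ fS fB h g gB gZ.
  have [||k kB kZ] := h (g \o f).
  + by move=> b zb bb /=; apply: gB; [exact: fZ|exact/fB].
  + by move=> z zz /=; apply/gZ/fZ.
  have [||g' gB' gZ'] := @extend_linear R (E i) M N f Z B' k (@ires_injective _ _ E i) sZ sB'.
  + by move=> a u v _ _; rewrite linearP.
  + by move=> z zz bz; apply: kB => //; apply/fB.
  exists g' => [b zb|z /[dup] zz /fS[w zw bw]]; first exact: gB'.
  have [b {}bw zE] : exists2 b, B' b & z = f w + b by exists (z - f w) => //; abel.
  rewrite zE !linearD (gB b _ bw) ?(gB' b bw); last first.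
    have -> : b = z - f w by rewrite zE; abel.
    by apply: (submodB sZ') => //; exact: fZ.
  by rewrite gZ' // linear0 !addr0 -kZ.
- move=> M N f Z B Z' B' sZ sZ' sB sB' fZ fS fB h g gB gZ.
  have [||g' gB' gZ'] := @extend_linear R (E i.+1) M N f Z B' g (@ires_injective _ _ E i.+1) sZ sB'.
  + by move=> a u v _ _; rewrite linearP.
  + by move=> z zz bz; apply: gB => //; apply/fB.
  have [||k kB kZ] := h g'.
  + by move=> b _; exact: gB'.
  + move=> z /fS[w zw bw].
    have [b {}bw zE] : exists2 b, B' b & z = f w + b by exists (z - f w) => //; abel.
    by rewrite zE !linearD (gB' b bw) linear0 addr0 gZ' // gZ.
  exists (k \o f) => [b zb bb|z zz] /=.
    by apply: kB; [exact: fZ|exact/fB].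
  by rewrite -kZ ?gZ' //; exact: fZ.
- move=> M r Z B sZ sB rZ rB rr h g gB gZ.
  have [||k kB kZ] := h (g \o r).
  + by move=> b _ -> /=; rewrite !linear0.
  + by move=> z zz /=; apply/gZ/rZ.
  exists (k \o r) => [b zb /rB /= ->|z zz /=]; first by rewrite linear0.
  have -> : g z = g (r z).
    apply/eqP; rewrite -subr_eq0 -linearB; apply/eqP/gB; last exact: rr.
    by apply: (submodB sZ) => //; exact: rZ.
  have rrB : r (z - r z) = 0 by apply/rB/rr.
  have rrE : r z = r (r z) by apply/eqP; rewrite -subr_eq0 -linearB rrB.
  by have := kZ (r z) (rZ _ zz); rewrite /= -rrE.
Qed.
End XR.

Lemma CV_vtheory (R : comNzRingType) (l : seq R) k : vtheory (fun M => @CV R l M k).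
Proof.
split.
- move=> M Z B sZ sB ZB e u zu du bu; exists 0%N, 0.
    by split; [exact: submod0 (submod_Kin _ sZ)|exact: submod0 (submod_Kdg _ _)].
  rewrite Kt0 linear0 subr0; exact: Kin_sub zu.
- by move=> M Z Z' B sZ sZ' sB h1 h2; apply: CV_ext.
- move=> M N f Z B Z' B' sZ sZ' sB sB' fZ fS fB; apply: (CV_map (f := f)) => //.
  by move=> a u v _ _; rewrite linearP.
- move=> M N f Z B Z' B' sZ sZ' sB sB' fZ fS fB; apply: (CV_pull (f := f)) => //.
  by move=> a u v _ _; rewrite linearP.
- by move=> M r Z B sZ; apply: CV_retract.
Qed.

Section VTheory.
Variables (R : comNzRingType)
  (V : forall M : lmodType R, (M -> Prop) -> (M -> Prop) -> Prop).
Hypothesis vV : vtheory V.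

Lemma veq (M : lmodType R) (Z B Z' B' : M -> Prop) : submod Z -> submod B ->
  (forall z, Z z <-> Z' z) -> (forall z, Z z -> (B z <-> B' z)) -> submod Z' -> submod B' ->
  V Z B -> V Z' B'.
Proof.
move=> sZ sB hZ hB sZ' sB'; apply: (vmap vV (f := idfun)) => // z /hZ // zz.
by exists z; rewrite ?subrr //; exact: submod0 sB'.
Qed.

Definition prodP (M N : Type) (Z : M -> Prop) (Z' : N -> Prop) (p : M * N) := Z p.1 /\ Z' p.2.
Lemma submod_prod (M N : lmodType R) (Z : M -> Prop) (Z' : N -> Prop) :
  submod Z -> submod Z' -> submod (prodP Z Z').
Proof.
move=> [z0 zD] [z0' zD']; split=> // a u v [? ?] [? ?].
by split; [apply: zD|apply: zD'].
Qed.

Lemma vprod (M N : lmodType R) (Z B : M -> Prop) (Z' B' : N -> Prop) :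
  submod Z -> submod B -> submod Z' -> submod B' ->
  (forall u, B u -> Z u) -> (forall u, B' u -> Z' u) ->
  V Z B -> V Z' B' -> V (prodP Z Z') (prodP B B').
Proof.
move=> sZ sB sZ' sB' BZ BZ' h h'.
have s1 := submod_prod sZ sZ'; have s2 := submod_prod sZ sB'; have s3 := submod_prod sB sB'.
apply: (vext vV s1 s2 s3).
- by move=> u [hu1 hu2]; split=> //; apply: BZ.
- by move=> u [hu1 hu2]; split=> //; apply: BZ'.
- apply: (vpull vV (f := fst) (Z' := Z) (B' := B)) => //.
  + by move=> z [].
  + by move=> v zv; exists (v, 0); [split => //; exact: submod0 sB'|rewrite subrr; exact: submod0 sB].
  + by move=> z [? ?]; split=> [[]|].
- apply: (vpull vV (f := snd) (Z' := Z') (B' := B')) => //.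
  + by move=> z [].
  + by move=> v zv; exists (0, v); [split => //; exact: submod0 sZ|rewrite subrr; exact: submod0 sB'].
  + by move=> z [? ?]; split=> [[]|].
Qed.

Section DSum.
Variables (J : finType) (M : lmodType R) (Z B : M -> Prop).
Hypotheses (sZ : submod Z) (sB : submod B) (BZ : forall u, B u -> Z u) (hV : V Z B).

Definition ffun_all (J0 : finType) (Z0 : M -> Prop) (u : {ffun J0 -> M}) := forall j, Z0 (u j).
Lemma submod_ffun (Z0 : M -> Prop) : submod Z0 -> submod (@ffun_all J Z0).
Proof.
move=> [z0 zD]; split=> [j|a u v hu hv j]; first by rewrite ffunE.
by rewrite !ffunE; apply: zD.
Qed.

Fact ev_linear (j : J) : linear (fun u : {ffun J -> M} => u j).
Proof. by move=> a u v; rewrite !ffunE. Qed.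
Let evj j := mklinear (ev_linear j).

(** Filter by the functions with values in [Z] at the indices of a list [s] and in [B] elsewhere.
    Adding a new index gives a subquotient isomorphic to Z/B through evaluation there. *)
Lemma vdsum : V (@ffun_all J Z) (@ffun_all J B).
Proof.
pose P (s : seq J) (u : {ffun J -> M}) := forall j, if j \in s then Z (u j) else B (u j).
have sP s : submod (P s).
  split=> [j|a u v hu hv j]; rewrite !ffunE.
    by case: ifP => _; [exact: submod0 sZ|exact: submod0 sB].
  have := hu j; have := hv j; case: ifP => _ ? ?.
    by apply: (submodD sZ) => //; apply: (submodZ sZ).
  by apply: (submodD sB) => //; apply: (submodZ sB).
have VP s : V (P s) (@ffun_all J B).
  elim: s => [|i s IHs].
    by apply: (vtriv vV (sP _) (submod_ffun sB)) => u hu j; have := hu j.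
  apply: (vext vV (sP _) (sP s) (submod_ffun sB)).
  - by move=> u hu j; case: ifP => _; [exact: BZ|].
  - by move=> u hu j; have := hu j; rewrite inE; case: (j \in s); rewrite ?orbT ?orbF //; case: ifP => // _; exact: BZ.
  - exact: IHs.
  have [is_|nis] := boolP (i \in s).
    apply: (vtriv vV (sP (i :: s)) (sP s)) => u hu j; have := hu j; rewrite inE.
    by have [->|] := eqVneq j i; rewrite ?is_.
  apply: (@vpull _ _ vV _ _ (evj i) _ _ Z B (sP (i :: s)) sZ (sP s) sB _ _ _ hV).
  - by move=> u hu; have := hu i; rewrite mem_head.
  - move=> v zv; exists [ffun j => if j == i then v else 0].
      move=> j; rewrite ffunE; have [->|ji] := eqVneq j i; first by rewrite mem_head.
      by case: ifP => _; [exact: submod0 sZ|exact: submod0 sB].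
    by rewrite /= ffunE eqxx subrr; exact: submod0 sB.
  - move=> u hu; split=> [hb|/= hb j]; first by have := hb i; rewrite (negPf nis).
    by have := hu j; rewrite inE; have [->|] := eqVneq j i; rewrite ?(negPf nis).
apply: (veq _ _ _ _ _ _ (VP (enum J))) => //; try exact: submod_ffun.
by move=> u; split=> h j; have := h j; rewrite mem_enum.
Qed.
End DSum.
End VTheory.

Section Pdc.
Variables (R : comNzRingType) (l : seq R) (Q : lmodType R) (E : inj_resolution Q).

(* projective dimension at most p, as seen by local cohomology and Ext(-, Q) *)
Definition pdc (p : nat) (M : lmodType R) (Z B : M -> Prop) : Prop :=
  (forall k, (k + p < size l)%N -> CV l k Z B) /\ (forall i, (p <= i)%N -> XR E i Z B).

Lemma pdc_vtheory p : vtheory (@pdc p).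
Proof.
split.
- move=> M Z B sZ sB h; split=> i _.
    exact: (vtriv (CV_vtheory l i)).
  exact: (vtriv (XR_vtheory E i)).
- move=> M Z Z' B sZ sZ' sB h1 h2 [v1 v2] [v1' v2']; split=> i hi.
    exact: (vext (CV_vtheory l i) sZ sZ' sB h1 h2 (v1 i hi) (v1' i hi)).
  exact: (vext (XR_vtheory E i) sZ sZ' sB h1 h2 (v2 i hi) (v2' i hi)).
- move=> M N f Z B Z' B' sZ sZ' sB sB' fZ fS fB [v1 v2]; split=> i hi.
    exact: (vmap (CV_vtheory l i) sZ sZ' sB sB' fZ fS fB (v1 i hi)).
  exact: (vmap (XR_vtheory E i) sZ sZ' sB sB' fZ fS fB (v2 i hi)).
- move=> M N f Z B Z' B' sZ sZ' sB sB' fZ fS fB [v1 v2]; split=> i hi.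
    exact: (vpull (CV_vtheory l i) sZ sZ' sB sB' fZ fS fB (v1 i hi)).
  exact: (vpull (XR_vtheory E i) sZ sZ' sB sB' fZ fS fB (v2 i hi)).
- move=> M r Z B sZ sB rZ rB rr [v1 v2]; split=> i hi.
    exact: (vretract (CV_vtheory l i) sZ sB rZ rB rr (v1 i hi)).
  exact: (vretract (XR_vtheory E i) sZ sB rZ rB rr (v2 i hi)).
Qed.

Lemma pdc_le p p' (M : lmodType R) (Z B : M -> Prop) : (p <= p')%N -> pdc p Z B -> pdc p' Z B.
Proof.
by move=> le [h1 h2]; split=> i hi; [apply: h1|apply: h2]; lia.
Qed.

Variables (M : lmodType R) (Z Z' B : M -> Prop).
Hypotheses (sZ : submod Z) (sZ' : submod Z') (sB : submod B).
Hypotheses (BZ' : forall u, B u -> Z' u) (Z'Z : forall u, Z' u -> Z u).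

(** The step of every resolution below: the cokernel of a module of dimension at most p inside one
    of dimension at most p + 1 has dimension at most p + 1. *)
Lemma pdc_quot p : pdc p.+1 Z B -> pdc p Z' B -> pdc p.+1 Z Z'.
Proof.
move=> [h1 h2] [h1' h2']; split=> i hi.
  by apply: (CV_quot (B := B)) => //; [apply: h1|apply: h1'; lia].
case: i hi => // i hi; apply: (XR_quot (B := B)) => //; [exact: h2|exact: h2'].
Qed.

End Pdc.

(** * Koszul complexes of regular sequences and of injective modules *)

Section KExact.
Variables (R : comNzRingType) (M : lmodType R) (e : nat).

Fixpoint inI (l : seq R) (m : M) : Prop :=
  if l is x :: l' then exists m1, inI l' (m - x ^+ e *: m1) else m = 0.

(** A regular sequence read from the end: the head is a nonzerodivisor modulo the tail, in
    accordance with the cone being built on the head. *)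
Fixpoint reg (l : seq R) : Prop :=
  if l is x :: l' then reg l' /\ forall m, inI l' (x ^+ e *: m) -> inI l' m else True.

Fixpoint Ktop (l : seq R) : KT l M -> M :=
  if l is x :: l' then fun u => Ktop u.2 else id.

Fixpoint Kemb (l : seq R) (m : M) : KT l M :=
  if l is x :: l' return KT l M then (0, Kemb l' m) else m.

Fixpoint Kemb0 (l : seq R) (m : M) : KT l M :=
  if l is x :: l' return KT l M then (Kemb0 l' m, 0) else m.

Lemma submod_inI l : submod (inI l).
Proof.
elim: l => [|x l [IH0 IHl]]; first exact: submod00.
split=> /= [|a u v [u1 hu] [v1 hv]]; first by exists 0; rewrite scaler0 subr0.
exists (a *: u1 + v1); have -> : a *: u + v - x ^+ e *: (a *: u1 + v1) =
  a *: (u - x ^+ e *: u1) + (v - x ^+ e *: v1).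
  by rewrite !scalerBr scalerDr !scalerA [x ^+ e * a]mulrC; modr.
exact: IHl.
Qed.

Lemma Kemb_linear l : linear (Kemb l).
Proof. by elim: l => //= x l IHl a u v; rewrite IHl; congr pair; rewrite /= scaler0 addr0. Qed.
Lemma Kemb0_linear l : linear (Kemb0 l).
Proof. by elim: l => //= x l IHl a u v; rewrite IHl; congr pair; rewrite /= scaler0 addr0. Qed.
Lemma Ktop_linear l : linear (@Ktop l).
Proof. by elim: l => //= x l IHl a u v; rewrite IHl. Qed.
HB.instance Definition _ l := GRing.isLinear.Build R M (KT l M) _ (Kemb l) (Kemb_linear l).
HB.instance Definition _ l := GRing.isLinear.Build R M (KT l M) _ (Kemb0 l) (Kemb0_linear l).
HB.instance Definition _ l := GRing.isLinear.Build R (KT l M) M _ (@Ktop l) (@Ktop_linear l).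

Lemma Kdg_emb l m : Kdg (size l).+1 (Kemb l m).
Proof.
elim: l => [|x l IHl] /=; first by left.
by split=> //; exact: submod0 (submod_Kdg _ _).
Qed.

Lemma Kdg_emb0 l m : Kdg 1 (Kemb0 l m).
Proof.
elim: l => [|x l IHl] /=; first by left.
by split=> //; exact: submod0 (submod_Kdg _ _).
Qed.

Lemma Kd_emb l m : Kd e (Kemb l m) = 0.
Proof.
by apply: (Kdg_big (k := (size l).+2)) => //; apply: Kdg_d; exact: Kdg_emb.
Qed.

Lemma Kembtop l (u : KT l M) : Kdg (size l).+1 u -> u = Kemb l (Ktop u).
Proof.
elim: l u => [|x l IHl] //= [a b] /= [/Kdg_big -> // hb].
by rewrite -IHl.
Qed.

Lemma Kemb0E l (u : KT l M) : Kdg 1 u -> exists m, u = Kemb0 l m.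
Proof.
elim: l u => [|x l IHl] /=; first by move=> u _; exists u.
by move=> [a b] /= [/IHl[m ->] /Kdg0->]; exists m.
Qed.

Lemma Kt_emb0 f l m : Kt f (Kemb0 l m) = Kemb0 l m.
Proof. by elim: l => //= x l ->; rewrite linear0 scaler0. Qed.

Lemma Kin_emb0 (B : M -> Prop) l m : submod B -> B m -> Kin B (Kemb0 l m).
Proof.
by move=> sB bm; elim: l => //= x l IHl; split=> //; exact: submod0 (submod_Kin _ sB).
Qed.

Lemma Kin_demb0 (B : M -> Prop) l m : submod B ->
  Kin B (Kd e (Kemb0 l m)) <-> forall y, y \in l -> B (y ^+ e *: m).
Proof.
move=> sB; elim: l => [|x l IHl] /=; first by split=> // _; exact: submod0 sB.
rewrite linear0 subr0 IHl; split.
  move=> [h1 h2] y; rewrite inE => /orP[/eqP->|]; last exact: h1.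
  move: h2; rewrite -linearZ /=; by elim: (l) => //= x' l' IH [/IH].
move=> h; split=> [y yl|]; first by apply: h; rewrite inE yl orbT.
by rewrite -linearZ /=; apply: Kin_emb0 => //; apply: h; exact: mem_head.
Qed.

Lemma Ktop_d l (w : KT l M) : Kdg (size l) w -> inI l (Ktop (Kd e w)).
Proof.
elim: l w => [|x l IHl]; first by [].
move=> [a b] /= [ha hb]; exists (Ktop a).
rewrite linearB linearZ /= addrC addKr.
by apply: (submodN (submod_inI l)); exact: IHl.
Qed.

Lemma inI_d l m : inI l m -> exists2 w : KT l M, Kdg (size l) w & Kd e w = Kemb l m.
Proof.
elim: l m => [|x l IHl] m /=; first by move=> ->; exists 0 => //; right.
move=> [m1 /IHl[w dw ew]]; exists (Kemb l m1, - w).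
  by split; [exact: Kdg_emb|apply: (submodN (submod_Kdg _ _))].
by rewrite /= Kd_emb linearN /= ew opprK -linearZ -linearD /= addrC subrK.
Qed.

Lemma Kexact l k (u : KT l M) : reg l -> (k < size l)%N -> Kdg k.+1 u -> Kd e u = 0 ->
  exists2 w, Kdg k w & u = Kd e w.
Proof.
elim: l k u => [|x l IHl] k // [a b] /= [rl rx] hk [da db] [ea eb].
have [w dw aw] : exists2 w, Kdg k w & a = Kd e w.
  move: hk; rewrite ltnS leq_eqVlt => /orP[/eqP ek|hk]; last exact: IHl.
  rewrite ek in da db *.
  (* In the top degree of the tail the cohomology is the quotient by the tail, on which [x ^+ e]
     acts injectively; this is where regularity enters. *)
  have /inI_d[w ? ew] : inI l (Ktop a).
    apply: rx; rewrite -linearZ /=; move/eqP: eb; rewrite subr_eq0 => /eqP ->.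
    exact: Ktop_d.
  by exists w => //; rewrite ew; exact: Kembtop.
have db' : Kdg k (b - x ^+ e *: w).
  by apply: (submodB (submod_Kdg _ _)) => //; apply: (submodZ (submod_Kdg _ _)).
have [v dv ev] : exists2 v, Kdg k.-1 v & b - x ^+ e *: w = Kd e v.
  case: k hk {da db} dw db' => [|k] hk dw db'.
    by exists 0; [exact: submod0 (submod_Kdg _ _)|move/Kdg0: db' => ->; rewrite linear0].
  apply: IHl => //; rewrite linearB linearZ /= -aw -[Kd e b](subrK (x ^+ e *: a)).
  by rewrite -opprB eb oppr0 add0r subrr.
exists (w, - v); first by split=> //; apply: (submodN (submod_Kdg _ _)).
by rewrite /= linearN /= opprK -aw -ev addrC subrK.
Qed.
End KExact.

Lemma CV_free (R : comNzRingType) (M : lmodType R) l k : (forall e, @reg R M e l) ->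
  (k < size l)%N -> CV l k (fun _ : M => True) (fun u => u = 0).
Proof.
move=> rl hk e u _ du bu; exists 0%N.
have bu0 : Kd e u = 0.
  by elim: (l) (Kd e u) bu => [|x l' IH] //= [a b] /= [/IH-> /IH->].
have [w dw ->] := Kexact (rl e) hk du bu0.
exists w; first by split=> //; elim: (l) w {dw} => [|x l' IH] //= w.
by rewrite Kt0 addn0 subrr; exact: submod0 (submod_Kin l (submod00 _)).
Qed.

Section KInjective.
Variables (R : comNzRingType) (E : lmodType R) (iE : injective_module E).

Definition killed e (l : seq R) (m : E) := forall y, y \in l -> y ^+ e *: m = 0.

Lemma killed_inI e l m r : killed e l m -> @inI R R^o e l r -> r *: m = 0.
Proof.
move=> km; elim: l r km => [|x l IHl] r km /=; first by move=> ->; rewrite scale0r.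
move=> [r1 /IHl h]; rewrite -[r](subrK (x ^+ e * r1)) scalerDl h.
  by rewrite add0r mulrC -scalerA km ?mem_head // scaler0.
by move=> y yl; apply: km; rewrite inE yl orbT.
Qed.

Lemma inI_mem e l y : y \in l -> @inI R R^o e l (y ^+ e).
Proof.
elim: l => [|x l IHl] //; rewrite inE => /orP[/eqP->|/IHl h] /=.
  by exists 1; rewrite [_ *: _]mulr1 subrr; exact: submod0 (submod_inI _ _ _).
by exists 0; rewrite scaler0 subr0.
Qed.

Lemma injective_div e x l m : @reg R R^o e (x :: l) -> killed e l m ->
  exists2 m0, killed e l m0 & x ^+ e *: m0 = m.
Proof.
move=> /= [rl rx] km.
pose Z : R^o -> Prop := @inI R R^o e (x :: l).
have sZ : submod Z by exact: submod_inI.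
have h (r : R) : exists r1 : R, Z r -> @inI R R^o e l (r - x ^+ e * r1).
  by case: (pselect (Z r)) => [[r1 ?]|?]; [exists r1|exists 0].
have [k hk] := choice h.
have uniq r r1 : Z r -> @inI R R^o e l (r - x ^+ e * r1) -> k r *: m = r1 *: m.
  move=> zr h1; apply/eqP; rewrite -subr_eq0 -scalerBl; apply/eqP/(killed_inI km)/rx.
  have -> : x ^+ e *: ((k r - r1) : R^o) = (r - x ^+ e * r1) - (r - x ^+ e * k r) :> R^o.
    by rewrite [LHS]mulrBr; abel.
  by apply: (submodB (submod_inI _ _ _)) => //; exact: hk.
have [| |g' _ gE] := @extend_linear R E R^o R^o idfun Z (fun b => b = 0) (fun r => k r *: m)
   iE sZ (submod00 _).
- move=> a u v zu zv; rewrite scalerA -scalerDl; apply: uniq.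
    by apply: (submodD sZ) => //; apply: (submodZ sZ).
  have -> : (a *: u + v : R^o) - x ^+ e * (a * k u + k v) =
      a *: (u - x ^+ e * k u : R^o) + (v - x ^+ e * k v).
    have e0 (a' u' v' x' p q : R) : a' * u' + v' - x' * (a' * p + q) =
      a' * (u' - x' * p) + (v' - x' * q) by ring.
    exact: e0.
  by apply: (submodD (submod_inI _ _ _)); [apply: (submodZ (submod_inI _ _ _))|]; exact: hk.
- by move=> z zz /= ->; rewrite (uniq _ 0) ?scale0r ?mulr0 ?subr0 //; [exact: submod0 sZ|exact: submod0 (submod_inI _ _ _)].
have gk (r : R^o) : r *: g' 1 = g' r by rewrite -linearZ /= [_ *: _]mulr1.
exists (g' 1) => [y yl|]; rewrite gk gE.
- have zy : Z (y ^+ e) by apply: inI_mem; rewrite inE yl orbT.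
  rewrite (uniq _ 0) ?scale0r ?mulr0 ?subr0 //; exact: inI_mem.
- by exists 0; rewrite scaler0 subr0; exact: inI_mem.
- by rewrite (uniq _ 1) ?scale1r ?mulr1 ?subrr //; [exact: inI_mem (mem_head _ _)|exact: submod0 (submod_inI _ _ _)].
- exact: inI_mem (mem_head _ _).
Qed.

(** For an injective module only degree 0 survives: the degree 0 cohomology of the tail consists of
    the elements killed by the tail, and [injective_div] says that [x ^+ e] acts surjectively on
    it. *)
Lemma Kinj e l k (u : KT l E) : @reg R R^o e l -> Kdg k.+2 u -> Kd e u = 0 ->
  exists2 w, Kdg k.+1 w & u = Kd e w.
Proof.
elim: l k u => [|x l IHl] k u.
  by move=> _ [//|->] _; exists 0; [right|].
case: u => a b rl [da db] [ea eb]; have [rl' rx] := rl.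
have [w dw aw] := IHl k a rl' da ea.
pose b' := b - x ^+ e *: w.
have db' : Kdg k.+1 b'.
  by apply: (submodB (submod_Kdg _ _)) => //; apply: (submodZ (submod_Kdg _ _)).
have eb' : Kd e b' = 0.
  rewrite linearB linearZ /= -aw; apply/eqP; rewrite subr_eq0 eq_sym -subr_eq0.
  exact/eqP.
case: k da db dw db' => [|k] da db dw db'.
  have [m em] := Kemb0E db'.
  have km : killed e l m.
    apply/(Kin_demb0 e l m (submod00 E)); rewrite -em eb'; exact: submod0 (submod_Kin _ (submod00 _)).
  have [m0 km0 xm0] := injective_div rl km.
  exists (w + Kemb0 l m0, 0).
    split=> /=; last exact: submod0 (submod_Kdg _ _).
    by apply: (submodD (submod_Kdg _ _)) => //; exact: Kdg_emb0.
  have d0 : Kd e (Kemb0 l m0) = 0.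
    have := (Kin_demb0 e l m0 (submod00 E)).2 km0.
    by elim: (l) (Kd e _) => [|y l' IH] //= [a' b''] /= [/IH-> /IH->].
  rewrite /= linear0 subr0 linearD /= d0 addr0 -aw scalerDr -linearZ /= xm0 -em.
  by rewrite addrC subrK.
have [v dv ev] := IHl k b' rl' db' eb'.
exists (w, - v); first by split=> //; apply: (submodN (submod_Kdg _ _)).
by rewrite /= linearN /= opprK -aw -ev addrC subrK.
Qed.

Lemma CV_injective l k : (forall e, @reg R R^o e l) -> (0 < k)%N ->
  CV l k (fun _ : E => True) (fun u => u = 0).
Proof.
case: k => // k rl _ e u _ du bu; exists 0%N.
have bu0 : Kd e u = 0.
  by elim: (l) (Kd e u) bu => [|x l' IH] //= [a b] /= [/IH-> /IH->].
have [w dw ->] := Kinj (rl e) du bu0.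
exists w; first by split=> //; elim: (l) w {dw} => [|x l' IH] //= w.
by rewrite Kt0 addn0 subrr; exact: submod0 (submod_Kin l (submod00 _)).
Qed.
End KInjective.

Section Bridge.
Variables (R : comNzRingType) (l : seq R) (J : R -> Prop).
Hypothesis rl : forall e, @reg R R^o e l.
Hypothesis tors1 : forall (M : lmodType R) (x : M),
  torsion J x -> exists e, forall y, y \in l -> y ^+ e *: x = 0.
Hypothesis tors2 : forall (M : lmodType R) (x : M) e,
  (forall y, y \in l -> y ^+ e *: x = 0) -> torsion J x.

(** Dimension shifting. With N i the cocycles of E i, the sequences 0 -> N i -> E i -> N (i+1) -> 0
    and the acyclicity of E i move the hypothesis from H^k of M to H^1 of N (k-1), which says that
    torsion cocycles are images of torsion elements. *)
Theorem CV_local_cohomology (M : lmodType R) k :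
  CV l k (fun _ : M => True) (fun u => u = 0) -> local_cohomology_zero J M k.
Proof.
move=> h E x tx dx; pose N i := fun y : E i => ires_d E i y = 0.
have sN i : submod (N i) by apply: (submod_ker (ires_d E i) (submod00 _)).
have sT (i : nat) := submodT (E i).
have hN i j : (0 < j)%N || (i == 0)%N -> (i + j = k)%N -> CV l j (N i) (fun u => u = 0).
  elim: i j => [|i IHi] j hj ij.
    rewrite add0n in ij; rewrite ij.
    apply: (@vmap _ _ (CV_vtheory l k) M (E 0%N) (ires_aug E) _ _ _ _ (submodT M) (sN 0%N)
      (submod00 M) (submod00 _)) => //.
    - by move=> z _; apply/ires_exact0; exists z.
    - by move=> v /ires_exact0[m <-]; exists m; rewrite ?subrr.
    - move=> z _; split=> [->|]; first by rewrite linear0.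
      by rewrite -(linear0 (ires_aug E)) => /ires_inj.
  rewrite orbF in hj.
  apply: (@vmap _ _ (CV_vtheory l j) (E i) (E i.+1) (ires_d E i) _ _ _ _ (sT i) (sN i.+1)
    (sN i) (submod00 _)) => //.
  - by move=> z _; apply/ires_exact; exists z.
  - by move=> v /ires_exact[m <-]; exists m; rewrite ?subrr.
  - apply: (CV_quot (sT i) (sN i) (submod00 _)) => //.
    + by move=> u ->; exact: submod0 (sN i).
      by apply: CV_injective => //; exact: ires_injective.
    by apply: IHi; rewrite ?addnS.
have [e ke] := tors1 tx.
case: k x tx dx h hN ke => [|k] x tx dx h hN ke.
  have [|||f [w [_ /Kdg0->]]] := hN 0%N 0%N isT erefl e (Kemb0 l x).
  - by apply: (Kin_emb0 _ (sN 0%N)).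
  - exact: Kdg_emb0.
  - apply/Kin_demb0; first exact: submod00.
    by move=> y yl; exact: ke.
  rewrite linear0 subr0 Kt_emb0 /= => h0.
  by elim: (l) h0 => //= y l' IH [/IH].
have [y0 yx] : exists y0, ires_d E k y0 = x by apply/ires_exact.
have sN0 : submod (fun u : E k => u = 0) by exact: submod00.
(* The Koszul coboundary of y0 has values in N k, since powers of the parameters kill x = d y0.
   Writing it as the coboundary of some w0 in N k makes y0 - w0 torsion. *)
have [|||f [w [zw dw] bw]] := hN k 1%N isT (addn1 k) e (Kd e (Kemb0 l y0)).
- by apply/Kin_demb0 => // y yl; rewrite /N linearZ /= yx ke.
- by apply: Kdg_d; exact: Kdg_emb0.
- by rewrite Kdd; exact: submod0 (submod_Kin _ _).
have [w0 ew] := Kemb0E dw.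
have zw0 : N k w0.
  by move: zw; rewrite ew; elim: (l) => //= ? ? IH [/IH].
exists (y0 - w0); last by rewrite linearB yx [ires_d E k w0]zw0 subr0.
apply: (tors2 (e := (e + f)%N)); apply/(Kin_demb0 _ _ _ sN0).
by move: bw; rewrite -Kdt Kt_emb0 ew -linearB -linearB.
Qed.
End Bridge.

(** * Polynomial rings *)

Section MonomialRegular.
Variables (n : nat) (K : comNzRingType).
Local Notation R := {mpoly K[n]}.
Implicit Types (p : R) (m : 'X_{1..n}).

Definition mres (P : pred 'X_{1..n}) p : R := \sum_(m <- msupp p | P m) p@_m *: 'X_[m].

Lemma mcoeff_mres P p m : (mres P p)@_m = if P m then p@_m else 0.
Proof.
rewrite /mres raddf_sum /=.
under eq_bigr do rewrite mcoeffZ mcoeffX.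
have [pm|pm] := boolP (m \in msupp p).
  case: ifP => Pm.
    rewrite big_mkcond (bigD1_seq m) ?msupp_uniq //= Pm eqxx mulr1 big1 ?addr0 // => k /negPf ->.
    by rewrite mulr0 if_same.
  by rewrite big1 // => k Pk; have [ek|] := eqVneq k m; rewrite ?mulr0 // -ek Pk in Pm *.
rewrite (memN_msupp_eq0 pm) if_same big_seq_cond big1 // => k /andP[kp _].
by have [ek|] := eqVneq k m; rewrite ?mulr0 // -ek kp in pm *.
Qed.

Lemma inI_monomial e (s : seq 'I_n) p :
  @inI R R^o e [seq 'X_i | i <- s] p <->
  forall m, p@_m != 0 -> has (fun i => e <= m i)%N s.
Proof.
elim: s p => [|i s IHs] p /=.
  split=> [->|h]; first by move=> m; rewrite mcoeff0 eqxx.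
  by apply/mpolyP => m; rewrite mcoeff0; apply/eqP/negPn/negP=> /h.
have Xe q m : ('X_i ^+ e *: (q : R^o))@_m != 0 -> (e <= m i)%N.
  rewrite [_ *: _]mulrC mpolyXn -mcoeff_msupp (perm_mem (msuppMX _ _)).
  by move=> /mapP[m' _ ->]; rewrite mnmDE mulmnE mnm1E eqxx; lia.
split=> [[p1 /IHs h] m pm|h].
  have [pe|pe] := eqVneq ('X_i ^+ e *: (p1 : R^o))@_m 0; last by rewrite (Xe _ _ pe).
  by rewrite h ?orbT // mcoeffB pe subr0.
pose p1 : R := \sum_(m <- msupp p | (e <= m i)%N) p@_m *: 'X_[m - (U_(i) *+ e)].
exists p1; apply/IHs => m; suff -> : p - 'X_i ^+ e *: (p1 : R^o) = mres (fun m => ~~ (e <= m i)%N) p.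
  rewrite mcoeff_mres; case: ifP => [/negPf hm /h|]; first by rewrite hm.
  by rewrite eqxx.
have -> : 'X_i ^+ e *: (p1 : R^o) = mres (fun m => e <= m i)%N p.
  rewrite [LHS]mulr_sumr; apply: eq_bigr => k hk.
  rewrite -scalerAr mpolyXn -mpolyXD addmC submK //.
  apply/mnm_lepP => j; rewrite mulmnE mnm1E; case: eqP => [<-|_]; by rewrite ?mul1n ?mul0n.
apply/mpolyP => k; rewrite mcoeffB !mcoeff_mres.
by case: ifP; rewrite ?subrr ?subr0.
Qed.

Lemma reg_X e (s : seq 'I_n) : uniq s -> @reg R R^o e [seq 'X_i | i <- s].
Proof.
elim: s => //= i s IHs /andP[ni us]; split; first exact: IHs.
move=> q /inI_monomial h; apply/inI_monomial => m qm.
have := h (U_(i) *+ e + m)%MM; rewrite [_ *: _]mulrC mpolyXn mcoeffMX => /(_ qm).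
move=> /hasP[j js hj]; apply/hasP; exists j => //; move: hj.
rewrite mnmDE mulmnE mnm1E; case: eqP => [ij|_]; last by rewrite mul0n add0n.
by rewrite ij js in ni.
Qed.

Definition Xlist : seq R := [seq 'X_i | i <- enum 'I_n].

Lemma size_Xlist : size Xlist = n. Proof. by rewrite size_map size_enum_ord. Qed.

Lemma reg_Xlist e : @reg R R^o e Xlist.
Proof. by apply: reg_X; exact: enum_uniq. Qed.

Lemma pdc_free (Q : lmodType R) (E : inj_resolution Q) :
  pdc Xlist E 0 (fun _ : R^o => True) (fun u => u = 0).
Proof.
split=> [k|i _ g _ gZ].
  by rewrite addn0; apply: CV_free; exact: reg_Xlist.
have /ires_exact[e0 he0] := gZ 1 I.
have hL : linear (fun r : R^o => (r : R) *: e0).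
  by move=> a u v; rewrite scalerA -scalerDl.
exists (mklinear hL) => [b _ ->|z _] /=; first exact: scale0r.
by rewrite linearZ /= he0 -linearZ /= [z%:A]mulr1.
Qed.

End MonomialRegular.

Section IrrelevantTorsion.
Variables (K : fieldType) (n : nat).
Local Notation R := {mpoly K[n.+1]}.
Local Notation m := (@irrelevant_ideal K n).

Lemma irrelevant_X i : m ('X_i : R).
Proof.
exists [:: (1, 'X_i)]; last by rewrite big_seq1 mul1r.
by move=> u; rewrite inE => /eqP->; exists i.
Qed.

Lemma ideal_pow_X (J : R -> Prop) x e : J x -> ideal_pow J e (x ^+ e).
Proof.
move=> Jx; exists [:: (1, x ^+ e)]; last by rewrite big_seq1 mul1r.
by move=> u; rewrite inE => /eqP->; exists (fun=> x) => //; rewrite prodr_const card_ord.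
Qed.

Lemma irrelevant_tors1 (M : lmodType R) (x : M) : torsion m x ->
  exists e, forall y, y \in Xlist n.+1 K -> y ^+ e *: x = 0.
Proof.
move=> [e he]; exists e => y /mapP[i _ ->]; apply/he/ideal_pow_X.
exact: irrelevant_X.
Qed.

Lemma irrelevant_mcoeff (p : R) : m p -> p@_0%MM = 0.
Proof.
move=> [s hs ->]; rewrite raddf_sum big_seq big1 // => u /hs [i ->] /=.
apply/eqP; rewrite mcoeff_eq0 (perm_mem (msuppMX _ _)); apply/mapP => -[k _].
by move/(congr1 (@mdeg _)); rewrite mdeg0 mdegD mdeg1.
Qed.

Lemma irrelevant_pow_msupp e p k : ideal_pow m e p -> p@_k != 0 -> (e <= mdeg k)%N.
Proof.
move=> [s hs ->]; apply: contraR; rewrite -ltnNge => hk.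
rewrite raddf_sum /= big_seq big1 // => u /hs [f hf ->].
suff h (g : R) (j : nat) (F : nat -> R) l : (forall i, m (F i)) -> (mdeg l < j)%N ->
    (g * \prod_(i < j) F i)@_l = 0.
  have [e0|e1] := posnP e; first by rewrite e0 in hk.
  pose F i := f (insubd (Ordinal e1) i).
  rewrite (eq_bigr (fun i : 'I_e => F i)); last first.
    by move=> i _; rewrite /F; congr f; apply: val_inj; rewrite val_insubd ltn_ord.
  by apply: h => // i; exact: hf.
move=> hF; elim: j g l => // j IHj g l hl.
rewrite big_ord_recr /= mulrA mcoeffM big1 // => -[k1 k2] /= /eqP lE.
have [k20|k20] := eqVneq (bmnm k2) 0%MM.
  by rewrite k20 (irrelevant_mcoeff (hF j)) mulr0.
rewrite IHj ?mul0r //; have := congr1 (@mdeg _) lE; rewrite mdegD.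
have : (0 < mdeg k2)%N by rewrite lt0n mdeg_eq0.
move: hl; lia.
Qed.

Lemma irrelevant_tors2 (M : lmodType R) (x : M) e :
  (forall y, y \in Xlist n.+1 K -> y ^+ e *: x = 0) -> torsion m x.
Proof.
(* Pigeonhole: a monomial of this degree in n + 1 variables has an exponent at least [e]. *)
move=> kx; exists (n.+1 * e)%N => r hr.
have kx' (i : 'I_n.+1) : 'X_i ^+ e *: x = 0 by apply/kx/map_f; rewrite mem_enum.
rewrite [r]mpolyE scaler_suml big_seq big1 // => k; rewrite mcoeff_msupp => /(irrelevant_pow_msupp hr) hk.
have [i hi] : exists i, (e <= k i)%N.
  case: e hk {kx kx' hr} => [|e] hk; first by exists ord0.
  apply/existsP; apply: contraLR hk; rewrite negb_exists -ltnNge => /forallP h.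
  rewrite mdegE (leq_ltn_trans (n := (\sum_(i < n.+1) e)%N)) //.
    by apply: leq_sum => i _; have := h i; rewrite -ltnNge ltnS.
  by rewrite sum_nat_const card_ord; lia.
have -> : k = (k - U_(i) *+ e + U_(i) *+ e)%MM.
  rewrite submK //; apply/mnm_lepP => j; rewrite mulmnE mnm1E.
  by case: eqP => [<-|_]; rewrite ?mul1n ?mul0n.
by rewrite mpolyXD -mpolyXn scalerAl -scalerA kx' scaler0.
Qed.

Theorem CV_irrelevant (M : lmodType R) k :
  CV (Xlist n.+1 K) k (fun _ : M => True) (fun u => u = 0) -> local_cohomology_zero m M k.
Proof.
apply: CV_local_cohomology => //.
- exact: reg_Xlist.
- exact: irrelevant_tors1.
- exact: irrelevant_tors2.
Qed.
End IrrelevantTorsion.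

Section QuotMod.
Variables (R : nzRingType) (M : lmodType R) (P : M -> Prop) (sP : submod P).
Local Open Scope quotient_scope.

Definition quot_mod : Type := Quotient.quot (subp sP).
HB.instance Definition _ := EqQuotient.on quot_mod.
HB.instance Definition _ := GRing.Zmodule.on quot_mod.

Lemma quot_modP (x y : M) : (\pi_quot_mod x = \pi_quot_mod y) <-> P (x - y).
Proof.
have -> : P (x - y) <-> x - y \in subp sP by split=> [/asboolT|/asboolP].
by rewrite (Quotient.idealrBE (subp sP)); split=> [/eqP|/eqP].
Qed.

Let scale (a : R) (x : quot_mod) : quot_mod := \pi_quot_mod (a *: repr x).

Fact quot_mod_scaleE a x : scale a (\pi_quot_mod x) = \pi_quot_mod (a *: x).
Proof.
apply/quot_modP; rewrite -scalerBr; apply: (submodZ sP); apply/quot_modP.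
by rewrite reprK.
Qed.

Fact quot_mod_scalerA a b x : scale a (scale b x) = scale (a * b) x.
Proof. by rewrite -[x]reprK (quot_mod_scaleE b) (quot_mod_scaleE a) (quot_mod_scaleE (a * b)) scalerA. Qed.
Fact quot_mod_scale1r : left_id 1 scale.
Proof. by move=> x; rewrite -[x]reprK quot_mod_scaleE scale1r. Qed.
Fact quot_mod_scalerDr : right_distributive scale +%R.
Proof.
move=> a x y; rewrite -[x]reprK -[y]reprK !quot_mod_scaleE.
by rewrite -!(raddfD \pi_quot_mod) quot_mod_scaleE scalerDr.
Qed.
Fact quot_mod_scalerDl x : {morph scale^~ x : a b / a + b}.
Proof.
by move=> a b; rewrite -[x]reprK !quot_mod_scaleE -(raddfD \pi_quot_mod) scalerDl.
Qed.
HB.instance Definition _ := GRing.Zmodule_isLmodule.Build R quot_mod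
  quot_mod_scalerA quot_mod_scale1r quot_mod_scalerDr quot_mod_scalerDl.

Definition quot_proj (x : M) : quot_mod := \pi_quot_mod x.
Fact quot_proj_linear : linear quot_proj.
Proof.
move=> a x y; rewrite /quot_proj (raddfD \pi_quot_mod); congr (_ + _).
exact: esym (quot_mod_scaleE a x).
Qed.
HB.instance Definition _ := GRing.isLinear.Build R M quot_mod _ quot_proj quot_proj_linear.

Lemma quot_proj0 x : quot_proj x = 0 <-> P x.
Proof. by rewrite -(linear0 quot_proj) quot_modP subr0. Qed.
Lemma quot_proj_surj y : exists x, quot_proj x = y.
Proof. by exists (repr y); rewrite /quot_proj reprK. Qed.
End QuotMod.

(** * Injective resolutions by coinduced modules *)

Section FieldExtension.
Variables (K : fieldType) (R : nzRingType) (iota : {rmorphism K -> R}).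
Variables (X Y M : lmodType R).

Definition Klin (A B : lmodType R) (f : A -> B) :=
  forall c u v, f (iota c *: u + v) = iota c *: f u + f v.

(** Zorn's lemma gives a K-complement of the image of [g]; the extension is [f] after projection
    along it. [Klin] is linearity over the subfield only. *)
Lemma Klinear_extend (g : {linear X -> Y}) (f : X -> M) : injective g -> Klin f ->
  exists2 F : Y -> M, Klin F & forall x, F (g x) = f x.
Proof.
move=> gI fL.
have fB u v : f (u - v) = f u - f v.
  by have := fL (-1) v u; rewrite rmorphN1 !scaleN1r [- v + u]addrC [- f v + _]addrC.
pose P (C : classical_sets.set Y) := (forall c u v, C u -> C v -> C (iota c *: u + v)) /\
  (forall x, C (g x) -> g x = 0).
have [F FP totF|A [[AD A0] Amax]] := @classical_sets.Zorn_bigcup Y P.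
  split=> [c u v [C1 FC1 Cu] [C2 FC2 Cv]|x [C FC Cx]]; last by have [_ ->] := FP C FC.
  have [C12|C21] := totF _ _ FC1 FC2.
    by exists C2 => //; apply: (FP C2 FC2).1 => //; exact: C12.
  by exists C1 => //; apply: (FP C1 FC1).1 => //; exact: C21.
(* The empty set satisfies [P], being the union of the empty chain, so 0 has to be adjoined to the
   maximal element. *)
pose A' y := A y \/ y = 0.
have A'D c u v : A' u -> A' v -> A' (iota c *: u + v).
  have A0' : (exists y, A y) -> A 0.
    by move=> [y Ay]; have := AD (-1) _ _ Ay Ay; rewrite rmorphN1 scaleN1r addNr.
  case=> [Au|->]; last by rewrite scaler0 add0r.
  case=> [Av|->]; first by left; exact: AD.
  by left; apply: AD => //; apply: A0'; exists u.
have A'0 x : A' (g x) -> g x = 0 by case=> // /A0.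
have dec y : exists x, A' (y - g x).
  apply: contrapT => ny.
  pose B z := exists c a, A' a /\ z = iota c *: y + a.
  have AB z : A' z -> B z by move=> Az; exists 0, z; rewrite rmorph0 scale0r add0r.
  have By : B y by exists 1, 0; rewrite rmorph1 scale1r addr0; split=> //; right.
  apply: (Amax B).
    split=> [z Az|]; first by apply: AB; left.
    move=> /(_ y By) Ay; apply: ny; exists 0; rewrite linear0 subr0; by left.
  split=> [c u v [c1 [a1 [Aa1 ->]]] [c2 [a2 [Aa2 ->]]]|x [c [a [Aa gx]]]].
    exists (c * c1 + c2), (iota c *: a1 + a2); split; first exact: A'D.
    by rewrite rmorphD rmorphM; modr.
  have [c0|c0] := eqVneq c 0.
    by apply: A'0; rewrite gx c0 rmorph0 scale0r add0r.
  case: ny; exists (iota c^-1 *: x).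
  have -> : y - g (iota c^-1 *: x) = iota (- c^-1) *: a + 0.
    rewrite linearZ /= gx scalerDr scalerA -rmorphM mulVf // rmorph1 scale1r rmorphN.
    by modr.
  by apply: A'D => //; right.
have [k hk] := choice dec.
have kE y x : A' (y - g x) -> k y = x.
  move=> h; apply: gI; apply/eqP; rewrite -subr_eq0 -linearB; apply/eqP/A'0.
  have -> : g (k y - x) = iota (-1) *: (y - g (k y)) + (y - g x).
    by rewrite rmorphN1 scaleN1r linearB; abel.
  exact: A'D.
exists (f \o k) => [c u v|x] /=.
  rewrite -fL; congr f; apply: kE.
  have -> : iota c *: u + v - g (iota c *: k u + k v) =
    iota c *: (u - g (k u)) + (v - g (k v)) by rewrite linearP; modr.
  exact: A'D.
by congr f; apply: kE; rewrite subrr; right.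
Qed.
End FieldExtension.

Section Coinduced.
Variables (K : fieldType) (R : comNzRingType) (iota : {rmorphism K -> R}) (M : lmodType R).

(* Hom_K(R, M), with R acting on the source *)
Definition cofP : {pred R -> M} :=
  fun g => `[< forall c r s, g (iota c * r + s) = iota c *: g r + g s >].
Fact cofP_closed : zmod_closed cofP.
Proof.
split=> [|g h /asboolP hg /asboolP hh]; apply/asboolP => c r s.
  by rewrite scaler0 addr0.
have E z : (g - h) z = g z - h z by [].
by rewrite !E hg hh; modr.
Qed.
HB.instance Definition _ := GRing.isZmodClosed.Build (R -> M) cofP cofP_closed.
Definition cof : Type := {g : R -> M | g \in cofP}.
HB.instance Definition _ := SubChoice.on cof.
HB.instance Definition _ := [SubChoice_isSubZmodule of cof by <:].

Lemma cofE (g : cof) c r s : val g (iota c * r + s) = iota c *: val g r + val g s.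
Proof. by case: g => g /= /asboolP. Qed.
Lemma cofD (g : cof) r s : val g (r + s) = val g r + val g s.
Proof. by have := cofE g 1 r s; rewrite rmorph1 mul1r scale1r. Qed.

Fact cof_scale_subproof (a : R) (g : cof) : (fun r => val g (a * r)) \in cofP.
Proof. by apply/asboolP => c r s; rewrite mulrDr mulrCA cofE. Qed.
Definition cof_scale (a : R) (g : cof) : cof := exist (fun g => g \in cofP) _ (cof_scale_subproof a g).

Fact cof_scalerA a b x : cof_scale a (cof_scale b x) = cof_scale (a * b) x.
Proof. by apply: val_inj; apply/funext => r /=; rewrite mulrA [b * a]mulrC. Qed.
Fact cof_scale1r : left_id 1 cof_scale.
Proof. by move=> x; apply: val_inj; apply/funext => r /=; rewrite mul1r. Qed.
Fact cof_scalerDr : right_distributive cof_scale +%R.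
Proof. by move=> a x y; apply: val_inj; apply/funext. Qed.
Fact cof_scalerDl x : {morph cof_scale^~ x : a b / a + b}.
Proof. by move=> a b; apply: val_inj; apply/funext => r /=; rewrite mulrDl cofD. Qed.
HB.instance Definition _ := GRing.Zmodule_isLmodule.Build R cof
  cof_scalerA cof_scale1r cof_scalerDr cof_scalerDl.

(** By adjunction, R-linear maps Y -> Hom_K(R, M) are K-linear maps Y -> M, and these extend along
    injections because K is a field. *)
Lemma cof_injective : injective_module cof.
Proof.
move=> X Y g f gI.
have fL : Klin iota (fun x => val (f x) 1).
  move=> c u v; change (val (f (iota c *: u + v)) 1 = iota c *: val (f u) 1 + val (f v) 1).
  rewrite linearP.
  have -> : val (iota c *: f u + f v) 1 = val (f u) (iota c * 1) + val (f v) 1 by [].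
  congr (_ + _); have := cofE (f u) c 1 0.
  have -> : val (f u) 0 = 0.
    by have := cofD (f u) 0 0; rewrite addr0 => /(congr1 (fun x => x - val (f u) 0)); rewrite addrK subrr.
  by rewrite !addr0.
have [F FL Fg] := Klinear_extend gI fL.
have FP y : (fun r : R => F (r *: y)) \in cofP.
  by apply/asboolP => c r s; rewrite scalerDl -scalerA FL.
pose h (y : Y) : cof := exist (fun g => g \in cofP) _ (FP y).
have hL : linear h.
  move=> a u v; apply: val_inj; apply/funext => r.
  have -> : val (a *: h u + h v) r = F ((a * r) *: u) + F (r *: v) by [].
  rewrite /= scalerDr scalerA [r * a]mulrC.
  by have := FL 1 ((a * r) *: u) (r *: v); rewrite rmorph1 !scale1r.
exists (mklinear hL) => x; apply: val_inj; apply/funext => r /=.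
by rewrite -linearZ Fg linearZ /= mulr1.
Qed.

Fact cof_unit_subproof (x : M) : (fun r : R => r *: x) \in cofP.
Proof. by apply/asboolP => c r s; rewrite scalerDl scalerA. Qed.
Definition cof_unit (x : M) : cof := exist (fun g => g \in cofP) _ (cof_unit_subproof x).
Fact cof_unit_linear : linear cof_unit.
Proof.
move=> a x y; apply: val_inj; apply/funext => r.
have -> : val (a *: cof_unit x + cof_unit y) r = (a * r) *: x + r *: y by [].
by rewrite /= scalerDr scalerA mulrC.
Qed.
HB.instance Definition _ := GRing.isLinear.Build R M cof _ cof_unit cof_unit_linear.

Lemma cof_unit_inj : injective cof_unit.
Proof. by move=> x y /(congr1 (fun g : cof => val g 1)); rewrite /= !scale1r. Qed.

Definition cof_im (g : cof) : Prop := exists x, g = cof_unit x.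
Fact submod_cof_im : submod cof_im.
Proof.
split; first by exists 0; rewrite linear0.
by move=> a u v [x ->] [y ->]; exists (a *: x + y); rewrite linearP.
Qed.
Definition cosyz : lmodType R := quot_mod submod_cof_im.
End Coinduced.

Section InjResolution.
Variables (K : fieldType) (R : comNzRingType) (iota : {rmorphism K -> R}) (M : lmodType R).

Fixpoint cosyzs (i : nat) : lmodType R := if i is i'.+1 then cosyz iota (cosyzs i') else M.
Definition cof_res i : lmodType R := cof iota (cosyzs i).
Definition cof_d i : {linear cof_res i -> cof_res i.+1} :=
  @cof_unit K R iota (cosyzs i.+1) \o quot_proj (submod_cof_im iota (cosyzs i)).

Lemma cof_dE i x : cof_d i x = 0 <-> exists y, cof_unit iota y = x.
Proof.
split=> [h|[y <-]].
  have /quot_proj0[y ->] : quot_proj (submod_cof_im iota (cosyzs i)) x = 0.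
    by apply: (@cof_unit_inj K R iota (cosyzs i.+1)); rewrite [LHS]h linear0.
  by exists y.
rewrite /cof_d /=; have -> : quot_proj (submod_cof_im iota (cosyzs i)) (cof_unit iota y) = 0.
  by apply/quot_proj0; exists y.
exact: linear0.
Qed.

Definition cof_resolution : inj_resolution M.
Proof.
refine (@InjResolution R M cof_res cof_d (@cof_unit K R iota M) _ _ _ _).
- by move=> i; exact: cof_injective.
- exact: cof_unit_inj.
- by move=> x; exact: cof_dE.
- move=> i x; rewrite cof_dE; split=> [[y <-]|[y <-]].
    have [z hz] := quot_proj_surj (sP := submod_cof_im iota (cosyzs i)) y.
    by exists z; rewrite -hz.
  by eexists; reflexivity.
Defined.
End InjResolution.

(** * Depth, Koszul cohomology and graded Nakayama *)

Section Depth.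
Variables (R : comNzRingType) (X : seq R).

Lemma CV0_torsion (M : lmodType R) (Z B : M -> Prop) u : submod B ->
  CV X 0 Z B -> submod Z -> Z u -> (forall x, x \in X -> exists a, B (x ^+ a *: u)) -> B u.
Proof.
move=> sB h sZ zu tu.
have [e he] : exists e, forall x, x \in X -> B (x ^+ e *: u).
  elim: (X) tu => [|x l IHl] tu; first by exists 0%N.
  have [|e he] := IHl; first by move=> y yl; apply: tu; rewrite inE yl orbT.
  have [a ha] := tu x (mem_head _ _).
  exists (a + e)%N => y; rewrite inE => /orP[/eqP->|/he hy].
    by rewrite addnC exprD -scalerA; apply: (submodZ sB).
  by rewrite exprD -scalerA; apply: (submodZ sB).
have [|||f [w [_ /Kdg0->]]] := h e (Kemb0 X u).
- exact: Kin_emb0.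
- exact: Kdg_emb0.
- exact/Kin_demb0.
rewrite linear0 subr0 Kt_emb0.
by elim: (X) => //= y l IH [/IH].
Qed.

Section KoszulDepth.
Variables (M : lmodType R) (Z B : M -> Prop) (w : seq R).
Hypotheses (sZ : submod Z) (sB : submod B) (BZ : forall u, B u -> Z u).

Definition KH (l : seq R) (i : nat) := forall u : KT l M,
  Kin Z u -> Kdg i.+1 u -> Kin B (Kd 1 u) ->
  exists2 v, Kin Z v /\ Kdg i v & Kin B (u - Kd 1 v).

Let T (P : M -> Prop) (l : seq R) i (u : KT l M) := Kin P u /\ Kdg i u.
Let sT (P : M -> Prop) l i : submod P -> submod (T P (l := l) i).
Proof. by move=> sP; apply: submodI; [exact: submod_Kin|exact: submod_Kdg]. Qed.

Let CVT l i j : CV X j Z B -> CV X j (T Z (l := l) i) (T B (l := l) i).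
Proof.
move=> h; elim: l i => [|x l IHl] i.
  have [->|i1] := eqVneq i 1%N.
    by apply: (veq (CV_vtheory X j) (Z := Z) (B := B)) => //; try exact: sT;
       move=> u; rewrite /T /=; intuition.
  apply: (vtriv (CV_vtheory X j)); try exact: sT.
  move=> u [_ /= [e1|->]]; first by rewrite e1 eqxx in i1.
  by split; [exact: submod0 sB|right].
have hBZ k (u : KT l M) : T B k u -> T Z k u by move=> [b d]; split=> //; exact: Kin_sub b.
apply: (veq (CV_vtheory X j) (Z := prodP (T Z (l := l) i) (T Z (l := l) i.-1))
   (B := prodP (T B (l := l) i) (T B (l := l) i.-1))).
- by apply: submod_prod; exact: sT.
- by apply: submod_prod; exact: sT.
- by move=> u; rewrite /T /prodP /=; intuition.
- by move=> u _; rewrite /T /prodP /=; intuition.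
- exact: sT.
- exact: sT.
by apply: (vprod (CV_vtheory X j)) => //; try exact: sT; exact: hBZ.
Qed.

Variable D : nat.
Hypothesis depth : forall i, (i < D)%N -> CV X i Z B.
Hypothesis radw : forall x, x \in X -> exists a (g : nat -> R),
  x ^+ a = \sum_(i < size w) g i * w`_i.

Let S i := imP (@Kd R M 1 w) (T Z (l := w) i) (T B (l := w) i.+1).
Let sS i : submod (S i).
Proof. by apply: submod_im; exact: sT. Qed.

Let BS i u : T B (l := w) i.+1 u -> S i u.
Proof. by exists 0; [exact: submod0 (sT _ _ sZ)|rewrite linear0 subr0]. Qed.
Let ST i u : S i u -> T Z (l := w) i.+1 u.
Proof.
move=> [v [zv dv] [b d]]; split.
  apply: (submodBr (submod_Kin w sZ)) (Kin_sub BZ b); exact: Kin_d.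
by apply: (submodBr (submod_Kdg _ _)) d; exact: Kdg_d.
Qed.

(** Cochains of degree i modulo coboundaries lose at most i from the depth of Z/B, as long as the
    Koszul complex is exact before degree i. *)
Let CVN i j : (j + i < D)%N -> (forall k, (k < i)%N -> KH w k) ->
  CV X j (T Z (l := w) i.+1) (S i).
Proof.
elim: i j => [|i IHi] j hj hK.
  rewrite addn0 in hj.
  have hv : CV X j (T Z (l := w) 1) (T B (l := w) 1) by apply: CVT; exact: depth.
  refine (veq (CV_vtheory X j) (sT _ _ sZ) (sT _ _ sB) _ _ (sT _ _ sZ) (sS _) hv) => //.
  move=> u _; split=> [|[v [_ /Kdg0->]]]; first exact: BS.
  by rewrite linear0 subr0.
apply: (CV_quot (sT _ _ sZ) (sS _) (sT _ _ sB) (@BS _) (@ST _)).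

- by apply: CVT; apply: depth; lia.
apply: (@vmap _ _ (CV_vtheory X j.+1) _ _ (@Kd R M 1 w) (T Z (l := w) i.+1) (S i) (S i.+1)
  (T B (l := w) i.+2) (sT _ _ sZ) (sS _) (sS _) (sT _ _ sB)).
- move=> z tz; exists z => //; rewrite subrr; exact: submod0 (sT _ _ sB).
- by move=> v [z tz bz]; exists z.
- move=> z [zz dz]; split.
    move=> [v [zv dv] [b d]]; split; last exact: Kdg_d.
    by have := Kin_d 1 sB b; rewrite linearB /= Kdd subr0.
  move=> [b _]; have [v [zv dv] bv] := hK i (ltnSn i) z zz dz b.
  by exists v => //; split=> //; apply: (submodB (submod_Kdg _ _)) => //; exact: Kdg_d.
- by apply: IHi => [|k ki]; [lia|apply: hK; lia].
Qed.

(** Koszul cohomology on [w] is killed by [w], hence is torsion for [X]; it lies in cochains modulo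
    coboundaries, which by [CVN] contain no such torsion. *)
Lemma Koszul_depth i : (i < D)%N -> KH w i.
Proof.
elim/ltn_ind: i => i IHi hi u zu du bu.
suff [v ? [? _]] : S i u by exists v.
apply: (CV0_torsion (sS i) (CVN _ _) (sT _ _ sZ)) => //.
- by move=> k ki; apply: IHi => //; lia.
move=> x /radw[a [g xa]]; exists a; rewrite xa scaler_suml.
apply: (submod_sum (sS i)) => j _; rewrite -scalerA; apply: (submodZ (sS i)).
have [|s [s1 s2 s3]] := @Khomot R M 1 w w`_j; first exact: mem_nth.
exists (s u); first by split; [exact: s2|exact: s1].
rewrite -[w`_j](expr1) s3 addrAC subrr add0r; split; first exact: s2.
by apply: s1; exact: Kdg_d.
Qed.
End KoszulDepth.
End Depth.

Section Grading.
Variables (R : comNzRingType) (homR : nat -> R -> Prop).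

Record grading (M : lmodType R) := Grading {
  gpi :> nat -> M -> M;
  gpiD : forall e u v, gpi e (u + v) = gpi e u + gpi e v;
  gpi_sum : forall u, exists N, forall N', (N <= N')%N -> u = \sum_(e < N') gpi e u;
  gpi_hom : forall a r e u, homR a r ->
    gpi e (r *: u) = if (a <= e)%N then r *: gpi (e - a) u else 0
}.

Definition graded (M : lmodType R) (g : grading M) (Z : M -> Prop) :=
  forall e u, Z u -> Z (g e u).

Section GradingTheory.
Variables (M : lmodType R) (g : grading M).
Lemma gpi0 e : g e 0 = 0.
Proof. by have := gpiD g e 0 0; rewrite addr0 => /(congr1 (+%R^~ (- g e 0))); rewrite addrK subrr. Qed.
Lemma gpiN e u : g e (- u) = - g e u.
Proof. by apply/eqP; rewrite -addr_eq0 -gpiD addNr gpi0. Qed.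
Lemma gpiB e u v : g e (u - v) = g e u - g e v.
Proof. by rewrite gpiD gpiN. Qed.

(** Induction on the degree: multiplication by [x] raises it by a > 0, and components in negative
    degree are absent. *)
Lemma Nakayama (Z B : M -> Prop) a x : submod B -> graded g B -> homR a x -> (0 < a)%N ->
  (forall u, Z u -> exists2 v, Z v & B (u - x *: v)) -> forall u, Z u -> B u.
Proof.
move=> sB gB hx a0 h u zu.
suff hB e v : Z v -> B (g e v).
  have [N /(_ N (leqnn N)) ->] := gpi_sum g u; apply: (submod_sum sB) => e _; exact: hB.
elim/ltn_ind: e v => e IHe v /h[v1 zv1 /(gB e)]; rewrite gpiB (gpi_hom g _ _ hx).
case: leqP => [ae|_]; last by rewrite subr0.
by move=> h1; apply: (submodBr sB) h1; apply: (submodZ sB); apply: IHe => //; lia.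
Qed.
End GradingTheory.

Section KGrading.
Variables (M : lmodType R) (g : grading M) (deg : R -> nat).

Fixpoint Kpi (e : nat) (l : seq R) : KT l M -> KT l M :=
  match l return KT l M -> KT l M with
  | [::] => g e
  | x :: l' => fun u => (if (deg x <= e)%N then Kpi (e - deg x) u.1 else 0, Kpi e u.2)
  end.

Lemma KpiD e l (u v : KT l M) : Kpi e (u + v) = Kpi e u + Kpi e v.
Proof.
elim: l e u v => [|x l IHl] e u v /=; first exact: gpiD.
by rewrite !IHl; case: ifP => // _; congr pair; rewrite /= addr0.
Qed.

Lemma Kpi0 e l : Kpi e (0 : KT l M) = 0.
Proof.
by elim: l e => [|x l IHl] e /=; [exact: gpi0|rewrite !IHl if_same].
Qed.

Lemma Kpi_hom a r e l (u : KT l M) : homR a r ->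
  Kpi e (r *: u) = if (a <= e)%N then r *: Kpi (e - a) u else 0.
Proof.
move=> hr; elim: l e u => [|x l IHl] e u /=; first exact: gpi_hom.
rewrite !IHl; case: (leqP a e) => ae; case: (leqP (deg x) e) => xe //=; congr pair => //=.
- case: (leqP a (e - deg x)) => h1; case: (leqP (deg x) (e - a)) => h2; try lia.
    by congr (_ *: Kpi _ _); lia.
  by rewrite scaler0.
- by case: leqP => h; [lia|rewrite scaler0].
- by case: leqP => h //; lia.
Qed.

Lemma Kpi_sum l (u : KT l M) : exists N, forall N', (N <= N')%N -> u = \sum_(e < N') Kpi e u.
Proof.
elim: l u => [|x l IHl] u /=; first exact: gpi_sum.
case: u => a b; have [Na ha] := IHl a; have [Nb hb] := IHl b.
exists (maxn (Na + deg x) Nb) => N' hN.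
have -> : \sum_(e < N') Kpi e ((a, b) : KT (x :: l) M) =
  (\sum_(e < N') (if (deg x <= e)%N then Kpi (e - deg x) a else 0), \sum_(e < N') Kpi e b).
  by elim: (N') => [|k IH]; rewrite ?big_ord0 // !big_ord_recr /= IH.
congr pair; last by apply: hb; lia.
have eN : N' = (deg x + (N' - deg x))%N by lia.
rewrite eN big_split_ord /= big1 ?add0r; last by move=> i _; rewrite leqNgt ltn_ord.
under eq_bigr do rewrite leq_addr addKn.
by apply: ha; lia.
Qed.

Definition Kgrading l : grading (KT l M) :=
  @Grading (KT l M) (fun e => @Kpi e l) (fun e => @KpiD e l) (@Kpi_sum l)
    (fun a r e u => @Kpi_hom a r e l u).

Lemma Kpi_d e l (u : KT l M) : (forall y, y \in l -> homR (deg y) y) ->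
  Kpi e (Kd 1 u) = Kd 1 (Kpi e u).
Proof.
elim: l e u => [|x l IHl] e u hl /=; first exact: gpi0.
have hx := hl x (mem_head _ _).
have {}IHl e' v := IHl e' v (fun y yl => hl y (mem_behead (s := x :: l) yl)).
rewrite expr1 KpiD -scaleN1r.
have KN v : Kpi e (-1 *: v : KT l M) = - Kpi e v.
  apply/eqP; rewrite scaleN1r -addr_eq0 -KpiD addNr; apply/eqP; exact: Kpi0.
rewrite KN (Kpi_hom _ _ hx) !IHl; case: leqP => h; congr pair.
  by rewrite linear0.
by rewrite /= scaler0 add0r.
Qed.

Lemma Kin_pi (Z : M -> Prop) e l (u : KT l M) : submod Z -> graded g Z -> Kin Z u -> Kin Z (Kpi e u).
Proof.
move=> sZ gZ; elim: l e u => [|x l IHl] e u /=; first exact: gZ.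
move=> [h1 h2]; split; last exact: IHl.
by case: ifP => _; [exact: IHl|exact: submod0 (submod_Kin _ sZ)].
Qed.

Lemma Kdg_pi k e l (u : KT l M) : Kdg k u -> Kdg k (Kpi e u).
Proof.
elim: l k e u => [|x l IHl] k e u /=.
  by case=> [->|->]; [left|right; exact: gpi0].
move=> [h1 h2]; split; last exact: IHl.
by case: ifP => _; [exact: IHl|exact: submod0 (submod_Kdg _ _)].
Qed.

Variables (Z B : M -> Prop).
Hypotheses (sZ : submod Z) (sB : submod B) (BZ : forall u, B u -> Z u).
Hypotheses (gZ : graded g Z) (gB : graded g B).

(** If (0, u) is the coboundary of (a, b) for [x :: l], then a is a cocycle and u = x a - d b. The
    cohomology on [l] therefore equals its multiple by [x], and Nakayama applies. *)
Lemma KH_drop x l i : (forall y, y \in x :: l -> homR (deg y) y) -> (0 < deg x)%N ->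
  KH Z B (x :: l) i.+1 -> KH Z B l i.
Proof.
move=> hl dx h u zu du bu.
pose W (u : KT l M) := [/\ Kin Z u, Kdg i.+1 u & Kin B (Kd 1 u)].
pose C := imP (@Kd R M 1 l) (fun v => Kin Z v /\ Kdg i v) (Kin B (l := l)).
have sC : submod C.
  by apply: submod_im; [apply: submodI; [exact: submod_Kin|exact: submod_Kdg]|exact: submod_Kin].
suff [v zv bv] : C u by exists v.
apply: (@Nakayama _ (Kgrading l) W C (deg x) x) => //.
- move=> e v [w [zw dw] bw]; exists (Kpi e w).
    by split; [exact: Kin_pi|exact: Kdg_pi].
  rewrite -Kpi_d => [|y yl]; last by apply: hl; rewrite inE yl orbT.
  by rewrite -(gpiB (Kgrading l)); apply: Kin_pi.
- by apply: hl; exact: mem_head.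
move=> {u zu du bu} u [zu du bu].
have [|||[a b] [[/= za zb] [da db]] [/= ba bb]] := h (0, u).
- by split=> //; exact: submod0 (submod_Kin _ sZ).
- by split=> //; exact: submod0 (submod_Kdg _ _).
- rewrite /= linear0 scaler0 sub0r; split; first exact: submod0 (submod_Kin _ sB).
  exact: (submodN (submod_Kin _ sB)).
exists a.
  split=> //; rewrite sub0r in ba; rewrite -[Kd 1 a]opprK; exact: (submodN (submod_Kin _ sB)).
exists (- b); first by split; [apply: (submodN (submod_Kin _ sZ))|apply: (submodN (submod_Kdg _ _))].
rewrite linearN opprK /=; rewrite expr1 in bb.
by have -> : u - x *: a + Kd 1 b = u - (x *: a - Kd 1 b) by abel.
Qed.

(* An ideal of dimension < depth contains a nonzerodivisor up to radical: no
   nonzero element of Z/B is killed by all of c. *)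
Theorem depth_torsion_free (X aux c : seq R) D u :
  (forall i, (i < D)%N -> CV X i Z B) -> (size aux < D)%N ->
  (forall y, y \in aux ++ c -> homR (deg y) y) -> (forall y, y \in aux -> (0 < deg y)%N) ->
  (forall x, x \in X -> exists a (h : nat -> R),
     x ^+ a = \sum_(i < size (aux ++ c)) h i * (aux ++ c)`_i) ->
  Z u -> (forall y, y \in c -> B (y *: u)) -> B u.
Proof.
move=> hX hD hom pos rad zu cu.
have : forall i, (i < D)%N -> KH Z B (aux ++ c) i by move=> i hi; exact: Koszul_depth hX rad i hi.
elim: aux D hD hom pos {hX rad} => [|x aux IH] D hD hom pos hK.
  have [|||v [_ /Kdg0 ->]] := hK 0%N hD (Kemb0 c u).
  - exact: Kin_emb0.
  - exact: Kdg_emb0.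
  - by apply/Kin_demb0 => // y yc; rewrite expr1; exact: cu.
  rewrite linear0 subr0.
  by elim: (c) => //= y l IH [/IH].
case: D hD hK => // D hD hK; apply: (IH D) => // [y yl|y yl|i hi].
- by apply: hom; rewrite inE yl orbT.
- by apply: pos; rewrite inE yl orbT.
apply: KH_drop (hK i.+1 hi); first exact: hom.
by apply: pos; exact: mem_head.
Qed.
End KGrading.
End Grading.

(** * Exterior operators *)

Section Fock.
Variables (R : comNzRingType) (s : nat) (P : lmodType R).
Local Notation V := {ffun {set 'I_s} -> P}.
Implicit Types (v : V) (A : {set 'I_s}) (i j : 'I_s).

Definition sig j A : nat := \sum_(l in A) (l < j).
(** Elements of the exterior algebra are functions on the subsets of the columns; [ext j] is
    multiplication by e_j on the left and [ctr j] contraction with the dual vector. They satisfy the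
    Clifford relations [ctr_ext]. *)
Definition ext j v : V := [ffun A : {set 'I_s} => if j \in A then (-1) ^+ sig j A *: v (A :\ j) else 0].
Definition ctr j v : V := [ffun A : {set 'I_s} => if j \in A then 0 else (-1) ^+ sig j A *: v (j |: A)].

Fact ext_linear j : linear (ext j).
Proof.
move=> a u v; apply/ffunP => A; rewrite !ffunE; case: ifP => _; last by rewrite scaler0 addr0.
by rewrite scalerDr !scalerA mulrC.
Qed.
HB.instance Definition _ j := GRing.isLinear.Build R V V _ (ext j) (@ext_linear j).
Fact ctr_linear j : linear (ctr j).
Proof.
move=> a u v; apply/ffunP => A; rewrite !ffunE; case: ifP => _; first by rewrite scaler0 addr0.
by rewrite scalerDr !scalerA mulrC.
Qed.
HB.instance Definition _ j := GRing.isLinear.Build R V V _ (ctr j) (@ctr_linear j).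

Lemma sigU j k A : k \notin A -> sig j (k |: A) = ((k < j) + sig j A)%N.
Proof. by move=> kA; rewrite /sig big_setU1. Qed.
Lemma sigD j k A : k \in A -> sig j A = ((k < j) + sig j (A :\ k))%N.
Proof. by move=> kA; rewrite /sig (big_setD1 k). Qed.

Lemma ext_anti i j v : ext i (ext j v) = - ext j (ext i v).
Proof.
apply/ffunP => A; rewrite !ffunE !inE.
have [->|nij] := eqVneq i j; first by rewrite /= scaler0 if_same oppr0.
rewrite /=; case: ifP => iA; case: ifP => jA; rewrite ?scaler0 ?oppr0 //.
rewrite !scalerA -scaleNr (sigD j iA) (sigD i jA) !exprD setDDl setUC -setDDl.
congr (_ *: _); case: (ltngtP i j) nij => [h|h|/val_inj->]; rewrite ?eqxx //= => _.
- by rewrite expr1 expr0; ring.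
- by rewrite expr1 expr0; ring.
Qed.

Lemma ext_sq j v : ext j (ext j v) = 0.
Proof. by apply/ffunP => A; rewrite !ffunE !inE eqxx /= scaler0 if_same. Qed.

Lemma ctr_anti i j v : ctr i (ctr j v) = - ctr j (ctr i v).
Proof.
apply/ffunP => A; rewrite !ffunE !inE.
have [->|nij] := eqVneq i j; first by rewrite /= scaler0 if_same oppr0.
rewrite /=; case: ifP => iA; case: ifP => jA; rewrite ?scaler0 ?oppr0 //.
rewrite !scalerA -scaleNr (sigU j) ?iA // (sigU i) ?jA // !exprD setUCA.
congr (_ *: _); case: (ltngtP i j) nij => [h|h|/val_inj->]; rewrite ?eqxx //= => _.
- by rewrite expr1 expr0; ring.
- by rewrite expr1 expr0; ring.
Qed.

Lemma ctr_ext i j v : ctr i (ext j v) = (i == j)%:R *: v - ext j (ctr i v).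
Proof.
apply/ffunP => A; rewrite !ffunE !inE.
have [->|nij] := eqVneq i j.
  rewrite /= scale1r; case: ifP => jA.
    rewrite /= scalerA (sigD j jA) ltnn add0n -exprD addnn -signr_odd odd_double expr0 scale1r.
    by rewrite setD1K // subrr.
  by rewrite subr0 scalerA (sigU j) ?jA // ltnn add0n -exprD addnn -signr_odd odd_double expr0
    scale1r setU1K ?jA.
rewrite scale0r sub0r /=; case: ifP => iA; case: ifP => jA; rewrite ?scaler0 ?oppr0 //.
rewrite !scalerA -scaleNr (sigU j) ?iA // (sigD i jA) !exprD.
have -> : (i |: A) :\ j = i |: A :\ j.
  by apply/setP => k; rewrite !inE; case: (eqVneq k i) => [->|] //=; rewrite nij.
congr (_ *: _); case: (ltngtP i j) nij => [h|h|/val_inj->]; rewrite ?eqxx //= => _.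
- by rewrite expr1 expr0; ring.
- by rewrite expr1 expr0; ring.
Qed.

Implicit Types w : 'I_s -> R.
Definition extv w v : V := \sum_j w j *: ext j v.
Definition ctrv w v : V := \sum_j w j *: ctr j v.
Fact extv_linear w : linear (extv w).
Proof.
move=> a u v; rewrite /extv scaler_sumr -big_split; apply: eq_bigr => j _ /=.
by rewrite linearP scalerDr !scalerA mulrC.
Qed.
HB.instance Definition _ w := GRing.isLinear.Build R V V _ (extv w) (@extv_linear w).
Fact ctrv_linear w : linear (ctrv w).
Proof.
move=> a u v; rewrite /ctrv scaler_sumr -big_split; apply: eq_bigr => j _ /=.
by rewrite linearP scalerDr !scalerA mulrC.
Qed.
HB.instance Definition _ w := GRing.isLinear.Build R V V _ (ctrv w) (@ctrv_linear w).

Lemma extv_anti w w' v : extv w (extv w' v) = - extv w' (extv w v).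
Proof.
rewrite /extv; under eq_bigr do rewrite linear_sum scaler_sumr.
rewrite exchange_big -sumrN; apply: eq_bigr => j _ /=.
rewrite linear_sum scaler_sumr -sumrN; apply: eq_bigr => i _ /=.
by rewrite !linearZ /= ext_anti !scalerN !scalerA mulrC.
Qed.
Lemma ctrv_anti w w' v : ctrv w (ctrv w' v) = - ctrv w' (ctrv w v).
Proof.
rewrite /ctrv; under eq_bigr do rewrite linear_sum scaler_sumr.
rewrite exchange_big -sumrN; apply: eq_bigr => j _ /=.
rewrite linear_sum scaler_sumr -sumrN; apply: eq_bigr => i _ /=.
by rewrite !linearZ /= ctr_anti !scalerN !scalerA mulrC.
Qed.
Lemma ctrv_extv w w' v :
  ctrv w (extv w' v) = (\sum_j w j * w' j) *: v - extv w' (ctrv w v).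
Proof.
rewrite /extv /ctrv; under eq_bigr do rewrite linear_sum scaler_sumr.
rewrite scaler_suml; under [X in _ = _ - X]eq_bigr do rewrite linear_sum scaler_sumr.
rewrite [X in _ = _ - X]exchange_big -sumrB; apply: eq_bigr => i _ /=.
have -> : (w i * w' i) *: v = \sum_j (w i * w' j * (i == j)%:R) *: v.
  rewrite (bigD1 i) //= eqxx mulr1 big1 ?addr0 // => j.
  by rewrite eq_sym => /negbTE->; rewrite mulr0 scale0r.
rewrite -sumrB; apply: eq_bigr => j _ /=.
by rewrite !linearZ /= ctr_ext !scalerBr !scalerA -scalerN [w' j * w i]mulrC.
Qed.

Lemma ctr_extv i w v : ctr i (extv w v) = w i *: v - extv w (ctr i v).
Proof.
have h u : ctr i u = ctrv (fun j => (j == i)%:R) u.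
  rewrite /ctrv (bigD1 i) //= eqxx scale1r big1 ?addr0 // => j /negbTE->.
  by rewrite scale0r.
rewrite !h ctrv_extv (bigD1 i) //= eqxx mul1r big1 ?addr0 // => j /negbTE->.
by rewrite mul0r.
Qed.

Definition fm (f : P -> P) v : V := [ffun A : {set 'I_s} => f (v A)].
Fact fm_linear (f : {linear P -> P}) : linear (fm f).
Proof. by move=> a u v; apply/ffunP => A; rewrite !ffunE linearP. Qed.
HB.instance Definition _ (f : {linear P -> P}) := GRing.isLinear.Build R V V _ (fm f) (@fm_linear f).

Lemma ext_fm (f : {linear P -> P}) j v : ext j (fm f v) = fm f (ext j v).
Proof. by apply/ffunP => A; rewrite !ffunE; case: ifP; rewrite ?linear0 ?linearZ. Qed.
Lemma ctr_fm (f : {linear P -> P}) j v : ctr j (fm f v) = fm f (ctr j v).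
Proof. by apply/ffunP => A; rewrite !ffunE; case: ifP; rewrite ?linear0 ?linearZ. Qed.
Lemma extv_fm (f : {linear P -> P}) w v : extv w (fm f v) = fm f (extv w v).
Proof. by rewrite /extv linear_sum; apply: eq_bigr => j _; rewrite ext_fm linearZ. Qed.
Lemma ctrv_fm (f : {linear P -> P}) w v : ctrv w (fm f v) = fm f (ctrv w v).
Proof. by rewrite /ctrv linear_sum; apply: eq_bigr => j _; rewrite ctr_fm linearZ. Qed.
End Fock.

Lemma eigen_step (R : comNzRingType) (M : lmodType R) (T q w : M) (i a c De Da : R) :
  T - (a * De) *: q - (- (i + a) * c * (De * Da)) *: w =
  T + (i * De) *: q + (- (i + a) * De) *: (q - (c * Da) *: w).
Proof.
rewrite scalerBr scalerA.
have -> : - (i + a) * De * (c * Da) = - (i + a) * c * (De * Da) by ring.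
have -> : - (i + a) * De = - (i * De) - a * De by ring.
by rewrite !scalerDl !scaleNr; abel.
Qed.

Section Eigen.
Variables (R : comUnitRingType) (M : lmodType R) (I : Type) (De : R) (N : I -> {linear M -> M}).
Hypothesis NC : forall k l u, N k (N l u) = N l (N k u).
Hypothesis Nsq : forall k u, N k (N k u) = De *: N k u.
Let T (r : seq I) u := \sum_(k <- r) N k u.
Let T_linear r : linear (T r).
Proof.
by move=> a u v; rewrite /T scaler_sumr -big_split; apply: eq_bigr => k _ /=; rewrite linearP.
Qed.

Let TD r x y : T r (x + y) = T r x + T r y.
Proof. by rewrite -[x]scale1r T_linear !scale1r. Qed.
Let T0 r : T r 0 = 0.
Proof. by rewrite /T big1 // => l _; rewrite linear0. Qed.
Let TZ r c x : T r (c *: x) = c *: T r x.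
Proof. by rewrite -[c *: x]addr0 T_linear T0 addr0. Qed.
Let TNN r x : T r (- x) = - T r x.
Proof. by rewrite -scaleN1r TZ scaleN1r. Qed.

(** The identity De = N_k + (De - N_k) splits off the eigenvalues De and 0 of N_k; doing so for each
    k in turn sorts a multiple of [u] by eigenvalues of the sum. *)
Lemma eigen_decomposition r u : exists f : nat -> M,
  [/\ De ^+ size r *: u = \sum_(a < (size r).+1) f a,
      forall a, T r (f a) = (a%:R * De) *: f a & forall a, (size r < a)%N -> f a = 0].
Proof.
elim: r => [|k r [f [f1 f2 f3]]].
  exists (fun a => if a is 0 then u else 0); split.
  - by rewrite big_ord1 expr0 scale1r.
  - by move=> a; rewrite /T big_nil; case: a => [|a]; rewrite ?mul0r ?scale0r ?scaler0.
  - by case.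
exists (fun a => De *: f a - N k (f a) + if a is b.+1 then N k (f b) else 0); split.
- rewrite big_split /= big_ord_recr /= f3 // ?(linear0, scaler0, oppr0, addr0) sumrB -!scaler_sumr.
  rewrite -f1 -linear_sum -f1 [X in _ = _ + X]big_ord_recl /= add0r -linear_sum -f1.
  by rewrite exprS scalerA subrK.
- move=> a; have hT v : T (k :: r) v = N k v + T r v by rewrite /T big_cons.
  have TN v : T r (N k v) = N k (T r v) by rewrite /T linear_sum; apply: eq_bigr => l _; exact: NC.
  have hf x : N k (De *: f a - N k (f a) + x) + T r (De *: f a - N k (f a) + x) =
      (a%:R * De) *: (De *: f a - N k (f a)) + (N k x + T r x).
    rewrite !TD TNN TZ TN f2 !linearD linearN !linearZ /= Nsq ?(scalerDr, scalerN, scalerA) [De * (_ * De)]mulrC; abel.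
  rewrite hT hf [RHS]scalerDr; congr (_ + _); case: a {hf} => [|b].
    by rewrite linear0 T0 addr0 scaler0.
  rewrite TN f2 Nsq linearZ /= -scalerDl; congr (_ *: _); rewrite -natr1; ring.
- move=> [//|a] ha; rewrite !f3 //; last exact: ltnW.
  by rewrite ?(linear0, scaler0, oppr0, addr0).
Qed.

(** The sum T has eigenvalues a De with a >= 0, while on Z modulo B it acts as - i De with i > 0.
    The product of the T - b De annihilates a multiple of [v], but modulo B it is a unit times a
    power of De. *)
Theorem eigen_kill (r : seq I) (Z B : M -> Prop) (i : nat) :
  (forall m, (m.+1%:R : R) \is a GRing.unit) ->
  submod Z -> submod B -> (forall v, Z v -> Z (\sum_(k <- r) N k v)) -> (0 < i)%N ->
  (forall v, Z v -> B (\sum_(k <- r) N k v + (i%:R * De) *: v)) ->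
  forall v, Z v -> exists a, B (De ^+ a *: v).
Proof.
rewrite /= => un sZ sB ZT i0 hB v zv.
(* [Q a] is the product of the T - b De for b < a. It is evaluated twice: on the eigenvectors, and
   modulo B. *)
pose Q := fix Q a u := if a is b.+1 then T r (Q b u) - (b%:R * De) *: Q b u else u.
have QL a : linear (Q a).
  elim: a => [|a IHa] c u w //=; rewrite IHa T_linear; rewrite !scalerDr !scalerN !scalerA.
  by rewrite [_ * De * c]mulrC; abel.
have QE b f a : T r f = (b%:R * De) *: f -> (b < a)%N -> Q a f = 0.
  move=> hf; elim: a => // a IHa; rewrite ltnS leq_eqVlt => /orP[/eqP<-|/IHa].
    have hQ c : T r (Q c f) = (b%:R * De) *: Q c f.
      by elim: c => //= c IHc; rewrite IHc -scalerBl TZ IHc !scalerA mulrC.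
    by rewrite /= hQ subrr.
  by move=> /= ->; rewrite scaler0 subr0 T0.
have [f [f1 f2 _]] := eigen_decomposition r v.
have Q0 : Q (size r).+1 (De ^+ size r *: v) = 0.
  have QS n m (h : nat -> M) : Q n (\sum_(a < m) h a) = \sum_(a < m) Q n (h a).
    have Qz a : Q a 0 = 0 by elim: a => //= a ->; rewrite T0 scaler0 subr0.
    elim: m => [|m IHm]; first by rewrite !big_ord0 Qz.
    by rewrite !big_ord_recr /= -IHm -[X in Q _ (X + _)]scale1r QL scale1r.
  rewrite f1 QS big1 // => b _; exact: (QE b).
have ZQ a u : Z u -> Z (Q a u).
  move=> zu; elim: a => //= a IHa; apply: (submodB sZ); first exact: ZT.
  exact: (submodZ sZ).
have [c cu hc] : exists2 c, c \is a GRing.unit &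
    B (Q (size r).+1 (De ^+ size r *: v) - (c * De ^+ (size r).+1) *: (De ^+ size r *: v)).
  elim: (size r).+1 => [|a [c cu hc]].
    by exists 1; rewrite ?unitr1 //= mul1r scale1r subrr; exact: submod0 sB.
  exists (- (i + a)%:R * c); first by rewrite unitrM unitrN cu -(prednK i0) addSn un.
  have := hB _ (ZQ a _ (submodZ sZ (De ^+ size r) zv)); set q := Q a _ in hc *; set w := _ *: v in hc * => h.
  rewrite /= -/q.
  rewrite exprS natrD eigen_step; by apply: (submodD sB) => //; apply: (submodZ sB).
rewrite Q0 sub0r in hc; exists ((size r).+1 + size r)%N.
have := submodZ sB (- c^-1) hc; rewrite !scalerN !scaleNr opprK !scalerA !mulrA mulVr // mul1r.
by rewrite -exprD.
Qed.
End Eigen.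

Section Wedge.
Variables (R : comUnitRingType) (s t : nat) (P : lmodType R) (X : 'M[R]_(t, s)).
Hypothesis unit2 : (2%:R : R) \is a GRing.unit.
Local Notation V := {ffun {set 'I_s} -> P}.
Implicit Types (v u : V) (k l : 'I_t) (r : seq 'I_t).

Definition om k : V -> V := extv (fun j => X k j).
Fact om_linear k : linear (om k). Proof. exact: extv_linear. Qed.
HB.instance Definition _ k := GRing.isLinear.Build R V V _ (om k) (@om_linear k).

Lemma om_linN k v : om k (- v) = - om k v.
Proof. exact: linearN. Qed.
Lemma om_linZ k a v : om k (a *: v) = a *: om k v.
Proof. exact: linearZ. Qed.
Lemma om_anti k l v : om k (om l v) = - om l (om k v).
Proof. exact: extv_anti. Qed.
Lemma om_sq k v : om k (om k v) = 0.
Proof.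
have h : (2%:R : R) *: om k (om k v) = 0.
  by rewrite scaler_nat mulr2n [X in X + _]om_anti addNr.
by rewrite -[LHS]scale1r -(mulVr unit2) -scalerA h scaler0.
Qed.

Fixpoint Om r v : V := if r is k :: r' then om k (Om r' v) else v.
(* the right derivative of [Om] with respect to the factor [om k] *)
Fixpoint Al r k v : V :=
  if r is l :: r' then
    if l == k then (-1) ^+ size r' *: Om r' v else om l (Al r' k v)
  else 0.

Fact Om_linear r : linear (Om r).
Proof. by elim: r => //= k r IHr a u v; rewrite IHr linearP. Qed.
HB.instance Definition _ r := GRing.isLinear.Build R V V _ (Om r) (@Om_linear r).
Fact Al_linear r k : linear (Al r k).
Proof.
elim: r => [|l r IHr] a u v /=; first by rewrite scaler0 addr0.
case: ifP => _; last by rewrite IHr linearP.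
by rewrite linearP scalerDr !scalerA mulrC.
Qed.
HB.instance Definition _ r k := GRing.isLinear.Build R V V _ (Al r k) (@Al_linear r k).

Lemma Om_anti r k v : Om r (om k v) = (-1) ^+ size r *: om k (Om r v).
Proof.
elim: r => [|l r IHr] /=; first by rewrite scale1r.
by rewrite IHr linearZ /= om_anti scalerN -scaleNr exprS mulN1r.
Qed.

Lemma Om_om r k v : k \in r -> Om r (om k v) = 0.
Proof.
elim: r => //= l r IHr; rewrite inE => /orP[/eqP<-|/IHr->]; last by rewrite linear0.
by rewrite Om_anti linearZ /= om_sq scaler0.
Qed.

Lemma Al_om r k v : uniq r -> k \in r -> Al r k (om k v) = Om r v.
Proof.
elim: r => //= l r IHr /andP[lr ur]; rewrite inE.
have [->|nkl] := eqVneq l k => /=.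
  by move=> _; rewrite Om_anti scalerA -exprD addnn -signr_odd odd_double scale1r.
by move=> kr; rewrite IHr.
Qed.

Lemma Al_anti r k l v : exists b : R, Al r k (om l v) = b *: om l (Al r k v).
Proof.
elim: r => [|h r [b IHr]] /=; first by exists 0; rewrite scale0r.
case: ifP => _.
  by exists ((-1) ^+ size r); rewrite Om_anti [om l (_ *: _)]linearZ.
by exists (- b); rewrite IHr linearZ /= om_anti scalerN scaleNr.
Qed.

Lemma Al_om_other r k l v : l != k -> l \in r -> Al r k (om l v) = 0.
Proof.
move=> nlk; elim: r => //= h r IHr; rewrite inE.
have [->|nhk] := eqVneq h k.
  by rewrite (negbTE nlk) /= => lr; rewrite Om_om // scaler0.
case/orP => [/eqP<-|/IHr->]; last by rewrite linear0.
by have [b ->] := Al_anti r k l v; rewrite linearZ /= om_sq scaler0.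
Qed.

(** Contraction with the j-th dual vector is an antiderivation, and applied to the row k it gives X
    k j. In top degree this becomes the Laplace relation [al_rel]. *)
Lemma Al_rel r j v : uniq r ->
  Om r (ctr j v) = (-1) ^+ size r *: ctr j (Om r v) + \sum_(k <- r) X k j *: Al r k v.
Proof.
elim: r => [|l r IHr] /=; first by rewrite big_nil addr0 scale1r.
move=> /andP[lr ur]; rewrite IHr // linearD linearZ /= [om l (\sum_(_ <- r) _)]linear_sum big_cons eqxx.
have -> : \sum_(k <- r) X k j *: (if l == k then (-1) ^+ size r *: Om r v else om l (Al r k v)) =
          \sum_(k <- r) om l (X k j *: Al r k v).
  apply: eq_big_seq => k kr; rewrite linearZ /=; case: eqP => // lk.
  by rewrite lk kr in lr.
rewrite [ctr j (om _ _)]ctr_extv scalerBr addrA; congr (_ + _).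
rewrite exprS mulN1r !scaleNr opprK !scalerA [_ * X _ _]mulrC /om; abel.
Qed.

Lemma Al_Om r k : uniq r -> k \in r -> exists b : bool, forall v,
  Al r k v = (-1) ^+ b *: Om (rem k r) v.
Proof.
elim: r => //= l r IHr /andP[lr ur]; rewrite inE.
have [_|nlk] := eqVneq l k => /=.
  by move=> _; exists (odd (size r)) => v; rewrite signr_odd.
move=> kr; have [b hb] := IHr ur kr.
by exists b => v; rewrite hb linearZ.
Qed.

Lemma Om_fm (f : {linear P -> P}) r v : Om r (fm f v) = fm f (Om r v).
Proof. by elim: r => //= k r ->; rewrite /om extv_fm. Qed.
Lemma Al_fm (f : {linear P -> P}) r k v : Al r k (fm f v) = fm f (Al r k v).
Proof.
elim: r => [|l r IHr] /=; first by rewrite linear0.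
case: ifP => _; first by rewrite Om_fm linearZ.
by rewrite IHr /om extv_fm.
Qed.

Section Local.
Variables (De : R) (rho : 'I_t -> 'I_s -> R) (r0 : seq 'I_t).
Hypothesis dual : forall k l, k \in r0 -> l \in r0 -> \sum_j rho k j * X l j = (k == l)%:R * De.
Local Notation cr k := (ctrv (P := P) (rho k)).

Lemma cr_om k l v : k \in r0 -> l \in r0 ->
  cr k (om l v) = ((k == l)%:R * De) *: v - om l (cr k v).
Proof. by move=> kr lr; rewrite /om ctrv_extv dual. Qed.

Definition Nop k : {linear V -> V} := (om k \o cr k)%FUN.

Lemma Nop_sq k v : k \in r0 -> Nop k (Nop k v) = De *: Nop k v.
Proof.
move=> kr; rewrite /= cr_om // eqxx mul1r linearB linearZ /=.
by rewrite [om k (om k _)]om_sq subr0.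
Qed.

Lemma Nop_comm k l v : k \in r0 -> l \in r0 -> Nop k (Nop l v) = Nop l (Nop k v).
Proof.
move=> kr lr; have [->//|nkl] := eqVneq k l.
rewrite /= (cr_om (cr l v) kr lr) (cr_om (cr k v) lr kr) [l == k]eq_sym (negbTE nkl) mul0r.
rewrite !scale0r !sub0r om_linN om_linN om_anti (ctrv_anti (rho l)).
by rewrite !om_linN.
Qed.

(** Induction on the rows: [om k u] is killed by the other rows, hence is a combination of their
    wedges up to a power of De, and contraction with [rho k] recovers [u]. The family [G] records
    the degrees of the witnesses. *)
Lemma Om_local (G : nat -> V -> Prop) r q u :
  (forall q, submod (G q)) -> (forall q k v, G q v -> G q.+1 (om k v)) ->
  (forall q w v, G q.+1 v -> G q (ctrv w v)) ->
  uniq r -> {subset r <= r0} -> G q.+1 u -> Om r u = 0 ->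
  exists2 w : 'I_t -> V, (forall k, G q (w k)) & De ^+ size r *: u = \sum_(k <- r) om k (w k).
Proof.
move=> sG Gom Gcr; elim: r q u => [|k r IHr] q u /=.
  move=> _ _ _ ->; exists (fun=> 0); rewrite ?big_nil ?scaler0 //.
  by move=> _; exact: submod0 (sG _).
move=> /andP[kr ur] sub gu h0.
have k0 : k \in r0 by apply: sub; exact: mem_head.
have sr : {subset r <= r0} by move=> l lr; apply: sub; rewrite inE lr orbT.
have [||w gw hw] := IHr q.+1 (om k u) ur sr; first exact: Gom.
  by rewrite Om_anti h0 scaler0.
exists (fun l => if l == k then De ^+ size r *: cr k u else - cr k (w l)).
  move=> l; case: ifP => _; first by apply: (submodZ (sG _)); exact: Gcr.
  by apply: (submodN (sG _)); apply: Gcr.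
rewrite big_cons eqxx linearZ /=.
have -> : \sum_(l <- r) om l (if l == k then De ^+ size r *: cr k u else - cr k (w l)) =
          \sum_(l <- r) cr k (om l (w l)).
  apply: eq_big_seq => l lr; case: eqP => [lk|/eqP nlk]; first by rewrite -lk lr in kr.
  by rewrite (cr_om _ k0 (sr _ lr)) [k == l]eq_sym (negbTE nlk) mul0r scale0r sub0r om_linN.
rewrite -linear_sum -hw linearZ /= (cr_om _ k0 k0) eqxx mul1r scalerBr scalerA -exprSr.
by abel.
Qed.

Fixpoint Ict r v : V := if r is k :: r' then cr k (Ict r' v) else v.

Lemma Om_cr r k v : {subset r <= r0} -> k \in r0 -> k \notin r ->
  Om r (cr k v) = (-1) ^+ size r *: cr k (Om r v).
Proof.
elim: r => [|l r IHr] /=; first by rewrite scale1r.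
move=> sub k0; rewrite inE negb_or => /andP[nkl kr].
have l0 : l \in r0 by apply: sub; exact: mem_head.
have sr : {subset r <= r0} by move=> h hr; apply: sub; rewrite inE hr orbT.
rewrite IHr // linearZ /= cr_om // (negbTE nkl) mul0r scale0r sub0r.
by rewrite exprS mulN1r scaleNr scalerN opprK.
Qed.

(** As [v] is killed by every row, wedging with row k after contracting with [rho k] is
    multiplication by De. For a top form this produces an inverse image under [Om]. *)
Lemma Om_Ict r v : uniq r -> {subset r <= r0} -> (forall l, l \in r -> om l v = 0) ->
  exists b : bool, Om r (Ict r v) = ((-1) ^+ b * De ^+ size r) *: v.
Proof.
elim: r => [|k r IHr] /=; first by exists false; rewrite mul1r scale1r.
move=> /andP[kr ur] sub h0.
have k0 : k \in r0 by apply: sub; exact: mem_head.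
have sr : {subset r <= r0} by move=> h hr; apply: sub; rewrite inE hr orbT.
have [|b hb] := IHr ur sr.
  by move=> l lr; apply: h0; rewrite inE lr orbT.
exists (odd (size r) (+) b); rewrite Om_cr // om_linZ hb [cr k (_ *: _)]linearZ /= om_linZ.
have kv : om k v = 0 by apply: h0; exact: mem_head.
have -> : om k (cr k v) = De *: v.
  have := cr_om v k0 k0; rewrite kv linear0 eqxx mul1r => /esym/eqP.
  by rewrite subr_eq0 => /eqP.
by rewrite !scalerA signr_addb signr_odd exprSr !mulrA.
Qed.
End Local.
End Wedge.

Section Determinant.
Variables (R : comNzRingType) (M : lmodType R).

Fixpoint fold_op (I : Type) (F : I -> M -> M) (r : seq I) v : M :=
  if r is k :: r' then F k (fold_op F r' v) else v.

Lemma eq_fold_op (I : eqType) (F G : I -> M -> M) r v :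
  (forall k u, k \in r -> F k u = G k u) -> fold_op F r v = fold_op G r v.
Proof.
elim: r => //= k r IHr h; rewrite IHr ?h ?mem_head // => l u lr.
by apply: h; rewrite inE lr orbT.
Qed.

Lemma fold_op_map (I J : Type) (f : I -> J) (F : J -> M -> M) r v :
  fold_op F (map f r) v = fold_op (fun k => F (f k)) r v.
Proof. by elim: r => //= k r ->. Qed.

Section Anti.
Variables (m : nat) (E : 'I_m -> {linear M -> M}).
Hypothesis EA : forall i j v, E i (E j v) = - E j (E i v).
Hypothesis E2 : forall i v, E i (E i v) = 0.

Lemma E_sum l (a : 'I_m -> R) v : E l (\sum_j a j *: E j v) = - \sum_j a j *: E j (E l v).
Proof.
by rewrite linear_sum -sumrN; apply: eq_bigr => j _; rewrite linearZ /= EA scalerN.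
Qed.

Lemma fold_op_move s1 s2 l v : E l (fold_op (fun j => E j) (s1 ++ s2) v) =
  (-1) ^+ size s1 *: fold_op (fun j => E j) (s1 ++ l :: s2) v.
Proof.
elim: s1 => [|k s1 IH] /=; first by rewrite scale1r.
by rewrite EA IH linearZ /= exprS mulN1r scaleNr.
Qed.
End Anti.

Lemma enum_lift m (l : 'I_m.+1) : exists s1 s2, [/\ enum 'I_m.+1 = s1 ++ l :: s2,
  [seq lift l i | i <- enum 'I_m] = s1 ++ s2 & size s1 = l].
Proof.
exists (take l (enum 'I_m.+1)), (drop l.+1 (enum 'I_m.+1)).
have sz : size (enum 'I_m.+1) = m.+1 by rewrite size_enum_ord.
split.
- rewrite -[LHS](cat_take_drop l); congr (_ ++ _).
  by rewrite (drop_nth l) ?sz // nth_ord_enum.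
- apply: (inj_map val_inj); rewrite map_cat map_take map_drop val_enum_ord -map_comp.
  have -> : map (val \o lift l) (enum 'I_m) = map (bump l) (iota 0 m).
    by rewrite -val_enum_ord -map_comp.
  have lm : (l <= m)%N by rewrite -ltnS.
  have -> : iota 0 m = iota 0 l ++ iota l (m - l) by rewrite -iotaD subnKC.
  rewrite map_cat; congr (_ ++ _).
    rewrite take_iota (minn_idPl _) ?(ltnW (ltn_ord l)) //.
    rewrite -[RHS]map_id; apply/eq_in_map => i; rewrite mem_iota /bump add0n => /andP[_ il].
    by rewrite [(l <= i)%N]leqNgt il.
  rewrite drop_iota add0n subSS -[in RHS](add1n l) iotaDl.
  by apply/eq_in_map => i; rewrite mem_iota /bump => /andP[li _]; rewrite li.
- by rewrite size_take sz ltn_ord.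
Qed.

(** Laplace expansion along the first row: a product of linear combinations of anticommuting
    operators of square zero is the determinant times their product. *)
Lemma fold_op_det m (Y : 'M[R]_m) (E : 'I_m -> {linear M -> M}) v :
  (forall i j u, E i (E j u) = - E j (E i u)) -> (forall i u, E i (E i u) = 0) ->
  fold_op (fun k u => \sum_l Y k l *: E l u) (enum 'I_m) v =
  \det Y *: fold_op (fun l => E l) (enum 'I_m) v.
Proof.
elim: m Y E => [|m IHm] Y E EA E2.
  by rewrite det_mx00 scale1r; case: (enum 'I_0) => [|[]].
rewrite [in LHS]enum_ordSl /= fold_op_map (expand_det_row _ ord0) scaler_suml.
apply: eq_bigr => l _; rewrite -scalerA; congr (_ *: _).
(* Under [E l] the remaining rows may omit column l, since [E l] has square zero. *)
have sub r : E l (fold_op (fun k u => \sum_j Y (lift ord0 k) j *: E j u) r v) =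
  E l (fold_op (fun k u => \sum_j (row' ord0 (col' l Y)) k j *: E (lift l j) u) r v).
  elim: r => //= k r IHr.
  have h u : \sum_j Y (lift ord0 k) j *: E j (E l u) =
      \sum_j (row' ord0 (col' l Y)) k j *: E (lift l j) (E l u).
    rewrite (bigD1_ord l) //= E2 scaler0 add0r; apply: eq_bigr => j _.
    by rewrite !mxE.
  rewrite E_sum // IHr h [RHS]linear_sum -sumrN; apply: eq_bigr => j _.
  by rewrite [E l (_ *: _)]linearZ /= [in RHS]EA scalerN.
rewrite sub IHm // linearZ /= -(fold_op_map (lift l) (fun j => E j)).
have [s1 [s2 [e1 e2 e3]]] := enum_lift l; rewrite e1 e2 fold_op_move // e3.
by rewrite /cofactor add0n scalerA mulrC.
Qed.
End Determinant.

(** * Polynomials in y and z, and the operators on polynomial forms *)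

Section Coefficients.
Variables (R : comNzRingType) (m : nat).
Local Notation P := {mpoly R[m]}.
Implicit Types (f : P) (a b : 'I_m).

Definition mulX a f : P := 'X_a * f.
Fact mulX_linear a : linear (mulX a).
Proof. by move=> c f g; rewrite /mulX mulrDr scalerAr. Qed.
HB.instance Definition _ a := GRing.isLinear.Build R P P _ (mulX a) (@mulX_linear a).

Definition derX a f : P := f^`M(a).
Fact derX_linear a : linear (derX a).
Proof. by move=> c f g; rewrite /derX linearP. Qed.
HB.instance Definition _ a := GRing.isLinear.Build R P P _ (derX a) (@derX_linear a).

Lemma derX_mulX a b f : derX a (mulX b f) = (a == b)%:R *: f + mulX b (derX a f).
Proof.
rewrite /derX /mulX mderivM mderivX mnm1E eq_sym; congr (_ + _).
case: eqP => [->|_]; last by rewrite !scale0r mul0r.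
have -> : (U_(b) - U_(b) = 0)%MM by apply/mnmP => i; rewrite mnmBE subnn mnm0E.
by rewrite mpolyX0 !scale1r mul1r.
Qed.
Lemma mulXC a b f : mulX a (mulX b f) = mulX b (mulX a f).
Proof. by rewrite /mulX mulrCA. Qed.
Lemma derXC a b f : derX a (derX b f) = derX b (derX a f).
Proof. exact: mderiv_comm. Qed.

Lemma mcoeff_mulX a f mm : (mulX a f)@_mm = if (0 < mm a)%N then f@_(mm - U_(a)) else 0.
Proof.
rewrite /mulX mulrC; case: ifP => h.
  have -> : mm = (U_(a) + (mm - U_(a)))%MM by rewrite addmC submK // lep1mP -lt0n.
  by rewrite mcoeffMX addmC addmK.
rewrite mcoeffM big1 // => -[m1 m2] /eqP /= e.
rewrite mcoeffX; case: eqP => [e'|]; last by rewrite mulr0.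
by move: h; rewrite {1}e mnmDE -e' mnm1E eqxx addn1.
Qed.
End Coefficients.

Section Pieces.
Variables (R : comNzRingType) (t : nat).
Local Notation P := {mpoly R[t + t]}.
Implicit Types (f : P) (k l : 'I_t) (m : 'X_{1..t + t}).

Definition ydeg m : nat := \sum_k m (lshift t k).
Definition zdeg m : nat := \sum_k m (rshift t k).
Definition yv k : 'I_(t + t) := lshift t k.
Definition zv k : 'I_(t + t) := rshift t k.

Lemma yv_inj k l : (yv k == yv l) = (k == l). Proof. exact: inj_eq (@lshift_inj _ _) _ _. Qed.
Lemma zv_inj k l : (zv k == zv l) = (k == l). Proof. exact: inj_eq (@rshift_inj _ _) _ _. Qed.
Lemma yz_neq k l : (yv k == zv l) = false. Proof. exact: eq_lrshift. Qed.
Lemma zy_neq k l : (zv k == yv l) = false. Proof. exact: eq_rlshift. Qed.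

Lemma ydegD m m' : ydeg (m + m') = (ydeg m + ydeg m')%N.
Proof. by rewrite /ydeg -big_split; apply: eq_bigr => k _; rewrite mnmDE. Qed.
Lemma zdegD m m' : zdeg (m + m') = (zdeg m + zdeg m')%N.
Proof. by rewrite /zdeg -big_split; apply: eq_bigr => k _; rewrite mnmDE. Qed.
Lemma sum_pick k : (\sum_l (k == l) = 1)%N.
Proof. by rewrite (bigD1 k) //= eqxx big1 ?addn0 // => l; rewrite eq_sym => /negbTE->. Qed.
Lemma ydeg_y k : ydeg U_(yv k) = 1%N.
Proof. by rewrite /ydeg; under eq_bigr do rewrite mnm1E yv_inj; exact: sum_pick. Qed.
Lemma ydeg_z k : ydeg U_(zv k) = 0%N.
Proof. by rewrite /ydeg big1 // => l _; rewrite mnm1E zy_neq. Qed.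
Lemma zdeg_z k : zdeg U_(zv k) = 1%N.
Proof. by rewrite /zdeg; under eq_bigr do rewrite mnm1E zv_inj; exact: sum_pick. Qed.
Lemma zdeg_y k : zdeg U_(yv k) = 0%N.
Proof. by rewrite /zdeg big1 // => l _; rewrite mnm1E yz_neq. Qed.

(* [j] is one more than the degree in the [z] variables, so that [j = 0] is the zero piece. *)
Definition pp (i j : nat) f : Prop := forall m, f@_m != 0 -> ydeg m = i /\ (zdeg m).+1 = j.

Lemma submod_pp i j : submod (pp i j).
Proof.
split=> [m|a u v hu hv m]; first by rewrite mcoeff0 eqxx.
rewrite mcoeffD mcoeffZ; have [u0|/hu//] := eqVneq u@_m 0.
by rewrite u0 mulr0 add0r; exact: hv.
Qed.

Lemma pp0 i f : pp i 0 f -> f = 0.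
Proof.
by move=> h; apply/mpolyP => m; rewrite mcoeff0; apply/eqP/negPn/negP => /h[].
Qed.

Lemma pp_my i j k f : pp i j f -> pp i.+1 j (mulX (yv k) f).
Proof.
move=> h m; rewrite mcoeff_mulX; case: ifP => [mk|_]; last by rewrite eqxx.
move=> /h[<- <-]; have e : m = (U_(yv k) + (m - U_(yv k)))%MM by rewrite addmC submK // lep1mP -lt0n.
by split; rewrite {1}e ?ydegD ?zdegD ?ydeg_y ?zdeg_y.
Qed.
Lemma pp_mz i j k f : pp i j f -> pp i j.+1 (mulX (zv k) f).
Proof.
move=> h m; rewrite mcoeff_mulX; case: ifP => [mk|_]; last by rewrite eqxx.
move=> /h[<- <-]; have e : m = (U_(zv k) + (m - U_(zv k)))%MM by rewrite addmC submK // lep1mP -lt0n.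
by split; rewrite {1}e ?ydegD ?zdegD ?ydeg_z ?zdeg_z.
Qed.
Lemma mcoeff_der0 a f m : (derX a f)@_m != 0 -> f@_(m + U_(a)) != 0.
Proof. by rewrite /derX mcoeff_deriv; apply: contraNneq => ->; rewrite mul0rn. Qed.
Lemma pp_dy i j k f : pp i.+1 j f -> pp i j (derX (yv k) f).
Proof.
move=> h m /mcoeff_der0/h; rewrite ydegD zdegD ydeg_y zdeg_y addn0 addn1.
by case=> [[-> ->]].
Qed.
Lemma pp_dy0 j k f : pp 0 j f -> derX (yv k) f = 0.
Proof.
move=> h; apply/mpolyP => m; rewrite mcoeff0; apply/eqP/negPn/negP.
by move=> /mcoeff_der0/h; rewrite ydegD ydeg_y addn1 => -[].
Qed.
Lemma pp_dz i j k f : pp i j.+1 f -> pp i j (derX (zv k) f).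
Proof.
move=> h m /mcoeff_der0/h; rewrite ydegD zdegD ydeg_z zdeg_z addn0 addn1.
by case=> -> [->].
Qed.

Lemma mcoeff_euler a f m : (mulX a (derX a f))@_m = f@_m *+ m a.
Proof.
rewrite mcoeff_mulX /derX; case: ifP => h; last first.
  by move/negbT: h; rewrite -eqn0Ngt => /eqP->.
rewrite mcoeff_deriv submK ?lep1mP -?lt0n //.
by rewrite mnmBE mnm1E eqxx subn1 prednK.
Qed.

Lemma mcoeff_sum' (I : Type) (r : seq I) (F : I -> P) m :
  (\sum_(k <- r) F k)@_m = \sum_(k <- r) (F k)@_m.
Proof. exact: raddf_sum. Qed.

Lemma euler_y i j f : pp i j f -> \sum_k mulX (yv k) (derX (yv k) f) = i%:R *: f.
Proof.
move=> h; apply/mpolyP => m; rewrite mcoeff_sum' mcoeffZ.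
under eq_bigr do rewrite mcoeff_euler.
rewrite sumrMnr mulr_natl; have [->|/h[<- _]//] := eqVneq f@_m 0.
by rewrite !mul0rn.
Qed.
Lemma euler_z i j f : pp i j.+1 f -> \sum_k mulX (zv k) (derX (zv k) f) = j%:R *: f.
Proof.
move=> h; apply/mpolyP => m; rewrite mcoeff_sum' mcoeffZ.
under eq_bigr do rewrite mcoeff_euler.
rewrite sumrMnr mulr_natl; have [->|/h[_ [<-]]//] := eqVneq f@_m 0.
by rewrite !mul0rn.
Qed.

Section Exterior.
Variable s : nat.
Local Notation V := {ffun {set 'I_s} -> P}.
Implicit Types (v : V) (A : {set 'I_s}) (p : 'I_s).

(* Likewise [q] is one more than the exterior degree. *)
Definition pc (q i j : nat) v : Prop := forall A,
  (#|A|.+1 = q -> pp i j (v A)) /\ (#|A|.+1 <> q -> v A = 0).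

Lemma submod_pc q i j : submod (pc q i j).
Proof.
split=> [A|a u v hu hv A]; rewrite !ffunE.
  by split=> // _; exact: submod0 (submod_pp _ _).
case: (hu A) (hv A) => [u1 u2] [v1 v2]; split=> h; last by rewrite u2 // v2 // scaler0 addr0.
by apply: (submod_pp i j).2; [exact: u1|exact: v1].
Qed.

Lemma pc_q0 i j v : pc 0 i j v -> v = 0.
Proof. by move=> h; apply/ffunP => A; rewrite ffunE; apply: (h A).2. Qed.
Lemma pc_j0 q i v : pc q i 0 v -> v = 0.
Proof.
move=> h; apply/ffunP => A; rewrite ffunE.
by have [/(h A).1/pp0|/eqP/(h A).2] := eqVneq #|A|.+1 q.
Qed.
Lemma pc_big q i j v : (s.+1 < q)%N -> pc q i j v -> v = 0.
Proof.
move=> hq h; apply/ffunP => A; rewrite ffunE; apply: (h A).2 => e.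
by have := max_card (mem A); rewrite card_ord => h1; rewrite -e ltnS ltnNge h1 in hq.
Qed.

Lemma pc_ext q i j p v : pc q i j v -> pc q.+1 i j (ext p v).
Proof.
move=> h A; rewrite !ffunE; case: ifP => pA; last first.
  by split=> // _; exact: submod0 (submod_pp _ _).
have cA : #|A| = (#|A :\ p|).+1 by rewrite (cardsD1 p) pA.
split=> [[e]|ne]; first by apply: (submodZ (submod_pp _ _)); apply: (h _).1; rewrite -cA.
by rewrite (h _).2 ?scaler0 // => e; apply: ne; rewrite cA e.
Qed.
Lemma pc_ctr q i j p v : pc q.+1 i j v -> pc q i j (ctr p v).
Proof.
move=> h A; rewrite !ffunE; case: ifP => pA.
  by split=> // _; exact: submod0 (submod_pp _ _).
have cA : #|p |: A| = (#|A|).+1 by rewrite cardsU1 pA.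
split=> [e|ne]; first by apply: (submodZ (submod_pp _ _)); apply: (h _).1; rewrite cA e.
by rewrite (h _).2 ?scaler0 // => e; apply: ne; move: e; rewrite cA => -[].
Qed.
Lemma pc_extv q i j w v : pc q i j v -> pc q.+1 i j (extv w v).
Proof.
move=> h; apply: (submod_sum (submod_pc _ _ _)) => p _.
by apply: (submodZ (submod_pc _ _ _)); exact: pc_ext.
Qed.
Lemma pc_ctrv q i j w v : pc q.+1 i j v -> pc q i j (ctrv w v).
Proof.
move=> h; apply: (submod_sum (submod_pc _ _ _)) => p _.
by apply: (submodZ (submod_pc _ _ _)); exact: pc_ctr.
Qed.
Lemma pc_fm (f : {linear P -> P}) q i j i' j' v :
  (forall g, pp i j g -> pp i' j' (f g)) -> pc q i j v -> pc q i' j' (fm f v).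
Proof.
by move=> hf h A; rewrite ffunE; split=> [/(h A).1/hf|/(h A).2->]; rewrite ?linear0.
Qed.
Lemma fm_sum_id (F : 'I_t -> {linear P -> P}) q i j c v :
  (forall g, pp i j g -> \sum_k F k g = c *: g) -> pc q i j v ->
  \sum_k fm (F k) v = c *: v.
Proof.
move=> hF h; apply/ffunP => A; rewrite ffunE sum_ffunE; under eq_bigr do rewrite ffunE.
have [/(h A).1/hF//|/eqP/(h A).2->] := eqVneq #|A|.+1 q.
by rewrite scaler0 big1 // => k _; rewrite linear0.
Qed.
End Exterior.
End Pieces.

Opaque ext ctr extv ctrv.

Section Differentials.
Variables (R : comUnitRingType) (s t : nat) (X : 'M[R]_(t, s)).
Hypothesis natU : forall m, (m.+1%:R : R) \is a GRing.unit.
Local Notation P := {mpoly R[t + t]}.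
Local Notation V := {ffun {set 'I_s} -> P}.
Implicit Types (v : V) (k l : 'I_t) (va : 'I_t -> 'I_(t + t)).
Local Notation om := (om X).

(** The Koszul operator sum_k om_k d/d(va k), where [va] selects the y or the z variables. *)
Definition D va v : V := \sum_k om k (fm (derX (va k)) v).
Fact D_linear va : linear (D va).
Proof.
move=> a u v; rewrite /D scaler_sumr -big_split; apply: eq_bigr => k _ /=.
by rewrite !linearP.
Qed.
HB.instance Definition _ va := GRing.isLinear.Build R V V _ (D va) (@D_linear va).

Lemma om_fm (f : {linear P -> P}) k v : om k (fm f v) = fm f (om k v).
Proof. exact: extv_fm. Qed.

Lemma fmC (f g : {linear P -> P}) v : (forall x, f (g x) = g (f x)) ->
  fm f (fm g v) = fm g (fm f v).
Proof. by move=> h; apply/ffunP => A; rewrite !ffunE h. Qed.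

Lemma DD va v : D va (D va v) = 0.
Proof.
pose F k l := om k (om l (fm (derX (va k)) (fm (derX (va l)) v))).
have e : D va (D va v) = \sum_k \sum_l F k l.
  rewrite {1}/D; apply: eq_bigr => k _; rewrite /D [fm _ (\sum_(_ < _) _)]linear_sum.
  rewrite [om k (\sum_(_ < _) _)]linear_sum; apply: eq_bigr => l _ /=.
  by rewrite /F [om l (fm (derX (va k)) _)]om_fm.
have h : D va (D va v) = - D va (D va v).
  rewrite {1}e exchange_big e -sumrN; apply: eq_bigr => k _ /=.
  rewrite -sumrN; apply: eq_bigr => l _; by rewrite /F (om_anti _ k l) opprK (fmC (f := derX (va k)) (g := derX (va l)) v (derXC _ _)).
have h2 : (2%:R : R) *: D va (D va v) = 0 by rewrite scaler_nat mulr2n {1}h addNr.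
by rewrite -[LHS]scale1r -(mulVr (natU 1)) -scalerA h2 scaler0.
Qed.

(** The candidate homotopy: contraction with [rho k] combined with multiplication by the k-th
    variable, over the rows of [r]. *)
Definition H va (rho : 'I_t -> 'I_s -> R) (r : seq 'I_t) v : V :=
  \sum_(k <- r) ctrv (rho k) (fm (mulX (va k)) v).
Fact H_linear va rho r : linear (H va rho r).
Proof.
move=> a u v; rewrite /H scaler_sumr -big_split; apply: eq_bigr => k _ /=.
by rewrite !linearP.
Qed.
HB.instance Definition _ va rho r := GRing.isLinear.Build R V V _ (H va rho r) (@H_linear va rho r).

(** The first sum comes from the derivative falling on the variable, the second from the Clifford
    relation. When [rho] is dual to the rows up to De, the second sum is De times an Euler
    operator. *)
Lemma DH va rho r v : injective va ->
  D va (H va rho r v) + H va rho r (D va v) =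
  \sum_(k <- r) om k (ctrv (rho k) v) +
  \sum_(k <- r) \sum_l (\sum_j rho k j * X l j) *: fm (mulX (va k)) (fm (derX (va l)) v).
Proof.
move=> inj; rewrite /H [D va (\sum_(_ <- _) _)]linear_sum -!big_split /=; apply: eq_bigr => k _.
rewrite {1}/D [D va v]/D [fm _ (\sum_(_ < _) _)]linear_sum [ctrv _ (\sum_(_ < _) _)]linear_sum.
rewrite -big_split /=.
have -> : om k (ctrv (rho k) v) = \sum_l (l == k)%:R *: om l (ctrv (rho k) v).
  rewrite (bigD1 k) //= eqxx scale1r big1 ?addr0 // => l /negbTE->.
  by rewrite scale0r.
rewrite -big_split; apply: eq_bigr => l _ /=.
set w := fm (mulX (va k)) (fm (derX (va l)) v).
have -> : fm (mulX (va k)) (om l (fm (derX (va l)) v)) = om l w by rewrite /w [om l (fm (mulX (va k)) _)]om_fm.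
have -> : fm (derX (va l)) (ctrv (rho k) (fm (mulX (va k)) v)) =
    (l == k)%:R *: ctrv (rho k) v + ctrv (rho k) w.
  rewrite -ctrv_fm -linearZ -linearD; congr (ctrv _ _); apply/ffunP => A; rewrite /w !ffunE /=.
  by rewrite derX_mulX (inj_eq inj).
rewrite [om l (_ + _)]linearD /= om_linZ [ctrv _ (om l _)]ctrv_extv; abel.
Qed.

(** [Pz] replaces a y by a z and [Qz] does the converse: the two nilpotent generators of sl_2 acting
    on the pairs (y_k, z_k). *)
Definition Pz v : V := \sum_k fm (mulX (zv k)) (fm (derX (yv k)) v).
Fact Pz_linear : linear Pz.
Proof.
move=> a u v; rewrite /Pz scaler_sumr -big_split; apply: eq_bigr => k _ /=.
by rewrite !linearP.
Qed.
HB.instance Definition _ := GRing.isLinear.Build R V V _ Pz Pz_linear.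
Definition Qz v : V := \sum_k fm (mulX (yv k)) (fm (derX (zv k)) v).
Fact Qz_linear : linear Qz.
Proof.
move=> a u v; rewrite /Qz scaler_sumr -big_split; apply: eq_bigr => k _ /=.
by rewrite !linearP.
Qed.
HB.instance Definition _ := GRing.isLinear.Build R V V _ Qz Qz_linear.

Lemma PzD v : Pz (D (@yv t) v) = D (@yv t) (Pz v).
Proof.
pose F k l := om l (fm (mulX (zv k)) (fm (derX (yv k)) (fm (derX (yv l)) v))).
have -> : Pz (D (@yv t) v) = \sum_k \sum_l F k l.
  rewrite /Pz; apply: eq_bigr => k _; rewrite /D [fm _ (\sum_(_ < _) _)]linear_sum.
  rewrite [fm _ (\sum_(_ < _) _)]linear_sum; apply: eq_bigr => l _ /=.
  by rewrite /F !om_fm.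
rewrite exchange_big /D; apply: eq_bigr => l _ /=.
rewrite /Pz [fm _ (\sum_(_ < _) _)]linear_sum [om l (\sum_(_ < _) _)]linear_sum.
apply: eq_bigr => k _; rewrite /F /=; congr (om l _); apply/ffunP => A; rewrite !ffunE /=.
by rewrite derX_mulX yz_neq scale0r add0r (derXC (yv k)).
Qed.

(** The commutator is the weight operator, the difference of the two Euler operators. *)
Lemma QzPz q i j v : pc q i j.+1 v -> Qz (Pz v) = Pz (Qz v) + (i%:R - j%:R) *: v.
Proof.
move=> h; rewrite scalerBl.
rewrite -(fm_sum_id (F := fun k => (mulX (yv k) \o derX (yv k))%FUN) _ h); last first.
  by move=> g /euler_y.
rewrite -(fm_sum_id (F := fun k => (mulX (zv k) \o derX (zv k))%FUN) _ h); last first.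
  by move=> g /euler_z.
have -> : Qz (Pz v) = \sum_k \sum_l fm (mulX (yv l)) (fm (derX (zv l)) (fm (mulX (zv k)) (fm (derX (yv k)) v))).
  rewrite exchange_big /Qz; apply: eq_bigr => k _ /=; rewrite /Pz [fm _ (\sum_(_ < _) _)]linear_sum.
  by rewrite [fm _ (\sum_(_ < _) _)]linear_sum.
have -> : Pz (Qz v) = \sum_k \sum_l fm (mulX (zv k)) (fm (derX (yv k)) (fm (mulX (yv l)) (fm (derX (zv l)) v))).
  rewrite /Pz; apply: eq_bigr => k _ /=; rewrite /Qz [fm _ (\sum_(_ < _) _)]linear_sum.
  by rewrite [fm _ (\sum_(_ < _) _)]linear_sum.
rewrite -sumrB -big_split; apply: eq_bigr => k _ /=.
apply/eqP; rewrite -subr_eq0; apply/eqP; rewrite opprD addrA -sumrB (bigD1 k) //=.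
rewrite [X in _ + X - _]big1 ?addr0.
  apply/ffunP => A; rewrite !ffunE; set x := v A.
  rewrite !derX_mulX eqxx !scale1r !linearD /=.
  rewrite (derXC (zv k) (yv k)) (mulXC (yv k) (zv k)) eqxx scale1r; abel.
move=> l nlk; apply/ffunP => A; rewrite !ffunE.
rewrite !derX_mulX zv_inj yv_inj (negbTE nlk) eq_sym (negbTE nlk) !scale0r !add0r.
by rewrite derXC mulXC subrr.
Qed.
End Differentials.
Transparent ext ctr extv ctrv.

(** * The internal grading of polynomial forms *)

Section PolyGrading.
Variables (R : comUnitRingType) (homR : nat -> R -> Prop) (gR : grading homR R^o).
Variables (t : nat) (w : 'I_(t + t) -> nat).
Local Notation m := (t + t)%N.
Local Notation P := {mpoly R[m]}.
Implicit Types (f : P) (mm : 'X_{1..m}).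

Definition wt mm : nat := \sum_a mm a * w a.
Lemma wtD mm mm' : wt (mm + mm') = (wt mm + wt mm')%N.
Proof. by rewrite /wt -big_split; apply: eq_bigr => a _; rewrite mnmDE mulnDl. Qed.
Lemma wtU a : wt U_(a) = w a.
Proof.
rewrite /wt (bigD1 a) //= mnm1E eqxx mul1n big1 ?addn0 // => b.
by rewrite mnm1E eq_sym => /negbTE->.
Qed.

(** Component of degree [e] when the variables have the weights [w] and the exterior basis vector
    carrying the coefficient has degree [sh]. *)
Definition gP (sh e : nat) f : P :=
  \sum_(mm <- msupp f) (if (sh + wt mm <= e)%N then gR (e - (sh + wt mm))%N f@_mm else 0) *: 'X_[mm].

Lemma mcoeff_gP sh e f mm :
  (gP sh e f)@_mm = if (sh + wt mm <= e)%N then gR (e - (sh + wt mm))%N f@_mm else 0.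
Proof.
rewrite /gP (raddf_sum (mcoeff mm)) /=; under eq_bigr do rewrite mcoeffZ mcoeffX.
have [fm|fm] := boolP (mm \in msupp f); last first.
  rewrite (memN_msupp_eq0 fm) gpi0 if_same big_seq big1 // => m2 m2f.
  by case: eqP => [e2|_]; [rewrite -e2 m2f in fm|rewrite mulr0].
rewrite (bigD1_seq mm) //= eqxx mulr1 big1 ?addr0 // => m2.
by rewrite eq_sym eq_sym => /negbTE->; rewrite mulr0.
Qed.

Lemma gP_D sh e f g : gP sh e (f + g) = gP sh e f + gP sh e g.
Proof.
by apply/mpolyP => mm; rewrite mcoeffD !mcoeff_gP mcoeffD; case: ifP; rewrite ?gpiD ?addr0.
Qed.
Lemma gP_hom sh a r e f : homR a r ->
  gP sh e (r *: f) = if (a <= e)%N then r *: gP sh (e - a) f else 0.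
Proof.
move=> hr; apply/mpolyP => mm; rewrite mcoeff_gP mcoeffZ (gpi_hom gR _ _ hr).
case: (leqP a e) => ae; rewrite ?mcoeffZ ?mcoeff_gP ?mcoeff0; last first.
  by case: ifP => // h; rewrite ifF //; lia.
case: (leqP (sh + wt mm) e) => h1; last by rewrite ifF ?mulr0 //; lia.
case: (leqP (sh + wt mm) (e - a)) => h2; last by rewrite ifF ?mulr0 //; lia.
by rewrite ifT; [congr (_ * gR _ _); lia|lia].
Qed.
Lemma sum_shift (V : zmodType) (F : nat -> V) k N : (k <= N)%N ->
  \sum_(e < N) (if (k <= e)%N then F (e - k)%N else 0) = \sum_(e < N - k) F e.
Proof.
move=> kN; have eN : N = (k + (N - k))%N by lia.
rewrite [in LHS]eN big_split_ord /= big1 ?add0r; last by move=> i _; rewrite leqNgt ltn_ord.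
by apply: eq_bigr => i _; rewrite leq_addr addKn.
Qed.
Lemma gP_sum sh f : exists N, forall N', (N <= N')%N -> f = \sum_(e < N') gP sh e f.
Proof.
have [N hN] : exists N, forall mm, mm \in msupp f -> forall N', (N <= N')%N ->
    f@_mm = \sum_(e < N') (gP sh e f)@_mm.
  elim: (msupp f) => [|mm l [N hN]]; first by exists 0%N.
  have [Nm hm] := gpi_sum gR f@_mm.
  exists (maxn N (sh + wt mm + Nm)) => m2; rewrite inE => /orP[/eqP->|ml] N' h; last by apply: hN => //; lia.
  under eq_bigr do rewrite mcoeff_gP.
  by rewrite (sum_shift (fun e => gR e f@_mm)); [apply: hm; lia|lia].
exists N => N' h; apply/mpolyP => mm; rewrite (raddf_sum (mcoeff mm)) /=.
have [fm|/memN_msupp_eq0 f0] := boolP (mm \in msupp f); first exact: hN.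
rewrite f0 big1 // => e _; rewrite mcoeff_gP f0 gpi0 if_same //.
Qed.

Lemma gP_sh sh e f : gP sh e f = if (sh <= e)%N then gP 0 (e - sh) f else 0.
Proof.
apply/mpolyP => mm; rewrite mcoeff_gP; case: (leqP sh e) => h; rewrite ?mcoeff_gP ?mcoeff0; last by rewrite ifF //; lia.
case: (leqP (sh + wt mm) e) => h1; last by rewrite ifF //; lia.
by rewrite ifT; [congr (gR _ _); lia|lia].
Qed.

Lemma gP_0 sh e : gP sh e 0 = 0.
Proof. by rewrite /gP msupp0 big_nil. Qed.
Lemma gP_N sh e f : gP sh e (- f) = - gP sh e f.
Proof. by apply/eqP; rewrite -addr_eq0 -gP_D addNr gP_0. Qed.

Lemma gP_mulX sh e a f : gP sh e (mulX a f) = if (w a <= e)%N then mulX a (gP sh (e - w a) f) else 0.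
Proof.
apply/mpolyP => mm; rewrite mcoeff_gP mcoeff_mulX.
have [h|h] := ltnP 0 (mm a); last first.
  rewrite gpi0 if_same; case: ifP; rewrite ?mcoeff0 // mcoeff_mulX.
  by rewrite ltnNge h.
have em : wt mm = (w a + wt (mm - U_(a)))%N.
  by rewrite -[in LHS](@submK _ U_(a) mm) ?lep1mP -?lt0n // wtD wtU addnC.
case: (leqP (w a) e) => h1; rewrite ?mcoeff0; last by rewrite ifF //; lia.
rewrite mcoeff_mulX h mcoeff_gP; case: (leqP (sh + wt mm) e) => h2; last by rewrite ifF //; lia.
by rewrite ifT; [congr (gR _ _); lia|lia].
Qed.

Lemma gP_derX sh e a f : gP sh e (derX a f) = derX a (gP sh (e + w a) f).
Proof.
apply/mpolyP => mm; rewrite mcoeff_gP /derX !mcoeff_deriv mcoeff_gP wtD wtU.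
have gM k (x : R) n : gR k (x *+ n) = gR k x *+ n.
  by elim: n => [|n IH]; rewrite ?mulr0n ?gpi0 // !mulrS gpiD IH.
case: (leqP (sh + wt mm) e) => h; last by rewrite ifF ?mul0rn //; lia.
by rewrite ifT; [rewrite gM; congr (gR _ _ *+ _); lia|lia].
Qed.

Lemma derX_gP_small sh e a f : (e < sh + w a)%N -> derX a (gP sh e f) = 0.
Proof.
move=> h; apply/mpolyP => mm; rewrite /derX mcoeff_deriv mcoeff_gP wtD wtU mcoeff0 ifF ?mul0rn //.
lia.
Qed.

Section Ext.
Variables (s : nat) (we : 'I_s -> nat).
Local Notation V := {ffun {set 'I_s} -> P}.
Implicit Types (v : V) (A : {set 'I_s}).
Definition wA A : nat := \sum_(j in A) we j.

Definition gV e v : V := [ffun A => gP (wA A) e (v A)].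
Lemma gV_D e u v : gV e (u + v) = gV e u + gV e v.
Proof. by apply/ffunP => A; rewrite !ffunE gP_D. Qed.
Lemma gV_hom a r e u : homR a r -> gV e (r *: u) = if (a <= e)%N then r *: gV (e - a) u else 0.
Proof.
move=> hr; apply/ffunP => A; rewrite !ffunE (gP_hom _ _ _ hr).
by case: ifP; rewrite !ffunE.
Qed.
Lemma gV_sum u : exists N, forall N', (N <= N')%N -> u = \sum_(e < N') gV e u.
Proof.
have [N hN] : exists N, forall A, A \in enum {set 'I_s} -> forall N', (N <= N')%N ->
    u A = \sum_(e < N') gP (wA A) e (u A).
  elim: (enum _) => [|A l [N hN]]; first by exists 0%N.
  have [Nm hm] := gP_sum (wA A) (u A).
  exists (maxn N Nm) => A2; rewrite inE => /orP[/eqP->|ml] N' h; last by apply: hN => //; lia.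
  by apply: hm; lia.
exists N => N' h; apply/ffunP => A; rewrite sum_ffunE {1}(hN A _ N') ?mem_enum //.
by apply: eq_bigr => e _; rewrite ffunE.
Qed.
Definition Vgrading : grading homR V := Grading gV_D gV_sum gV_hom.

Lemma gV_ext e j v : gV e (ext j v) = if (we j <= e)%N then ext j (gV (e - we j) v) else 0.
Proof.
apply/ffunP => A; rewrite !ffunE; case: ifP => jA; last first.
  by rewrite gP_0; case: ifP; rewrite !ffunE ?jA.
have gs k b (x : P) : gP k b ((-1) ^+ sig j A *: x) = (-1) ^+ sig j A *: gP k b x.
  by rewrite -signr_odd; case: odd; rewrite ?expr0 ?expr1 ?scale1r // !scaleN1r gP_N.
have eA : wA A = (we j + wA (A :\ j))%N by rewrite /wA (big_setD1 j).
rewrite gs gP_sh eA; case: (leqP (we j) e) => h; rewrite !ffunE ?jA; last first.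
  by rewrite ifF ?scaler0 //; lia.
rewrite [in RHS]gP_sh; congr (_ *: _); case: (leqP (we j + wA (A :\ j)) e) => h1; last by rewrite ifF //; lia.
by rewrite ifT; [congr (gP _ _ _); lia|lia].
Qed.

Lemma gV_mulX e a v : gV e (fm (mulX a) v) = if (w a <= e)%N then fm (mulX a) (gV (e - w a) v) else 0.
Proof. by apply/ffunP => A; rewrite !ffunE gP_mulX; case: ifP; rewrite !ffunE. Qed.

Lemma gV_sum' (I : Type) (r : seq I) (F : I -> V) e : gV e (\sum_(k <- r) F k) = \sum_(k <- r) gV e (F k).
Proof. by elim: r => [|k r IH]; rewrite ?big_nil ?big_cons ?gV_D ?IH //; exact: (gpi0 Vgrading). Qed.

Variables (X : 'M[R]_(t, s)) (dd : 'I_t -> 'I_s -> nat) (wx : 'I_t -> nat).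
Hypothesis homX : forall k j, homR (dd k j) (X k j).
Hypothesis wxE : forall k j, wx k = (dd k j + we j)%N.

Lemma gV_om e k v : gV e (om X k v) = if (wx k <= e)%N then om X k (gV (e - wx k) v) else 0.
Proof.
rewrite /om /extv gV_sum'; case: leqP => h.
  apply: eq_bigr => j _; rewrite (gV_hom _ _ (homX k j)) gV_ext.
  have := wxE k j => wkj; rewrite ifT; last lia.
  by rewrite wkj subnDA ifT //; lia.
rewrite big1 // => j _; rewrite (gV_hom _ _ (homX k j)) gV_ext.
have := wxE k j => wkj; case: ifP => // h1; rewrite ifF ?scaler0 //; lia.
Qed.

Lemma gV_D_comm va e v : (forall k, w (va k) = wx k) -> gV e (D X va v) = D X va (gV e v).
Proof.
move=> wv; rewrite /D gV_sum'; apply: eq_bigr => k _; rewrite gV_om.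
have gd e' : gV e' (fm (derX (va k)) v) = fm (derX (va k)) (gV (e' + wx k) v).
  by apply/ffunP => A; rewrite !ffunE gP_derX wv.
case: leqP => h; first by rewrite gd subnK.
apply/esym; suff -> : fm (derX (va k)) (gV e v) = 0 by rewrite linear0.
apply/ffunP => A; rewrite !ffunE derX_gP_small // wv; lia.
Qed.

Lemma gV_Om e r v : gV e (Om X r v) =
  if (\sum_(k <- r) wx k <= e)%N then Om X r (gV (e - \sum_(k <- r) wx k) v) else 0.
Proof.
elim: r e => [|k r IH] e /=; first by rewrite big_nil subn0.
rewrite gV_om big_cons; case: leqP => h; last by rewrite ifF //; lia.
rewrite IH; case: leqP => h1; last by rewrite linear0 ifF //; lia.
by rewrite subnDA ifT //; lia.
Qed.

Lemma gV_Al e r k v : uniq r -> k \in r -> gV e (Al X r k v) =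
  if (\sum_(l <- rem k r) wx l <= e)%N then Al X r k (gV (e - \sum_(l <- rem k r) wx l) v) else 0.
Proof.
move=> ur kr; have [b hb] := Al_Om P X ur kr.
rewrite !hb; have gs x : gV e ((-1) ^+ b *: x) = (-1) ^+ b *: gV e x.
  case: b {hb}; rewrite ?expr0 ?expr1 ?scale1r // !scaleN1r; exact: (gpiN Vgrading).
by rewrite gs gV_Om; case: ifP; rewrite ?scaler0.
Qed.
End Ext.
End PolyGrading.

Section Free.
Variables (R : comNzRingType) (Xl : seq R) (Q : lmodType R) (E : inj_resolution Q).
Hypothesis free0 : pdc Xl E 0 (fun _ : R^o => True) (fun u => u = 0).

Lemma pdc_pp t i j : pdc Xl E 0 (@pp R t i j) (fun u => u = 0).
Proof.
pose J := {m : 'X_{1..(t + t)%N < (i + j).+1} | (ydeg (bmnm m) == i) && ((zdeg (bmnm m)).+1 == j)}.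
pose F (g : {ffun J -> R^o}) : {mpoly R[t + t]} := \sum_(x : J) (g x : R) *: 'X_[val (val x)].
have FL : linear F.
  move=> a u v; rewrite /F scaler_sumr -big_split; apply: eq_bigr => x _ /=.
  by rewrite !ffunE scalerDl scalerA.
have cF g (x : J) : (F g)@_(val (val x)) = g x.
  rewrite /F (raddf_sum (mcoeff _)) /= (bigD1 x) //= mcoeffZ mcoeffX eqxx mulr1 big1 ?addr0 // => y yx.
  rewrite mcoeffZ mcoeffX; case: eqP => [e|]; last by rewrite mulr0.
  by case/eqP: yx; apply: val_inj; apply: val_inj.
have h := vdsum (pdc_vtheory Xl E 0) J (submodT _) (submod00 _) (fun _ _ => I) free0.
apply: (@vmap _ _ (pdc_vtheory Xl E 0) _ _ (mklinear FL) _ _ _ _ _ _ _ _ _ _ _ h).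
- by apply: submod_ffun; exact: submodT.
- exact: submod_pp.
- by apply: submod_ffun; exact: submod00.
- exact: submod00.
- move=> g _ mm hne; have [/andP[/eqP-> /eqP->]//|nm] := boolP ((ydeg mm == i) && ((zdeg mm).+1 == j)).
  case/eqP: hne; rewrite /F (raddf_sum (mcoeff _)) /= big1 // => x _.
  rewrite mcoeffZ mcoeffX; case: eqP => [e|]; last by rewrite mulr0.
  by have := valP x; rewrite e (negbTE nm).
- move=> f hf; exists [ffun x : J => f@_(val (val x)) : R^o] => //=.
  apply/eqP; rewrite subr_eq0; apply/eqP/mpolyP => mm.
  have [hm|hm] := boolP ((ydeg mm == i) && ((zdeg mm).+1 == j)).
    have bm : (mdeg mm < (i + j).+1)%N.
      rewrite mdegE big_split_ord /= -/(ydeg mm) -/(zdeg mm).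
      by case/andP: hm => /eqP-> /eqP<-; lia.
    pose x : J := exist _ (BMultinom bm) hm.
    by rewrite -[mm]/(val (val x)) cF ffunE.
  have -> : f@_mm = 0 by apply/eqP/negPn/negP => /hf[e1 e2]; rewrite e1 e2 !eqxx in hm.
  rewrite /F (raddf_sum (mcoeff _)) /= big1 // => x _.
  rewrite mcoeffZ mcoeffX; case: eqP => [e|]; last by rewrite mulr0.
  by have := valP x; rewrite e (negbTE hm).
- move=> g _; split=> [g0|/= g0 x]; last by rewrite -cF g0 mcoeff0.
  by rewrite /= /F big1 // => x _; rewrite (g0 x) scale0r.
Qed.

Section Fiber.
Variables (s : nat) (P : lmodType R) (Zp Bp : P -> Prop) (p : nat).
Hypotheses (sZ : submod Zp) (sB : submod Bp) (BZ : forall f, Bp f -> Zp f).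
Local Notation V := {ffun {set 'I_s} -> P}.
Definition fq (q : nat) (Z : P -> Prop) (v : V) : Prop := forall A : {set 'I_s},
  (#|A|.+1 = q -> Z (v A)) /\ (#|A|.+1 <> q -> v A = 0).
Lemma submod_fq q Z : submod Z -> submod (fq q Z).
Proof.
move=> sZ'; split=> [A|a u v hu hv A]; rewrite !ffunE.
  by split=> // _; exact: submod0 sZ'.
case: (hu A) (hv A) => [u1 u2] [v1 v2]; split=> h; last by rewrite u2 // v2 // scaler0 addr0.
by apply: sZ'.2; [exact: u1|exact: v1].
Qed.

Lemma pdc_fq q : pdc Xl E p Zp Bp -> pdc Xl E p (fq q Zp) (fq q Bp).
Proof.
move=> hp; pose J := {A : {set 'I_s} | #|A|.+1 == q}.
pose F (g : {ffun J -> P}) : V := [ffun A => if insub A is Some x then g x else 0].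
have FL : linear F.
  by move=> a u v; apply/ffunP => A; rewrite !ffunE; case: insub => [x|]; rewrite ?ffunE ?scaler0 ?addr0.
have h := vdsum (pdc_vtheory Xl E p) J sZ sB BZ hp.
have FE g (A : {set 'I_s}) (hA : #|A|.+1 == q) : F g A = g (Sub A hA) by rewrite ffunE insubT.
have FN g (A : {set 'I_s}) : #|A|.+1 <> q -> F g A = 0 by move=> /eqP hA; rewrite ffunE insubN.
apply: (@vmap _ _ (pdc_vtheory Xl E p) _ _ (mklinear FL) _ _ _ _ _ _ _ _ _ _ _ h).
- exact: submod_ffun.
- exact: submod_fq.
- exact: submod_ffun.
- exact: submod_fq.
- move=> g hg A; split; last exact: FN.
  by move=> /eqP hA; change (Zp (F g A)); rewrite (FE _ _ hA); exact: hg.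
- move=> v hv; exists [ffun x : J => v (val x)] => [x|A].
    by rewrite ffunE; apply: (hv _).1; apply/eqP; exact: (valP x).
  rewrite !ffunE /=; split=> [/eqP hA|nA]; first by rewrite insubT ffunE subrr; exact: submod0 sB.
  by rewrite (hv A).2 // insubN ?subrr //; exact/eqP.
- move=> g hg; split=> [bg A|bg x].
    split; last exact: FN.
    by move=> /eqP hA; change (Bp (F g A)); rewrite (FE _ _ hA); exact: bg.
  have hx : #|val x|.+1 == q by exact: (valP x).
  have := (bg (val x)).1 (eqP hx); change (Bp (F g (val x)) -> Bp (g x)); rewrite (FE _ _ hx).
  by congr (Bp (g _)); exact: val_inj.
Qed.
End Fiber.

Lemma pdc_pc s t q i j : pdc Xl E 0 (@pc R t s q i j) (fun u => u = 0).
Proof.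
have h0 f : f = 0 -> @pp R t i j f by move=> ->; case: (@submod_pp R t i j).
have h := pdc_fq s (@submod_pp R t i j) (submod00 _) h0 q (pdc_pp t i j).
apply: (veq (pdc_vtheory Xl E 0) _ _ _ _ _ _ h) => //.
- exact: submod_fq (@submod_pp R t i j).
- exact: submod_fq (submod00 _).
- move=> v _; split=> [hv|->]; last by move=> A; rewrite ffunE.
  apply/ffunP => A; rewrite ffunE; have [|] := eqVneq #|A|.+1 q; first exact: (hv A).1.
  by move=> /eqP; exact: (hv A).2.
- exact: submod_pc.
- exact: submod00.
Qed.
End Free.

Notation spc := (@submod_pc _ _ _ _ _ _).
Notation spp := (@submod_pp _ _ _ _).

Section FiberOps.
Variables (R : comUnitRingType) (s : nat) (P : lmodType R).
Local Notation V := {ffun {set 'I_s} -> P}.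
Implicit Types (Z : P -> Prop) (v : V).

Lemma fq_ext Z q p v : submod Z -> fq q Z v -> fq q.+1 Z (ext p v).
Proof.
move=> sZ h A; rewrite !ffunE; case: ifP => pA; last first.
  by split=> // _; exact: submod0 sZ.
have cA : #|A| = (#|A :\ p|).+1 by rewrite (cardsD1 p) pA.
split=> [[e]|ne]; first by apply: (submodZ sZ); apply: (h _).1; rewrite -cA.
by rewrite (h _).2 ?scaler0 // => e; apply: ne; rewrite cA e.
Qed.
Lemma fq_ctrv Z q w v : submod Z -> fq q.+1 Z v -> fq q Z (ctrv w v).
Proof.
move=> sZ h; rewrite /ctrv; apply: (submod_sum (@submod_fq R s P q Z sZ)) => p _; apply: (submodZ (@submod_fq R s P q Z sZ)).
move=> A; rewrite !ffunE; case: ifP => pA.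
  by split=> // _; exact: submod0 sZ.
have cA : #|p |: A| = (#|A|).+1 by rewrite cardsU1 pA.
split=> [e|ne]; first by apply: (submodZ sZ); apply: (h _).1; rewrite cA e.
by rewrite (h _).2 ?scaler0 // => e; apply: ne; move: e; rewrite cA => -[].
Qed.
Lemma fq_fm Z Z' (f : {linear P -> P}) q v :
  (forall x, Z x -> Z' (f x)) -> fq q Z v -> fq q Z' (fm f v).
Proof. by move=> hf h A; rewrite ffunE; split=> [/(h A).1/hf|/(h A).2->]; rewrite ?linear0. Qed.
End FiberOps.

Section PieceOps.
Variables (R : comUnitRingType) (s t : nat) (X : 'M[R]_(t, s)).
Local Notation P := {mpoly R[t + t]}.
Local Notation V := {ffun {set 'I_s} -> P}.
Implicit Types (v : V) (f : P) (q i j : nat) (k : 'I_t).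
Local Notation pc := (@pc R t s).
Local Notation Dy := (D X (@yv t)).
Local Notation Dz := (D X (@zv t)).
Local Notation enumt := (enum 'I_t).

Lemma pc_om q i j k v : pc q i j v -> pc q.+1 i j (om X k v).
Proof. exact: pc_extv. Qed.
Lemma pc_Om q i j r v : pc q i j v -> pc (size r + q) i j (Om X r v).
Proof. by move=> h; elim: r => //= k r IH; exact: pc_om. Qed.
Lemma pc_Dy q i j v : pc q i.+1 j v -> pc q.+1 i j (Dy v).
Proof.
move=> h; rewrite /D; apply: (submod_sum spc) => k _; apply: pc_om.
by apply: pc_fm h => f; exact: pp_dy.
Qed.
Lemma pc_Dz q i j v : pc q i j.+1 v -> pc q.+1 i j (Dz v).
Proof.
move=> h; rewrite /D; apply: (submod_sum spc) => k _; apply: pc_om.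
by apply: pc_fm h => f; exact: pp_dz.
Qed.
Lemma pc_Hy rho r q i j v : pc q.+1 i j v -> pc q i.+1 j (H (@yv t) rho r v).
Proof.
move=> h; rewrite /H; apply: (submod_sum spc) => k _; apply: pc_ctrv.
by apply: pc_fm h => f; exact: pp_my.
Qed.
Lemma pc_Hz rho r q i j v : pc q.+1 i j v -> pc q i j.+1 (H (@zv t) rho r v).
Proof.
move=> h; rewrite /H; apply: (submod_sum spc) => k _; apply: pc_ctrv.
by apply: pc_fm h => f; exact: pp_mz.
Qed.
Lemma pc_Pz q i j v : pc q i.+1 j v -> pc q i j.+1 (Pz v).
Proof.
move=> h; rewrite /Pz; apply: (submod_sum spc) => k _.
apply: (@pc_fm _ _ _ (mulX (zv k)) q i j i j.+1) => [f|]; first exact: pp_mz.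
by apply: pc_fm h => f; exact: pp_dy.
Qed.
Lemma pc_Qz q i j v : pc q i j.+1 v -> pc q i.+1 j (Qz v).
Proof.
move=> h; rewrite /Qz; apply: (submod_sum spc) => k _.
apply: (@pc_fm _ _ _ (mulX (yv k)) q i j i.+1 j) => [f|]; first exact: pp_my.
by apply: pc_fm h => f; exact: pp_dz.
Qed.

Lemma fm_dy0 q j k v : pc q 0 j v -> fm (derX (yv k)) v = 0.
Proof.
move=> h; apply/ffunP => A; rewrite !ffunE; have [e|/eqP e] := eqVneq #|A|.+1 q.
  exact: (pp_dy0 k ((h A).1 e)).
by rewrite (h A).2 // linear0.
Qed.

Lemma Dy_sum q j (w : 'I_t -> V) : (forall k, pc q 0 j (w k)) ->
  Dy (\sum_k fm (mulX (yv k)) (w k)) = \sum_k om X k (w k).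
Proof.
move=> hw; rewrite /D; apply: eq_bigr => l _.
suff -> : fm (derX (yv l)) (\sum_k fm (mulX (yv k)) (w k)) = w l by [].
rewrite [fm _ (\sum_(_ < _) _)]linear_sum (bigD1 l) //= big1 ?addr0 => [|k nkl].
  have h0 := fm_dy0 l (hw l); apply/ffunP => A; rewrite !ffunE /= derX_mulX eqxx scale1r.
  by move/ffunP/(_ A): h0; rewrite !ffunE => ->; rewrite linear0 addr0.
have h0 := fm_dy0 l (hw k); apply/ffunP => A; rewrite !ffunE /= derX_mulX.
rewrite yv_inj eq_sym (negbTE nkl) scale0r add0r.
by move/ffunP/(_ A): h0; rewrite !ffunE => ->; rewrite linear0.
Qed.

(** The coefficient of the top form. On exterior degree s - t it is the pairing with the t-minors,
    so its image is I with coefficients in y and z. *)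
Definition eps v : P := Om X enumt v setT.
Fact eps_linear : linear eps.
Proof. by move=> a u v; rewrite /eps linearP !ffunE. Qed.
HB.instance Definition _ := GRing.isLinear.Build R V P _ eps eps_linear.
(** On exterior degree s - t + 1, the pairing with the (t-1)-minors that avoid row k, up to sign. *)
Definition al k v : P := Al X enumt k v setT.
Fact al_linear k : linear (al k).
Proof. by move=> a u v; rewrite /al linearP !ffunE. Qed.
HB.instance Definition _ k := GRing.isLinear.Build R V P _ (al k) (@al_linear k).
(** The form al.z: the t-minors of the matrix bordered by the column z, those involving z, expanded
    along it. *)
Definition psi v : P := \sum_k mulX (zv k) (al k v).
Fact psi_linear : linear psi.
Proof.
move=> a u v; rewrite /psi scaler_sumr -big_split; apply: eq_bigr => k _ /=.
by rewrite !linearP.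
Qed.
HB.instance Definition _ := GRing.isLinear.Build R V P _ psi psi_linear.

Lemma mem_enumt k : k \in enumt. Proof. by rewrite mem_enum. Qed.
Lemma uniq_enumt : uniq enumt. Proof. exact: enum_uniq. Qed.
Hint Resolve mem_enumt uniq_enumt : core.

Hypothesis natU : forall m, (m.+1%:R : R) \is a GRing.unit.
Lemma unit2 : (2%:R : R) \is a GRing.unit. Proof. exact: natU 1%N. Qed.

Lemma eps_om k v : eps (om X k v) = 0.
Proof. by rewrite /eps (Om_om X unit2) // ffunE. Qed.
Lemma eps_fm (f : {linear P -> P}) v : eps (fm f v) = f (eps v).
Proof. by rewrite /eps Om_fm ffunE. Qed.
Lemma al_fm (f : {linear P -> P}) k v : al k (fm f v) = f (al k v).
Proof. by rewrite /al Al_fm ffunE. Qed.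
Lemma al_om k v : al k (om X k v) = eps v.
Proof. by rewrite /al Al_om. Qed.
Lemma al_om_other k l v : l != k -> al k (om X l v) = 0.
Proof. by move=> nlk; rewrite /al (Al_om_other X unit2) // ffunE. Qed.
Lemma eps_D va v : eps (D X va v) = 0.
Proof. by rewrite /D linear_sum big1 // => k _; rewrite /= eps_om. Qed.
Lemma psi_fm (f : {linear P -> P}) v : (forall k g, f (mulX (zv k) g) = mulX (zv k) (f g)) ->
  psi (fm f v) = f (psi v).
Proof. by move=> hf; rewrite /psi linear_sum; apply: eq_bigr => k _; rewrite al_fm hf. Qed.
(** [al k] turns [om k] into [eps] and kills the other rows. The identity makes [eps + psi] vanish
    on the image of the cone differential [Dc]. *)
Lemma psi_Dy v : psi (Dy v) = eps (Pz v).
Proof.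
rewrite /psi /Pz linear_sum; apply: eq_bigr => k _; rewrite /= eps_fm eps_fm; congr (mulX _ _).
rewrite /D linear_sum (bigD1 k) //= al_om eps_fm big1 ?addr0 // => l nlk.
by rewrite al_om_other.
Qed.

Variable c1 : nat.
Local Notation c := c1.+1.
Hypothesis sE : s = (t + c1)%N.
Hypothesis t0 : (0 < t)%N.

Lemma top_eq q i j v : q = s.+1 -> pc q i j v -> v setT = 0 -> v = 0.
Proof.
move=> -> h v0; apply/ffunP => A; rewrite ffunE; have [e|/eqP e] := eqVneq #|A|.+1 s.+1.
  suff -> : A = setT by [].
  by apply/eqP; rewrite eqEcard subsetT cardsT card_ord -ltnS e ltnSn.
exact: (h A).2.
Qed.
Lemma top_pp q i j v : q = s.+1 -> pc q i j v -> pp i j (v setT).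
Proof. by move=> -> h; apply: (h setT).1; rewrite cardsT card_ord. Qed.

Lemma pp_eps i j v : pc c i j v -> pp i j (eps v).
Proof.
move=> /(pc_Om enumt); apply: top_pp; rewrite size_enum_ord sE; lia.
Qed.
Lemma eps0_Om i j v : pc c i j v -> eps v = 0 -> Om X enumt v = 0.
Proof.
move=> /(pc_Om enumt) h; apply: (top_eq _ h); rewrite size_enum_ord sE; lia.
Qed.
Lemma size_rem_enumt k : size (rem k enumt) = t.-1.
Proof. by rewrite size_rem // size_enum_ord. Qed.
Lemma pc_Al i j k v : pc c.+1 i j v -> pc s.+1 i j (Al X enumt k v).
Proof.
move=> h; have [b ->] := Al_Om P X uniq_enumt (mem_enumt k).
apply: (submodZ spc); have := pc_Om (rem k enumt) h.
by rewrite size_rem_enumt; have -> : (t.-1 + c.+1 = s.+1)%N by rewrite sE; lia.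
Qed.
Lemma pp_al i j k v : pc c.+1 i j v -> pp i j (al k v).
Proof. by move=> /(pc_Al k); exact: top_pp. Qed.
Lemma al0_Om i j k v : pc c.+1 i j v -> al k v = 0 -> Om X (rem k enumt) v = 0.
Proof.
move=> h a0; have := top_eq erefl (pc_Al k h) a0; have [b ->] := Al_Om P X uniq_enumt (mem_enumt k).
move/(congr1 (fun x => (-1) ^+ b *: x)); by rewrite scaler0 scalerA -expr2 sqrr_sign scale1r.
Qed.
Lemma pp_psi i j v : pc c.+1 i j v -> pp i j.+1 (psi v).
Proof.
by move=> h; rewrite /psi; apply: (submod_sum spp) => k _; apply: pp_mz; exact: pp_al.
Qed.
Lemma al_rel i j p u : pc c.+1 i j u -> \sum_k X k p *: al k u = eps (ctr p u).
Proof.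
move=> h; rewrite /eps Al_rel // !ffunE sum_ffunE.
have -> : Om X enumt u = 0.
  apply: (@pc_big R t s (size enumt + c.+1) i j); last exact: pc_Om.
  by rewrite size_enum_ord sE; lia.
rewrite inE scaler0 add0r big_enum /=; apply: eq_bigr => k _.
by rewrite !ffunE.
Qed.
Lemma al_relv i j rho u : pc c.+1 i j u ->
  \sum_k (\sum_p rho p * X k p) *: al k u = eps (ctrv rho u).
Proof.
move=> h; rewrite /ctrv linear_sum; under [RHS]eq_bigr do rewrite linearZ /= -(al_rel _ h) scaler_sumr.
rewrite exchange_big; apply: eq_bigr => k _; rewrite scaler_suml.
by apply: eq_bigr => p _; rewrite scalerA.
Qed.
End PieceOps.

(** * The sl_2 splitting and the derivative trick *)

Section Sl2.
Variables (R : comUnitRingType) (s t : nat).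
Local Notation P := {mpoly R[t + t]}.
Local Notation V := {ffun {set 'I_s} -> P}.
Implicit Types (v : V).
Local Notation pc := (@pc R t s).
Local Notation Pz := (@Pz R s t).
Local Notation Qz := (@Qz R s t).
Hypothesis natU : forall m, (m.+1%:R : R) \is a GRing.unit.

Lemma pc_Qzn q i j m v : pc q i (m + j) v -> pc q (m + i) j (iter m Qz v).
Proof.
elim: m j => [|m IH] j //= h; apply: pc_Qz; apply: IH; by rewrite addnS -addSn.
Qed.

(** The usual sl_2 commutation of a power of one generator with the other. The integer (m + 1)(a - b
    + m) is positive because b < a, hence a unit. *)
Lemma Qzn_Pz q a b m v : (b < a)%N -> pc q a b.+1 v ->
  iter m.+1 Qz (Pz v) = Pz (iter m.+1 Qz v) + (m.+1 * (a - b + m))%:R *: iter m Qz v.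
Proof.
move=> ba h; elim: m => [|m IH].
  by rewrite /= (QzPz h) mul1n addn0 natrB // ltnW.
have QD x y : Qz (x + y) = Qz x + Qz y by exact: linearD.
have QZ b' x : Qz (b' *: x) = b' *: Qz x by exact: linearZ.
rewrite [LHS]/= -[Qz (iter m Qz (Pz v))]/(iter m.+1 Qz (Pz v)) IH QD QZ.
rewrite -[Qz (iter m Qz v)]/(iter m.+1 Qz v) -[iter m.+2 Qz v]/(Qz (iter m.+1 Qz v)).
have [mb|bm] := leqP m.+1 b.
  have h1 : pc q (m.+1 + a) (b - m.+1).+1 (iter m.+1 Qz v).
    by apply: pc_Qzn; rewrite addnS subnKC.
  rewrite (QzPz h1) -addrA -scalerDl; congr (_ + _ *: _).
  rewrite -natrB; last lia.
  by rewrite -natrD; congr (_%:R); nia.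
have -> : iter m.+1 Qz v = 0.
  apply: (@pc_j0 _ _ _ q (m.+1 + a)); have h2 : pc q (b.+1 + a) 0 (iter b.+1 Qz v).
    by apply: pc_Qzn; rewrite addn0.
  have {}h2 := pc_j0 h2; have -> : m.+1 = (m - b + b.+1)%N by lia.
  rewrite iterD h2; have -> : iter (m - b) Qz 0 = 0 by elim: (m - b)%N => //= n ->; rewrite linear0.
  exact: submod0 spc.
by rewrite !linear0.
Qed.

(** On pieces whose y-degree exceeds the z-degree, [Pz] is injective; the point is a left inverse
    that is linear and respects degrees, so that it splits off a summand. *)
Lemma sl2_split q a b : (b <= a)%N -> exists sg : {linear V -> V},
  (forall e, pc q a b.+2 e -> pc q a.+1 b.+1 (sg e)) /\
  (forall v, pc q a.+1 b.+1 v -> sg (Pz v) = v).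
Proof.
move=> ba.
(* Descending induction on m, starting at m = b + 1, where [Qz] to the power m vanishes on z-degree
   b. Dividing by the integer of [Qzn_Pz] passes from m + 1 to m, and m = 0 is the left inverse. *)
suff H d m : (m + d = b.+1)%N -> exists sg : {linear V -> V},
  (forall e, pc q a b.+2 e -> pc q a.+1 b.+1 (sg e)) /\
  (forall v, pc q a.+1 b.+1 v -> sg (Pz v) = iter m Pz (iter m Qz v)).
  by have [sg [h1 h2]] := H b.+1 0%N erefl; exists sg.
elim: d m => [|d IH] m md.
  exists (\0%R : {linear V -> V}); split=> [e _|v h]; first exact: submod0 spc.
  have -> : iter m Qz v = 0.
    by apply: (@pc_j0 _ _ _ q (m + a.+1)); apply: pc_Qzn; rewrite md.
  by elim: (m) => //= n <-; rewrite /= linear0.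
have [|sg [h1 h2]] := IH m.+1; first lia.
pose cf := (m.+1 * (a.+1 - b + m))%:R : R.
have cu : cf \is a GRing.unit.
  have -> : cf = ((m.+1 * (a.+1 - b + m)).-1.+1)%:R by rewrite /cf prednK // muln_gt0 /=; lia.
  exact: natU.
pose F (v : V) : V := cf^-1 *: (iter m Pz (iter m.+1 Qz v) - sg v).
have iL (f : {linear V -> V}) n : linear (iter n f).
  by elim: n => [|n IHn] x u v //=; rewrite IHn linearP.
have FL : linear F.
  move=> x u v; rewrite /F iL iL linearP !scalerDr !scalerN !scalerDr !scalerA [cf^-1 * x]mulrC; abel.
have pP n i j e : pc q (n + i) j e -> pc q i (n + j) (iter n Pz e).
  elim: n i j => [|n IHn] i j //= he; rewrite addSn; apply: pc_Pz; apply: IHn.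
  by rewrite addnS -addSn.
exists (mklinear FL); split=> [e he|v hv].
  apply: (submodZ spc); apply: (submodB spc); last exact: h1.
  have -> : b.+1 = (m + d.+1)%N by lia.
  apply: pP; have -> : (m + a.+1 = m.+1 + a)%N by lia.
  apply: pc_Qzn; by have -> : (m.+1 + d.+1 = b.+2)%N by lia.
change (F (Pz v) = iter m Pz (iter m Qz v)); rewrite /F (Qzn_Pz m (ba : (b < a.+1)%N) hv) h2 //.
have -> : iter m Pz (Pz (iter m.+1 Qz v) + (m.+1 * (a.+1 - b + m))%:R *: iter m Qz v) =
  iter m.+1 Pz (iter m.+1 Qz v) + cf *: iter m Pz (iter m Qz v).
  rewrite [X in iter m Pz X = _]addrC iL addrC.
  by rewrite -iterSr.
by rewrite addrAC subrr add0r scalerA mulVr ?scale1r.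
Qed.
End Sl2.

Section DerivativeTrick.
Variables (R : comUnitRingType) (t : nat).
Hypothesis natU : forall m, (m.+1%:R : R) \is a GRing.unit.
Local Notation P := {mpoly R[t + t]}.
Local Notation pp := (@pp R t).
Implicit Types (f : P) (j b : nat).
Variables (De : R) (L : {linear P -> P}) (k0 : 'I_t) (Qj : nat -> P -> Prop).
Hypothesis LD : forall f, derX (zv k0) (L f) = De *: f + L (derX (zv k0) f).
Hypotheses (sQ : forall j, submod (Qj j)) (LQ : forall j f, Qj j f -> Qj j.+1 (L f))
  (DQ : forall j f, Qj j.+1 f -> Qj j (derX (zv k0) f)).

Lemma derX_iter b f : derX (zv k0) (iter b.+1 L f) =
  (b.+1%:R * De) *: iter b L f + iter b.+1 L (derX (zv k0) f).
Proof.
elim: b => [|b IH]; first by rewrite /= LD mul1r.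
rewrite [iter b.+2 L f]/= LD -/(iter b.+1 L f) IH linearD linearZ /=.
rewrite addrA -scalerDl; congr (_ *: _ + _); rewrite -[b.+2%:R]natr1; ring.
Qed.

(* Differentiating a relation L^b g = 0 gives, up to powers of De, the same for
   the derivative of g with exponent b + 1, and from there for b - 1. *)
Lemma derivative_trick j b f : pp 0 j f -> Qj (b.+1 + j)%N (iter b.+1 L f) ->
  exists a, Qj j (De ^+ a *: f).
Proof.
elim: j b f => [|j IHj] b f hf hQ.
  by exists 0%N; rewrite (pp0 hf) scaler0; exact: submod0 (sQ 0).
have ZL n x u : iter n L (x *: u) = x *: iter n L u by elim: n => //= n ->; rewrite linearZ.
elim: b f hf hQ => [|b IHb] f hf hQ.
  rewrite add1n in hQ; have [|a ha] := IHj 1%N (derX (zv k0) f) (pp_dz hf).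
    have := LQ (DQ hQ); rewrite derX_iter /= mul1r linearD linearZ /=.
    by move=> /(submodB (sQ _)) => /(_ _ (submodZ (sQ _) De hQ)); rewrite addrAC subrr add0r.
  exists a.+1; have := submodZ (sQ _) (De ^+ a) (DQ hQ); rewrite derX_iter /= mul1r scalerDr.
  rewrite scalerA -exprSr => h1; apply: (submodDr (sQ _) _ h1).
  by rewrite -linearZ; exact: LQ.
rewrite addSn in hQ; have [|a ha] := IHj b.+2 (derX (zv k0) f) (pp_dz hf).
  have := LQ (DQ hQ); rewrite derX_iter linearD linearZ /=.
  have -> : (b.+3 + j = (b.+1 + j.+1).+1)%N by lia.
  move=> /(submodB (sQ _)) => /(_ _ (submodZ (sQ _) (b.+2%:R * De) hQ)).
  by rewrite addrAC subrr add0r.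
have hI : Qj (b.+1 + j.+1)%N (iter b.+1 L (De ^+ a.+1 *: f)).
  have LQn n j' u : Qj j' u -> Qj (n + j')%N (iter n L u).
    by move=> hu; elim: n => //= n IHn; exact: LQ.
  have := submodZ (sQ _) (b.+2%:R^-1 * De ^+ a) (DQ hQ).
  have e : (b.+2%:R^-1 * De ^+ a) * (b.+2%:R * De) = De ^+ a.+1.
    by rewrite mulrACA mulVr ?natU // mul1r exprSr.
  rewrite derX_iter scalerDr [_ *: (_ *: iter b.+1 L f)]scalerA e -ZL.
  rewrite -[(_ * _) *: iter b.+2 L _]scalerA -[De ^+ a *: iter b.+2 L _]ZL => h1.
  apply: (submodDr (sQ _) _ h1).
  apply: (submodZ (sQ _)); have := LQn b.+2 _ _ ha.
  by have -> : (b.+2 + j = b.+1 + j.+1)%N by lia.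
have [a' ha'] := IHb _ (submodZ spp _ hf) hI.
by exists (a' + a.+1)%N; rewrite exprD -scalerA.
Qed.
End DerivativeTrick.

(** * Exactness of the strands *)

Section Strands.
Variables (R : comUnitRingType) (s t c1 : nat) (X : 'M[R]_(t, s)).
Hypothesis natU : forall m, (m.+1%:R : R) \is a GRing.unit.
Hypotheses (sE : s = (t + c1)%N) (t0 : (0 < t)%N).
Variables (Xl : seq R) (Q : lmodType R) (E : inj_resolution Q).
Hypothesis free0 : pdc Xl E 0 (fun _ : R^o => True) (fun u => u = 0).
Variables (homR : nat -> R -> Prop) (gR : grading homR R^o).
Variables (w : 'I_(t + t) -> nat) (we : 'I_s -> nat) (dd : 'I_t -> 'I_s -> nat) (wx : 'I_t -> nat).
Hypothesis homX : forall k j, homR (dd k j) (X k j).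
Hypothesis wxE : forall k j, wx k = (dd k j + we j)%N.
Hypotheses (wy : forall k, w (yv k) = wx k) (wz : forall k, w (zv k) = wx k).
Local Notation c := c1.+1.
Local Notation P := {mpoly R[t + t]}.
Local Notation V := {ffun {set 'I_s} -> P}.
Local Notation pc := (@pc R t s).
Local Notation pp := (@pp R t).
Local Notation Dy := (D X (@yv t)).
Local Notation Dz := (D X (@zv t)).
Local Notation Hy := (H (@yv t)).
Local Notation Hz := (H (@zv t)).
Local Notation eps := (eps X).
Local Notation psi := (psi X).
Local Notation al := (al X).
Local Notation Pz := (@Pz R s t).
Local Notation enumt := (enum 'I_t).
Local Notation g := (@Vgrading R homR gR t w s we).
Local Notation pdc := (@pdc R Xl Q E).
Local Notation zeroP := (fun u => u = 0).
Implicit Types (v : V) (f : P) (q i j : nat) (k l : 'I_t).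

(** [rho] is a dual basis of the rows in [r] up to the factor De; a minor on these rows supplies one
    through its adjugate. *)
Definition dual (r : seq 'I_t) (De : R) (rho : 'I_t -> 'I_s -> R) := forall k l,
  k \in r -> l \in r -> \sum_j rho k j * X l j = (k == l)%:R * De.

(** The depth principle with the matrix hidden: if Z/B has dimension at most p < N, an element that
    vanishes on every chart in [loc] is zero. [N] plays the role of the codimension of the
    complement of the charts. *)
Definition detect (N : nat) (loc : R -> Prop) := forall (Z B : V -> Prop) p u,
  submod Z -> submod B -> (forall v, B v -> Z v) -> graded g Z -> graded g B ->
  pdc p Z B -> (p < N)%N -> Z u ->
  (forall De, loc De -> exists a, B (De ^+ a *: u)) -> B u.
Hypothesis detect_t : detect c (fun De => exists rho, dual enumt De rho).

Let mem_e k : k \in enumt. Proof. by rewrite mem_enum. Qed.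
Let uniq_e : uniq enumt. Proof. exact: enum_uniq. Qed.
Let sumE (G : 'I_t -> V) : \sum_(k <- enumt) G k = \sum_k G k.
Proof. by rewrite big_enum. Qed.

Lemma graded_pc q i j : graded g (pc q i j).
Proof.
move=> e u h A; rewrite ffunE; split=> [/(h A).1 hA m|/(h A).2->]; last by rewrite gP_0.
rewrite mcoeff_gP; have [u0|/hA//] := eqVneq (u A)@_m 0.
by rewrite u0 gpi0 if_same eqxx.
Qed.
Lemma graded_0 : graded g (fun u : V => u = 0).
Proof. by move=> e u ->; exact: (gpi0 g). Qed.
Lemma graded_D va Z B : (forall k, w (va k) = wx k) -> graded g Z -> graded g B ->
  graded g (imP (D X va) Z B).
Proof.
move=> wv gZ gB e v [u zu bu]; exists (g e u); first exact: gZ.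
rewrite -(gV_D_comm gR homX wxE e u wv) -(gpiB g); exact: gB.
Qed.

Definition imD q i j : V -> Prop := imP Dy (pc q i j) zeroP.
Lemma submod_imD q i j : submod (imD q i j).
Proof. by apply: submod_im; [exact: spc|exact: submod00]. Qed.
Lemma imDP q i j u : pc q i j u -> imD q i j (Dy u).
Proof. by move=> h; exists u => //; rewrite subrr. Qed.
Lemma imDE q i j v : imD q i j v -> exists2 u, pc q i j u & v = Dy u.
Proof. by move=> [u h /eqP]; rewrite subr_eq0 => /eqP->; exists u. Qed.
Lemma imD_pc q i j v : imD q i.+1 j v -> pc q.+1 i j v.
Proof. by move=> /imDE[u hu ->]; exact: pc_Dy. Qed.
Lemma graded_imD q i j : graded g (imD q i j).
Proof. by apply: graded_D; [exact: wy|exact: graded_pc|exact: graded_0]. Qed.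

Lemma eulerV_y q i j v : pc q i j v ->
  \sum_k fm (mulX (yv k)) (fm (derX (yv k)) v) = i%:R *: v.
Proof.
move=> h; apply/ffunP => A; rewrite ffunE sum_ffunE; under eq_bigr do rewrite !ffunE.
have [/(h A).1/euler_y//|/eqP/(h A).2->] := eqVneq #|A|.+1 q.
by rewrite scaler0 big1 // => k _; rewrite !linear0.
Qed.
Lemma eulerV_z q i j v : pc q i j.+1 v ->
  \sum_k fm (mulX (zv k)) (fm (derX (zv k)) v) = j%:R *: v.
Proof.
move=> h; apply/ffunP => A; rewrite ffunE sum_ffunE; under eq_bigr do rewrite !ffunE.
have [/(h A).1/euler_z//|/eqP/(h A).2->] := eqVneq #|A|.+1 q.
by rewrite scaler0 big1 // => k _; rewrite !linear0.
Qed.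

(** On cocycles [DH] becomes T + (i + 1) De by Euler's formula. The positive y-degree makes the
    constant positive, as [eigen_kill] demands. *)
Lemma homotopy_y De rho q i j v : dual enumt De rho -> pc q.+1 i.+1 j v -> Dy v = 0 ->
  \sum_(k <- enumt) Nop P X rho k v + (i.+1%:R * De) *: v = Dy (Hy rho enumt v).
Proof.
move=> du h d0; have inj : injective (@yv t) := @lshift_inj t t.
have := DH X rho enumt v inj; rewrite d0 linear0 addr0 => ->; congr (_ + _).
rewrite mulrC -scalerA -(eulerV_y h) sumE scaler_sumr; apply: eq_bigr => k _.
rewrite (bigD1 k) //= du // eqxx mul1r big1 ?addr0 // => l nlk.
by rewrite du // eq_sym (negbTE nlk) mul0r scale0r.
Qed.

Lemma pc_Nop rho k q i j v : pc q.+1 i j v -> pc q.+1 i j (Nop P X rho k v).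
Proof. by move=> h; rewrite /Nop /=; apply: pc_om; exact: pc_ctrv. Qed.

Lemma local_y De rho q i j v : dual enumt De rho -> pc q.+1 i.+1 j v -> Dy v = 0 ->
  exists a, imD q i.+2 j (De ^+ a *: v).
Proof.
move=> du h d0.
have NC k l u : Nop P X rho k (Nop P X rho l u) = Nop P X rho l (Nop P X rho k u).
  exact: (Nop_comm du).
have Nsq k u : Nop P X rho k (Nop P X rho k u) = De *: Nop P X rho k u.
  exact: (Nop_sq (unit2 natU) du).
pose Zc v := pc q.+1 i.+1 j v /\ Dy v = 0.
have sZ : submod Zc by exact: (submodI spc (submod_ker Dy (submod00 _))).
have hT u : Zc u -> pc q.+1 i.+1 j (\sum_(k <- enumt) Nop P X rho k u).
  by move=> [hu _]; apply: (submod_sum spc) => k _; exact: pc_Nop.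
refine (eigen_kill NC Nsq (r := enumt) (i := i.+1) natU sZ (submod_imD q i.+2 j) _ _ _ (conj h d0)) => //.
- move=> u zu; split; first exact: hT.
  have := homotopy_y du zu.1 zu.2 => /(congr1 Dy).
  rewrite (DD X natU) linearD linearZ /= zu.2 scaler0 addr0 //.
- move=> u zu; rewrite (homotopy_y du zu.1 zu.2); apply: imDP; exact: pc_Hy zu.1.
Qed.

Lemma exact_y q i j v : (q < c)%N -> pdc q (pc q.+1 i.+1 j) (imD q i.+2 j) ->
  pc q.+1 i.+1 j v -> Dy v = 0 -> imD q i.+2 j v.
Proof.
move=> qc hp h d0; apply: (detect_t spc (submod_imD _ _ _) _ _ _ hp qc h) => //.
- exact: imD_pc.
- exact: graded_pc.
- exact: graded_imD.
- by move=> De [rho du]; exact: local_y du h d0.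
Qed.

(** The induction of the acyclicity lemma: the bound on one cokernel gives, by detection, exactness
    at that spot, and exactness gives the bound on the next cokernel. *)
Lemma pdc_coker q i j : (q <= c)%N -> pdc q (pc q.+1 i j) (imD q i.+1 j).
Proof.
elim: q i j => [|q IH] i j qc.
  apply: (veq (pdc_vtheory Xl E 0) _ _ _ _ _ _ (pdc_pc free0 s t 1 i j)) => //; try exact: spc.
  - exact: submod00.
  - move=> u _; split=> [->|/imDE[x /pc_q0-> ->]]; last by rewrite linear0.
    exact: submod0 (submod_imD _ _ _).
  - exact: submod_imD.
have qc' : (q < c)%N by [].
have h1 : pdc q (imD q.+1 i.+1 j) zeroP.
  apply: (@vmap _ _ (pdc_vtheory Xl E q) _ _ Dy (pc q.+1 i.+1 j) (imD q i.+2 j) (imD q.+1 i.+1 j)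
    zeroP spc (submod_imD _ _ _) (submod_imD _ _ _) (submod00 _)).
  - by move=> z hz; exact: imDP.
  - by move=> z [u hu hz]; exists u.
  - move=> z hz; split=> [/imDE[u _ ->]|d0]; first exact: (DD X natU).
    by apply: exact_y => //; apply: IH; lia.
  - by apply: IH; lia.
apply: (pdc_quot spc (submod_imD _ _ _) (submod00 _) _ _ _ h1).
- by move=> u ->; exact: submod0 (submod_imD _ _ _).
- by move=> u; exact: imD_pc.
- exact: (pdc_le (leq0n _) (pdc_pc free0 s t _ _ _)).
Qed.

Lemma Dy_exact q i j v : (q < c)%N -> pc q.+1 i.+1 j v -> Dy v = 0 -> imD q i.+2 j v.
Proof. by move=> qc; apply: exact_y => //; apply: pdc_coker; lia. Qed.

Lemma imD_sum q j (u : 'I_t -> V) : (forall k, pc q 0 j (u k)) -> imD q 1 j (\sum_k om X k (u k)).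
Proof.
move=> hu; rewrite -(Dy_sum X hu); apply: imDP; apply: (submod_sum spc) => k _.
by apply: pc_fm (hu k) => f; exact: pp_my.
Qed.

Lemma local_om (r : seq 'I_t) De rho q j v : uniq r -> dual r De rho -> pc q.+1 0 j v ->
  Om X r v = 0 -> imD q 1 j (De ^+ size r *: v).
Proof.
move=> ur du h o0.
have [u hu e] := Om_local du (G := fun q => pc q 0 j) (fun _ => spc)
  (fun _ _ _ => @pc_om _ _ _ _ _ _ _ _ _) (fun _ _ _ => @pc_ctrv _ _ _ _ _ _ _ _) ur (fun _ x => x) h o0.
rewrite e.
have -> : \sum_(k <- r) om X k (u k) = \sum_k om X k (if k \in r then u k else 0).
  rewrite big_uniq // big_mkcond; apply: eq_bigr => k _; case: ifP => // _.
  by rewrite linear0.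
by apply: imD_sum => k; case: ifP => // _; exact: submod0 spc.
Qed.

(** In y-degree 0 the Euler operator vanishes and the homotopy says nothing; here the charts are
    handled by [Om_local], the kernel of [eps] being that of the product of all the rows. *)
Lemma eps_exact j v : pc c 0 j v -> eps v = 0 -> imD c1 1 j v.
Proof.
move=> h e0; have hp := pdc_coker 0 j (leqnSn c1).
apply: (detect_t spc (submod_imD _ _ _) _ _ _ hp (ltnSn c1) h) => //.
- exact: imD_pc.
- exact: graded_pc.
- exact: graded_imD.
- move=> De [rho du]; exists (size enumt); apply: (local_om uniq_e du h); exact: (eps0_Om sE t0 h e0).
Qed.

Definition Ie j : P -> Prop := imP eps (pc c 0 j) zeroP.
Lemma submod_Ie j : submod (Ie j).
Proof. by apply: submod_im; [exact: spc|exact: submod00]. Qed.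
Lemma IeP j u : pc c 0 j u -> Ie j (eps u).
Proof. by move=> h; exists u => //; rewrite subrr. Qed.
Lemma IeE j f : Ie j f -> exists2 u, pc c 0 j u & f = eps u.
Proof. by move=> [u h /eqP]; rewrite subr_eq0 => /eqP->; exists u. Qed.
Lemma Ie_pp j f : Ie j f -> pp 0 j f.
Proof. by move=> /IeE[u hu ->]; exact: (pp_eps sE t0 hu). Qed.

Theorem pdc_Ie j : pdc c1 (Ie j) zeroP.
Proof.
apply: (@vmap _ _ (pdc_vtheory Xl E c1) _ _ eps (pc c 0 j) (imD c1 1 j) (Ie j)
    zeroP spc (submod_Ie _) (submod_imD _ _ _) (submod00 _)).
- by move=> z hz; exact: IeP.
- by move=> z [u hu hz]; exists u.
- move=> z hz; split=> [/imDE[u _ ->]|]; first exact: (eps_D X natU).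
  exact: eps_exact.
- exact: pdc_coker.
Qed.

Theorem pdc_A j : pdc c (pp 0 j) (Ie j).
Proof.
apply: (pdc_quot spp (submod_Ie _) (submod00 _) _ _ _ (pdc_Ie j)).
- by move=> u ->; exact: submod0 (submod_Ie _).
- exact: Ie_pp.
- exact: (pdc_le (leq0n _) (pdc_pp free0 t _ _)).
Qed.

Theorem pdc_L0 j : pdc c (pc c.+1 0 j) (imD c 1 j).
Proof. exact: pdc_coker. Qed.

Lemma Ie_fm (F : {linear P -> P}) j j' : (forall f, pp 0 j f -> pp 0 j' (F f)) ->
  forall f, Ie j f -> Ie j' (F f).
Proof.
move=> hF f /IeE[u hu ->]; rewrite -eps_fm; apply: IeP; exact: pc_fm hF hu.
Qed.

Variable pm : nat.
Hypothesis detect_1 : detect pm.+1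
  (fun De => exists k0 rho, dual (rem k0 enumt) De rho).

Lemma uniq_rem k : uniq (rem k enumt). Proof. exact: rem_uniq. Qed.
Lemma mem_rem k l : (l \in rem k enumt) = (l != k).
Proof. by rewrite mem_rem_uniq // inE mem_e andbT. Qed.

(* On the locus of a (t-1)-minor, al is generated by its k0 component. *)
Lemma al_minor k0 De rho l i j u : dual (rem k0 enumt) De rho -> l != k0 -> pc c.+1 i j u ->
  De *: al l u + (\sum_p rho l p * X k0 p) *: al k0 u = eps (ctrv (rho l) u).
Proof.
move=> du nl h; rewrite -(al_relv X sE t0 (rho l) h) (bigD1 k0) //= addrC; congr (_ + _).
rewrite (bigD1 l) //= du ?mem_rem // eqxx mul1r big1 ?addr0 // => k /andP[nk nkl].
by rewrite du ?mem_rem // eq_sym (negbTE nkl) mul0r scale0r.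
Qed.

(** If al_k0 u = eps eta, subtracting om_k0 eta makes the product of the other rows vanish, and
    these have a dual basis. *)
Lemma al_inj k0 De rho j u : dual (rem k0 enumt) De rho -> pc c.+1 0 j u ->
  Ie j (al k0 u) -> imD c 1 j (De ^+ t.-1 *: u).
Proof.
move=> du h /IeE[eta heta e].
have h2 : pc c.+1 0 j (u - om X k0 eta) by apply: (submodB spc) => //; exact: pc_om.
have o0 : Om X (rem k0 enumt) (u - om X k0 eta) = 0.
  by apply: (al0_Om sE t0 h2); rewrite linearB /= al_om e subrr.
have hb := local_om (uniq_rem k0) du h2 o0; rewrite size_rem_enumt scalerBr in hb.
apply: (submodBr (submod_imD _ _ _) _ hb).
apply: (submodZ (submod_imD _ _ _)).
have -> : om X k0 eta = \sum_k om X k (if k == k0 then eta else 0).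
  rewrite (bigD1 k0) //= eqxx big1 ?addr0 // => k /negbTE->.
  by rewrite linear0.
by apply: imD_sum => k; case: ifP => // _; exact: submod0 spc.
Qed.

(** Multiplication by al.z embeds the cokernel L0 in A[z]. On a chart al.z is a linear form in z
    times al_k0, and that form can be cancelled by differentiating in z_k0. *)
Lemma psi_inj j u : (c <= pm)%N -> pc c.+1 0 j u -> Ie j.+1 (psi u) -> imD c 1 j u.
Proof.
move=> cp h hI; have hp := pdc_L0 j.
apply: (detect_1 spc (submod_imD _ _ _) _ _ _ hp _ h) => //.
- exact: imD_pc.
- exact: graded_pc.
- exact: graded_imD.
move=> De [k0 [rho du]].
pose r l := \sum_p rho l p * X k0 p.
(* By [al_minor], De al_l is - r_l al_k0 modulo I, so that De psi(u) is this linear form times al_k0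
   u modulo I. *)
pose Lf f : P := De *: mulX (zv k0) f - \sum_(l | l != k0) r l *: mulX (zv l) f.
have LL : linear Lf.
  move=> a f f'; rewrite /Lf linearP !scalerDr !scalerA [De * a]mulrC.
  have -> : \sum_(l | l != k0) r l *: mulX (zv l) (a *: f + f') =
    a *: \sum_(l | l != k0) r l *: mulX (zv l) f + \sum_(l | l != k0) r l *: mulX (zv l) f'.
    rewrite scaler_sumr -big_split; apply: eq_bigr => l _ /=.
    by rewrite linearP scalerDr !scalerA [r l * a]mulrC.
  rewrite scalerN; abel.
pose L := mklinear LL.
have LfE f : L f = Lf f by [].
have LD f : derX (zv k0) (L f) = De *: f + L (derX (zv k0) f).
  have e1 : derX (zv k0) (De *: mulX (zv k0) f) = De *: f + De *: mulX (zv k0) (derX (zv k0) f).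
    by rewrite [derX _ (_ *: _)]linearZ /= derX_mulX eqxx scale1r scalerDr.
  have e2 : derX (zv k0) (\sum_(l | l != k0) r l *: mulX (zv l) f) =
      \sum_(l | l != k0) r l *: mulX (zv l) (derX (zv k0) f).
    rewrite [derX _ (\sum_(_ < _ | _) _)]linear_sum; apply: eq_bigr => l nl.
    by rewrite linearZ /= derX_mulX zv_inj eq_sym (negbTE nl) scale0r add0r.
  by rewrite !LfE /Lf [derX _ (_ - _)]linearB /= e1 e2 addrA.
have Lpp j' f : pp 0 j' f -> pp 0 j'.+1 (L f).
  move=> hf; rewrite LfE; apply: (submodB spp); first by apply: (submodZ spp); exact: pp_mz.
  by apply: (submod_sum spp) => l _; apply: (submodZ spp); exact: pp_mz.
have hg : pp 0 j (al k0 u) by exact: (pp_al sE t0 h).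
have hL : Ie j.+1 (L (al k0 u)).
  have e : De *: psi u = L (al k0 u) + \sum_(l | l != k0) mulX (zv l) (eps (ctrv (rho l) u)).
    rewrite LfE /Lf /psi (bigD1 k0) //= scalerDr -addrA; congr (_ + _).
    rewrite addrC -sumrB scaler_sumr; apply: eq_bigr => l nl.
    rewrite -(al_minor du nl h) -/(r l) [mulX (zv l) (_ + _)]linearD /=.
    by rewrite [mulX _ (De *: _)]linearZ [mulX _ (r l *: _)]linearZ /= addrK.
  have hS : Ie j.+1 (\sum_(l | l != k0) mulX (zv l) (eps (ctrv (rho l) u))).
    apply: (submod_sum (submod_Ie _)) => l _; apply: (Ie_fm (F := mulX (zv l))) => [f|].
      exact: pp_mz.
    by apply: IeP; exact: pc_ctrv.
  by have := submodZ (submod_Ie _) De hI; rewrite e; exact: (submodDr (submod_Ie _) hS).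
have LQ j' f : Ie j' f -> Ie j'.+1 (L f) by apply: Ie_fm => f'; exact: Lpp.
have DQ j' f : Ie j'.+1 f -> Ie j' (derX (zv k0) f).
  by apply: (Ie_fm (F := derX (zv k0))) => f'; exact: pp_dz.
have [a ha] := derivative_trick natU LD submod_Ie LQ DQ (b := 0) hg hL.
exists (t.-1 + a)%N; rewrite exprD -scalerA; apply: (al_inj du); first exact: (submodZ spc).
by rewrite linearZ.
Qed.
End Strands.

(** * The maximal minors of the matrix bordered by the column z *)

Section BorderedComplexes.
Variables (R : comUnitRingType) (s t c1 : nat) (X : 'M[R]_(t, s)).
Hypothesis natU : forall m, (m.+1%:R : R) \is a GRing.unit.
Hypotheses (sE : s = (t + c1)%N) (t0 : (0 < t)%N).
Variables (Xl : seq R) (Q : lmodType R) (E : inj_resolution Q).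
Hypothesis free0 : pdc Xl E 0 (fun _ : R^o => True) (fun u => u = 0).
Variables (homR : nat -> R -> Prop) (gR : grading homR R^o).
Variables (w : 'I_(t + t) -> nat) (we : 'I_s -> nat) (dd : 'I_t -> 'I_s -> nat) (wx : 'I_t -> nat).
Hypothesis homX : forall k j, homR (dd k j) (X k j).
Hypothesis wxE : forall k j, wx k = (dd k j + we j)%N.
Hypotheses (wy : forall k, w (yv k) = wx k) (wz : forall k, w (zv k) = wx k).
Local Notation c := c1.+1.
Local Notation P := {mpoly R[t + t]}.
Local Notation V := {ffun {set 'I_s} -> P}.
Local Notation pc := (@pc R t s).
Local Notation pp := (@pp R t).
Local Notation Dy := (D X (@yv t)).
Local Notation Dz := (D X (@zv t)).
Local Notation Hy := (H (@yv t)).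
Local Notation Hz := (H (@zv t)).
Local Notation eps := (eps X).
Local Notation psi := (psi X).
Local Notation al := (al X).
Local Notation Pz := (@Pz R s t).
Local Notation enumt := (enum 'I_t).
Local Notation g := (@Vgrading R homR gR t w s we).
Local Notation pdc := (@pdc R Xl Q E).
Local Notation zeroP := (fun u => u = 0).
Implicit Types (v : V) (f : P) (q i j : nat) (k l : 'I_t).

Local Notation dual := (dual X).
Local Notation imD := (imD X).
Local Notation Ie := (Ie c1 X).
Local Notation detect := (@detect R s t Xl Q E homR gR w we).
Hypothesis detect_t : detect c (fun De => exists rho, dual enumt De rho).
Variable pm : nat.
Hypothesis detect_1 : detect pm.+1 (fun De => exists k0 rho, dual (rem k0 enumt) De rho).
Hypothesis c_pm : (c <= pm)%N.
Local Notation sIe := (submod_Ie c1 X _).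
Local Notation simD := (submod_imD X _ _ _).

Let Dyx q i j v : (q < c)%N -> pc q.+1 i.+1 j v -> Dy v = 0 -> imD q i.+2 j v.
Proof. by move=> a1 a2 a3; eapply Dy_exact; eauto. Qed.
Let epsx j v : pc c 0 j v -> eps v = 0 -> imD c1 1 j v.
Proof. by move=> a1 a2; eapply eps_exact; eauto. Qed.
Let pdcA j : pdc c (pp 0 j) (Ie j).
Proof. by eapply pdc_A; eauto. Qed.
Let psix j u : pc c.+1 0 j u -> Ie j.+1 (psi u) -> imD c 1 j u.
Proof. by move=> a1 a2; eapply psi_inj; eauto. Qed.
Let epsD va v : eps (D X va v) = 0.
Proof. exact: eps_D. Qed.

(** The part of z-degree j - 1 of the ideal I + al.z. As index 0 stands for the zero piece, the
    truncated [j.-1] also gives the intended meaning for j = 0 and j = 1. *)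
Definition Jp j : P -> Prop := imP psi (pc c.+1 0 j.-1) (Ie j).
Lemma submod_Jp j : submod (Jp j).
Proof. by apply: submod_im; [exact: spc|exact: submod_Ie]. Qed.
Lemma Jp_Ie j f : Ie j f -> Jp j f.
Proof. by move=> h; exists 0; [exact: submod0 spc|rewrite linear0 subr0]. Qed.
Lemma Jp_psi j u : pc c.+1 0 j u -> Jp j.+1 (psi u).
Proof. by move=> h; exists u => //; rewrite subrr; exact: submod0 sIe. Qed.
Lemma JpE j f : Jp j f -> exists eta u, [/\ pc c 0 j eta, pc c.+1 0 j.-1 u & f = eps eta + psi u].
Proof.
move=> [u hu /IeE[eta heta e]]; exists eta, u; split=> //.
by rewrite -e subrK.
Qed.
Lemma Jp_pp j f : Jp j f -> pp 0 j f.
Proof.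
case: j => [|j] /JpE[eta [u [h1 h2 ->]]].
  by rewrite (pc_j0 h1) (pc_j0 h2) !linear0 addr0; exact: submod0 spp.
by apply: (submodD spp); [exact: (pp_eps sE t0 h1)|exact: (pp_psi sE t0 h2)].
Qed.

Section Cone.
Variable b : nat.
Hypothesis bc : (b <= c1)%N.
Definition Zs q i (x : V * V) := pc q i b.+2 x.1 /\ pc q.+1 i b.+1 x.2.
(** The cone of [Pz] between two strands of [Dy], of neighbouring z-degrees; its last terms map to I
    + al.z by [eps + psi]. *)
Definition Dc (x : V * V) : V * V := (Dy x.1 + Pz x.2, - Dy x.2).
Fact Dc_linear : linear Dc.
Proof.
move=> a x y; rewrite /Dc /= !linearP; congr pair.
by rewrite /= scalerDr; abel.
Qed.
HB.instance Definition _ := GRing.isLinear.Build R (V * V)%type (V * V)%type _ Dc Dc_linear.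
Lemma submod_Zs q i : submod (Zs q i).
Proof. exact: (submod_prod spc spc). Qed.
Definition Bs q i := imP Dc (Zs q i) (fun x => x = 0).
Lemma submod_Bs q i : submod (Bs q i).
Proof. by apply: submod_im; [exact: submod_Zs|exact: submod00]. Qed.
Lemma BsP q i x : Zs q i x -> Bs q i (Dc x).
Proof. by move=> h; exists x => //; rewrite subrr. Qed.
Lemma BsE q i y : Bs q i y -> exists2 x, Zs q i x & y = Dc x.
Proof. by move=> [x h /eqP]; rewrite subr_eq0 => /eqP->; exists x. Qed.
Lemma Zs_Dc q i x : Zs q i.+1 x -> Zs q.+1 i (Dc x).
Proof.
move=> [h1 h2]; split=> /=; last by apply: (submodN spc); exact: pc_Dy.
by apply: (submodD spc); [exact: pc_Dy|exact: pc_Pz].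
Qed.
Lemma DcDc x : Dc (Dc x) = 0.
Proof.
rewrite /Dc /= linearD [Pz (- _)]linearN [Dy (- _)]linearN /= !(DD X natU) PzD add0r addrN.
by congr pair; rewrite /= !oppr0.
Qed.

(** Exactness of both strands suffices: lift the second component, correct the first by [Pz] of the
    lift, then lift that. *)
Lemma cone_exact q i x : (q.+1 + i = c1)%N -> Zs q.+1 i.+1 x -> Dc x = 0 -> Bs q i.+2 x.
Proof.
case: x => e k qi [/= he hk] [e1 /eqP]; rewrite oppr_eq0 => /eqP k0.
have qc : (q.+1 < c)%N by lia.
have [k' hk' ek] := imDE (Dyx qc hk k0).
have h1 : pc q.+1 i.+1 b.+2 (e + Pz k') by apply: (submodD spc) => //; exact: pc_Pz.
have d1 : Dy (e + Pz k') = 0 by rewrite linearD /= -PzD -ek.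
have [e' he' ee] := imDE (Dyx (ltnW qc) h1 d1).
suff -> : (e, k) = Dc (e', - k') by apply: BsP; split=> //; exact: (submodN spc).
by rewrite /Dc /= [Pz (- _)]linearN [Dy (- _)]linearN /= -ee -ek opprK addrK.
Qed.

(** The cone has one term more than the bound allows. In the base case this first term, in exterior
    degree 0 and y-degree c, is split off. *)
Lemma cone_pdc q i : (q + i = c1)%N -> pdc q (Zs q.+1 i) (Bs q i.+1).
Proof.
elim: q i => [|q IH] i qi.
  have ei : i = c1 by lia.
  (* Since b <= c1 < c, the y-degree exceeds the z-degree and [Pz] has a left inverse; [r] below is
     the resulting projection, killing the image of the extra term. *)
  have [sg [sg1 sg2]] := sl2_split s t natU 1 bc.
  pose r (x : V * V) : V * V := x - Dc (0, sg x.1).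
  have rL : linear r.
    move=> a x y; rewrite /r /= linearP.
    have -> : ((0, a *: sg x.1 + sg y.1) : V * V) = a *: (0, sg x.1) + (0, sg y.1).
      by congr pair; rewrite /= ?scaler0 ?addr0.
    rewrite linearP scalerBr; abel.
  have hz x : Zs 1 i x -> Zs 0 i.+1 (0, sg x.1).
    by move=> [h1 h2]; split; [exact: submod0 spc|rewrite ei; apply: sg1; rewrite -ei].
  apply: (@vretract _ _ (pdc_vtheory Xl E 0) _ (mklinear rL) (Zs 1 i) (Bs 0 i.+1) (submod_Zs _ _) (submod_Bs _ _)).
  - move=> x h; apply: (submodB (submod_Zs _ _)) => //; apply: Zs_Dc; exact: hz.
  - move=> x /BsE[[e k] [/= /pc_q0-> hk] ->]; change (r (Dc (0, k)) = 0); rewrite /r /= linear0 add0r sg2 ?subrr //.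
    by rewrite -ei.
  - move=> x h; change (Bs 0 i.+1 (x - r x)); rewrite /r opprB addrC subrK; apply: BsP; exact: hz.
  - have := vprod (pdc_vtheory Xl E 0) spc (submod00 _) spc (submod00 _) _ _
      (pdc_pc free0 s t 1 i b.+2) (pdc_pc free0 s t 2 i b.+1).
    move=> h; apply: (veq (pdc_vtheory Xl E 0) _ _ _ _ _ _ (h _ _)) => //.
    + exact: submod_Zs.
    + exact: (submod_prod (submod00 _) (submod00 _)).
    + by move=> [x y] _; split=> [[/= -> ->]|[-> ->]].
    + exact: submod_Zs.
    + exact: submod00.
    + by move=> u ->; exact: submod0 spc.
    + by move=> u ->; exact: submod0 spc.
have h1 : pdc q (Bs q.+1 i.+1) (fun x => x = 0).
  apply: (@vmap _ _ (pdc_vtheory Xl E q) _ _ Dc (Zs q.+1 i.+1) (Bs q i.+2) (Bs q.+1 i.+1)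
    (fun x => x = 0) (submod_Zs _ _) (submod_Bs _ _) (submod_Bs _ _) (submod00 _)).
  - by move=> z hz; exact: BsP.
  - by move=> z [u hu hz]; exists u.
  - move=> z hz; split=> [/BsE[u _ ->]|d0]; first exact: DcDc.
    by apply: cone_exact => //; lia.
  - by apply: IH; lia.
apply: (pdc_quot (submod_Zs _ _) (submod_Bs _ _) (submod00 _) _ _ _ h1).
- by move=> u ->; exact: submod0 (submod_Bs _ _).
- by move=> u /BsE[x hx ->]; exact: Zs_Dc.
- apply: (pdc_le (leq0n _)).
  have h := vprod (pdc_vtheory Xl E 0) spc (submod00 _) spc (submod00 _) _ _
      (pdc_pc free0 s t q.+2 i b.+2) (pdc_pc free0 s t q.+3 i b.+1).
  apply: (veq (pdc_vtheory Xl E 0) _ _ _ _ _ _ (h _ _)) => //.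
  + exact: submod_Zs.
  + exact: (submod_prod (submod00 _) (submod00 _)).
  + by move=> [x y] _; split=> [[/= -> ->]|[-> ->]].
  + exact: submod_Zs.
  + exact: submod00.
  + by move=> u ->; exact: submod0 spc.
  + by move=> u ->; exact: submod0 spc.
Qed.

(** Exactness at the last spot combines [psi_inj], which handles the second component, with
    [eps_exact] for the corrected first one. *)
Lemma cone_Jp : pdc c1 (Jp b.+2) (fun f => f = 0).
Proof.
pose F (x : V * V) : P := eps x.1 + psi x.2.
have FL : linear F by move=> a x y; rewrite /F /= !linearP scalerDr; abel.
apply: (@vmap _ _ (pdc_vtheory Xl E c1) _ _ (mklinear FL) (Zs c1.+1 0) (Bs c1 1) (Jp b.+2)
    (fun x => x = 0) (submod_Zs _ _) (submod_Jp _) (submod_Bs _ _) (submod00 _)).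
- move=> x [h1 h2]; apply: (submodD (submod_Jp _)); last exact: Jp_psi.
  by apply: Jp_Ie; exact: IeP.
- by move=> f /JpE[eta [u [h1 h2 ->]]]; exists (eta, u) => //; exact: subrr.
- move=> [e k] [/= h1 h2]; change (Bs c1 1 (e, k) <-> eps e + psi k = 0); split.
    move=> /BsE[[e' k'] _ [-> ->]]; rewrite linearD linearN /= epsD (psi_Dy X natU) add0r subrr //.
  move=> e0; have hI : Ie b.+2 (psi k).
    have -> : psi k = eps (- e) by apply/eqP; rewrite linearN -addr_eq0 addrC e0.
    by apply: IeP; exact: (submodN spc).
  have [k' hk' ek] := imDE (psix h2 hI).
  have h3 : pc c 0 b.+2 (e + Pz k') by apply: (submodD spc) => //; exact: pc_Pz.
  have [|e' he' ee] := imDE (epsx h3 _); first by rewrite linearD /= -(psi_Dy X natU) -ek.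
  suff -> : (e, k) = Dc (e', - k') by apply: BsP; split=> //; exact: (submodN spc).
  by rewrite /Dc /= [Pz (- _)]linearN [Dy (- _)]linearN /= -ee -ek opprK addrK.
- by apply: cone_pdc; rewrite addn0.
Qed.
End Cone.

(** Bordering does not increase the dimension c of A in z-degrees below c. The degrees 0 and 1 of
    the index are the zero piece and A itself, where no cone is involved. *)
Theorem pdc_BB j : (j <= c)%N -> pdc c (pp 0 j) (Jp j).
Proof.
case: j => [|[|b]] hj.
- apply: (vtriv (pdc_vtheory Xl E c) spp (submod_Jp _)) => f /pp0->; exact: submod0 (submod_Jp _).
- apply: (veq (pdc_vtheory Xl E c) spp sIe _ _ spp (submod_Jp _) (pdcA 1)) => // f _; split.
    exact: Jp_Ie.
  by move=> [u /pc_j0->]; rewrite linear0 subr0.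
have bc : (b <= c1)%N by lia.
apply: (pdc_quot spp (submod_Jp _) (submod00 _) _ _ _ (cone_Jp bc)).
- by move=> u ->; exact: submod0 (submod_Jp _).
- exact: Jp_pp.
- exact: (pdc_le (leq0n _) (pdc_pp free0 t _ _)).
Qed.
End BorderedComplexes.

(** * The conormal module *)

Section ConormalResolution.
Variables (R : comUnitRingType) (s t c1 : nat) (X : 'M[R]_(t, s)).
Hypothesis natU : forall m, (m.+1%:R : R) \is a GRing.unit.
Hypotheses (sE : s = (t + c1)%N) (t0 : (0 < t)%N).
Variables (Xl : seq R) (Q : lmodType R) (E : inj_resolution Q).
Hypothesis free0 : pdc Xl E 0 (fun _ : R^o => True) (fun u => u = 0).
Variables (homR : nat -> R -> Prop) (gR : grading homR R^o).
Variables (w : 'I_(t + t) -> nat) (we : 'I_s -> nat) (dd : 'I_t -> 'I_s -> nat) (wx : 'I_t -> nat).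
Hypothesis homX : forall k j, homR (dd k j) (X k j).
Hypothesis wxE : forall k j, wx k = (dd k j + we j)%N.
Hypotheses (wy : forall k, w (yv k) = wx k) (wz : forall k, w (zv k) = wx k).
Local Notation c := c1.+1.
Local Notation P := {mpoly R[t + t]}.
Local Notation V := {ffun {set 'I_s} -> P}.
Local Notation pc := (@pc R t s).
Local Notation pp := (@pp R t).
Local Notation Dy := (D X (@yv t)).
Local Notation Dz := (D X (@zv t)).
Local Notation Hy := (H (@yv t)).
Local Notation Hz := (H (@zv t)).
Local Notation eps := (eps X).
Local Notation psi := (psi X).
Local Notation al := (al X).
Local Notation Pz := (@Pz R s t).
Local Notation enumt := (enum 'I_t).
Local Notation g := (@Vgrading R homR gR t w s we).
Local Notation pdc := (@pdc R Xl Q E).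
Local Notation zeroP := (fun u => u = 0).
Implicit Types (v : V) (f : P) (q i j : nat) (k l : 'I_t).

Local Notation dual := (dual X).
Local Notation imD := (imD X).
Local Notation Ie := (Ie c1 X).
Local Notation detect := (@detect R s t Xl Q E homR gR w we).
Hypothesis detect_t : detect c (fun De => exists rho, dual enumt De rho).
Variable pm : nat.
Hypothesis detect_1 : detect pm.+1 (fun De => exists k0 rho, dual (rem k0 enumt) De rho).
Hypothesis c_pm : (c <= pm)%N.
Local Notation sIe := (submod_Ie c1 X _).
Local Notation simD := (submod_imD X _ _ _).

Let Dyx q i j v : (q < c)%N -> pc q.+1 i.+1 j v -> Dy v = 0 -> imD q i.+2 j v.
Proof. by move=> a1 a2 a3; eapply Dy_exact; eauto. Qed.
Let epsx j v : pc c 0 j v -> eps v = 0 -> imD c1 1 j v.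
Proof. by move=> a1 a2; eapply eps_exact; eauto. Qed.
Let pdcA j : pdc c (pp 0 j) (Ie j).
Proof. by eapply pdc_A; eauto. Qed.
Let psix j u : pc c.+1 0 j u -> Ie j.+1 (psi u) -> imD c 1 j u.
Proof. by move=> a1 a2; eapply psi_inj; eauto. Qed.
Let epsD va v : eps (D X va v) = 0.
Proof. exact: eps_D. Qed.

Local Notation Jp := (Jp c1 X).
Local Notation sJp := (submod_Jp c1 X _).
Let BBx j : (j <= c)%N -> pdc c (pp 0 j) (Jp j).
Proof. by move=> a1; eapply pdc_BB; eauto. Qed.

(** [eps] and [psi] are top components of homogeneous operators, so homogeneity is visible first for
    the shift by the degree of the top form; [graded_Jp] removes it. *)
Lemma graded_Jp_top j e f : Jp j f -> Jp j (gP gR w (wA we [set: 'I_s]) e f).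
Proof.
move=> /JpE[eta [u [h1 h2 ->]]].
have et v : (gV gR w we e v) setT = gP gR w (wA we setT) e (v setT) by rewrite ffunE.
pose W := (\sum_k wx k)%N.
have e1 : gP gR w (wA we setT) e (eps eta) = eps (if (W <= e)%N then gV gR w we (e - W) eta else 0).
  rewrite /Submission.eps -et (gV_Om gR _ homX wxE) big_enum /= -/W; case: ifP => // _.
  by rewrite linear0.
have e2 : gP gR w (wA we setT) e (psi u) = psi (if (W <= e)%N then gV gR w we (e - W) u else 0).
  have -> : psi u = (\sum_k fm (mulX (zv k)) (Al X enumt k u) : V) setT.
    by rewrite sum_ffunE /Submission.psi; apply: eq_bigr => k _; rewrite ffunE.
  rewrite -et gV_sum' sum_ffunE /Submission.psi; apply: eq_bigr => k _.
  pose Sk := (\sum_(l <- rem k enumt) wx l)%N.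
  have eW : W = (wx k + Sk)%N.
    rewrite /W /Sk (bigD1 k) //=; congr addn; rewrite big_uniq ?rem_uniq ?enum_uniq //=.
    by apply: eq_bigl => l; rewrite mem_rem_uniq ?enum_uniq // inE mem_enum andbT.
  have eAl e' : gV gR w we e' (Al X enumt k u) =
      if (Sk <= e')%N then Al X enumt k (gV gR w we (e' - Sk) u) else 0.
    by rewrite (gV_Al gR _ homX wxE) ?enum_uniq ?mem_enum.
  rewrite eW; clearbody Sk; rewrite gV_mulX wz; case: leqP => h; last first.
    by rewrite ffunE ifF ?linear0 //; lia.
  rewrite ffunE eAl; case: leqP => h'.
    by rewrite ifT; [rewrite /Submission.al subnDA|lia].
  by rewrite ffunE ifF ?linear0 //; lia.
rewrite gP_D e1 e2; apply: (submodD sJp).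
  apply: Jp_Ie; apply: IeP; case: ifP => _; last exact: submod0 spc.
  exact: graded_pc.
case: j h2 {h1 e1 e2} => [|j] h2; last first.
  by apply: Jp_psi; case: ifP => _; [exact: graded_pc|exact: submod0 spc].
have -> : u = 0 by exact: (pc_j0 h2).
have g0 n : gV gR w we n (0 : V) = 0 by exact: (gpi0 g n).
by rewrite g0 if_same linear0; exact: submod0 sJp.
Qed.
Lemma graded_Jp j sh e f : Jp j f -> Jp j (gP gR w sh e f).
Proof.
move=> h; rewrite gP_sh; case: ifP => _; last exact: submod0 sJp.
have := graded_Jp_top (e - sh + wA we setT) h; rewrite gP_sh leq_addl addnK //.
Qed.

Definition Jb q j : V -> Prop := fq q (Jp j).
Lemma submod_Jb q j : submod (Jb q j). Proof. exact: (@submod_fq R s P q (Jp j) (submod_Jp c1 X j)). Qed.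
Local Notation sJb := (submod_Jb _ _).
Lemma Jb_pc q j v : Jb q j v -> pc q 0 j v.
Proof.
move=> h A; split=> [/(h A).1|/(h A).2//]; exact: (Jp_pp sE t0).
Qed.
Lemma graded_Jb q j : graded g (Jb q j).
Proof.
move=> e u h A; rewrite ffunE; split=> [/(h A).1|/(h A).2->]; last by rewrite gP_0.
exact: graded_Jp.
Qed.

Lemma Jp_mulz j k f : Jp j f -> Jp j.+1 (mulX (zv k) f).
Proof.
move=> /JpE[eta [u [h1 h2 ->]]]; rewrite linearD /= -eps_fm -psi_fm; last by move=> *; exact: mulXC.
apply: (submodD sJp); first by apply: Jp_Ie; apply: IeP; apply: pc_fm h1 => f'; exact: pp_mz.
apply: Jp_psi; case: j h2 {h1} => [|j] h2; last by apply: pc_fm h2 => f'; exact: pp_mz.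
by rewrite (pc_j0 h2) linear0; exact: submod0 spc.
Qed.

(** The coefficient of e_p in [Dz]: Dz is the sum over p of e_p wedge this derivation, so stability
    of I + al.z under it makes [Dz] act on forms modulo I + al.z. *)
Definition Gop p f : P := \sum_k X k p *: derX (zv k) f.
Fact Gop_linear p : linear (Gop p).
Proof.
move=> a f f'; rewrite /Gop scaler_sumr -big_split; apply: eq_bigr => k _ /=.
by rewrite linearP scalerDr !scalerA mulrC.
Qed.
HB.instance Definition _ p := GRing.isLinear.Build R P P _ (Gop p) (@Gop_linear p).
Lemma pp_Gop p j f : pp 0 j.+1 f -> pp 0 j (Gop p f).
Proof.
by move=> h; apply: (submod_sum spp) => k _; apply: (submodZ spp); exact: pp_dz.
Qed.

(* d(al.z) = al, and the al_k satisfy the relations of the rows of X modulo I. *)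
Lemma Jp_Gop p j f : Jp j.+1 f -> Jp j (Gop p f).
Proof.
move=> /JpE[eta [u [h1 /= h2 ->]]]; rewrite linearD; apply: (submodD sJp).
  by rewrite -eps_fm; apply: Jp_Ie; apply: IeP; apply: pc_fm h1 => f'; exact: pp_Gop.
have e : Gop p (psi u) = eps (ctr p u) + psi (fm (Gop p) u).
  have -> : psi (fm (Gop p) u) = \sum_k X k p *: psi (fm (derX (zv k)) u).
    have -> : fm (Gop p) u = \sum_k X k p *: fm (derX (zv k)) u.
      by apply/ffunP => A; rewrite ffunE sum_ffunE /Gop; apply: eq_bigr => k _; rewrite !ffunE.
    by rewrite linear_sum; apply: eq_bigr => k _; rewrite linearZ.
  rewrite -(al_rel X sE t0 p h2) [LHS]/Gop.
  rewrite -big_split; apply: eq_bigr => k _ /=; rewrite -scalerDr; congr (_ *: _).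
  rewrite {1}/Submission.psi linear_sum /=.
  have -> : al k u = \sum_l (k == l)%:R *: al l u.
    rewrite (bigD1 k) //= eqxx scale1r big1 ?addr0 // => l; rewrite eq_sym => /negbTE->.
    by rewrite scale0r.
  rewrite /Submission.psi -big_split; apply: eq_bigr => l _ /=.
  by rewrite derX_mulX zv_inj al_fm.
change (Jp j (Gop p (psi u))); rewrite e; apply: (submodD sJp).
  by apply: Jp_Ie; apply: IeP; exact: pc_ctr.
case: j h2 {h1 e} => [|j] h2; last by apply: Jp_psi; apply: pc_fm h2 => f'; exact: pp_Gop.
have -> : fm (Gop p) u = 0 by rewrite (pc_j0 h2) linear0.
by rewrite linear0; exact: submod0 sJp.
Qed.

Lemma Jb_Dz q j v : Jb q j.+1 v -> Jb q.+1 j (Dz v).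
Proof.
move=> h; have -> : Dz v = \sum_p ext p (fm (Gop p) v).
  rewrite /D /om /extv exchange_big; apply: eq_bigr => p _ /=.
  have -> : fm (Gop p) v = \sum_k X k p *: fm (derX (zv k)) v.
    by apply/ffunP => A; rewrite ffunE sum_ffunE /Gop; apply: eq_bigr => k _; rewrite !ffunE.
  by rewrite linear_sum; apply: eq_bigr => k _; rewrite linearZ.
apply: (submod_sum sJb) => p _; apply: fq_ext; first exact: submod_Jp.
by apply: fq_fm h => f; exact: Jp_Gop.
Qed.
Lemma Jb_Hz rho r q j v : Jb q.+1 j v -> Jb q j.+1 (Hz rho r v).
Proof.
move=> h; rewrite /H; apply: (submod_sum sJb) => k _; apply: fq_ctrv; first exact: submod_Jp.
by apply: fq_fm h => f; exact: Jp_mulz.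
Qed.

Section Minor.
Variables (k0 : 'I_t) (De : R) (rho : 'I_t -> 'I_s -> R).
Hypothesis du : dual (rem k0 enumt) De rho.
Local Notation r0 := (rem k0 enumt).
Local Notation de := (De ^+ t.-1).
Let r l := \sum_p rho l p * X k0 p.

Definition topv f : V := [ffun A => if A == setT then f else 0].
Lemma pc_topv i j f : pp i j f -> pc s.+1 i j (topv f).
Proof.
move=> h A; rewrite ffunE; case: eqP => [->|nA]; first by rewrite cardsT card_ord.
split=> // _; exact: submod0 spp.
Qed.
Lemma topv_om l f : om X l (topv f) = 0.
Proof.
apply/ffunP => A; rewrite ffunE /om /extv sum_ffunE big1 // => j _; rewrite !ffunE.
case: ifP => jA; last by rewrite scaler0.
case: eqP => [e|_]; last by rewrite !scaler0.
by have := setD11 j A; rewrite e inE.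
Qed.

(** Contract the top form with the dual basis; by [Om_Ict] this inverts the product of the rows
    other than k0 up to a sign and De^(t-1). The sign is absorbed in [lam]. *)
Lemma al_unit : exists lam : P -> V, (forall j f, pp 0 j f -> pc c.+1 0 j (lam f)) /\
  (forall f, al k0 (lam f) = de *: f).
Proof.
have ur : uniq r0 by apply: rem_uniq; exact: enum_uniq.
have [b0 hb0] := Al_Om P X (enum_uniq 'I_t) (mem_enum 'I_t k0 : k0 \in enumt = true).
pose lam f := Ict rho r0 (topv f).
have hI f : exists b : bool, Om X r0 (lam f) = ((-1) ^+ b * De ^+ size r0) *: topv f.
  by apply: (Om_Ict du) => // l _; exact: topv_om.
have hs f : exists e : R, e * e = 1 /\ al k0 (lam f) = e *: (de *: f).
  have [b hb] := hI f; exists ((-1) ^+ b0 * (-1) ^+ b); split.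
    by rewrite mulrACA -!expr2 !sqrr_sign mulr1.
  by rewrite /Submission.al hb0 hb size_rem_enumt !ffunE eqxx !scalerA mulrA.
have [ee hee] := boolp.choice hs.
exists (fun f => ee f *: lam f); split=> [j f hf|f].
  apply: (submodZ spc); have : pc (size r0 + c.+1) 0 j (topv f).
    by rewrite size_rem_enumt; have -> : (t.-1 + c.+1 = s.+1)%N by [rewrite sE; lia]; exact: pc_topv.
  rewrite /lam; elim: (r0) (c.+1) (topv f) => //= l q IH n v hv; apply: pc_ctrv; apply: IH.
  by rewrite addnS.
by rewrite -[RHS]scale1r -(hee f).1 -scalerA -(hee f).2 linearZ.
Qed.
(** Applying al.z to the element [lam f] shows that, on a chart, the ideal I + al.z contains a
    linear form expressing z_k0 through the other z_l. *)
Lemma J_minor j f : pp 0 j f ->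
  Jp j.+1 (de *: (De *: mulX (zv k0) f - \sum_(l | l != k0) r l *: mulX (zv l) f)).
Proof.
have [lam [hlam alam]] := al_unit; move=> hf; have hl := hlam _ _ hf.
have -> : de *: (De *: mulX (zv k0) f - \sum_(l | l != k0) r l *: mulX (zv l) f) =
    De *: psi (lam f) - \sum_(l | l != k0) mulX (zv l) (eps (ctrv (rho l) (lam f))).
  have e l : l != k0 -> mulX (zv l) (eps (ctrv (rho l) (lam f))) =
      De *: mulX (zv l) (al l (lam f)) + (de * r l) *: mulX (zv l) f.
    move=> nl; rewrite -(al_minor sE t0 du nl hl) alam -/(r l) [mulX (zv l) (_ + _)]linearD /=.
    by rewrite !scalerA [mulX _ (De *: _)]linearZ [mulX _ ((_ * _) *: f)]linearZ /= [r l * _]mulrC.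
  have -> : psi (lam f) = mulX (zv k0) (de *: f) + \sum_(l | l != k0) mulX (zv l) (al l (lam f)).
    by rewrite /Submission.psi (bigD1 k0) //= alam.
  rewrite (eq_bigr _ e) big_split /= -scaler_sumr.
  have e3 : de *: \sum_(l | l != k0) r l *: mulX (zv l) f = \sum_(l | l != k0) (de * r l) *: mulX (zv l) f.
    by rewrite scaler_sumr; apply: eq_bigr => l _; rewrite scalerA.
  by rewrite [LHS]scalerBr e3 [mulX _ (de *: f)]linearZ /= [De *: (_ + _)]scalerDr !scalerA [De * de]mulrC; abel.
apply: (submodB sJp); first by apply: (submodZ sJp); exact: Jp_psi.
apply: (submod_sum sJp) => l _; apply: Jp_mulz; apply: Jp_Ie; apply: IeP; exact: pc_ctrv.
Qed.

(** Scaling by De^(t-1) absorbs the factor of [J_minor], and the value 0 at k0 makes the operators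
    N'_k commute for all rows, not only for those of the minor. *)
Let rho' l : 'I_s -> R := fun p => if l == k0 then 0 else de * rho l p.
Let De' := de * De.
Let du' : dual r0 De' rho'.
Proof.
move=> k l kr lr; have nk : k != k0 by move: kr; rewrite mem_rem_uniq ?enum_uniq // inE => /andP[].
rewrite /rho' (negbTE nk); under eq_bigr do rewrite -mulrA.
by rewrite -mulr_sumr du // /De'; ring.
Qed.
Let cr0 v : ctrv (rho' k0) v = 0.
Proof. by rewrite /ctrv big1 // => p _; rewrite /rho' eqxx scale0r. Qed.
Let N' := Nop P X rho'.
Let N'0 v : N' k0 v = 0. Proof. by rewrite /N' /= cr0 linear0. Qed.
Let N'z k : N' k 0 = 0. Proof. exact: (linear0 (Nop P X rho' k)). Qed.
Let memr k : k != k0 -> k \in r0.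
Proof. by move=> nk; rewrite mem_rem_uniq ?enum_uniq // inE nk mem_enum. Qed.
Let N'C k l v : N' k (N' l v) = N' l (N' k v).
Proof.
have [->|nk] := eqVneq k k0; first by rewrite (N'0 v) (N'0 (N' l v)) N'z.
have [->|nl] := eqVneq l k0; first by rewrite (N'0 v) (N'0 (N' k v)) N'z.
exact: (Nop_comm du' v (memr nk) (memr nl)).
Qed.
Let N'sq k v : N' k (N' k v) = De' *: N' k v.
Proof.
have [->|nk] := eqVneq k k0; first by rewrite !N'0 scaler0.
exact: (Nop_sq (unit2 natU) du' v (memr nk)).
Qed.

(** In [DH] the row k0 contributes cross terms; they regroup as multiples of the linear form of
    [J_minor], hence vanish modulo I + al.z and leave the Euler operator. *)
Lemma homotopy_z q j v : pc q.+1 0 j.+2 v ->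
  Jb q.+1 j.+2 (Dz (Hz rho' r0 v) + Hz rho' r0 (Dz v) -
     (\sum_(k <- r0) N' k v + (j.+1%:R * De') *: v)).
Proof.
move=> h; have inj : injective (@zv t) := @rshift_inj t t.
have eA : \sum_(k <- r0) om X k (ctrv (rho' k) v) = \sum_(k <- r0) N' k v by [].
rewrite (DH X rho' r0 v inj) eA opprD addrACA subrr add0r mulrC -scalerA -(eulerV_z h).
have sumr (G : 'I_t -> V) : \sum_(k <- r0) G k = \sum_(k | k != k0) G k.
  rewrite big_uniq ?rem_uniq ?enum_uniq //; apply: eq_bigl => k.
  by rewrite mem_rem_uniq ?enum_uniq // inE mem_enum andbT.
rewrite sumr scaler_sumr [X in _ - X](bigD1 k0) //= opprD addrCA -sumrB.
pose f A := derX (zv k0) (v A).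
have -> : - (De' *: fm (mulX (zv k0)) (fm (derX (zv k0)) v)) +
  \sum_(k | k != k0) (\sum_l (\sum_p rho' k p * X l p) *: fm (mulX (zv k)) (fm (derX (zv l)) v) -
     De' *: fm (mulX (zv k)) (fm (derX (zv k)) v)) =
  \sum_(k | k != k0) (de * r k) *: fm (mulX (zv k)) (fm (derX (zv k0)) v) -
    De' *: fm (mulX (zv k0)) (fm (derX (zv k0)) v).
  rewrite addrC; congr (_ - _); apply: eq_bigr => k nk.
  rewrite (bigD1 k) //= du' ?memr // eqxx mul1r addrAC subrr add0r.
  rewrite (bigD1 k0) //=; last by rewrite eq_sym.
  have -> : \sum_p rho' k p * X k0 p = de * r k.
    by rewrite /rho' (negbTE nk) /r mulr_sumr; apply: eq_bigr => p _; rewrite mulrA.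
  rewrite big1 ?addr0 // => l /andP[nlk nl].
  by rewrite du' ?memr // eq_sym (negbTE nlk) mul0r scale0r.
set U := (_ - _).
pose F A := - (de *: (De *: mulX (zv k0) (f A) - \sum_(l | l != k0) r l *: mulX (zv l) (f A))).
have eU A : U A = F A.
  rewrite /F scalerBr opprB scaler_sumr scalerA /U ffunE sum_ffunE; congr (_ + _); last by rewrite !ffunE.
  by apply: eq_bigr => k _; rewrite !ffunE scalerA.
move=> A; rewrite eU /F.
split=> [e|ne]; first by apply: (submodN sJp); apply: J_minor; apply: pp_dz; exact: (h A).1.
have f0 : f A = 0 by rewrite /f (h A).2 // linear0.
rewrite f0 [mulX _ 0]linear0 scaler0 big1 ?subr0 ?scaler0 ?oppr0 // => l _.
by rewrite [mulX _ 0]linear0 scaler0.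
Qed.

Let DzB u v : Dz (u - v) = Dz u - Dz v. Proof. exact: linearB. Qed.
Let DzD u v : Dz (u + v) = Dz u + Dz v. Proof. exact: linearD. Qed.
Let DzZ a u : Dz (a *: u) = a *: Dz u. Proof. exact: linearZ. Qed.
(** The same eigenvalue argument as for y, now for cocycles modulo I + al.z. *)
Lemma local_z q j v : pc q.+1 0 j.+2 v -> Jb q.+2 j.+1 (Dz v) ->
  exists a, imP Dz (pc q 0 j.+3) (Jb q.+1 j.+2) (De ^+ a *: v).
Proof.
move=> h hd; pose Zc u := pc q.+1 0 j.+2 u /\ Jb q.+2 j.+1 (Dz u).
pose B := imP Dz (pc q 0 j.+3) (Jb q.+1 j.+2).
have sB : submod B by apply: submod_im; [exact: spc|exact: submod_Jb].
have sZ : submod Zc by exact: (submodI spc (submod_ker Dz (submod_Jb _ _))).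
pose T u := \sum_(k <- r0) N' k u.
have hT u : Zc u -> pc q.+1 0 j.+2 (T u).
  by move=> [hu _]; apply: (submod_sum spc) => k _; exact: pc_Nop.
have hZ u : Zc u -> Zc (T u).
  move=> zu; split; first exact: hT.
  have h1 := Jb_Dz (homotopy_z zu.1); rewrite -/(T u) in h1.
  have gen (T1 a b : V) (cc : R) : Dz T1 = Dz a - cc *: Dz u - Dz (Dz b + a - (T1 + cc *: u)).
    rewrite (DzB (Dz b + a)) (DzD (Dz b)) (DzD T1) (DzZ cc u) (DD X natU).
    by move: (Dz T1) (Dz a) (cc *: Dz u) => x y z; abel.
  have e := gen (T u) (Hz rho' r0 (Dz u)) (Hz rho' r0 u) (j.+1%:R * De').
  rewrite e; apply: (submodB (submod_Jb _ _)) h1; apply: (submodB (submod_Jb _ _)).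
    by apply: Jb_Dz; apply: Jb_Hz; exact: zu.2.
  by apply: (submodZ (submod_Jb _ _)); exact: zu.2.
have hB u : Zc u -> B (T u + (j.+1%:R * De') *: u).
  move=> zu; exists (Hz rho' r0 u); first by apply: pc_Hz; exact: zu.1.
  have h1 := homotopy_z zu.1; have h2 := Jb_Hz rho' r0 zu.2; rewrite -/(T u) in h1.
  have -> : T u + (j.+1%:R * De') *: u - Dz (Hz rho' r0 u) = Hz rho' r0 (Dz u) -
      (Dz (Hz rho' r0 u) + Hz rho' r0 (Dz u) - (T u + (j.+1%:R * De') *: u)) by abel.
  exact: (submodB (submod_Jb _ _) h2 h1).
have [a ha] : exists a, B (De' ^+ a *: v) := eigen_kill N'C N'sq (r := r0) (i := j.+1) natU sZ sB hZ isT hB (conj h hd).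
(* De' is De^(t-1) times De. *)
exists (t * a)%N; move: ha; rewrite /De' -exprSr prednK // exprM //.
Qed.
End Minor.

Definition Bz q j := imP Dz (pc q 0 j.+1) (Jb q.+1 j).
Lemma submod_Bz q j : submod (Bz q j).
Proof. by apply: submod_im; [exact: spc|exact: submod_Jb]. Qed.
Lemma Jb_Bz q j v : Jb q.+1 j v -> Bz q j v.
Proof. by move=> h; exists 0; [exact: submod0 spc|rewrite linear0 subr0]. Qed.
Lemma Bz_pc q j v : Bz q j v -> pc q.+1 0 j v.
Proof.
move=> [u hu /Jb_pc hv]; apply: (submodBr spc) hv; exact: pc_Dz.
Qed.
Lemma pdc_Jb q j : (j <= c)%N -> pdc c (pc q 0 j) (Jb q j).
Proof. by move=> hj; exact: (pdc_fq s spp (submod_Jp _ _ _) (fun f => @Jp_pp R s t c1 X sE t0 j f) q (BBx hj)). Qed.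

(** Along the complex of [Dz] exterior degree plus z-degree is c - 1. Its terms have dimension at
    most c, and each of the q arrows adds one. Detection is applied up to dimension 2c - 2, whence
    the condition on [pm]. *)
Lemma pdc_Bz q j : (q + j.+1 = c)%N -> (2 * c <= pm.+2)%N -> pdc (c + q) (pc q.+1 0 j.+1) (Bz q j.+1).
Proof.
elim: q j => [|q IH] j qj hpm.
  apply: (@veq _ _ (pdc_vtheory Xl E (c + 0)) _ (pc 1 0 j.+1) (Jb 1 j.+1) _ _ spc (submod_Jb _ _) _ _ spc (submod_Bz _ _)) => //.
  - move=> u _; split; first exact: Jb_Bz.
    by move=> [x /pc_q0->]; rewrite linear0 subr0.
  - by rewrite addn0; apply: pdc_Jb; lia.
have h0 := IH j.+1 ltac:(lia) hpm.
have h1 : pdc (c + q) (imP Dz (pc q.+1 0 j.+2) (Jb q.+2 j.+1)) (Jb q.+2 j.+1).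
  apply: (@vmap _ _ (pdc_vtheory Xl E (c + q)) _ _ Dz (pc q.+1 0 j.+2) (Bz q j.+2) _ _
     spc (submod_Bz _ _) (submod_Bz _ _) (submod_Jb _ _)).
  - by move=> z hz; exists z => //; rewrite subrr; exact: submod0 (submod_Jb _ _).
  - by move=> z [u hu hz]; exists u.
  - move=> z hz; split=> [[u hu hv]|hd].
      have := Jb_Dz hv; rewrite (linearB Dz) /= (DD X natU) subr0 //.
    apply: (detect_1 spc (submod_Bz _ _) _ _ _ h0 _ hz) => //.
    + exact: Bz_pc.
    + exact: graded_pc.
    + by apply: graded_D => //; [exact: graded_pc|exact: graded_Jb].
    + by lia.
    + by move=> De [k0 [rho du]]; exact: (local_z du hz hd).
  - exact: h0.
rewrite addnS; apply: (pdc_quot spc (submod_Bz _ _) (submod_Jb _ _) _ _ _ h1).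
- exact: Jb_Bz.
- exact: Bz_pc.
- by apply: (pdc_le _ (pdc_Jb _ _)); lia.
Qed.

Lemma Dz_sum q j (u : 'I_t -> V) : (forall k, pc q j 1 (u k)) -> imP Dz (pc q j 2) (fun v => v = 0) (\sum_k om X k (u k)).
Proof.
move=> hu; exists (\sum_k fm (mulX (zv k)) (u k)).
  by apply: (submod_sum spc) => k _; apply: pc_fm (hu k) => f; exact: pp_mz.
have dz0 l k : fm (derX (zv l)) (u k) = 0.
  by apply: (@pc_j0 _ _ _ q j); apply: pc_fm (hu k) => f; exact: pp_dz.
apply/eqP; rewrite subr_eq0; apply/eqP; rewrite /D; apply: eq_bigr => l _; congr (om X l _).
rewrite [fm _ (\sum_(_ < _) _)]linear_sum (bigD1 l) //= big1 ?addr0 => [|k nkl].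
  apply/ffunP => A; rewrite !ffunE /= derX_mulX eqxx scale1r.
  by move/ffunP/(_ A): (dz0 l l); rewrite !ffunE => ->; rewrite linear0 addr0.
apply/ffunP => A; rewrite !ffunE /= derX_mulX zv_inj eq_sym (negbTE nkl) scale0r add0r.
by move/ffunP/(_ A): (dz0 l k); rewrite !ffunE => ->; rewrite linear0.
Qed.

(* I/I^2, where I^2 appears as eps of I-multiples *)
Definition I2 : P -> Prop := imP eps (fq c (Ie 1)) (fun f => f = 0).

(** The complex of [Dz] ends in z-degree 0, where I + al.z is just I; its cokernel there is the
    exterior power modulo the rows and modulo I, which is I/I^2. *)
Lemma eps_I2 v : pc c 0 1 v -> (Bz c1 1 v <-> I2 (eps v)).
Proof.
have Jp1 f : Jp 1 f <-> Ie 1 f.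
  split; last exact: Jp_Ie.
  by move=> [u /pc_j0->]; rewrite linear0 subr0.
have Jb1 v' : Jb c 1 v' <-> fq c (Ie 1) v'.
  by split=> h A; split=> [/(h A).1/Jp1|/(h A).2].
move=> h; split=> [[u hu /Jb1 hv]|[v' hv' /eqP]].
  exists (v - Dz u) => //; rewrite linearB /= epsD subr0 subrr //.
rewrite subr_eq0 => /eqP e.
have hp' : pc c 0 1 v' by apply: Jb_pc; exact/Jb1.
have hp : pc c 0 1 (v - v') by exact: (submodB spc).
have [|u hu eu] := imDE (epsx hp _); first by rewrite linearB /= e subrr.
have -> : v = Dy u + v' by rewrite -eu subrK.
apply: (submodD (submod_Bz _ _)); last by apply: Jb_Bz; exact/Jb1.
(* In degree one y and z play the same part: both [Dy] and [Dz] have as image the sum of the images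
   of the [om k]. *)
have [|w' hw' /eqP] := @Dz_sum c1 0 (fun k => fm (derX (yv k)) u).
  by move=> k; apply: pc_fm hu => f; exact: pp_dy.
rewrite subr_eq0 -/(Dy u) => /eqP ->; exists w' => //; rewrite subrr; exact: submod0 (submod_Jb _ _).
Qed.

Theorem pdc_conormal : (2 * c <= pm.+2)%N -> pdc (c + c1) (Ie 1) I2.
Proof.
move=> hpm.
have sI2 : submod I2.
  by apply: submod_im; [exact: (@submod_fq R s P c (Ie 1) (submod_Ie _ _ _))|exact: submod00].
apply: (@vmap _ _ (pdc_vtheory Xl E (c + c1)) _ _ eps (pc c 0 1) (Bz c1 1) (Ie 1) I2
     spc (submod_Ie _ _ _) (submod_Bz _ _) sI2).
- by move=> z hz; exact: IeP.
- by move=> f /IeE[u hu ->]; exists u => //; rewrite subrr; exact: submod0 sI2.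
- exact: eps_I2.
- by apply: pdc_Bz => //; rewrite addn1.
Qed.
End ConormalResolution.

Local Open Scope quotient_scope.

(** * The complex I/I^2 -> L0^s -> L0^t -> R/I on the charts *)

Section Constants.
Variables (R : comUnitRingType) (s t c1 : nat) (X : 'M[R]_(t, s)).
Hypotheses (sE : s = (t + c1)%N) (t0 : (0 < t)%N).
Local Notation c := c1.+1.
Local Notation P := {mpoly R[t + t]}.
Local Notation V := {ffun {set 'I_s} -> P}.
Local Notation pc := (@pc R t s).
Local Notation pp := (@pp R t).
Local Notation eps := (eps X).
Local Notation Ie := (Ie c1 X).
Local Notation sIe := (submod_Ie c1 X _).
Local Notation enumt := (enum 'I_t).
Implicit Types (v : V) (f : P) (A : {set 'I_s}).

Lemma mnm_yz (m : 'X_{1..t + t}) : ydeg m = 0%N -> zdeg m = 0%N -> m = 0%MM.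
Proof.
move=> y0 z0; apply/mnmP => i; rewrite mnm0E -[i]splitK.
by case: (split i) => k /=; apply/eqP; [move/eqP: y0|move/eqP: z0]; rewrite sum_nat_eq0 => /forallP/(_ k).
Qed.
Lemma pp_const f : pp 0 1 f -> f = f@_0%MM *: 1.
Proof.
move=> h; apply/mpolyP => m; rewrite mcoeffZ mcoeff1.
have [->|nm] := eqVneq m 0%MM; first by rewrite mulr1.
rewrite mulr0; apply/eqP; apply: contraNT nm => /h[y0 [z0]].
by apply/eqP; apply: mnm_yz.
Qed.
Lemma pp_1 : pp 0 1 (1 : P).
Proof.
move=> m; rewrite mcoeff1; have [->|_] := eqVneq m 0%MM; last by rewrite eqxx.
by move=> _; rewrite /ydeg /zdeg !big1 // => k _; rewrite mnm0E.
Qed.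
Lemma IeV q r v : Ie 1 (r *: 1) -> pc q 0 1 v -> fq q (Ie 1) (r *: v).
Proof.
move=> hr hv A; rewrite ffunE; split=> [/(hv A).1/pp_const->|/(hv A).2->]; last by rewrite scaler0.
by rewrite scalerA mulrC -scalerA; apply: (submodZ sIe).
Qed.

End Constants.

Section ConormalLocus.
Variables (R : comUnitRingType) (s t c1 : nat) (X : 'M[R]_(t, s)).
Hypothesis natU : forall m, (m.+1%:R : R) \is a GRing.unit.
Hypotheses (sE : s = (t + c1)%N) (t0 : (0 < t)%N).
Variables (Xl : seq R) (Q : lmodType R) (E : inj_resolution Q).
Hypothesis free0 : pdc Xl E 0 (fun _ : R^o => True) (fun u => u = 0).
Variables (homR : nat -> R -> Prop) (gR : grading homR R^o).
Variables (w : 'I_(t + t) -> nat) (we : 'I_s -> nat) (dd : 'I_t -> 'I_s -> nat) (wx : 'I_t -> nat).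
Hypothesis homX : forall k j, homR (dd k j) (X k j).
Hypothesis wxE : forall k j, wx k = (dd k j + we j)%N.
Hypotheses (wy : forall k, w (yv k) = wx k) (wz : forall k, w (zv k) = wx k).
Local Notation c := c1.+1.
Local Notation P := {mpoly R[t + t]}.
Local Notation V := {ffun {set 'I_s} -> P}.
Local Notation pc := (@pc R t s).
Local Notation pp := (@pp R t).
Local Notation Dy := (D X (@yv t)).
Local Notation Dz := (D X (@zv t)).
Local Notation Hy := (H (@yv t)).
Local Notation Hz := (H (@zv t)).
Local Notation eps := (eps X).
Local Notation psi := (psi X).
Local Notation al := (al X).
Local Notation Pz := (@Pz R s t).
Local Notation enumt := (enum 'I_t).
Local Notation g := (@Vgrading R homR gR t w s we).
Local Notation pdc := (@pdc R Xl Q E).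
Local Notation zeroP := (fun u => u = 0).
Implicit Types (v : V) (f : P) (q i : nat) (k : 'I_t).

Local Notation dual := (dual X).
Local Notation imD := (imD X).
Local Notation Ie := (Ie c1 X).
Local Notation detect := (@detect R s t Xl Q E homR gR w we).
Hypothesis detect_t : detect c (fun De => exists rho, dual enumt De rho).
Variable pm : nat.
Hypothesis detect_1 : detect pm.+1 (fun De => exists k0 rho, dual (rem k0 enumt) De rho).
Hypothesis c_pm : (c <= pm)%N.
Local Notation sIe := (submod_Ie c1 X _).
Local Notation simD := (submod_imD X _ _ _).

Let Dyx q i j v : (q < c)%N -> pc q.+1 i.+1 j v -> Dy v = 0 -> imD q i.+2 j v.
Proof. by move=> a1 a2 a3; eapply Dy_exact; eauto. Qed.
Let epsx j v : pc c 0 j v -> eps v = 0 -> imD c1 1 j v.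
Proof. by move=> a1 a2; eapply eps_exact; eauto. Qed.
Let pdcA j : pdc c (pp 0 j) (Ie j).
Proof. by eapply pdc_A; eauto. Qed.
Let psix j u : pc c.+1 0 j u -> Ie j.+1 (psi u) -> imD c 1 j u.
Proof. by move=> a1 a2; eapply psi_inj; eauto. Qed.
Let epsD va v : eps (D X va v) = 0.
Proof. exact: eps_D. Qed.

Local Notation Jp := (Jp c1 X).
Local Notation sJp := (submod_Jp c1 X _).
Let BBx j : (j <= c)%N -> pdc c (pp 0 j) (Jp j).
Proof. by move=> a1; eapply pdc_BB; eauto. Qed.

Local Notation Bz := (@Bz R s t c1 X).
Local Notation I2 := (@I2 R s t c1 X).
Local Notation top := (fun f : P => f@_0%MM).
Local Notation L := (imD c 1 1).

Lemma fq_om q k v : fq q (Ie 1) v -> fq q.+1 (Ie 1) (om X k v).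
Proof.
move=> h; rewrite /om /extv; apply: (submod_sum (@submod_fq R s P q.+1 (Ie 1) sIe)) => j _.
by apply: (submodZ (@submod_fq R s P q.+1 (Ie 1) sIe)); apply: fq_ext h; exact: (submod_Ie c1 X 1).
Qed.
Lemma fq_Om q r v : fq q (Ie 1) v -> fq (size r + q) (Ie 1) (Om X r v).
Proof. by move=> h; elim: r => //= k r IH; exact: fq_om. Qed.
(** L0 is an A-module: [psi] carries I times forms into I, and it is injective on L0 modulo I. *)
Lemma L0_kill v : fq c.+1 (Ie 1) v -> L v.
Proof.
move=> h; apply: psix.
  by move=> A; split=> [/(h A).1/(Ie_pp sE t0)|/(h A).2].
rewrite /Submission.psi; apply: (submod_sum sIe) => k _.
apply: (Ie_fm (F := mulX (zv k)) (j := 1)) => [f|]; first exact: pp_mz.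
have [b hb] := Al_Om P X (enum_uniq 'I_t) (mem_enum 'I_t k : k \in enumt = true).
rewrite /Submission.al hb ffunE; apply: (submodZ sIe); apply: (fq_Om (rem k enumt) h setT).1.
by rewrite size_rem_enumt cardsT card_ord sE; lia.
Qed.
Lemma L_Bz q v : imD q 1 1 v -> Bz q 1 v.
Proof.
move=> [u hu /eqP]; rewrite subr_eq0 => /eqP ->.
have hk k : pc q 0 1 (fm (derX (yv k)) u) by apply: pc_fm hu => f; exact: pp_dy.
have [w' hw' /eqP] := Dz_sum X hk.
rewrite subr_eq0 => /eqP e; have eD : Dy u = Dz w' by exact: e.
by exists w' => //; rewrite eD subrr; exact: submod0 (submod_Jb _ _ _ _).
Qed.
Lemma L_om k v : pc c 0 1 v -> L (om X k v).
Proof.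
move=> h; have -> : om X k v = \sum_l om X l (if l == k then v else 0).
  rewrite (bigD1 k) //= eqxx big1 ?addr0 // => l /negbTE->.
  by rewrite linear0.
by apply: imD_sum => l; case: ifP => // _; exact: submod0 spc.
Qed.
Lemma om_ext k (j : 'I_s) v : om X k (ext j v) = - ext j (om X k v).
Proof.
rewrite /om /extv linear_sum -sumrN; apply: eq_bigr => l _.
by rewrite linearZ /= ext_anti scalerN.
Qed.
Lemma ext_D va (j : 'I_s) v : ext j (D X va v) = - \sum_k om X k (ext j (fm (derX (va k)) v)).
Proof.
rewrite /D linear_sum -sumrN; apply: eq_bigr => k _.
by rewrite om_ext opprK.
Qed.

(** The three arrows: wedge with each e_j, the matrix X itself, and the sum of the [al k]. *)
Definition fa v : {ffun 'I_s -> V} := [ffun j => ext j v].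
Fact fa_linear : linear fa.
Proof. by move=> a u v; apply/ffunP => j; rewrite !ffunE linearP. Qed.
Definition fb (u : {ffun 'I_s -> V}) : {ffun 'I_t -> V} := [ffun k => \sum_j X k j *: u j].
Fact fb_linear : linear fb.
Proof.
move=> a u v; apply/ffunP => k; rewrite !ffunE scaler_sumr -big_split; apply: eq_bigr => j _.
by rewrite /= !ffunE scalerDr !scalerA mulrC.
Qed.
Definition fc (u : {ffun 'I_t -> V}) : P := \sum_k al k (u k).
Fact fc_linear : linear fc.
Proof.
move=> a u v; rewrite /fc scaler_sumr -big_split; apply: eq_bigr => k _.
by rewrite !ffunE linearP.
Qed.
Let la := mklinear fa_linear.
Let lb := mklinear fb_linear.
Let lc := mklinear fc_linear.
Let Z0 : V -> Prop := pc c 0 1.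
Let Z1 : {ffun 'I_s -> V} -> Prop := @ffun_all R V _ (pc c.+1 0 1).
Let B1 : {ffun 'I_s -> V} -> Prop := @ffun_all R V _ L.
Let Z2 : {ffun 'I_t -> V} -> Prop := @ffun_all R V _ (pc c.+1 0 1).
Let B2 : {ffun 'I_t -> V} -> Prop := @ffun_all R V _ L.
Let sZ1 : submod Z1. Proof. exact: (submod_ffun _ spc). Qed.
Let sB1 : submod B1. Proof. exact: (submod_ffun _ simD). Qed.
Let sZ2 : submod Z2. Proof. exact: (submod_ffun _ spc). Qed.
Let sB2 : submod B2. Proof. exact: (submod_ffun _ simD). Qed.
Let Lpc v : L v -> pc c.+1 0 1 v. Proof. exact: imD_pc. Qed.
Let BZ1 u : B1 u -> Z1 u. Proof. by move=> h j; apply: Lpc. Qed.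
Let BZ2 u : B2 u -> Z2 u. Proof. by move=> h j; apply: Lpc. Qed.

Lemma la_Bz v : Bz c1 1 v -> B1 (la v).
Proof.
move=> [u hu hv] j; rewrite /= ffunE.
have -> : v = Dz u + (v - Dz u) by abel.
rewrite linearD /=; apply: (submodD simD).
  rewrite ext_D; apply: (submodN simD); apply: (submod_sum simD) => k _.
  by apply: L_om; apply: pc_ext; apply: pc_fm hu => f; exact: pp_dz.
apply: L0_kill; apply: fq_ext; first exact: (submod_Ie c1 X 1).
move=> A; split=> [/(hv A).1|/(hv A).2] //.
by move=> [x /pc_j0->]; rewrite linear0 subr0.
Qed.
Lemma lb_la v : Z0 v -> B2 (lb (la v)).
Proof.
move=> h k; rewrite /= ffunE.
have -> : \sum_j X k j *: (fa v) j = om X k v by rewrite /om /extv; apply: eq_bigr => j _; rewrite ffunE.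
exact: L_om.
Qed.
Lemma al_L k v : L v -> Ie 1 (al k v).
Proof.
move=> [u hu /eqP]; rewrite subr_eq0 => /eqP ->.
have hk (l : 'I_t) : pc c 0 1 (fm (derX (yv l)) u) by apply: pc_fm hu => f; exact: pp_dy.
rewrite /D linear_sum; apply: (submod_sum sIe) => l _ /=.
have [->|nlk] := eqVneq l k; first by rewrite al_om; apply: IeP; exact: hk.
by rewrite (al_om_other X natU) //; exact: submod0 sIe.
Qed.
Lemma lc_B2 u : B2 u -> Ie 1 (lc u).
Proof. by move=> h; apply: (submod_sum sIe) => k _; apply: al_L. Qed.
Lemma lc_lb u : Z1 u -> Ie 1 (lc (lb u)).
Proof.
move=> h; rewrite /= /fc.
have -> : \sum_k al k (fb u k) = \sum_j eps (ctr j (u j)).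
  rewrite (eq_bigr (fun k => \sum_j X k j *: al k (u j))).
    by rewrite exchange_big; apply: eq_bigr => j _; rewrite (al_rel X sE t0 j (h j)).
  by move=> k _; rewrite ffunE linear_sum; apply: eq_bigr => j _; rewrite linearZ.
by apply: (submod_sum sIe) => j _; apply: IeP; apply: pc_ctr.
Qed.

Section Chart.
Variables (k0 : 'I_t) (De : R) (rho : 'I_t -> 'I_s -> R).
Hypothesis du : dual (rem k0 enumt) De rho.
Local Notation r0 := (rem k0 enumt).
Local Notation de := (De ^+ t.-1).
Let alx u : pc c.+1 0 1 u -> Ie 1 (al k0 u) -> L (de *: u).
Proof. by move=> a1 a2; eapply al_inj; eauto. Qed.
Let lomx q v : pc q.+1 0 1 v -> Om X r0 v = 0 -> imD q 1 1 (de *: v).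
Proof.
move=> h o; rewrite -(size_rem_enumt k0); eapply local_om; eauto; exact: (rem_uniq _ (enum_uniq _)).
Qed.
Let rkE k : (k \in r0) = (k != k0).
Proof. by rewrite mem_rem_uniq ?enum_uniq // inE mem_enum andbT. Qed.

(** Cokernel of the last arrow: [al k0] is onto up to De^(t-1). *)
Lemma chart_A f : pp 0 1 f -> imP lc Z2 (Ie 1) (de *: f).
Proof.
have [lam [hlam alam]] : exists lam : P -> V, (forall j f, pp 0 j f -> pc c.+1 0 j (lam f)) /\
  (forall f, al k0 (lam f) = de *: f) by eapply al_unit; eauto.
move=> hf; exists [ffun k => if k == k0 then lam f else 0].
  by move=> k; rewrite ffunE; case: ifP => _; [exact: hlam|exact: submod0 spc].
rewrite /= /fc (bigD1 k0) //= ffunE eqxx alam big1 ?addr0 ?subrr; first exact: submod0 sIe.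
by move=> k /negbTE nk; rewrite ffunE nk linear0.
Qed.

(** The rows other than k0 are solved for with the dual basis [rho]; what is left in row k0 is
    killed by [al k0] modulo I, and [al_inj] removes it. *)
Lemma chart_2 u : Z2 u -> Ie 1 (lc u) -> imP lb Z1 B2 (De ^+ t *: u).
Proof.
move=> h hI; pose r l := \sum_p rho l p * X k0 p.
pose w0 := De *: u k0 - \sum_(l | l != k0) r l *: u l.
have hw0 : pc c.+1 0 1 w0.
  by apply: (submodB spc); [|apply: (submod_sum spc) => l _]; apply: (submodZ spc); exact: h.
have hd : L (de *: w0).
  apply: alx => //; have -> : al k0 w0 = De *: lc u - \sum_(l | l != k0) eps (ctrv (rho l) (u l)).
    have elc : lc u = al k0 (u k0) + \sum_(k | k != k0) al k (u k).
      by rewrite /= /fc (bigD1 k0).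
    have e1 : al k0 w0 = De *: al k0 (u k0) - \sum_(l | l != k0) r l *: al k0 (u l).
      rewrite /w0 linearB linearZ /= linear_sum; congr (_ - _).
      by apply: eq_bigr => l _; rewrite linearZ.
    rewrite e1 elc scalerDr scaler_sumr -addrA -sumrB; congr (_ + _).
    rewrite -sumrN; apply: eq_bigr => l nl.
    by rewrite -(al_minor sE t0 du nl (h l)) -/(r l); abel.
  apply: (submodB sIe); first exact: (submodZ sIe).
  by apply: (submod_sum sIe) => l _; apply: IeP; apply: pc_ctrv.
pose mu : {ffun 'I_s -> V} := [ffun j => \sum_(l | l != k0) rho l j *: u l].
exists (de *: mu).
  by move=> j; rewrite !ffunE; apply: (submodZ spc); apply: (submod_sum spc) => l _; apply: (submodZ spc).
have fbmu k : lb mu k = \sum_(l | l != k0) (\sum_p rho l p * X k p) *: u l.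
  rewrite /= ffunE (eq_bigr (fun j => \sum_(l | l != k0) (rho l j * X k j) *: u l)).
    by rewrite exchange_big; apply: eq_bigr => l _; rewrite scaler_suml.
  by move=> j _; rewrite ffunE scaler_sumr; apply: eq_bigr => l _; rewrite scalerA mulrC.
move=> k; have -> : (De ^+ t *: u - lb (de *: mu)) k = de *: (De *: u k - lb mu k).
  rewrite [lb _]linearZ !ffunE scalerBr scalerA -exprSr prednK //.
rewrite fbmu; have [->|nk] := eqVneq k k0; first exact: hd.
rewrite (bigD1 k) //= du ?rkE // eqxx mul1r big1 ?addr0 ?subrr ?scaler0; first exact: submod0 simD.
by move=> l /andP[nl nlk]; rewrite du ?rkE // (negbTE nlk) mul0r scale0r.
Qed.

Lemma lam_ex : exists2 lam : V, pc c.+1 0 1 lam & al k0 lam = de *: 1.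
Proof.
have [lam [hlam alam]] : exists lam : P -> V, (forall j f, pp 0 j f -> pc c.+1 0 j (lam f)) /\
  (forall f, al k0 (lam f) = de *: f) by eapply al_unit; eauto.
by exists (lam 1); [apply: hlam; exact: pp_1|exact: alam].
Qed.
Lemma ext_ctrv (ar : 'I_s -> R) (j : 'I_s) v : ext j (ctrv ar v) = ar j *: v - ctrv ar (ext j v).
Proof.
have -> : ctrv ar (ext j v) = ar j *: v - ext j (ctrv ar v); last by abel.
rewrite /ctrv (eq_bigr (fun p => ar p *: ((p == j)%:R *: v) - ar p *: ext j (ctr p v))).
  rewrite sumrB; congr (_ - _); last by rewrite linear_sum; apply: eq_bigr => p _; rewrite linearZ.
  rewrite (bigD1 j) //= eqxx scale1r big1 ?addr0 // => p /negbTE->.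
  by rewrite scale0r scaler0.
by move=> p _; rewrite ctr_ext scalerBr.
Qed.
Lemma Om_top q v : pc q.+1 0 1 v -> (c < q)%N -> Om X r0 v = 0.
Proof.
move=> h cq; have := pc_Om X r0 h; rewrite size_rem_enumt; apply: pc_big.
by rewrite sE; lia.
Qed.

(** On the chart L0 is generated by [lam], so u_j is a scalar a_j times [lam]; the preimage is the
    contraction of [lam] with the vector a. *)
Lemma chart_1 u : Z1 u -> B2 (lb u) -> imP la Z0 B1 (De ^+ (t.-1 + t.-1) *: u).
Proof.
move=> h hb; have [lam hlam alam] := lam_ex.
pose ar j := (al k0 (u j))@_0%MM.
have arE j : al k0 (u j) = ar j *: 1 by apply: pp_const; exact: (pp_al sE t0 (h j)).
have Ia k : Ie 1 ((\sum_j ar j * X k j) *: 1).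
  have := al_L k0 (hb k); rewrite /= ffunE linear_sum.
  have -> : \sum_j al k0 (X k j *: u j) = (\sum_j ar j * X k j) *: 1 => //.
  by rewrite scaler_suml; apply: eq_bigr => j _; rewrite linearZ /= arE scalerA mulrC.
exists (de *: ctrv ar lam); first by apply: (submodZ spc); apply: pc_ctrv.
move=> j; have -> : (De ^+ (t.-1 + t.-1) *: u - la (de *: ctrv ar lam)) j =
    - (de *: (ar j *: lam - de *: u j)) + de *: ctrv ar (ext j lam).
  rewrite !ffunE [ext j _]linearZ /= ext_ctrv exprD -scalerA -[ar j *: lam]/(ar j *: lam).
  rewrite !scalerBr; abel.
apply: (submodD simD).
  apply: (submodN simD); apply: alx; first by apply: (submodB spc); apply: (submodZ spc).
  have e1 : al k0 (ar j *: lam) = (de * ar j) *: 1 by rewrite linearZ /= alam scalerA mulrC.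
  have e2 : al k0 (de *: u j) = (de * ar j) *: 1 by rewrite linearZ /= arE scalerA.
  by rewrite linearB /= e1 e2 subrr; exact: submod0 sIe.
(* e_j wedge [lam] has exterior degree c + 1, so the product of the t - 1 rows kills it and it comes
   from the rows. Contraction with a then leaves sums a.X_k, which lie in I by [Ia]. *)
have [w'] : imD c.+1 1 1 (de *: ext j lam) by apply: lomx; [exact: pc_ext|apply: (Om_top (pc_ext j hlam))].
move=> hw' /eqP; rewrite subr_eq0 => /eqP e.
rewrite -[de *: ctrv ar _]linearZ e /D linear_sum; apply: (submod_sum simD) => k _ /=.
have hk : pc c.+1 0 1 (fm (derX (yv k)) w') by apply: pc_fm hw' => f; exact: pp_dy.
have -> : ctrv ar (om X k (fm (derX (yv k)) w')) = (\sum_j ar j * X k j) *: fm (derX (yv k)) w' -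
    om X k (ctrv ar (fm (derX (yv k)) w')) by exact: ctrv_extv.
apply: (submodB simD); last by apply: L_om; apply: pc_ctrv.
by apply: L0_kill; apply: IeV.
Qed.

Lemma Om_ext r (j : 'I_s) v : Om X r (ext j v) = (-1) ^+ size r *: ext j (Om X r v).
Proof.
elim: r => [|k r IH] /=; first by rewrite scale1r.
by rewrite IH linearZ /= om_ext scalerN exprS mulN1r scaleNr.
Qed.
Lemma Om_ctrv0 (ar : 'I_s -> R) r v : (forall k, k \in r -> \sum_j ar j * X k j = 0) ->
  Om X r (ctrv ar v) = (-1) ^+ size r *: ctrv ar (Om X r v).
Proof.
elim: r => [|k r IH] h /=; first by rewrite scale1r.
rewrite IH => [|l lr]; last by apply: h; rewrite inE lr orbT.
rewrite [ctrv ar (om X k _)]ctrv_extv h ?mem_head // scale0r add0r linearZ /= exprS mulN1r scaleNr scalerN opprK //.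
Qed.
Lemma ext_inj0 q v : pc q 0 1 v -> (q < s.+1)%N -> (forall j, ext j v = 0) -> v = 0.
Proof.
move=> h qs h0; apply/ffunP => A; rewrite [RHS]ffunE.
have [e|ne] := eqVneq #|A|.+1 q; last by apply: (h A).2; apply/eqP.
have [l lA] : exists l, l \notin A.
  apply/existsP; rewrite -negb_forall; apply/negP => /forallP hA.
  have AT : A = setT by apply/setP => l; rewrite hA inE.
  by move: e qs; rewrite AT cardsT card_ord => <-; rewrite ltnn.
have := congr1 (fun f : V => f (l |: A)) (h0 l); rewrite !ffunE setU11.
have -> : (l |: A) :\ l = A by apply/setP => x; rewrite !inE; case: eqP => // ->; rewrite (negbTE lA).
by move/(congr1 (fun x => (-1) ^+ sig l (l |: A) *: x)); rewrite scaler0 scalerA -expr2 sqrr_sign scale1r.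
Qed.

(** After subtraction of a contraction of [lam] with coefficients in I, the product of the rows of
    [v] has zero wedge with each e_l. Being below the top degree it vanishes, and [v] comes from the
    rows. *)
Lemma chart_0 v : Z0 v -> B1 (la v) -> Bz c1 1 (De ^+ (t.-1 + t.-1) *: v).
Proof.
move=> h hb; have [lam hlam alam] := lam_ex.
pose ar j := (al k0 (ext j v))@_0%MM.
have arE j : al k0 (ext j v) = ar j *: 1 by apply: pp_const; exact: (pp_al sE t0 (pc_ext j h)).
have Ia j : Ie 1 (ar j *: 1) by rewrite -arE; apply: al_L; have := hb j; rewrite /= ffunE.
have aX k : k \in r0 -> \sum_j ar j * X k j = 0.
  rewrite rkE => nk; have e : (\sum_j ar j * X k j) *: (1 : P) = 0.
    rewrite -(al_om_other X natU v nk) /om /extv linear_sum scaler_suml; apply: eq_bigr => j _.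
    by rewrite linearZ /= arE scalerA mulrC.
  by have /(congr1 (fun f : P => f@_0%MM)) := e; rewrite mcoeffZ mcoeff1 eqxx mulr1 mcoeff0.
pose x := de *: v - ctrv ar lam.
have hx : pc c 0 1 x by apply: (submodB spc); [exact: (submodZ spc)|exact: pc_ctrv].
have ox : Om X r0 x = 0.
  apply: (ext_inj0 (pc_Om X r0 hx)); first by rewrite size_rem_enumt sE; lia.
  move=> l; have e : Om X r0 (ext l x) = 0.
    apply: (al0_Om sE t0 (pc_ext l hx)); rewrite /x linearB linearZ /= ext_ctrv.
    have z : al k0 (ctrv ar (ext l lam)) = 0.
      have [b hb'] := Al_Om P X (enum_uniq 'I_t) (mem_enum 'I_t k0 : k0 \in enumt = true).
      rewrite /Submission.al hb' Om_ctrv0 // (Om_top (pc_ext l hlam)) // linear0 !scaler0 ffunE //.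
    have e1 : al k0 (ar l *: lam) = (de * ar l) *: 1 by rewrite linearZ /= alam scalerA mulrC.
    have e2 : al k0 (de *: ext l v) = (de * ar l) *: 1 by rewrite linearZ /= arE scalerA.
    by rewrite [al k0 (_ - (_ - _))]linearB /= e2 [al k0 (_ - _)]linearB /= z e1 subr0 subrr.
  move: e; rewrite Om_ext => /(congr1 (fun y => (-1) ^+ size r0 *: y)).
  by rewrite scaler0 scalerA -expr2 sqrr_sign scale1r.
have -> : De ^+ (t.-1 + t.-1) *: v = de *: x + de *: ctrv ar lam.
  by rewrite /x [in RHS]scalerBr scalerA -exprD; abel.
have sBz : submod (Bz c1 1) := submod_Bz c1 X _ _.
apply: (submodD sBz); first by apply: L_Bz; apply: lomx.
apply: (submodZ sBz); apply: (submod_sum sBz) => j _.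
apply: Jb_Bz => A; have := IeV (Ia j) (pc_ctr j hlam) A; rewrite -[ar j *: _]/(ar j *: _).
by move=> [h1 h2]; split=> [/h1/Jp_Ie|/h2].
Qed.
End Chart.

(** A bound for the dimension, as an affine cone, of the locus of the (t-1)-minors; the next
    hypothesis is Grothendieck vanishing for modules supported there. *)
Variable e : nat.
Hypothesis dimq : forall (M : lmodType R) (Z B : M -> Prop) (N k : nat), submod Z -> submod B ->
  (forall k0 De rho, dual (rem k0 enumt) De rho -> forall z, Z z -> B (De ^+ N *: z)) ->
  (e < k)%N -> CV Xl k Z B.
Local Notation N := (size Xl).
Local Notation CV := (CV Xl).

Let imc := imP lc Z2 (Ie 1).
Let simc : submod imc. Proof. exact: (submod_im _ sZ2 sIe). Qed.
Let imb := imP lb Z1 B2.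
Let simb : submod imb. Proof. exact: (submod_im _ sZ1 sB2). Qed.
Let ima := imP la Z0 B1.
Let sima : submod ima. Proof. exact: (submod_im _ spc sB1). Qed.
Let kc u := Z2 u /\ Ie 1 (lc u).
Let skc : submod kc. Proof. exact: (submodI sZ2 (submod_ker lc sIe)). Qed.
Let kb u := Z1 u /\ B2 (lb u).
Let skb : submod kb. Proof. exact: (submodI sZ1 (submod_ker lb sB2)). Qed.
Let ka u := Z0 u /\ B1 (la u).
Let ska : submod ka. Proof. exact: (submodI spc (submod_ker la sB1)). Qed.

(** Beginning of a chase from right to left along the complex: the homology has cohomology in
    degrees at most e only, and passing over each of the three arrows costs one degree, so e + 1
    becomes e + 3. The upper bound on k comes from A and L0, both of dimension c. *)
Lemma CV_imc (k : nat) : (e.+1 < k)%N -> (k + c < N)%N -> CV k imc (Ie 1).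
Proof.
move=> ek kN; apply: (CV_sub (Z := pp 0 1)) => //.
- exact: sIe.
- by move=> f hf; exists 0; [exact: submod0 sZ2|rewrite linear0 subr0].
- move=> f [u hu hf]; apply: (submodBr spp) (Ie_pp sE t0 hf).
  by apply: (submod_sum spp) => l _; exact: (pp_al sE t0 (hu l)).
- exact: (pdcA 1).1.
- move=> k1; apply: (dimq (N := t.-1)) => //; first exact: spp.
    by move=> k0 De rho du z; apply: (chart_A du).
  by lia.
Qed.
Lemma CV_ffun (J : finType) (k : nat) : (k + c < N)%N ->
  CV k (@ffun_all R V J (pc c.+1 0 1)) (@ffun_all R V J L).
Proof.
move=> kN; apply: (vdsum (CV_vtheory Xl k) J spc simD Lpc).
have h : pdc c (pc c.+1 0 1) L by eapply pdc_L0; eauto.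
exact: h.1.
Qed.
Lemma CV_kc (k : nat) : (e.+2 < k)%N -> (k + c < N)%N -> CV k kc B2.
Proof.
move=> ek kN; apply: (CV_sub (Z := Z2)) => //.
- by move=> u hu; split; [exact: BZ2|exact: lc_B2].
- by move=> u [].
- exact: CV_ffun.
- move=> k1; apply: (CV_pull (f := lc) (Z' := imc) (B' := Ie 1)) => //.
  all: try exact: sIe.
  all: try by move=> a u v _ _; rewrite linearP.
  all: try by move=> z hz; exists z => //; rewrite subrr; exact: (submod0 sIe).
  all: try by move=> v [u hu hv]; exists u.
  all: try by move=> z hz; split=> [hk|h]; [exact: hk.2|split].
  by apply: CV_imc; lia.
Qed.
Lemma CV_imb (k : nat) : (e.+2 < k)%N -> (k + c < N)%N -> CV k imb B2.
Proof.
move=> ek kN; apply: (CV_sub (Z := kc)) => //.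
- by move=> u hu; exists 0; [exact: submod0 sZ1|rewrite linear0 subr0].
- move=> u [v hv huv]; have -> : u = (u - lb v) + lb v by abel.
  have hlb : Z2 (lb v).
    move=> l; rewrite /= ffunE; apply: (submod_sum spc) => j _; apply: (submodZ spc); exact: hv.
  split; first by apply: (submodD sZ2) => //; exact: BZ2.
  rewrite linearD; apply: (submodD sIe); [exact: lc_B2|exact: lc_lb].
- exact: CV_kc.
- move=> k1; apply: (dimq (N := t)) => //; last by lia.
  by move=> k0 De rho du z [z1 z2]; apply: (chart_2 du).
Qed.
Lemma CV_kb (k : nat) : (e.+3 < k)%N -> (k + c < N)%N -> CV k kb B1.
Proof.
move=> ek kN; apply: (CV_sub (Z := Z1)) => //.
- move=> u hu; split; first exact: BZ1.
  move=> l; rewrite /= ffunE; apply: (submod_sum simD) => j _; apply: (submodZ simD); exact: hu.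
- by move=> u [].
- exact: CV_ffun.
- move=> k1; apply: (CV_pull (f := lb) (Z' := imb) (B' := B2)) => //.
  all: try exact: sIe.
  all: try by move=> a u v _ _; rewrite linearP.
  all: try by move=> z hz; exists z => //; rewrite subrr; exact: (submod0 sB2).
  all: try by move=> v [u hu hv]; exists u.
  all: try by move=> z hz; split=> [hk|h]; [exact: hk.2|split].
  by apply: CV_imb; lia.
Qed.
Lemma CV_ima (k : nat) : (e.+3 < k)%N -> (k + c < N)%N -> CV k ima B1.
Proof.
move=> ek kN; apply: (CV_sub (Z := kb)) => //.
- by move=> u hu; exists 0; [exact: (submod0 spc)|rewrite linear0 subr0].
- move=> u [v hv huv]; have -> : u = (u - la v) + la v by abel.
  have hla : Z1 (la v) by move=> l; rewrite /= ffunE; exact: pc_ext.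
  split; first by apply: (submodD sZ1) => //; exact: BZ1.
  rewrite linearD; apply: (submodD sB2); last exact: lb_la.
  move=> l; rewrite /= ffunE; apply: (submod_sum simD) => j _; apply: (submodZ simD); exact: huv.
- exact: CV_kb.
- move=> k1; apply: (dimq (N := t.-1 + t.-1)) => //; last by lia.
  by move=> k0 De rho du z [z1 z2]; apply: (chart_1 du).
Qed.

Theorem CV_conormal (k : nat) : (e.+3 < k)%N -> (k + c < N)%N -> CV k (Ie 1) I2.
Proof.
move=> ek kN; have sBz : submod (Bz c1 1) := submod_Bz c1 X _ _.
have sI2 : submod I2.
  by apply: submod_im; [exact: (@submod_fq R s P c (Ie 1) sIe)|exact: submod00].
apply: (CV_map (f := eps) (Z := Z0) (B := Bz c1 1)) => //.
- exact: spc.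
- by move=> a u v _ _; rewrite linearP.
- by move=> z hz; exact: IeP.
- by move=> f /IeE[u hu ->]; exists u => //; rewrite subrr; exact: submod0 sI2.
- by move=> z hz; eapply eps_I2; eauto.
apply: (CV_ext (Z' := ka)) => //; first exact: spc.
- move=> u hu; split; last exact: la_Bz.
  exact: (Bz_pc sE t0 hu).
- by move=> u [].
- apply: (dimq (N := t.-1 + t.-1)) => //; last by lia.
  by move=> k0 De rho du z [z1 z2]; apply: (chart_0 du).
- apply: (CV_pull (f := la) (Z' := ima) (B' := B1)) => //.
  all: try exact: spc.
  all: try exact: sIe.
  all: try by move=> a u v _ _; rewrite linearP.
  all: try by move=> z hz; exists z => //; rewrite subrr; exact: (submod0 sB1).
  all: try by move=> v [u hu hv]; exists u.
  all: try by move=> z hz; split=> [hk|h]; [exact: hk.2|split].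
  exact: CV_ima.
Qed.
End ConormalLocus.

(** Projectivity lifts through surjections; the target is therefore replaced by the image of [g]. *)
Lemma lift_exact (R : comNzRingType) (Pj M N : lmodType R) (g : {linear M -> N}) (w : {linear Pj -> N}) :
  projective Pj -> (forall p, exists x, g x = w p) -> exists h : {linear Pj -> M}, forall p, g (h p) = w p.
Proof.
move=> hP hw; pose I0 (y : N) := exists x, g x = y.
have sI : submod I0.
  split; first by exists 0; rewrite linear0.
  by move=> a u v [x <-] [y <-]; exists (a *: x + y); rewrite linearP.
have g1L : linear (fun x : M => to_sub sI (ex_intro (fun x' => g x' = g x) x erefl)).
  by move=> a x y; apply: val_inj; rewrite /= linearP.
have w1L : linear (fun p : Pj => to_sub sI (hw p)).
  by move=> a x y; apply: val_inj; rewrite /= linearP.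
have [|h hh] := hP _ _ (mklinear g1L) (mklinear w1L).
  move=> y; have [x hx] := sub_modP y; exists x; apply: val_inj.
  by rewrite [LHS]to_subK.
by exists h => p; have /(congr1 val) := hh p; rewrite [LHS]to_subK [RHS]to_subK.
Qed.

Lemma extend_exact (R : comNzRingType) (E A B C : lmodType R) (d1 : {linear C -> A}) (d0 : {linear A -> B})
  (w : {linear A -> E}) : injective_module E -> (forall x, d0 x = 0 -> exists y, d1 y = x) ->
  (forall y, w (d1 y) = 0) -> exists v : {linear B -> E}, forall x, v (d0 x) = w x.
Proof.
move=> iE ex hw.
have [||v _ hv] := @extend_linear R E A B d0 (fun _ => True) (fun b => b = 0) w iE (submodT _) (submod00 _).
- by move=> *; rewrite linearP.
- by move=> z _ /ex[y <-].
by exists v => x; exact: hv.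
Qed.

(** * Ext into the canonical module *)

Section Balance.
Variables (R : comNzRingType) (M : lmodType R) (Pr : proj_resolution M) (Q : lmodType R) (E : inj_resolution Q).
Notation dP := (pres_d Pr).
Notation dE := (ires_d E).
Notation aug := (pres_aug Pr).
Notation iota := (ires_aug E).

Lemma pres_dd i x : dP i (dP i.+1 x) = 0. Proof. by apply/pres_exact; exists x. Qed.
Lemma aug_d x : aug (dP 0 x) = 0. Proof. by apply/pres_exact0; exists x. Qed.
Lemma dE_iota x : dE 0 (iota x) = 0. Proof. by apply/ires_exact0; exists x. Qed.
Lemma iota_inj0 x : iota x = 0 -> x = 0.
Proof. by move=> h; apply: (@ires_inj _ _ E); rewrite linear0. Qed.

Definition bic i m (w : {linear Pr i -> E m}) := (forall p, w (dP i p) = 0) /\ forall p, dE m (w p) = 0.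

(** A zigzag in the double complex Hom(P_i, E_m): [w] is joined to some f : P_(i+m) -> Q satisfying
    [F] by alternately lifting through E and composing with P. It compares Ext computed with P and
    with E. *)
Fixpoint Rel (F : forall n, {linear Pr n -> Q} -> Prop) m : forall i, {linear Pr i -> E m} -> Prop :=
  match m return forall i, {linear Pr i -> E m} -> Prop with
  | 0 => fun i w => exists2 f : {linear Pr i -> Q}, (forall p, w p = iota (f p)) & F i f
  | m'.+1 => fun i w => exists2 u : {linear Pr i -> E m'}, (forall p, w p = dE m' (u p)) &
       Rel F (u \o dP i)%FUN
  end.

Lemma lift_E i m (w : {linear Pr i -> E m.+1}) : (forall p, dE m.+1 (w p) = 0) ->
  exists u : {linear Pr i -> E m}, forall p, dE m (u p) = w p.
Proof. by move=> h; apply: lift_exact; [exact: pres_projective|move=> p; apply/ires_exact]. Qed.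
Lemma lift_E0 i (w : {linear Pr i -> E 0}) : (forall p, dE 0 (w p) = 0) ->
  exists u : {linear Pr i -> Q}, forall p, iota (u p) = w p.
Proof. by move=> h; apply: lift_exact; [exact: pres_projective|move=> p; apply/ires_exact0]. Qed.
Lemma extend_P i m (w : {linear Pr i.+1 -> E m}) : (forall p, w (dP i.+1 p) = 0) ->
  exists v : {linear Pr i -> E m}, forall p, v (dP i p) = w p.
Proof.
by move=> h; apply: (extend_exact (d1 := dP i.+1)) => //; [exact: ires_injective|move=> x /pres_exact].
Qed.

Lemma Rel_sub (F G : forall n, {linear Pr n -> Q} -> Prop) m i (w : {linear Pr i -> E m}) :
  (forall f, F (i + m)%N f -> G (i + m)%N f) -> Rel F w -> Rel G w.
Proof.
elim: m i w => [|m IH] i w h /= [f hf hF].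
  by exists f => //; move: h; rewrite addn0; apply.
by exists f => //; apply: IH hF => g; move: h; rewrite addnS -addSn; apply.
Qed.

Lemma Rel_ext F m i (w w' : {linear Pr i -> E m}) : (forall p, w' p = w p) -> Rel F w -> Rel F w'.
Proof. by case: m w w' => [|m] w w' h /= [f hf Ff]; exists f => // p; rewrite h. Qed.

Lemma Rel_exists m i (w : {linear Pr i -> E m}) : bic w -> Rel (fun n f => ext_cocycle f) w.
Proof.
elim: m i w => [|m IH] i w [w1 w2] /=.
  have [u hu] := lift_E0 w2; exists u => // y; apply: iota_inj0; rewrite hu; exact: w1.
have [u hu] := lift_E w2; exists u => //; apply: IH; split=> p /=.
  by rewrite pres_dd linear0.
by rewrite hu w1.
Qed.

Lemma Rel_lin (F G H : forall n, {linear Pr n -> Q} -> Prop) a m i (w w' w'' : {linear Pr i -> E m}) :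
  (forall n (f g h : {linear Pr n -> Q}), F n f -> G n g -> (forall p, h p = a *: f p + g p) -> H n h) ->
  (forall p, w'' p = a *: w p + w' p) -> Rel F w -> Rel G w' -> Rel H w''.
Proof.
move=> hF; elim: m i w w' w'' => [|m IH] i w w' w'' hw /= [f hf Ff] [g hg Gg].
  have hL : linear (fun p => a *: f p + g p).
    by move=> b x y; rewrite [f (_ + _)]linearP [g (_ + _)]linearP /= !scalerDr !scalerA [a * b]mulrC; abel.
  exists (mklinear hL) => [p|]; first by rewrite hw hf hg -linearP.
  exact: (hF _ _ _ (mklinear hL) Ff Gg).
have hL : linear (fun p => a *: f p + g p).
  by move=> b x y; rewrite [f (_ + _)]linearP [g (_ + _)]linearP /= !scalerDr !scalerA [a * b]mulrC; abel.
exists (mklinear hL) => [p|]; first by rewrite hw hf hg -linearP.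
by apply: IH Ff Gg.
Qed.

(* w extends a cocycle across the boundary: it is trivial in the double complex *)
Definition triv i m : {linear Pr i -> E m} -> Prop :=
  match i return {linear Pr i -> E m} -> Prop with
  | 0 => fun w => match m return {linear Pr 0 -> E m} -> Prop with
      | 0 => fun w => forall p, w p = 0
      | m'.+1 => fun w => exists2 b : {linear Pr 0 -> E m'}, forall p, b (dP 0 p) = 0 & forall p, w p = dE m' (b p)
      end w
  | i'.+1 => fun w => exists2 v : {linear Pr i' -> E m}, forall p, dE m (v p) = 0 & forall p, w p = v (dP i' p)
  end.

(** With [triv_Rel] this matches the trivial classes of the two computations; the intermediate lifts
    are corrected along the zigzag. *)
Lemma Rel_triv F m i (w : {linear Pr i -> E m}) : Rel F w -> triv w ->
  Rel (fun n f => F n f /\ ext_coboundary f) w.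
Proof.
elim: m i w => [|m IH] [|i] w /= [f hf Ff].
- by move=> h; exists f => //; split=> // p; apply: iota_inj0; rewrite -hf h.
- move=> [v hv wv]; exists f => //; split=> //; have [v' hv'] := lift_E0 hv.
  by exists v' => p; apply: (@ires_inj _ _ E); rewrite hv' -wv hf.
- move=> [b hb wb]; exists f => //; apply: (IH 1%N) => //=.
  exists (f \- b) => p /=; first by rewrite /= linearB /= -hf wb subrr.
  by rewrite /= hb subr0.
move=> [v hv wv]; exists f => //; apply: (IH i.+2) => //=.
have [v' hv'] := lift_E hv.
exists (f \- (v' \o dP i)%FUN) => p /=; first by rewrite linearB /= hv' -wv hf subrr.
by rewrite /= pres_dd linear0 subr0.
Qed.

Lemma triv_Rel m i (w : {linear Pr i -> E m}) : bic w ->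
  Rel (fun n f => ext_coboundary f) w -> triv w.
Proof.
elim: m i w => [|m IH] [|i] w [w1 w2] /= [f hf Ff].
- by move=> p; rewrite hf Ff linear0.
- have [v' hv'] := Ff; exists (iota \o v')%FUN => p /=; first exact: dE_iota.
  by rewrite hf hv'.
- have bu : bic (f \o dP 0)%FUN.
    by split=> p /=; [rewrite pres_dd linear0|rewrite -hf w1].
  have [v hv wv] := IH 1%N _ bu Ff; exists (f \- v) => p /=; first by have /= := wv p => ->; rewrite subrr.
  by rewrite linearB /= hv subr0.
have bu : bic (f \o dP i.+1)%FUN.
  by split=> p /=; [rewrite pres_dd linear0|rewrite -hf w1].
have [v hv wv] := IH i.+2 _ bu Ff.
have hz p : (f \- v) (dP i.+1 p) = 0 by have /= := wv p => ->; rewrite subrr.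
have [b hb] := extend_P (w := f \- v) hz.
  exists (dE m \o b)%FUN => p /=; first exact: ires_dd.
by rewrite hb /= linearB /= hv subr0 hf.
Qed.

(** The zigzag run in the other direction, down to P_0, where a class becomes a map factoring
    through the augmentation. *)
Lemma Rel_surj F m i (w : {linear Pr i -> E m}) : bic w -> Rel F w ->
  exists2 w0 : {linear Pr 0 -> E (i + m)%N}, bic w0 & Rel F w0.
Proof.
elim: i m w => [|i IH] m w bw Fw; first by exists w.
have [u hu] := extend_P bw.1.
have bu : bic (dE m \o u)%FUN.
  by split=> p /=; [rewrite hu bw.2|exact: ires_dd].
rewrite addSnnS; apply: (IH m.+1 _ bu); exists u => //=.
by apply: (Rel_ext (w := w)).
Qed.

Section RegularSequence.
Variable N : nat.
Variable a : nat -> R.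
Hypothesis areg : forall k (f : Q), (k < N)%N ->
  (exists g : nat -> Q, a k *: f = \sum_(l < k) a l *: g l) -> exists g : nat -> Q, f = \sum_(l < k) a l *: g l.
Hypothesis akill : forall k (x : M), (k < N)%N -> a k *: x = 0.

Let J k (f : Q) := exists g : nat -> Q, f = \sum_(l < k) a l *: g l.
Let sJ k : submod (J k).
Proof.
split; first by exists (fun=> 0); rewrite big1 // => l _; rewrite scaler0.
move=> b u v [g ->] [g' ->]; exists (fun l => b *: g l + g' l).
rewrite scaler_sumr -big_split; apply: eq_bigr => l _ /=.
by rewrite scalerDr !scalerA mulrC.
Qed.
Let J_mul k f : J k.+1 (a k *: f).
Proof.
exists (fun l => if l == k then f else 0); rewrite big_ord_recr /= eqxx big1 ?add0r // => l _.
by rewrite ltn_eqF ?scaler0 // ltn_ord.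
Qed.
Let J_le k f : J k f -> J k.+1 f.
Proof.
move=> [g ->]; exists (fun l => if (l < k)%N then g l else 0); rewrite big_ord_recr /= ltnn scaler0 addr0.
by apply: eq_bigr => l _; rewrite ltn_ord.
Qed.

(** Multiplication by a_k lifts the zero map of the module, hence is null-homotopic on P. *)
Lemma mul_homotopy k : (k < N)%N -> exists h : forall n, {linear Pr n -> Pr n.+1},
  (forall p, a k *: p = dP 0 (h 0%N p)) /\
  forall n p, a k *: p = dP n.+1 (h n.+1 p) + h n (dP n p).
Proof.
move=> kN.
have aL n : linear (fun p : Pr n => a k *: p).
  by move=> b x y; rewrite scalerDr !scalerA mulrC.
have [h0 hh0] : exists h : {linear Pr 0 -> Pr 1}, forall p, dP 0 (h p) = a k *: p.
  apply: (lift_exact (g := dP 0) (w := mklinear (aL 0%N))); first exact: pres_projective.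
  by move=> p; apply/pres_exact0; rewrite [LHS]linearZ /= akill.
pose T n := {linear Pr n -> Pr n.+1}.
have step n (h : T n) : (forall p, dP n (h (dP n p)) = a k *: dP n p) ->
    exists h' : T n.+1, forall p, dP n.+1 (h' p) = a k *: p - h (dP n p).
  move=> hn; have wL : linear (fun p : Pr n.+1 => a k *: p - h (dP n p)).
    move=> b x y; rewrite [dP n (_ + _)]linearP /= [h (_ + _)]linearP /= scalerDr scalerBr !scalerA [a k * b]mulrC; abel.
  apply: (lift_exact (g := dP n.+1) (w := mklinear wL)); first exact: pres_projective.
  move=> p; apply/pres_exact; change (dP n (a k *: p - h (dP n p)) = 0).
  by rewrite linearB linearZ /= hn subrr.
pose P n (h : T n) := forall p, dP n (h (dP n p)) = a k *: dP n p.
have [nx hnx] : exists nx : forall n, {h : T n | P n h} -> {h : T n.+1 | P n.+1 h},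
    forall n h p, dP n.+1 (sval (nx n h) p) = a k *: p - sval h (dP n p).
  have ex n (h : {h : T n | P n h}) : exists h' : {h : T n.+1 | P n.+1 h},
      forall p, dP n.+1 (sval h' p) = a k *: p - sval h (dP n p).
    have [h' hh'] := step n _ (svalP h).
    have Ph' : P n.+1 h' by move=> p; rewrite hh' pres_dd linear0 subr0.
    by exists (exist _ h' Ph').
  exists (fun n h => sval (boolp.cid (ex n h))) => n h p.
  exact: (svalP (boolp.cid (ex n h))).
have P0 : P 0%N h0 by move=> p; rewrite hh0.
pose hs := fix hs n : {h : T n | P n h} := if n is n'.+1 then nx n' (hs n') else exist _ h0 P0.
exists (fun n => sval (hs n)); split=> [p|n p]; first by rewrite hh0.
by rewrite hnx subrK.
Qed.

(** Rees' lemma: Ext^q into Q modulo the first k elements vanishes when q + k < N. The homotopy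
    turns a cocycle in degree q + 1 into one in degree q modulo k + 1 elements; the relation
    obtained is then divided by a_k. *)
Lemma regular_cocycle q k (f : {linear Pr q -> Q}) : (q + k < N)%N ->
  (forall p, J k (f (dP q p))) -> 
  match q return {linear Pr q -> Q} -> Prop with
  | 0 => fun f => forall p, J k (f p)
  | q'.+1 => fun f => exists g : {linear Pr q' -> Q}, forall p, J k (f p - g (dP q' p))
  end f.
Proof.
elim: q k f => [|q IH] k f qk hf.
  have kN : (k < N)%N by lia.
  have [h [h0 _]] := mul_homotopy kN; move=> p; apply: (areg kN).
  have := hf (h 0%N p); rewrite -h0 linearZ /=.
  by [].
have kN : (k < N)%N by lia.
have [h [_ h1]] := mul_homotopy kN.
have ef p : a k *: f p = f (dP q.+1 (h q.+1 p)) + f (h q (dP q p)) by rewrite -linearD -h1 linearZ.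
have hJ p : J k.+1 ((f \o h q)%FUN (dP q p)).
  have -> : (f \o h q)%FUN (dP q p) = a k *: f p - f (dP q.+1 (h q.+1 p)).
    by rewrite ef addrAC subrr add0r.
  by apply: (submodB (sJ _)); [exact: J_mul|apply: J_le; exact: hf].
(* Values in the ideal of k + 1 elements are written as a_k times a linear map modulo the first k;
   linearity of the quotient uses projectivity of P_q. *)
have split1 (e : {linear Pr q -> Q}) : (forall p, J k.+1 (e p)) ->
    exists e' : {linear Pr q -> Q}, forall p, J k (e p - a k *: e' p).
  move=> he.
  pose Sm (x : Q * Q) := J k x.2.
  have sS : submod Sm by split=> [|b x y hx hy]; [exact: submod0 (sJ k)|exact: (sJ k).2].
  have vL b (x y : sub_mod sS) : val (b *: x + y) = b *: val x + val y by exact: linearP.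
  have gL : linear (fun x : sub_mod sS => a k *: (val x).1 + (val x).2).
    by move=> b x y; rewrite vL /= !scalerDr !scalerA [a k * b]mulrC; abel.
  have [|u hu] := lift_exact (g := mklinear gL) (w := e) (@pres_projective _ _ Pr q).
    move=> p; have [g eg] := he p; rewrite big_ord_recr /= in eg.
    have hs : Sm (g k, \sum_(l < k) a l *: g l) by exists g.
    by exists (to_sub sS hs); rewrite [LHS]/= eg addrC.
  have eL : linear (fun p => (val (u p)).1) by move=> b x y; rewrite [u _]linearP vL.
  exists (mklinear eL) => p; rewrite -hu.
  have -> : mklinear gL (u p) - a k *: mklinear eL p = (val (u p)).2.
    by rewrite [LHS]/= addrAC subrr add0r.
  exact: (sub_modP (u p)).
have fin (e' : {linear Pr q -> Q}) (e2 : Pr q.+1 -> Q) : (forall p, J k (e2 p)) ->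
    (forall p, a k *: f p = a k *: e' (dP q p) + e2 p) ->
    exists g : {linear Pr q -> Q}, forall p, J k (f p - g (dP q p)).
  move=> h2 he; exists e' => p; apply: (areg kN).
  by rewrite scalerBr he addrAC subrr add0r; exact: h2.
case: q f qk hf h h1 ef hJ split1 fin IH => [|q] f qk hf h h1 ef hJ split1 fin IH.
  have [e' he'] := split1 (f \o h 0%N)%FUN (IH k.+1 (f \o h 0%N)%FUN ltac:(lia) hJ).
  apply: (fin e' (fun p => f (dP 1 (h 1%N p)) + ((f \o h 0%N)%FUN (dP 0 p) - a k *: e' (dP 0 p)))).
    by move=> p; apply: (submodD (sJ _)); [exact: hf|exact: he'].
  by move=> p; rewrite ef /=; abel.
have [g hg] := IH k.+1 (f \o h q.+1)%FUN ltac:(lia) hJ.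
have [e' he'] := split1 ((f \o h q.+1)%FUN \- (g \o dP q)%FUN) hg.
apply: (fin e' (fun p => f (dP q.+2 (h q.+2 p)) +
    (f (h q.+1 (dP q.+1 p)) - g (dP q (dP q.+1 p)) - a k *: e' (dP q.+1 p)))).
  by move=> p; apply: (submodD (sJ _)); [exact: hf|exact: (he' (dP q.+1 p))].
by move=> p; rewrite ef pres_dd linear0 subr0; abel.
Qed.

Lemma regular_coboundary q (f : {linear Pr q -> Q}) : (q < N)%N -> ext_cocycle f -> ext_coboundary f.
Proof.
move=> qN hf; have J0 x : J 0 x -> x = 0 by move=> [g ->]; rewrite big_ord0.
have := @regular_cocycle q 0 f; rewrite addn0 => /(_ qN) h.
have {}h := h (fun p => _).
case: q f qN hf h => [|q] f qN hf h.
  by move=> p; apply: J0; apply: h => p'; rewrite hf; exact: submod0 (sJ 0).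
have [|g hg] := h; first by move=> p'; rewrite hf; exact: submod0 (sJ 0).
by exists g => p; apply/eqP; rewrite -subr_eq0; apply/eqP; apply: J0.
Qed.
End RegularSequence.
End Balance.

Local Open Scope quotient_scope.

Section KilledModule.
Variables (R : comNzRingType) (I : idealr R) (M : lmodType R).
Hypothesis kill : forall r x, r \in (I : {pred R}) -> r *: (x : M) = 0.
Local Notation A := {ideal_quot I}.

(** The proof is a parameter so that the R/I-module structure can be attached to a new type. *)
Definition killed_mod (_ : forall r x, r \in (I : {pred R}) -> r *: (x : M) = 0) : Type := M.
Local Notation KM := (killed_mod kill).
HB.instance Definition _ := GRing.Zmodule.copy KM M.
Let sc (a : A) (x : KM) : KM := repr a *: (x : M).
Lemma killed_scaleE r (x : M) : repr (\pi_A r) *: x = r *: x.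
Proof.
apply/eqP; rewrite -subr_eq0 -scalerBl; apply/eqP; apply: kill.
by rewrite (Quotient.idealrBE I) reprK.
Qed.
Fact killed_scalerA a b x : sc a (sc b x) = sc (a * b) x.
Proof. by rewrite /sc scalerA -[a in RHS]reprK -[b in RHS]reprK -rmorphM killed_scaleE. Qed.
Fact killed_scale1r : left_id 1 sc.
Proof. by move=> x; rewrite /sc -(rmorph1 \pi_A) killed_scaleE scale1r. Qed.
Fact killed_scalerDr : right_distributive sc +%R.
Proof. by move=> a x y; rewrite /sc scalerDr. Qed.
Fact killed_scalerDl x : {morph sc^~ x : a b / a + b}.
Proof. by move=> a b; rewrite /sc -[a in LHS]reprK -[b in LHS]reprK -rmorphD killed_scaleE scalerDl. Qed.
HB.instance Definition _ := GRing.Zmodule_isLmodule.Build A KM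
  killed_scalerA killed_scale1r killed_scalerDr killed_scalerDl.
Lemma killedE (a : A) (x : KM) : a *: x = (repr a *: (x : M) : M).
Proof. by []. Qed.
End KilledModule.

(** * Change of rings from R to R/I *)

Section ChangeOfRings.
Variables (R : comNzRingType) (I : idealr R).
Local Notation A := {ideal_quot I}.
Local Notation qpi := (quot_pi I).
Local Notation rs N := (restr qpi N).

Lemma restr_scale (N : lmodType A) r (x : rs N) : r *: x = (qpi r *: (x : N) : N).
Proof. by []. Qed.
Lemma pi_kill r : r \in (I : {pred R}) -> qpi r = 0.
Proof.
move=> rI; apply: (eq_trans _ (rmorph0 qpi)); have h := Quotient.idealrBE I r 0.
by apply/eqP; rewrite subr0 rI in h; exact: (esym h).
Qed.
Lemma restr_kill (N : lmodType A) r (x : rs N) : r \in (I : {pred R}) -> r *: x = 0.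
Proof. by move=> /pi_kill rI; rewrite restr_scale rI scale0r. Qed.

Lemma restr_linear (N N' : lmodType A) (f : {linear N -> N'}) : linear (f : rs N -> rs N').
Proof. by move=> a u v; rewrite !restr_scale [LHS]linearP. Qed.

(** [Pj] is projective over R/I while [g] is only R-linear: restricted to the elements killed by I
    and to their images, [g] becomes a surjection of R/I-modules. *)
Lemma lift_killed (Pj : lmodType A) (M N : lmodType R) (g : {linear M -> N}) (w : {linear rs Pj -> N}) :
  projective Pj ->
  (forall p, exists2 x, (forall r, r \in (I : {pred R}) -> r *: x = 0) & g x = w p) ->
  exists h : {linear rs Pj -> M}, forall p, g (h p) = w p.
Proof.
move=> hP hw.
pose M0 (x : M) := forall r, r \in (I : {pred R}) -> r *: x = 0.
have sM : submod M0.
  split=> [r _|a u v hu hv r rI]; first by rewrite scaler0.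
  by rewrite scalerDr scalerA mulrC -scalerA hu // hv // scaler0 addr0.
pose N0 (y : N) := exists2 x, M0 x & g x = y.
have sN : submod N0.
  split; first by exists 0; [exact: submod0 sM|rewrite linear0].
  by move=> a u v [x hx <-] [y hy <-]; exists (a *: x + y); [exact: sM.2|rewrite linearP].
have kM r (x : sub_mod sM) : r \in (I : {pred R}) -> r *: x = 0.
  by move=> rI; apply: val_inj; rewrite linearZ linear0 /=; exact: (sub_modP x).
have kN r (y : sub_mod sN) : r \in (I : {pred R}) -> r *: y = 0.
  move=> rI; apply: val_inj; rewrite linearZ linear0 /=; have [x hx <-] := sub_modP y.
  by rewrite -linearZ hx // linear0.
have gN (x : sub_mod sM) : N0 (g (val x)) by exists (val x) => //; exact: (sub_modP x).
pose g1 (x : killed_mod kM) : killed_mod kN := to_sub sN (gN x).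
have g1L : linear g1.
  by move=> a x y; apply: val_inj; rewrite /g1 /= linearP.
pose w1 (p : Pj) : killed_mod kN := to_sub sN (hw p).
have w1L : linear w1.
  move=> a x y; apply: val_inj; rewrite /w1 /=.
  by rewrite -[a in LHS]reprK -[_ *: x]/(repr a *: (x : rs Pj)) linearP.
have [|h hh] := hP _ _ (mklinear g1L) (mklinear w1L).
  move=> y; have [x hx e] := sub_modP (y : sub_mod sN).
  by exists (to_sub sM hx); apply: val_inj; rewrite /= e.
have hL : linear (fun p : rs Pj => val (h p : sub_mod sM)).
  move=> a x y; rewrite restr_scale [h _]linearP killedE.
  rewrite linearP; congr (_ + _).
  apply/eqP; rewrite -subr_eq0 -scalerBl; apply/eqP; apply: (sub_modP (h x : sub_mod sM)).
  by rewrite (Quotient.idealrBE I) reprK.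
by exists (mklinear hL) => p; have /(congr1 val) := hh p.
Qed.

Variables (E : inj_resolution (R^o : lmodType R)) (c : nat).
Notation dE := (ires_d E).
(** The complex Hom_R(A, E), whose cohomology is Ext_R(A, R); [exl] and [exr] below say that it is
    exact away from degree c. *)
Definition EI q (x : E q) := forall r, r \in (I : {pred R}) -> r *: x = 0.
Lemma submod_EI q : submod (@EI q).
Proof.
split=> [r _|a u v hu hv r rI]; first by rewrite scaler0.
by rewrite scalerDr scalerA mulrC -scalerA hu // hv // scaler0 addr0.
Qed.
Lemma EI_lin q q' (f : {linear E q -> E q'}) x : EI x -> EI (f x).
Proof. by move=> h r rI; rewrite -linearZ h // linear0. Qed.
Lemma EI_restr (N : lmodType A) q (f : {linear rs N -> E q}) x : EI (f x).
Proof. by move=> r rI; rewrite -linearZ (restr_kill x rI) linear0. Qed.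

Hypothesis c0 : (0 < c)%N.
Hypothesis ex0 : forall x : E 0, EI x -> dE 0 x = 0 -> x = 0.
Hypothesis exl : forall q (x : E q.+1), (q.+1 < c)%N -> EI x -> dE q.+1 x = 0 ->
  exists2 y : E q, EI y & dE q y = x.
Hypothesis exr : forall q (x : E q.+1), (c < q.+1)%N -> EI x -> dE q.+1 x = 0 ->
  exists2 y : E q, EI y & dE q y = x.

(** Below degree c the torsion complex is exact, starts at 0 and consists of injective A-modules, so
    it is contractible. Each map is defined on boundaries and extended to all of E^(q+1) by
    injectivity of E^q. *)
Lemma contraction : exists sg : forall q, {linear E q.+1 -> E q},
  (forall x, EI x -> sg 0%N (dE 0 x) = x) /\
  forall q x, (q.+1 < c)%N -> EI x -> sg q.+1 (dE q.+1 x) + dE q (sg q x) = x.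
Proof.
pose good q (s : {linear E q.+1 -> E q}) (phi : E q -> E q) := forall x, EI x -> s (dE q x) = x - phi x.
have base : exists s : {linear E 1 -> E 0}, forall x, EI x -> s (dE 0 x) = x.
  have [||s _ hs] := @extend_linear R (E 0) (E 0) (E 1) (dE 0) (@EI 0) (fun y => y = 0) id
    (@ires_injective _ _ E 0) (submod_EI 0) (submod00 _) => //.
  by exists s.
have step q (s : {linear E q.+1 -> E q}) : (q.+1 < c)%N ->
    (forall y : E q, EI y -> dE q (s (dE q y)) = dE q y) ->
    exists s' : {linear E q.+2 -> E q.+1}, forall x, EI x -> s' (dE q.+1 x) = x - dE q (s x).
  move=> qc hs.
  have [||s' _ hs'] := @extend_linear R (E q.+1) (E q.+1) (E q.+2) (dE q.+1) (@EI q.+1) (fun y => y = 0)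
    (fun x => x - dE q (s x)) (@ires_injective _ _ E q.+1) (submod_EI q.+1) (submod00 _).
  - by move=> a u v _ _; rewrite [s _]linearP [dE q _]linearP /= scalerBr; abel.
  - by move=> z hz /(exl qc hz)[y hy <-]; rewrite hs // subrr.
  - by exists s'.
pose P q (s : {linear E q.+1 -> E q}) := (q.+1 < c)%N -> forall y : E q, EI y -> dE q (s (dE q y)) = dE q y.
have ex q (s : {s | P q s}) : exists s' : {s | P q.+1 s},
    (q.+1 < c)%N -> forall x, EI x -> sval s' (dE q.+1 x) = x - dE q (sval s x).
  have [qc|qc] := boolP (q.+1 < c)%N.
    have [s' hs'] := step q (sval s) qc (svalP s qc).
    have Ps' : P q.+1 s' by move=> _ y hy; rewrite hs' // linearB /= ires_dd subr0.
    by exists (exist _ s' Ps').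
  have P0 : P q.+1 (\0%R : {linear _ -> _}) by move=> q2; case/negP: qc; exact: ltnW.
  by exists (exist _ _ P0).
have [s0 hs0] := base.
have P0 : P 0%N s0 by move=> _ y hy; rewrite hs0.
pose ss := fix ss q : {s | P q s} := if q is q'.+1 then sval (boolp.cid (ex q' (ss q'))) else exist _ s0 P0.
exists (fun q => sval (ss q)); split=> [|q x qc hx]; first exact: hs0.
by rewrite [sval (ss q.+1) _](svalP (boolp.cid (ex q (ss q))) qc x hx) subrK.
Qed.

(* Ext_A^j into the kernel of d on the killed part of the injective resolution *)
Section Shift.
Variables (N : lmodType A) (Pr : proj_resolution N) (m0 : nat).
Notation dP := (pres_d Pr).
Hypothesis vanish : forall m (f : {linear rs N -> E m.+1}), (m0 <= m.+1)%N ->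
  (forall x, dE m.+1 (f x) = 0) -> exists h : {linear rs N -> E m}, forall x, f x = dE m (h x).

Let dPr i := mklinear (restr_linear (dP i)) : {linear rs (Pr i.+1) -> rs (Pr i)}.
Let augr := mklinear (restr_linear (pres_aug Pr)) : {linear rs (Pr 0) -> rs N}.

(** Above degree c the cocycles Z^q of the torsion complex satisfy 0 -> Z^q -> EI^q -> Z^(q+1) -> 0.
    So Ext_A^(j+1)(N, Z^q) moves to Ext_A^1(N, Z^(q+j)), and its class lies in Ext_R^(q+j+1)(N, R),
    which [vanish] makes zero. *)
Lemma shift j q (f : {linear rs (Pr j.+1) -> E q}) : (c <= q)%N -> (m0 <= q + j.+1)%N ->
  (forall p, f (dPr j.+1 p) = 0) -> (forall p, dE q (f p) = 0) ->
  exists g : {linear rs (Pr j) -> E q}, (forall p, f p = g (dPr j p)) /\ forall p, dE q (g p) = 0.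
Proof.
elim: j q f => [|j IH] q f cq mq f1 f2.
  have [|g0 hg0] := extend_exact (d1 := dPr 1) (d0 := dPr 0) (w := f) (@ires_injective _ _ E q) _ f1.
    by move=> x /(@pres_exact _ _ Pr).
  have [||phi hphi] := extend_exact (d1 := dPr 0) (d0 := augr) (w := (dE q \o g0)%FUN) (@ires_injective _ _ E q.+1).
  - by move=> x /(@pres_exact0 _ _ Pr).
  - by move=> y /=; rewrite hg0.
  have [||psi hpsi] := vanish (m := q) (f := phi); first by rewrite -addn1.
    move=> x; have [p <-] := @pres_surj _ _ Pr x.
    by have -> := hphi p; exact: ires_dd.
  exists (g0 \- (psi \o augr)%FUN); split=> p /=.
    have -> : augr (dPr 0 p) = 0 by apply/(@pres_exact0 _ _ Pr); exists p.
    by rewrite linear0 subr0 hg0.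
  by rewrite linearB /= -hpsi hphi subrr.
have [|g0 hg0] := extend_exact (d1 := dPr j.+2) (d0 := dPr j.+1) (w := f) (@ires_injective _ _ E q) _ f1.
  by move=> x /(@pres_exact _ _ Pr).
have [||||k [hk1 hk2]] := IH q.+1 (dE q \o g0)%FUN.
- exact: leqW.
- by rewrite addSnnS.
- by move=> p /=; rewrite hg0.
- by move=> p; exact: ires_dd.
have [|k' hk'] := lift_killed (g := dE q) (w := k) (@pres_projective _ _ Pr j).
  by move=> p; apply: exr => //; exact: EI_restr.
exists (g0 \- (k' \o dPr j)%FUN); split=> p /=.
  have -> : dPr j (dPr j.+1 p) = 0 by apply/(@pres_exact _ _ Pr); exists p.
  by rewrite linear0 subr0 hg0.
by rewrite linearB /= hk' -hk1 subrr.
Qed.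
End Shift.
End ChangeOfRings.

Local Open Scope quotient_scope.

Section CanonicalExt.
Variables (R : comNzRingType) (I : idealr R).
Local Notation A := {ideal_quot I}.
Local Notation qpi := (quot_pi I).
Local Notation rs N := (restr qpi N).
Local Notation RA := (rs A^o).
Variables (E : inj_resolution (R^o : lmodType R)).
Notation dE := (ires_d E).
Variable P : proj_resolution RA.
Notation dP := (pres_d P).
Notation aug := (pres_aug P).
Notation iota := (ires_aug E).

Local Notation EI := (@EI R I E _).

Lemma repr_eq (p q : R) : \pi_A p = \pi_A q -> p - q \in I.
Proof. by move=> e; rewrite (Quotient.idealrBE I) e eqxx. Qed.
(** An element killed by I is the same as a linear map from A, the one taking that value at 1. *)
Lemma elt_linear q (x : E q) : EI x -> linear (fun a : RA => repr (a : A) *: x).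
Proof.
move=> hx r a b /=; rewrite scalerA -scalerDl; apply/eqP; rewrite -subr_eq0 -scalerBl; apply/eqP; apply: hx.
apply: repr_eq; rewrite rmorphD rmorphM /= (reprK (a : A)) (reprK (b : A)).
exact: (reprK (r *: a + b : A)).
Qed.
Lemma elt_bic q (x : E q) (hx : EI x) : dE q x = 0 -> bic (mklinear (elt_linear hx) \o aug)%FUN.
Proof.
move=> dx; split=> p /=; last by rewrite [dE q _]linearZ /= dx scaler0.
by rewrite aug_d; apply: (linear0 (mklinear (elt_linear hx))).
Qed.
Lemma p1_ex : exists p1 : P 0, aug p1 = (1 : A).
Proof. exact: pres_surj. Qed.
Lemma elt_of q (v : {linear P 0 -> E q}) p1 : aug p1 = (1 : A) -> (forall p, v (dP 0 p) = 0) ->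
  EI (v p1) /\ forall p, v p = repr (aug p : A) *: v p1.
Proof.
move=> h1 hv.
have ker p : aug p = 0 -> v p = 0 by move=> /pres_exact0[y <-].
have aug1 r : aug (r *: p1) = \pi_A r by rewrite linearZ /= h1 restr_scale /= [LHS]mulr1.
split=> [r rI|p].
  rewrite -linearZ; apply: ker; rewrite aug1; exact: (pi_kill rI).
rewrite -linearZ; apply/eqP; rewrite -subr_eq0 -linearB; apply/eqP; apply: ker.
by rewrite linearB /= aug1 reprK subrr.
Qed.
Lemma elt1 q (x : E q) : EI x -> repr (1 : A) *: x = x.
Proof.
move=> hx; apply/eqP; rewrite -{2}[x]scale1r -subr_eq0 -scalerBl; apply/eqP; apply: hx.
by rewrite (Quotient.idealrBE I) reprK rmorph1.
Qed.
Lemma triv_elt q (x : E q.+1) (hx : EI x) : triv (mklinear (elt_linear hx) \o aug)%FUN ->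
  exists2 y : E q, EI y & dE q y = x.
Proof.
move=> [v hv xv]; have [p1 h1] := p1_ex; have [ey _] := elt_of h1 hv.
by exists (v p1) => //; rewrite -xv /= h1 elt1.
Qed.
Lemma triv_elt0 (x : E 0) (hx : EI x) : triv (mklinear (elt_linear hx) \o aug)%FUN -> x = 0.
Proof. by move=> h; have [p1 h1] := p1_ex; have := h p1; rewrite /= h1 elt1. Qed.

Lemma EI_exact N : (forall q (f : {linear P q -> R^o}), (q < N)%N -> ext_cocycle f -> ext_coboundary f) ->
  ((0 < N)%N -> forall x : E 0, EI x -> dE 0 x = 0 -> x = 0) /\
  (forall q (x : E q.+1), (q.+1 < N)%N -> EI x -> dE q.+1 x = 0 -> exists2 y : E q, EI y & dE q y = x).
Proof.
move=> hN; have main q (x : E q) (hx : EI x) : (q < N)%N -> dE q x = 0 ->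
    triv (mklinear (elt_linear hx) \o aug)%FUN.
  move=> qN dx; apply: triv_Rel; first exact: elt_bic.
  by apply: Rel_sub (Rel_exists (elt_bic hx dx)) => f; apply: hN.
by split=> [N0 x hx dx|q x qN hx dx]; [apply: (triv_elt0 (main _ _ hx N0 dx))|apply: (triv_elt (main _ _ hx qN dx))].
Qed.

Lemma EI_exact_top c : (forall m (f : {linear RA -> E m.+1}), (c <= m)%N ->
    (forall x, dE m.+1 (f x) = 0) -> exists h : {linear RA -> E m}, forall x, f x = dE m (h x)) ->
  forall q (x : E q.+1), (c < q.+1)%N -> EI x -> dE q.+1 x = 0 -> exists2 y : E q, EI y & dE q y = x.
Proof.
move=> van q x cq hx dx; have [||h hh] := van q (mklinear (elt_linear hx)) => //.
  by move=> a /=; rewrite [dE q.+1 _]linearZ /= dx scaler0.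
by exists (h (1 : A)); [exact: EI_restr|rewrite -hh /= elt1].
Qed.

Lemma Rel_witness F m i (w : {linear P i -> E m}) : Rel F w ->
  exists n (f : {linear P n -> R^o}), [/\ n = (i + m)%N, F n f &
    forall G : forall n, {linear P n -> R^o} -> Prop, G n f -> Rel G w].
Proof.
elim: m i w => [|m IH] i w /= [f hf hF].
  by exists i, f; split=> //; [rewrite addn0|move=> G Gf; exists f].
have [n [g [e Fg hG]]] := IH _ _ hF; exists n, g; split=> //; first by rewrite e addSnnS.
by move=> G Gg; exists f => //; exact: hG.
Qed.

Variables (c2 : nat) (KA : lmodType A).
Local Notation c := c2.+2.
Variable cl : {linear P c -> R^o} -> KA.
Hypothesis clP : Ext_class qpi cl.
Hypothesis reg0 : forall q (f : {linear P q -> R^o}), (q < c)%N -> ext_cocycle f -> ext_coboundary f.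
Hypothesis vanA : forall m (f : {linear RA -> E m.+1}), (c <= m)%N ->
    (forall x, dE m.+1 (f x) = 0) -> exists h : {linear RA -> E m}, forall x, f x = dE m (h x).

(** The zigzag ends in degree 0 + c, so the class map, which exists in degree c only, is applied
    after a cast. *)
Definition Fcl y n (f : {linear P n -> R^o}) := ext_cocycle f /\
  forall e : n = c, cl (ecast m {linear P m -> R^o} e f) = y.
Lemma Fcl_c y (f : {linear P c -> R^o}) : Fcl y f <-> ext_cocycle f /\ cl f = y.
Proof.
split=> [[h1 h2]|[h1 h2]]; split=> //; first by rewrite -(h2 erefl).
by move=> e; rewrite (eq_irrelevance e erefl).
Qed.
Let Z (x : E c) := EI x /\ dE c x = 0.
Let sZ : submod Z. Proof. exact: (submodI (submod_EI I E _) (submod_ker _ (submod00 _))). Qed.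
Definition Th (x : E c) y := exists hx : EI x, Rel (Fcl y) (mklinear (elt_linear hx) \o aug)%FUN.

Lemma Th_ex x : Z x -> exists y, Th x y.
Proof.
move=> [hx dx]; have [n [f [e cf hG]]] := Rel_witness (Rel_exists (elt_bic hx dx)).
rewrite add0n in e; subst n; exists (cl f), hx; apply: hG; exact/Fcl_c.
Qed.
Lemma Th_lin r x x' y y' : Th x y -> Th x' y' -> Th (r *: x + x') (qpi r *: y + y').
Proof.
move=> [hx h] [hx' h']; have hx2 := (submod_EI I E c).2 r _ _ hx hx'; exists hx2.
apply: (Rel_lin (a := r) _ _ h h') => [n f g k [cf ef] [cg eg] hk|p /=]; last first.
  by rewrite scalerDr !scalerA [r * _]mulrC.
split=> [z|e]; first by rewrite hk cf cg scaler0 addr0.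
subst n; rewrite /=; have [clL _ _] := clP.
by rewrite -(ef erefl) -(eg erefl) /=; apply: clL.
Qed.
Lemma Th_0 x : Th x 0 -> Z x -> exists2 b : E c2.+1, EI b & dE _ b = x.
Proof.
move=> [hx h] [_ dx]; apply: (triv_elt (hx := hx)); apply: triv_Rel; first exact: elt_bic.
apply: Rel_sub h => f /Fcl_c[cf ef]; have [_ _ cl0] := clP; exact/(cl0 _ cf).
Qed.
Lemma Th_bd b y : EI b -> Th (dE c2.+1 b) y -> y = 0.
Proof.
move=> hb [hx h].
have tr : triv (mklinear (elt_linear hx) \o aug)%FUN.
  exists (mklinear (elt_linear hb) \o aug)%FUN => p /=; last by rewrite linearZ.
  by rewrite aug_d; apply: (linear0 (mklinear (elt_linear hb))).
have [n [f [e [Ff bf] _]]] := Rel_witness (Rel_triv h tr); rewrite add0n in e; subst n.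
have [cf <-] := (Fcl_c _ _).1 Ff; have [_ _ cl0] := clP; exact/(cl0 _ cf).
Qed.
Lemma Th_surj y : exists2 x, Z x & Th x y.
Proof.
have [_ clS _] := clP; have [f cf ef] := clS y.
have bw : bic (iota \o f)%FUN by split=> p /=; [rewrite cf linear0|exact: dE_iota].
have Fw : Rel (Fcl y) (m := 0) (iota \o f)%FUN by exists f => //; exact/Fcl_c.
have := Rel_surj bw Fw; rewrite addn0 => -[w0 [b1 b2] Fw0].
have [p1 h1] := p1_ex; have [hx e] := elt_of h1 b1.
exists (w0 p1); first by split; [exact: hx|exact: b2].
by exists hx; apply: Rel_ext Fw0 => p; rewrite /= -e.
Qed.

Let EIx := EI_exact reg0.
Let EIt := EI_exact_top vanA.

Lemma Th_uniq x y y' : Th x y -> Th x y' -> y = y'.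
Proof.
move=> h h'; have := Th_lin (-1) h' h; rewrite scaleN1r addNr rmorphN1 scaleN1r => h0.
have : Th (dE c2.+1 0) (- y' + y) by rewrite linear0.
by move/(Th_bd (submod0 (submod_EI I E _))) => /eqP; rewrite addrC subr_eq0 => /eqP.
Qed.

(** The boundaries in degree c split off by [contraction], so K_A embeds as a summand of the
    cocycles Z. A cocycle with values in K_A is pushed to Z, made a coboundary there by [shift], and
    mapped back. *)
Theorem Ext_canonical_zero (N : lmodType A) m0 j :
  (forall m (f : {linear rs N -> E m.+1}), (m0 <= m.+1)%N ->
    (forall x, dE m.+1 (f x) = 0) -> exists h : {linear rs N -> E m}, forall x, f x = dE m (h x)) ->
  (0 < j)%N -> (m0 <= c + j)%N -> Ext_zero N KA j.
Proof.
move=> vanN j0 mj Pr f cf.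
have [sg [_ sg1]] := @contraction R I E c (EIx.1 isT) EIx.2.
(* The projection onto the boundaries provided by the contraction. *)
pose rho x := dE c2.+1 (sg c2.+1 x).
have rho_b b : EI b -> rho (dE _ b) = dE _ b.
  by move=> hb; rewrite /rho -{2}(sg1 c2 b) // linearD /= ires_dd addr0.
have ex1 (x : E c) : exists y : KA, Z x -> Th x y.
  by have [/Th_ex[y hy]|nz] := EM (Z x); [exists y|exists 0].
have [th hth] := boolp.choice ex1.
have ex2 (y : KA) : exists x : E c, Z x /\ Th x y by have [x] := Th_surj y; exists x.
have [se hse] := boolp.choice ex2.
(* Removing the boundary part makes the chosen representative canonical, which is what makes [s]
   compatible with the module structures. *)
pose s y := se y - rho (se y).
have rhoL a x y : rho (a *: x + y) = a *: rho x + rho y by rewrite /rho !linearP.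
have rhoB u v : rho (u - v) = rho u - rho v.
  by have := rhoL (-1) v u; rewrite !scaleN1r ![- _ + _]addrC.
have Zrho x : Z x -> Z (rho x).
  by move=> [hx _]; split; [do 2!apply: EI_lin; exact: hx|rewrite /rho ires_dd].
have Zs y : Z (s y) by apply: (submodB sZ); [|apply: Zrho]; exact: (hse y).1.
have well x y : Z x -> Th x y -> s y = x - rho x.
  move=> zx h; have [zs hs] := hse y.
  have := Th_lin (-1) h hs; rewrite scaleN1r addrC rmorphN1 scaleN1r addNr => h0.
  have [|b hb eb] := Th_0 h0; first exact: (submodB sZ).
  have e := rho_b _ hb; rewrite eb rhoB in e.
  rewrite /s; have -> : rho (se y) = rho x + (se y - x) by rewrite -e addrCA subrr addr0.
  abel.
have th_s y : th (s y) = y.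
  have [zs hs] := hse y; have := Th_lin (-1) (hth _ (Zrho _ zs)) hs.
  rewrite scaleN1r addrC rmorphN1 scaleN1r.
  have -> : th (rho (se y)) = 0.
    by apply: Th_bd (hth _ (Zrho _ zs)); apply: EI_lin; exact: zs.1.
  by rewrite oppr0 add0r => h; exact: (Th_uniq (hth _ (Zs y)) h).
case: j j0 mj f cf => // j _ mj f cf.
have fL : linear (fun p : rs (Pr j.+1) => s (f p)).
  move=> r u v; rewrite restr_scale [f _]linearP.
  have [zu hu] := hse (f u); have [zv hv] := hse (f v).
  rewrite (well _ _ _ (Th_lin r hu hv)); last exact: sZ.2.
  by rewrite rhoL /s scalerBr; abel.
have s0 : s 0 = 0.
  have h0 : Th 0 0 by have := Th_lin 0 (hse 0).2 (hse 0).2; have := Th_lin (-1) (hse 0).2 (hse 0).2; rewrite scaleN1r addNr scaler0 addr0.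
  have r0 : rho 0 = 0 by rewrite /rho [sg _ 0]linear0 linear0.
  by rewrite (well _ _ (submod0 sZ) h0) r0 subrr.
have [||g [g1 g2]] := @shift R I E c EIt N Pr m0 vanN j c (mklinear fL) (leqnn _) mj.
- by move=> p /=; rewrite cf s0.
- by move=> p /=; exact: (Zs _).2.
have Zg p : Z (g p) by split; [exact: EI_restr|exact: g2].
have hL : linear (fun p : Pr j => th (g p)).
  move=> a u v; have -> : a *: u + v = (repr a *: (u : rs (Pr j)) + v : rs (Pr j)) by rewrite restr_scale /= reprK.
  rewrite linearP -[in RHS](reprK a); apply: (Th_uniq (hth _ (sZ.2 _ _ _ (Zg u) (Zg v)))).
  by apply: Th_lin; apply: hth.
by exists (mklinear hL) => p /=; rewrite -[LHS]th_s; congr th; exact: (g1 p).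
Qed.
End CanonicalExt.

(** * Radicals, minors and general matrices *)

Section IdealSpan.
Variable R : comNzRingType.
Implicit Types (J : R^o -> Prop) (l : seq R) (r x y : R).

(** Membership in J + (l), peeling off one generator at a time so that J can grow in inductions. *)
Fixpoint isp J l r : Prop := if l is y :: l' then exists h, isp J l' (r - h * y) else J r.

Lemma submod_isp J l : submod J -> submod (isp J l : R^o -> Prop).
Proof.
move=> sJ; elim: l => //= y l [h0 hD]; split; first by exists 0; rewrite mul0r subr0.
move=> a u v [h hu] [k hv]; exists (a * h + k).
have -> : a *: u + v - (a * h + k) * y = a *: (u - h * y : R^o) + (v - k * y) :> R^o.
  by rewrite scalerBr mulrDl -mulrA -[a *: (h * y : R^o)]/(a * (h * y)); abel.
exact: hD.
Qed.
Lemma isp_base J l r : J r -> isp J l r.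
Proof. by move=> h; elim: l => //= y l IH; exists 0; rewrite mul0r subr0. Qed.
Lemma isp_gen J l (I : R^o -> Prop) r : submod I -> (forall x, J x -> I x) ->
  (forall y, y \in l -> I y) -> isp J l r -> I r.
Proof.
move=> sI JI; elim: l r => [|y l IH] r hl /=; first by move=> /JI.
move=> [h hr]; have {}hr : I (r - h * y).
  by apply: IH hr => z zl; apply: hl; rewrite inE zl orbT.
have -> : r = (r - h * y) + h * y by rewrite subrK.
apply: (submodD sI hr); apply: (submodZ sI h (u := y)); apply: hl; exact: mem_head.
Qed.
Lemma isp_mem J l y : submod J -> y \in l -> isp J l y.
Proof.
move=> sJ; elim: l => //= z l IH; rewrite inE => /orP[/eqP->|/IH h].
  by exists 1; rewrite mul1r subrr; exact: (submod0 (submod_isp l sJ)).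
by exists 0; rewrite mul0r subr0.
Qed.
Lemma isp_sub J l l' r : submod J -> {subset l <= l'} -> isp J l r -> isp J l' r.
Proof.
move=> sJ ll; apply: isp_gen; first exact: submod_isp.
  by move=> x; exact: isp_base.
by move=> y /ll; exact: isp_mem.
Qed.
Lemma isp_sum J l r : isp J l r -> exists r0 (h : nat -> R), J r0 /\ r = r0 + \sum_(i < size l) h i * l`_i.
Proof.
elim: l r => [|y l IH] r /=; first by exists r, (fun=> 0); rewrite big_ord0 addr0.
move=> [h /IH[r0 [g [hr e]]]]; exists r0, (fun i => if i is i'.+1 then g i' else h); split=> //.
by rewrite big_ord_recl /= -[LHS](subrK (h * y)) e; abel.
Qed.
(** One generator y is replaced at a time: (x^a)^N - (h y)^N is a multiple of x^a - h y, and (h y)^N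
    lies in the ideal of y^N. *)
Lemma isp_pow J l x a N : submod J -> isp J l (x ^+ a) ->
  exists a', isp J [seq y ^+ N | y <- l] (x ^+ a').
Proof.
elim: l J a => [|y l IH] J a sJ /=; first by exists a.
move=> [h hx]; pose J1 := isp J [:: y ^+ N].
have sJ1 : submod (J1 : R^o -> Prop) by exact: submod_isp.
have [|a' ha'] := IH J1 (a * N)%N sJ1.
  have s1 := submod_isp l sJ1.
  have -> : x ^+ (a * N) = ((x ^+ a) ^+ N - (h * y) ^+ N) + h ^+ N * y ^+ N by rewrite exprM exprMn subrK.
  apply: (submodD s1); last first.
    by apply: (submodZ s1 (h ^+ N) (u := y ^+ N)); apply: isp_base; exact: isp_mem (mem_head _ _).
  rewrite subrXX mulrC; apply: (submodZ s1 _ (u := x ^+ a - h * y)).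
  by apply: (isp_gen s1 _ _ hx) => [z Jz|z zl]; [do 2!apply: isp_base|exact: isp_mem].
exists a'; apply: (isp_gen (submod_isp (y ^+ N :: _) sJ) _ _ ha') => [z [k hk]|z zl].
  by exists k; exact: isp_base.
by apply: isp_mem => //; rewrite inE zl orbT.
Qed.
Lemma isp_nil J l x a : submod J -> (forall y, y \in l -> exists b, J (y ^+ b)) ->
  isp J l (x ^+ a) -> exists b, J (x ^+ b).
Proof.
move=> sJ; elim: l a => [|y l IH] a hl /=; first by exists a.
move=> [h hx]; have [b hb] := hl y (mem_head _ _); have s1 := submod_isp l sJ.
apply: (IH (a * b)%N) => [z zl|]; first by apply: hl; rewrite inE zl orbT.
have -> : x ^+ (a * b) = ((x ^+ a) ^+ b - (h * y) ^+ b) + h ^+ b * y ^+ b by rewrite exprM exprMn subrK.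
apply: (submodD s1); last by apply: (submodZ s1 (h ^+ b) (u := y ^+ b)); apply: isp_base.
by rewrite subrXX mulrC; apply: (submodZ s1 _ (u := x ^+ a - h * y)).
Qed.
End IdealSpan.

(** * Detection by depth over the polynomial ring *)

Section Detect.
Variables (K : fieldType) (n : nat).
Local Notation R := {mpoly K[n.+1]}.
Local Notation zeroP := (fun u => u = 0).
Definition homR (e : nat) (r : R) : Prop := r \is e.-homog.
Fact gRD e (u v : R^o) : pihomog mdeg e (u + v) = pihomog mdeg e u + pihomog mdeg e v :> R^o.
Proof. exact: pihomogD. Qed.
Fact gR_sum (u : R^o) : exists N, forall N', (N <= N')%N -> u = \sum_(e < N') pihomog mdeg e u :> R^o.
Proof. by exists (msize u) => N' h; apply: pihomog_partitionE. Qed.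
Fact gR_hom a r e (u : R^o) : homR a r -> pihomog mdeg e (r *: u) =
  if (a <= e)%N then r *: (pihomog mdeg (e - a) u : R^o) else 0 :> R^o.
Proof.
move=> hr; rewrite -[r *: u]/(r * u) {1}(pihomog_partitionE (mf := mdeg) (leqnn (msize u))) mulr_sumr raddf_sum /=.
have hd d : r * pihomog mdeg d u \is (a + d).-homog by apply: dhomogM => //; exact: pihomogP.
rewrite (eq_bigr (fun d : 'I__ => if (a + d == e)%N then r * pihomog mdeg d u else 0)); last first.
  move=> d _; case: eqP => [<-|/eqP ne]; first by rewrite pihomog_dE.
  by rewrite (pihomog_ne0 ne).
rewrite -big_mkcond /=; case: leqP => h; last by rewrite big1 // => d /eqP e0; move: h; rewrite -e0 ltnNge leq_addr.
rewrite -[r *: _]/(r * _); have [lt|ge] := ltnP (e - a) (msize u).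
  rewrite (big_pred1 (Ordinal lt)) // => d; rewrite /= -val_eqE /=; lia.
rewrite big1 => [|d /eqP e0]; last by move: (ltn_ord d); lia.
suff -> : pihomog mdeg (e - a) u = 0 by rewrite mulr0.
rewrite pihomogE big1_seq // => m' /andP[/eqP dm' mu].
by have := msize_mdeg_lt mu; rewrite dm' ltnNge ge.
Qed.
Definition gR : grading homR R^o := Grading gRD gR_sum gR_hom.

(** Degree of a homogeneous form, with 1 for the zero polynomial so that forms of positive degree
    always get a positive number. *)
Definition dg (y : R) : nat := if y == 0 then 1 else (msize y).-1.
Lemma dgP d y : homR d y -> (0 < d)%N -> homR (dg y) y /\ (0 < dg y)%N.
Proof.
move=> h d0; rewrite /dg; have [->|y0] := eqVneq y 0; first by split=> //; exact: dhomog0.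
have h' := dhomog_msize h; split=> //.
by rewrite -(dhomog_uniq y0 h h').
Qed.

Variables (Q : lmodType R) (E : inj_resolution Q).
Local Notation Xl := (Xlist n.+1 K).
Definition poshom (y : R) := exists2 d, (0 < d)%N & homR d y.
Definition prim (l : seq R) := forall x, x \in Xl -> exists a, isp (zeroP : R^o -> Prop) l (x ^+ a).
Lemma prim_sub l l' : {subset l <= l'} -> prim l -> prim l'.
Proof. by move=> ll h x /h[a ha]; exists a; apply: isp_sub ha => //; exact: submod00. Qed.

(** All the forms are raised to one common positive power; those of [cs] then carry [u] into [B],
    the radical is unchanged, and there are fewer forms in [aux] than the depth n + 1 - p. *)
Lemma detect_span (M : lmodType R) (g : grading homR M) (Z B : M -> Prop) (aux cs : seq R) p u :
  submod Z -> submod B -> (forall v, B v -> Z v) -> graded g Z -> graded g B ->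
  pdc Xl E p Z B -> (p + size aux < n.+1)%N -> (forall y, y \in aux ++ cs -> poshom y) ->
  prim (aux ++ cs) -> Z u -> (forall y, y \in cs -> exists a, B (y ^+ a *: u)) -> B u.
Proof.
move=> sZ sB BZ gZ gB [hCV _] hp hpos hpr Zu hu.
have [N hN] : exists N, forall y, y \in cs -> B (y ^+ N.+1 *: u).
  elim: cs hu {hpos hpr} => [|y cs IH] hu; first by exists 0%N.
  have [|N hN] := IH; first by move=> z zc; apply: hu; rewrite inE zc orbT.
  have [a ha] := hu y (mem_head _ _); exists (a + N)%N => z; rewrite inE => /orP[/eqP->|/hN h].
    by rewrite -addnS addnC exprD -scalerA; exact: (submodZ sB).
  by rewrite -addnS exprD -scalerA; exact: (submodZ sB).
have pw y : y \in aux ++ cs -> homR (dg (y ^+ N.+1)) (y ^+ N.+1) /\ (0 < dg (y ^+ N.+1))%N.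
  move=> /hpos[d d0 hd]; apply: (dgP (d := (d * N.+1)%N)); last by rewrite muln_gt0 d0.
  exact: dhomogMn.
apply: (depth_torsion_free (g := g) (deg := dg) sZ sB BZ gZ gB (X := Xl)
    (aux := [seq y ^+ N.+1 | y <- aux]) (c := [seq y ^+ N.+1 | y <- cs]) (D := (n.+1 - p)%N)) => //.
- by move=> i hi; apply: hCV; rewrite size_Xlist; lia.
- by rewrite size_map ltn_subRL.
- by move=> y; rewrite -map_cat => /mapP[z /pw[hz _] ->].
- by move=> y /mapP[z zc ->]; apply: (pw z _).2; rewrite mem_cat zc.
- move=> x /hpr[a ha]; have [a' ha'] := isp_pow N.+1 (submod00 _) ha.
  by have [r0 [h [-> e]]] := isp_sum ha'; exists a', h; rewrite -map_cat e add0r.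
- by move=> y /mapP[z zc ->]; apply: hN.
Qed.

Section Regular.
Variables (c : nat) (De : nat -> R) (aux : seq R).
Hypotheses (free0 : pdc Xl E 0 (fun _ : R^o => True) zeroP).
Hypothesis De_hom : forall l, (l < c)%N -> poshom (De l).
Hypothesis aux_hom : forall y, y \in aux -> poshom y.
Hypothesis size_aux : (size aux + c <= n.+1)%N.
Hypothesis prim_De : prim (aux ++ [seq De l | l <- iota 0 c]).
Let J k (f : R^o) := exists g : nat -> R^o, f = \sum_(l < k) De l *: g l.
Let sJ k : submod (J k).
Proof.
split; first by exists (fun=> 0); rewrite big1 // => l _; rewrite scaler0.
move=> b u v [g ->] [g' ->]; exists (fun l => b *: g l + g' l).
rewrite scaler_sumr -big_split; apply: eq_bigr => l _ /=.
by rewrite scalerDr !scalerA mulrC.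
Qed.
Let J_mem k l f : (l < k)%N -> J k (De l *: f).
Proof.
move=> lk; exists (fun i => if i == l then f else 0).
rewrite (bigD1 (Ordinal lk)) //= eqxx big1 ?addr0 // => i; rewrite -val_eqE /= => /negbTE->.
by rewrite scaler0.
Qed.
Let gJ k : (k <= c)%N -> graded gR (J k).
Proof.
move=> kc e u [g ->]; rewrite [gpi _ _ _]raddf_sum /=; apply: (submod_sum (sJ k)) => l _.
have [d _ hd] := De_hom (leq_trans (ltn_ord l) kc).
by rewrite [pihomog _ _ _](gR_hom _ _ hd); case: ifP => _; [exact: J_mem|exact: submod0 (sJ k)].
Qed.
(** Modulo J_k the element [f] is killed by De_0, ..., De_k; the later De_l join [aux]. Their number
    stays below the depth n + 1 - k of R/J_k, so [f] is zero there. *)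
Let areg1 k f : (k < c)%N -> pdc Xl E k (fun _ : R^o => True) (J k) -> J k (De k *: f) -> J k f.
Proof.
move=> kc hp hf.
apply: (detect_span (g := gR) (aux := aux ++ [seq De l | l <- iota k.+1 (c - k.+1)])
    (cs := [seq De l | l <- iota 0 k.+1]) (submodT _) (sJ k) _ _ (gJ (ltnW kc)) hp) => //.
- by rewrite size_cat size_map size_iota; lia.
- move=> y; rewrite !mem_cat -orbA => /or3P[/aux_hom//| |] /mapP[l]; rewrite mem_iota => hl ->; apply: De_hom; lia.
- apply: prim_sub prim_De => y; rewrite !mem_cat => /orP[->//|/mapP[l]]; rewrite mem_iota => hl ->.
  have [lk|lk] := leqP l k; first by apply/orP; right; apply: map_f; rewrite mem_iota; lia.
  by apply/orP; left; apply/orP; right; apply: map_f; rewrite mem_iota; lia.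
- move=> y /mapP[l]; rewrite mem_iota => hl ->; exists 1%N; rewrite expr1.
  have [->|nlk] := eqVneq l k; [exact: hf|apply: J_mem; lia].
Qed.
Let pdcJ k : (k <= c)%N -> pdc Xl E k (fun _ : R^o => True) (J k).
Proof.
elim: k => [|k IH] kc.
  apply: (veq (pdc_vtheory Xl E 0) (submodT _) (submod00 _) _ _ (submodT _) (sJ 0) free0) => // z _.
  by split=> [->|[g ->]]; [exact: submod0 (sJ 0)|rewrite big_ord0].
have h := IH (ltnW kc).
have mL : linear (fun f : R^o => De k *: f : R^o) by move=> a u v; rewrite scalerDr !scalerA mulrC.
have JJ v : J k v -> J k.+1 v.
  by move=> [g ->]; apply: (submod_sum (sJ k.+1)) => l _; apply: J_mem; exact: leqW (ltn_ord l).
apply: (pdc_quot (submodT _) (sJ k.+1) (sJ k) JJ _ (pdc_le (leqnSn k) h)) => //.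
apply: (@vmap _ _ (pdc_vtheory Xl E k) _ _ (mklinear mL) _ _ _ _ (submodT _) (sJ k.+1) (sJ k) (sJ k) _ _ _ h).
- by move=> z _; apply: J_mem.
- move=> v [g ->]; exists (g k) => //; rewrite big_ord_recr /= addrK.
  by apply: (submod_sum (sJ k)) => l _; exact: J_mem.
- by move=> z _; split=> [hz|]; [exact: (submodZ (sJ k))|exact: areg1].
Qed.
Lemma areg k (f : R^o) : (k < c)%N ->
  (exists g : nat -> R^o, De k *: f = \sum_(l < k) De l *: g l) ->
  exists g : nat -> R^o, f = \sum_(l < k) De l *: g l.
Proof. by move=> kc; exact: (areg1 kc (pdcJ (ltnW kc))). Qed.
End Regular.
End Detect.

Section Dual.
Variables (R : comNzRingType) (t s m : nat) (X : 'M[R]_(t, s)).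
(** Cramer's rule: the dual basis is the adjugate of the square submatrix, spread over the columns
    chosen by [g]. *)
Lemma dual_sub (f : 'I_m -> 'I_t) (g : 'I_m -> 'I_s) (r : seq 'I_t) : injective f ->
  (forall k, k \in r -> exists k', f k' = k) ->
  exists rho : 'I_t -> 'I_s -> R, forall k l, k \in r -> l \in r ->
    \sum_j rho k j * X l j = (k == l)%:R * \det (mxsub f g X).
Proof.
move=> fi hr; pose Y := mxsub f g X.
exists (fun k j => if [pick k' | f k' == k] is Some k' then \sum_i (g i == j)%:R * \adj Y i k' else 0).
move=> k l kr lr; case: pickP => [k' /eqP fk|no]; last first.
  by have [k' e] := hr _ kr; have := no k'; rewrite e eqxx.
have [l' fl] := hr _ lr; rewrite -fk -fl (inj_eq fi).
rewrite (eq_bigr (fun j => \sum_i (g i == j)%:R * (\adj Y i k' * X (f l') j))); last first.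
  by move=> j _; rewrite mulr_suml; apply: eq_bigr => i _; rewrite mulrA.
rewrite exchange_big (eq_bigr (fun i => Y l' i * \adj Y i k')) /=; last first.
  move=> i _; rewrite (bigD1 (g i)) //= eqxx mul1r big1 ?addr0; first by rewrite [Y l' i]mxE mulrC.
  by move=> j; rewrite eq_sym => /negbTE->; rewrite mul0r.
have := congr1 (fun A : 'M_m => A l' k') (mul_mx_adj Y); rewrite !mxE => ->.
by rewrite eq_sym mulr_natl.
Qed.
End Dual.

Local Open Scope quotient_scope.

(** * Identification with the ideal of minors and with I/I^2 *)

Section Minors.
Variables (R : comUnitRingType) (s t c1 : nat) (X : 'M[R]_(t, s)).
Hypotheses (sE : s = (t + c1)%N) (t0 : (0 < t)%N).
Local Notation c := c1.+1.
Local Notation P := {mpoly R[t + t]}.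
Local Notation V := {ffun {set 'I_s} -> P}.
Local Notation pc := (@pc R t s).
Local Notation pp := (@pp R t).
Local Notation eps := (eps X).
Local Notation Ie := (Ie c1 X).
Local Notation sIe := (submod_Ie c1 X _).
Local Notation enumt := (enum 'I_t).
Implicit Types (v : V) (f : P) (A : {set 'I_s}).

Definition bas A : V := [ffun B => if B == A then 1 else 0].
Lemma setU1_D1 j A (C : {set 'I_s}) : j \in C -> j \notin A -> (C :\ j == A) = (C == j |: A).
Proof.
move=> jC jA; apply/eqP/eqP => [<-|->]; first by rewrite setD1K.
by apply/setP => x; rewrite !inE; case: eqP => // ->; rewrite (negbTE jA).
Qed.
Lemma ext_bas j A : j \notin A -> ext j (bas A) = (-1) ^+ sig j (j |: A) *: bas (j |: A).
Proof.
move=> jA; apply/ffunP => C; rewrite !ffunE; case: ifP => jC.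
  rewrite (setU1_D1 jC jA); case: eqP => [->//|_]; by rewrite !scaler0.
by case: eqP => [e|_]; [move: jC; rewrite e setU11|rewrite scaler0].
Qed.
Lemma ext_bas0 j A : j \in A -> ext j (bas A) = 0.
Proof.
move=> jA; apply/ffunP => C; rewrite !ffunE; case: ifP => // jC.
case: eqP => [e|_]; last by rewrite scaler0.
by move: jA; rewrite -e !inE eqxx.
Qed.

Section Injection.
Variable g : 'I_t -> 'I_s.
Hypothesis gi : injective g.
Local Notation A := (~: (g @: setT)).
Let E l : {linear V -> V} := ext (g l).
Lemma fold_bas (r : seq 'I_t) : uniq r ->
  exists b : bool, fold_op (fun l => E l) r (bas A) = (-1) ^+ b *: bas (A :|: [set g l | l in r]).
Proof.
elim: r => [_|l r IH /= /andP[lr ur]].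
  exists false; rewrite scale1r /=; congr bas; rewrite -[LHS]setU0; congr (_ :|: _).
  by apply/setP => x; rewrite inE; apply/esym/negbTE/imsetP => -[y]; rewrite in_nil.
have [b ->] := IH ur; rewrite [E l _]linearZ /= ext_bas; last first.
  rewrite !inE negb_or negbK; apply/andP; split; first by apply: imset_f; rewrite inE.
  by apply/imsetP => -[l' l'r /gi e]; move: lr; rewrite e l'r.
exists (b (+) odd (sig (g l) (g l |: (A :|: [set g x | x in r])))).
rewrite scalerA signr_addb signr_odd; congr (_ *: bas _).
apply/setP => x; rewrite !inE; apply/idP/idP.
  case/or3P => [/eqP->|->//|/imsetP[y yr ->]]; apply/orP; right; apply: imset_f.
    by rewrite inE eqxx.
  by rewrite inE yr orbT.
case/orP => [->|/imsetP[y]]; first by rewrite orbT.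
rewrite inE => /orP[/eqP->->|yr ->]; first by rewrite eqxx.
by rewrite (imset_f g yr) !orbT.
Qed.
Lemma Om_bas (r : seq 'I_t) :
  Om X r (bas A) = fold_op (fun k u => \sum_l X k (g l) *: E l u) r (bas A) /\
  forall j, j \in A -> ext j (Om X r (bas A)) = 0.
Proof.
elim: r => [|k r [IH1 IH2]] /=; first by split=> // j; exact: ext_bas0.
split=> [|j jA].
  rewrite -IH1; set u := Om X r _; rewrite /om /extv (bigID (mem A)) /= big1 => [|j jA]; last by rewrite IH2 ?scaler0.
  rewrite add0r (eq_bigl (mem (g @: setT))) => [|j]; last by rewrite inE negbK.
  rewrite big_imset /=; first by apply: eq_bigl => l; rewrite inE.
  by move=> x y _ _; exact: gi.
rewrite /om /extv linear_sum big1 // => p _.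
by rewrite linearZ /= ext_anti IH2 // linear0 oppr0 scaler0.
Qed.
(** Columns already in the basis form contribute nothing, so only those of [g] act, and
    [fold_op_det] produces their minor. *)
Lemma eps_bas : exists b : bool, eps (bas A) = ((-1) ^+ b * \det (mxsub id g X)) *: 1.
Proof.
have [b hb] := fold_bas (enum_uniq 'I_t); exists b; rewrite /Submission.eps (Om_bas enumt).1.
have -> : fold_op (fun k u => \sum_l X k (g l) *: E l u) enumt (bas A) =
   fold_op (fun k u => \sum_l (mxsub id g X) k l *: E l u) enumt (bas A).
  by apply: eq_fold_op => k u _; apply: eq_bigr => l _; rewrite mxE.
rewrite (fold_op_det (mxsub id g X) (E := E)); first last.
- by move=> i u; exact: ext_sq.
- by move=> i j u; exact: ext_anti.
rewrite hb !ffunE ifT; first by rewrite !scalerA mulrC.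
apply/eqP/setP => x; rewrite !inE; apply/esym.
case: (boolP (x \in g @: setT)) => //= /imsetP[l _ ->].
by apply: imset_f; rewrite mem_enum.
Qed.
Lemma card_gA : #|A| = c1.
Proof. by rewrite cardsCs setCK card_imset // cardsT !card_ord sE addKn. Qed.
End Injection.
Lemma pc_bas A : #|A| = c1 -> pc c 0 1 (bas A).
Proof.
move=> hA B; rewrite ffunE; case: eqP => [->|_]; last by split=> // _; exact: submod0 spp.
by split=> [_|]; [exact: pp_1|rewrite hA].
Qed.
Lemma det_mxsub_rows (f : 'I_t -> 'I_t) (g : 'I_t -> 'I_s) : injective f ->
  exists b : bool, \det (mxsub f g X) = (-1) ^+ b * \det (mxsub id g X).
Proof.
move=> fi; exists (perm fi : bool).
have -> : mxsub f g X = row_perm (perm fi) (mxsub id g X) by apply/matrixP => i j; rewrite !mxE permE.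
by rewrite row_permE det_mulmx det_perm.
Qed.
Lemma Ie_det (f : 'I_t -> 'I_t) (g : 'I_t -> 'I_s) : injective f -> injective g -> Ie 1 (\det (mxsub f g X) *: 1).
Proof.
move=> fi gi; have [b ->] := det_mxsub_rows g fi; have [b' e] := eps_bas gi.
have h := IeP X (pc_bas (card_gA gi)); rewrite e in h.
set de := \det _ in h *; have := submodZ sIe ((-1) ^+ b * (-1) ^+ b') h.
by rewrite scalerA -mulrA [_ * (_ * de)]mulrA -expr2 sqrr_sign mul1r.
Qed.
Lemma enum_val_ltn (B : {set 'I_s}) (i j : 'I_#|B|) : (i < j)%N -> (enum_val i < enum_val j)%N.
Proof.
move=> ij; have x0 : 'I_s := enum_val i.
have so : sorted (fun x y : 'I_s => x < y)%N (enum B).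
  rewrite /enum_mem; apply: sorted_filter; first by move=> x y z; exact: ltn_trans.
  by have := iota_ltn_sorted 0 s; rewrite -val_enum_ord sorted_map enumT.
rewrite !(enum_val_nth x0); apply: (sorted_ltn_nth _ x0 so) => //.
- by move=> x y z; exact: ltn_trans.
- by rewrite inE -cardE.
- by rewrite inE -cardE.
Qed.
Lemma eps_set A : #|A| = c1 -> exists (g : 'I_t -> 'I_s) (r : R),
  {homo g : i k / (i < k)%N} /\ eps (bas A) = (r * \det (mxsub id g X)) *: 1.
Proof.
move=> hA; have e : t = #|~: A| by rewrite cardsCs setCK hA card_ord sE addnK.
pose g l := enum_val (cast_ord e l).
have gi : injective g by move=> x y /enum_val_inj/cast_ord_inj.
have eA : ~: (g @: setT) = A.
  rewrite -[RHS]setCK; congr (~: _); apply/setP => x; apply/imsetP/idP => [[l _ ->]|xA].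
    exact: enum_valP.
  by exists (cast_ord (esym e) (enum_rank_in xA x)) => //; rewrite /g cast_ordKV enum_rankK_in.
have [b] := eps_bas gi; rewrite eA => hb; exists g, ((-1) ^+ b); split=> // i k ik.
exact: enum_val_ltn.
Qed.
Lemma eps_expand v : pc c 0 1 v ->
  eps v = \sum_(A : {set 'I_s} | #|A| == c1) (v A)@_0%MM *: eps (bas A).
Proof.
move=> h; have {1}-> : v = \sum_(A : {set 'I_s} | #|A| == c1) (v A)@_0%MM *: bas A.
  apply/ffunP => B; rewrite sum_ffunE; have [e|ne] := eqVneq #|B| c1; last first.
    rewrite (h B).2; last by move=> [e]; rewrite e eqxx in ne.
    rewrite big1 // => A /eqP hA; rewrite !ffunE; case: eqP => [e|_]; last by rewrite scaler0.
    by rewrite e hA eqxx in ne.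
  rewrite (bigD1 B) ?e //= !ffunE eqxx -pp_const; last by apply: (h B).1; rewrite e.
  rewrite big1 ?addr0 // => A /andP[_ nAB]; rewrite !ffunE eq_sym (negbTE nAB) scaler0 //.
by rewrite linear_sum; apply: eq_bigr => A _; rewrite linearZ.
Qed.
End Minors.

Section MinorIdeal.
Variables (K : fieldType) (n t c1 s : nat).
Local Notation R := {mpoly K[n.+1]}.
Variables (X : 'M[R]_(t, s)) (I : idealr R).
Hypotheses (sE : s = (t + c1)%N) (t0 : (0 < t)%N).
Hypothesis hI : forall p, p \in (I : {pred R}) <-> minor_ideal t X p.
Local Notation c := c1.+1.
Local Notation P := {mpoly R[t + t]}.
Local Notation V := {ffun {set 'I_s} -> P}.
Local Notation eps := (eps X).
Local Notation Ie := (Ie c1 X).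
Local Notation sIe := (submod_Ie c1 X _).

Lemma scale1_inj (a b : R) : a *: (1 : P) = b *: 1 -> a = b.
Proof. by move/(congr1 (fun f : P => f@_0%MM)); rewrite !mcoeffZ mcoeff1 eqxx !mulr1. Qed.
Lemma homo_inj m m' (g : 'I_m -> 'I_m') : {homo g : i k / (i < k)%N} -> injective g.
Proof.
move=> h x y e; apply: val_inj; have [lt|lt|//] := ltngtP x y.
  by have := h _ _ lt; rewrite e ltnn.
by have := h _ _ lt; rewrite e ltnn.
Qed.
Lemma idealr_sum (J : finType) (Pd : pred J) (F : J -> R) :
  (forall j, Pd j -> F j \in (I : {pred R})) -> \sum_(j | Pd j) F j \in (I : {pred R}).
Proof. exact: rpred_sum. Qed.
Lemma IeI r : Ie 1 (r *: 1) <-> r \in (I : {pred R}).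
Proof.
split=> [/IeE[v hv]|/hI[l hl ->]].
  rewrite (eps_expand X hv).
  have hA (A : {set 'I_s}) : exists m, #|A| == c1 -> m \in (I : {pred R}) /\ eps (bas R t A) = m *: 1.
    have [/eqP e|_] := boolP (#|A| == c1); last by exists 0.
    have [g [b [gh eg]]] := eps_set X sE e; exists (b * \det (mxsub id g X)) => _; split=> //.
    by apply: idealMr; apply/hI; exists [:: (1, \det (mxsub id g X))]; [move=> u; rewrite inE => /eqP->; exists id, g; split|rewrite big_seq1 mul1r].
  have [m hm] := boolp.choice hA => e.
  have -> : r = \sum_(A : {set 'I_s} | #|A| == c1) (v A)@_0%MM * m A.
    apply: scale1_inj; rewrite e scaler_suml; apply: eq_bigr => A /hm[_ ->].
    by rewrite scalerA.
  by apply: idealr_sum => A /hm[h _]; exact: idealMr.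
rewrite scaler_suml big_seq; apply: (submod_sum sIe) => u /hl[f [g [fh gh ->]]].
rewrite -scalerA; apply: (submodZ sIe); apply: (Ie_det X sE); exact: homo_inj.
Qed.
Local Notation I2 := (imP eps (fq c (Ie 1)) (fun f : P => f = 0)).
Let sI2 : submod I2.
Proof. by apply: submod_im; [exact: (@submod_fq R s P c (Ie 1) sIe)|exact: submod00]. Qed.
Local Notation Isq := (ideal_pow (fun p => p \in (I : {pred R})) 2).
Lemma Isq_mul a b : a \in (I : {pred R}) -> b \in (I : {pred R}) -> Isq (a * b).
Proof.
move=> aI bI; exists [:: (1, a * b)]; last by rewrite big_seq1 mul1r.
move=> u; rewrite inE => /eqP -> /=; exists (fun i : 'I_2 => if i == ord0 then a else b).
  by move=> i; case: ifP.
by rewrite big_ord_recl big_ord1.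
Qed.
(** An element of [I2] is a combination of minors with coefficients in I, hence in I^2; conversely a
    product of two elements of I is the first one times a form mapping to the second. *)
Lemma I2I r : I2 (r *: 1) <-> Isq r.
Proof.
split=> [[v hv /eqP]|[l hl ->]].
  have hpc : Submission.pc c 0 1 v by move=> A; split=> [/(hv A).1/(Ie_pp sE t0)|/(hv A).2].
  rewrite subr_eq0 (eps_expand X hpc) => /eqP.
  have hA (A : {set 'I_s}) : exists m, #|A| == c1 -> m \in (I : {pred R}) /\ eps (bas R t A) = m *: 1.
    have [/eqP e|_] := boolP (#|A| == c1); last by exists 0.
    have [g [b [gh eg]]] := eps_set X sE e; exists (b * \det (mxsub id g X)) => _; split=> //.
    apply/IeI; rewrite -eg; apply: IeP; exact: pc_bas.
  have [m hm] := boolp.choice hA => e.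
  have -> : r = \sum_(A : {set 'I_s} | #|A| == c1) (v A)@_0%MM * m A.
    apply: scale1_inj; rewrite e scaler_suml; apply: eq_bigr => A /hm[_ ->].
    by rewrite scalerA.
  apply: (big_ind Isq); [exact: ideal_gen0|exact: ideal_genD|move=> A hA1].
  apply: Isq_mul; last by have [] := hm A hA1.
  have h1 : Ie 1 (v A) by apply: (hv A).1; rewrite (eqP hA1).
  by apply/IeI; rewrite -pp_const //; exact: (Ie_pp sE t0 h1).
rewrite scaler_suml big_seq; apply: (submod_sum sI2) => u /hl[f hf ->].
rewrite big_ord_recl big_ord1 -scalerA; apply: (submodZ sI2).
have /IeI/IeE[eta heta e] := hf (lift ord0 ord0).
exists (f ord0 *: eta); first by apply: IeV => //; apply/IeI.
by rewrite [eps (_ *: _)]linearZ /= -e scalerA subrr.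
Qed.

Fact c0_linear : linear (fun f : P => f@_0%MM : R^o).
Proof. by move=> a u v; rewrite mcoeffD mcoeffZ. Qed.
Let c0 := mklinear c0_linear.
Let Ip : R^o -> Prop := fun r => r \in (I : {pred R}).
Let I2p : R^o -> Prop := Isq.
Lemma submod_Ip : submod Ip.
Proof. split; first exact: rpred0. by move=> a u v; rewrite /Ip => hu hv; apply: rpredD => //; exact: idealMr. Qed.
Lemma submod_I2p : submod I2p.
Proof. split; first exact: ideal_gen0. by move=> a u v hu hv; apply: ideal_genD => //; exact: ideal_genM. Qed.
Lemma const1 r : Submission.pp 0 1 (r *: (1 : P)). Proof. by apply: (submodZ spp); exact: pp_1. Qed.
Lemma v_A (V0 : forall M : lmodType R, (M -> Prop) -> (M -> Prop) -> Prop) : vtheory V0 ->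
  V0 P (Submission.pp 0 1) (Ie 1) -> V0 R^o (fun=> True) Ip.
Proof.
move=> vV; apply: (@vmap _ _ vV _ _ c0 _ _ _ _ spp (submodT _) sIe submod_Ip) => //.
- move=> v _; exists (v *: 1); first exact: const1.
  by rewrite /= mcoeffZ mcoeff1 eqxx mulr1 subrr; exact: submod0 submod_Ip.
- by move=> z hz; rewrite {1}(pp_const hz); exact: IeI.
Qed.
Lemma v_I (V0 : forall M : lmodType R, (M -> Prop) -> (M -> Prop) -> Prop) : vtheory V0 ->
  V0 P (Ie 1) I2 -> V0 R^o Ip I2p.
Proof.
move=> vV; apply: (@vmap _ _ vV _ _ c0 _ _ _ _ sIe submod_Ip sI2 submod_I2p) => //.
- by move=> z hz; apply/IeI; rewrite -pp_const //; exact: (Ie_pp sE t0 hz).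
- move=> v hv; exists (v *: 1); first exact/IeI.
  by rewrite /= mcoeffZ mcoeff1 eqxx mulr1 subrr; exact: submod0 submod_I2p.
- by move=> z hz; rewrite {1}(pp_const (Ie_pp sE t0 hz)); exact: I2I.
Qed.

Local Notation A := {ideal_quot I}.
Local Notation rs N := (restr (quot_pi I) N).
(** The class in I/I^2, with the class of 0 for x outside I; it is linear on I. *)
Definition cls (x : R) : rs (conormal I) := \pi_(conormal I) (insubd (0 : ideal_sub I) x).
Lemma cls_lin a u v : Ip u -> Ip v -> cls (a *: (u : R^o) + v) = a *: cls u + cls v.
Proof.
move=> hu hv; have huv : Ip (a *: (u : R^o) + v) by exact: submod_Ip.2.
have e : a *: cls u = \pi_(conormal I) (ideal_sub_scale a (insubd (0 : ideal_sub I) u)).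
  exact: (conormal_scaleE a (insubd (0 : ideal_sub I) u)).
rewrite e /cls; apply: (eq_trans _ (raddfD \pi_(conormal I) _ _)); congr (\pi _).
by apply: val_inj; rewrite /= !val_insubd; rewrite /Ip in hu hv huv; rewrite hu hv huv.
Qed.
Lemma cls0 x : Ip x -> (I2p x <-> cls x = 0).
Proof.
move=> hx; have e := Quotient.idealrBE (in_square (I := I)) (insubd (0 : ideal_sub I) x) 0.
rewrite subr0 in e; have v : val (insubd (0 : ideal_sub I) x) = x by rewrite val_insubd hx.
rewrite /cls; split=> [h|h].
  apply: (eq_trans _ (raddf0 \pi_(conormal I))); apply/eqP; rewrite -e.
  by apply/asboolP; rewrite v.
have : insubd (0 : ideal_sub I) x \in in_square (I := I) by rewrite e h; apply/eqP; rewrite raddf0.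
by move/asboolP; rewrite v.
Qed.
Lemma cls_surj (y : conormal I) : exists2 x, Ip x & cls x = y.
Proof.
exists (val (repr y)); first exact: (valP (repr y)).
by rewrite /cls valKd reprK.
Qed.
Lemma CV_conormal_restr Xl k : CV Xl k Ip I2p -> CV Xl k (fun _ : rs (conormal I) => True) (fun u => u = 0).
Proof.
apply: (@CV_map R Xl R^o (rs (conormal I)) cls Ip I2p _ _ submod_Ip (submod00 _) cls_lin) => //; last exact: cls0.
by move=> v _; have [x hx <-] := cls_surj v; exists x => //; rewrite subrr.
Qed.
Section Vanish.
Variables (Q : lmodType R) (E : inj_resolution Q).
Notation dE := (ires_d E).
(** Passes from linear forms on the subquotient I/I^2 of R to linear forms on the module
    [conormal I], through representatives. *)
Lemma van_conormal m (f : {linear rs (conormal I) -> E m.+1}) : XR E m Ip I2p ->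
  (forall x, dE m.+1 (f x) = 0) -> exists h : {linear rs (conormal I) -> E m}, forall x, f x = dE m (h x).
Proof.
move=> hX hf.
have [||g _ hg] := @extend_linear R (E m.+1) R^o R^o idfun Ip (fun y => y = 0) (fun x => f (cls x))
    (@ires_injective _ _ E m.+1) submod_Ip (submod00 _).
- by move=> a u v hu hv; rewrite cls_lin // linearP.
- by move=> z _ /= ->; have /(cls0 (submod0 submod_Ip)) -> := submod0 submod_I2p; rewrite linear0.
have [|z hz|h h0 hh] := hX g.
- by move=> b hb h2; rewrite -[b]/(idfun b) hg //; have /(cls0 hb) -> := h2; rewrite linear0.
- by rewrite -[z]/(idfun z) hg.
pose F (y : rs (conormal I)) := h (val (repr (y : conormal I))).
have hcls x : Ip x -> F (cls x) = h x.
  move=> hx; set y := val (repr (cls x : conormal I)); have hy : Ip y by exact: (valP (repr (cls x : conormal I))).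
  have ey : cls y = cls x by rewrite /cls /y valKd reprK.
  apply/eqP; rewrite -subr_eq0 -[F _]/(h y) -linearB; apply/eqP; apply: h0.
    exact: (submodB submod_Ip).
  apply/(cls0 (submodB submod_Ip hy hx)); have := cls_lin (-1) hx hy.
  by rewrite !scaleN1r addrC => ->; rewrite ey addNr.
have FL : linear F.
  move=> a u v; have [x hx <-] := cls_surj u; have [y hy <-] := cls_surj v.
  by rewrite -cls_lin // !hcls ?linearP //; exact: submod_Ip.2.
exists (mklinear FL) => y; have [x hx <-] := cls_surj y.
by rewrite /= hcls // -hh // -[x]/(idfun x) hg.
Qed.
Lemma van_A m (f : {linear rs A^o -> E m.+1}) : XR E m (fun _ : R^o => True) Ip ->
  (forall x, dE m.+1 (f x) = 0) -> exists h : {linear rs A^o -> E m}, forall x, f x = dE m (h x).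
Proof.
move=> hX hf; pose pr (x : R^o) : rs A^o := quot_pi I x.
have prL : linear pr.
  by move=> a u v; rewrite /pr rmorphD rmorphM.
have pr0 x : Ip x -> pr x = 0.
  move=> hx; apply: (eq_trans _ (rmorph0 (quot_pi I))); have e := Quotient.idealrBE I x 0.
  by apply/eqP; rewrite subr0 in e; rewrite -e.
have gL : linear (fun x : R^o => f (pr x)) by move=> a u v; rewrite prL linearP.
have [||h h0 hh] := hX (mklinear gL).
- by move=> b _ hb; rewrite /= pr0 // linear0.
- by move=> z _; exact: hf.
pose F (y : rs A^o) := h (repr (y : A)).
have hF x : F (pr x) = h x.
  apply/eqP; rewrite -subr_eq0 -linearB; apply/eqP; apply: h0 => //.
  rewrite /Ip (Quotient.idealrBE I) reprK; exact: eqxx.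
have prS (y : rs A^o) : pr (repr (y : A)) = y by exact: (reprK (y : A)).
have FL : linear F.
  by move=> a u v; rewrite -[u]prS -[v]prS -prL !hF linearP.
by exists (mklinear FL) => y; rewrite -[y]prS /= hF -hh.
Qed.
End Vanish.
End MinorIdeal.

(** * Coefficient matrices and openness *)

Notation rowT n L N := ('I_L * 'X_{1..n.+1 < N.+1})%type.
Notation colT n N := {m : 'X_{1..n.+1 < N.+1} | mdeg m == N}.

Section CoefficientMatrix.
Variables (A : comNzRingType) (n : nat).
Local Notation P := {mpoly A[n.+1]}.
Implicit Types (l : seq P) (N L : nat).
(** A Macaulay matrix: the rows are the multiples of the forms by all monomials of degree at most N,
    the columns the monomials of degree exactly N. Its size does not depend on the degrees of the
    forms. *)
Definition Gmx l L N : 'M[A]_(#|{: rowT n L N}|, #|{: colT n N}|) :=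
  \matrix_(r, k) let x : rowT n L N := enum_val r in let m : colT n N := enum_val k in
    ('X_[x.2] * l`_x.1)@_(val m).
Lemma Gmx_sum l L N (b : rowT n L N -> A) (k : 'I_#|{: colT n N}|) :
  \sum_r b (enum_val r) * Gmx l L N r k =
  (\sum_(i < L) (\sum_(m : 'X_{1..n.+1 < N.+1}) b (i, m) *: 'X_[m]) * l`_i)@_(val (enum_val k)).
Proof.
rewrite (eq_bigr (fun r => b (enum_val r) * ('X_[(enum_val r).2] * l`_(enum_val r).1)@_(val (enum_val k)))); last first.
  by move=> r _; rewrite mxE.
rewrite -(big_enum_val (A := {: rowT n L N}) (fun x : rowT n L N => b x * ('X_[x.2] * l`_x.1)@_(val (enum_val k)))) /=.
rewrite (eq_bigl xpredT) // raddf_sum /=.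
rewrite (eq_bigr (fun i : 'I_L => \sum_(m : 'X_{1..n.+1 < N.+1}) b (i, m) * ('X_[m] * l`_i)@_(val (enum_val k)))).
  by rewrite pair_big /=; apply: eq_bigr => -[i m].
move=> i _; rewrite mulr_suml raddf_sum; apply: eq_bigr => m _ /=.
by rewrite -scalerAl mcoeffZ.
Qed.
End CoefficientMatrix.

Lemma Gmx_map (A B : comNzRingType) (f : {rmorphism A -> B}) n (l : seq {mpoly A[n.+1]}) L N :
  map_mx f (Gmx l L N) = Gmx (map (map_mpoly f) l) L N.
Proof.
apply/matrixP => r k; rewrite !mxE /=.
have -> : (map (map_mpoly f) l)`_(enum_val r).1 = map_mpoly f (l`_(enum_val r).1).
  have [lt|ge] := ltnP (enum_val r).1 (size l); first by rewrite (nth_map 0).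
  by rewrite !nth_default ?size_map // rmorph0.
by rewrite -(map_mpolyX f) -rmorphM /= mcoeff_map_mpoly.
Qed.

Section FullRank.
Variables (K : fieldType) (n : nat).
Local Notation R := {mpoly K[n.+1]}.
Local Notation zeroP := (fun u => u = 0).
Implicit Types l : seq R.
Local Notation is0 := (isp (zeroP : R^o -> Prop)).

Lemma isp_bsum l (h : 'I_(size l) -> R) : is0 l (\sum_i h i * l`_i).
Proof.
have s0 : submod (is0 l : R^o -> Prop) by apply: submod_isp; exact: submod00.
apply: (submod_sum s0) => i _; apply: (submodZ s0 (h i) (u := l`_i)); apply: isp_mem; first exact: submod00.
exact: mem_nth.
Qed.
(** Full rank writes x_j^N as the degree N component of a combination of the forms; the forms being
    homogeneous, that component is again in their ideal. *)
Lemma full_prim l N : (forall y, y \in l -> poshom y) -> row_full (Gmx l (size l) N) -> prim l.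
Proof.
move=> hl /row_fullP[B hB] x /mapP[j _ ->]; exists N.
pose mj := (U_(j) *+ N)%MM : 'X_{1..n.+1}.
have dj : mdeg mj = N by rewrite mdegMn mdeg1 mul1n.
have bj : (mdeg mj < N.+1)%N by rewrite dj.
have cj : mdeg (BMultinom bj) == N by rewrite /= dj.
pose k0 := enum_rank (exist (fun m : 'X_{1..n.+1 < N.+1} => mdeg m == N) _ cj : colT n N).
pose h (i : 'I_(size l)) : R := \sum_(m : 'X_{1..n.+1 < N.+1}) B k0 (enum_rank ((i, m) : rowT n (size l) N)) *: 'X_[m].
pose S := \sum_i h i * l`_i.
have eS (k : 'I_#|{: colT n N}|) : S@_(val (enum_val k)) = (k0 == k)%:R.
  have := congr1 (fun M : 'M_#|{: colT n N}| => M k0 k) hB; rewrite !mxE => <-.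
  rewrite -(Gmx_sum l (fun x => B k0 (enum_rank x))).
  by apply: eq_bigr => r _; rewrite enum_valK.
have -> : ('X_j : R) ^+ N = pihomog mdeg N S.
  apply/mpolyP => m; rewrite mpolyXn mcoeffX.
  have [dm|ndm] := eqVneq (mdeg m) N; last first.
    rewrite (dhomog_nemf_coeff (pihomogP mdeg N S)) //.
    by case: eqP => // e; move: ndm; rewrite -e dj eqxx.
  have bm : (mdeg m < N.+1)%N by rewrite dm.
  have cm : mdeg (BMultinom bm) == N by rewrite /= dm.
  pose k := enum_rank (exist (fun m : 'X_{1..n.+1 < N.+1} => mdeg m == N) _ cm : colT n N).
  have <- : S@_m = (pihomog mdeg N S)@_m.
    have lt : (N < maxn (msize S) N.+1)%N by rewrite leq_max leqnn orbT.
    rewrite {1}(pihomog_partitionE (mf := mdeg) (leq_maxl (msize S) N.+1)) [LHS]raddf_sum.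
    rewrite (bigD1 (Ordinal lt) isT) big1; first exact: addr0.
    move=> e /= ne; apply: (dhomog_nemf_coeff (pihomogP mdeg e S)).
    by apply/eqP => h1; move/eqP: ne; apply; apply: val_inj; rewrite /= -h1; exact: dm.
  have eSm : S@_m = (k0 == k)%:R by rewrite -(eS k) /k enum_rankK.
  rewrite eSm; congr (_%:R); congr nat_of_bool.
  rewrite /k0 /k (inj_eq enum_rank_inj) -val_eqE /= -val_eqE /=.
  by first [done | apply/eqP/eqP => h1; exact: h1].
have [H hH] : exists H : 'I_(size l) -> R, pihomog mdeg N S = \sum_i H i * l`_i.
  have hi (i : 'I_(size l)) : exists H, pihomog mdeg N (h i * l`_i) = H * l`_i.
    have [d _ hd] := hl _ (mem_nth 0 (ltn_ord i)).
    rewrite mulrC; exists (if (d <= N)%N then pihomog mdeg (N - d) (h i) else 0).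
    rewrite [pihomog _ _ _](gR_hom N (h i : R^o) hd); case: ifP => _; last by rewrite mul0r.
    by rewrite -[_ *: _]/(_ * _) mulrC.
  have [H hH] := boolp.choice hi; exists H; rewrite raddf_sum; apply: eq_bigr => i _ /=; exact: hH.
by rewrite hH; exact: isp_bsum.
Qed.

(** If x_j^(a_j) is in the ideal for each j, every monomial of degree N, the sum of the a_j, is
    divisible by one of them. *)
Lemma prim_full l : (forall y, y \in l -> poshom y) -> prim l -> exists N, row_full (Gmx l (size l) N).
Proof.
move=> hl hp.
have h1 (j : 'I_n.+1) : exists a, is0 l ('X_j ^+ a).
  by apply: hp; apply: map_f; rewrite mem_enum.
have [a ha] := boolp.choice h1.
pose N := (\sum_j a j)%N; exists N.
have mon (m : 'X_{1..n.+1}) : mdeg m = N -> is0 l 'X_[m].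
  move=> dm; have [j hj] : exists j, (a j <= m j)%N.
    apply/existsP; rewrite -[X in is_true X]negbK negb_exists; apply/negP => /forallP hm.
    have : (mdeg m < N)%N.
      rewrite mdegE /N; have le j : (m j <= a j)%N by rewrite ltnW // ltnNge hm.
      rewrite (bigD1 ord0) // [X in (_ < X)%N](bigD1 ord0) //= -addSn leq_add //.
        by rewrite ltnNge hm.
      by apply: leq_sum => j _.
    by rewrite dm ltnn.
  have -> : 'X_[m] = 'X_[(m - U_(j) *+ a j)%MM] * 'X_j ^+ a j :> R.
    rewrite mpolyXn -mpolyXD submK //; apply/mnm_lepP => i; rewrite mulmnE mnm1E.
    by case: eqP => [<-|_]; rewrite ?mul1n ?mul0n.
  have s0 : submod (is0 l : R^o -> Prop) by apply: submod_isp; exact: submod00.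
  exact: (submodZ s0 'X_[(m - U_(j) *+ a j)%MM] (ha j)).
have hk (k : 'I_#|{: colT n N}|) : exists h : 'I_(size l) -> R,
    (forall i, (msize (h i) <= N.+1)%N) /\ 'X_[val (val (enum_val k))] = \sum_i h i * l`_i.
  set m : 'X_{1..n.+1} := val _; have dm : mdeg m = N by apply/eqP; exact: (valP (enum_val k)).
  have [r0 [h [-> e]]] := isp_sum (mon m dm); rewrite add0r in e.
  have hi (i : 'I_(size l)) : exists H, (msize H <= N.+1)%N /\ pihomog mdeg N (h i * l`_i) = H * l`_i.
    have [d _ hd] := hl _ (mem_nth 0 (ltn_ord i)).
    exists (if (d <= N)%N then pihomog mdeg (N - d) (h i) else 0).
    rewrite mulrC [pihomog _ _ (_ * _)](gR_hom N (h i : R^o) hd); case: ifP => dN; last by rewrite msize0 mul0r.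
    split; last by rewrite -[_ *: _]/(_ * _) mulrC.
    rewrite mmeasureE; apply/bigmax_leqP_seq => m' mu _.
    by rewrite ltnS (dhomog_mf (pihomogP mdeg (N - d) (h i)) mu) leq_subr.
  have [H hH] := boolp.choice hi; exists H; split=> [i|]; first exact: (hH i).1.
  have pm : pihomog mdeg N 'X_[m] = 'X_[m] :> R by apply: pihomog_dE; rewrite dhomogX; apply/eqP.
  by rewrite -pm e raddf_sum; apply: eq_bigr => i _ /=; exact: (hH i).2.
have [h hh] := boolp.choice hk.
apply/row_fullP; exists (\matrix_(k < #|{: colT n N}|, r < #|{: rowT n (size l) N}|)
  let x : rowT n (size l) N := enum_val r in (h k x.1)@_x.2).
apply/matrixP => k k'; rewrite !mxE.
pose b (x : rowT n (size l) N) := (h k x.1)@_x.2.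
rewrite (eq_bigr (fun r => b (enum_val r) * Gmx l (size l) N r k')) => [|r _]; last by rewrite [X in X * _]mxE.
rewrite (Gmx_sum l b) /b /=.
rewrite (eq_bigr (fun i => h k i * l`_i)) => [|i _]; last by rewrite -mpolywE //; exact: (hh k).1.
rewrite -(hh k).2 mcoeffX; congr (_%:R); congr nat_of_bool; apply/eqP/eqP => [e|->//].
by apply: enum_val_inj; apply: val_inj; apply: val_inj.
Qed.
End FullRank.

Section Generic.
Variables (K : fieldType) (n t s : nat) (d : 'I_t -> 'I_s -> nat).
Local Notation R := {mpoly K[n.+1]}.
Local Notation CT := (mx_coord n d).
Local Notation S := {mpoly K[#|CT|]}.
(** The generic homogeneous matrix, its coefficients being indeterminates indexed by the coordinates
    of the affine space of matrices. *)
Definition gmx : 'M[{mpoly S[n.+1]}]_(t, s) := \matrix_(i, j) \sum_(k < #|CT|)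
  (if (val (enum_val k)).1 == (i, j) then ('X_k : S) *: 'X_[(val (enum_val k)).2] else 0).
Definition spec (M : 'M[R]_(t, s)) : {rmorphism S -> K} := meval (mx_coords (d := d) M).
Lemma gmxE M : homogeneous_mx d M -> map_mx (map_mpoly (spec M)) gmx = M.
Proof.
move=> hM; apply/matrixP => i j; rewrite !mxE raddf_sum /=; apply/mpolyP => m; rewrite raddf_sum /=.
have e1 (k : 'I_#|CT|) : (map_mpoly (spec M) (if (val (enum_val k)).1 == (i, j) then
      ('X_k : S) *: 'X_[(val (enum_val k)).2] else 0))@_m =
    (if ((val (enum_val k)).1 == (i, j)) && (val (val (enum_val k)).2 == m) then (M i j)@_m else 0).
  rewrite mcoeff_map_mpoly; case: eqP => [e|_] /=; last by rewrite mcoeff0 rmorph0.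
  rewrite mcoeffZ mcoeffX rmorphM rmorph_nat /spec /= mevalXU /mx_coords e /=.
  by case: eqP => [->|_]; rewrite ?mulr1 ?mulr0.
rewrite (eq_bigr _ (fun k _ => e1 k)) {e1}.
rewrite -(big_enum_val (A := CT) (fun x : CT => if ((val x).1 == (i, j)) && (val (val x).2 == m) then (M i j)@_m else 0)) /=.
rewrite (eq_bigl xpredT) //.
have [dm|ndm] := eqVneq (mdeg m) (d i j); last first.
  rewrite (dhomog_nemf_coeff (hM i j) ndm) big1 // => x _.
  by rewrite if_same.
have bm : (mdeg m < (\max_i \max_j d i j).+1)%N.
  rewrite ltnS dm; apply: (leq_trans (leq_bigmax (F := fun j => d i j) j)).
  exact: (leq_bigmax (F := fun i => \max_j d i j)).
pose x0 : 'I_t * 'I_s * 'X_{1..n.+1 < (\max_i \max_j d i j).+1} := ((i, j), BMultinom bm).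
have cx : mdeg x0.2 == d x0.1.1 x0.1.2 by rewrite /= dm.
rewrite (bigD1 (exist _ x0 cx : CT)) //= !eqxx /= big1 ?addr0 // => x nx.
case: ifP => // /andP[/eqP e /eqP e2]; case/eqP: nx; apply: val_inj => /=.
case: (val x) e e2 => x1 x2 /= -> e2; congr pair; exact: val_inj.
Qed.

(** Full rank for some N is the non-vanishing of some maximal minor for some N; the two conditions
    are joined by taking products. *)
Lemma zariski_full (l1 l2 : seq {mpoly S[n.+1]}) : zariski_open d (fun M : 'M[R]_(t, s) =>
  (exists N, row_full (Gmx (map (map_mpoly (spec M)) l1) (size l1) N)) /\
  (exists N, row_full (Gmx (map (map_mpoly (spec M)) l2) (size l2) N))).
Proof.
pose F0 (l : seq {mpoly S[n.+1]}) (f : S) := exists N (g : 'I_#|{: colT n N}| -> 'I_#|{: rowT n (size l) N}|),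
  f = \det (rowsub g (Gmx l (size l) N)).
have key l M : (exists N, row_full (Gmx (map (map_mpoly (spec M)) l) (size l) N)) <->
    exists2 f, F0 l f & spec M f != 0.
  have ed N g : spec M (\det (rowsub g (Gmx l (size l) N))) =
      \det (rowsub g (Gmx (map (map_mpoly (spec M)) l) (size l) N)).
    by rewrite -det_map_mx -Gmx_map; congr (\det _); apply/matrixP => x y; rewrite !mxE.
  split=> [[N hN]|[f [N [g ->]]]].
    exists (\det (rowsub (fullrankfun hN) (Gmx l (size l) N))); first by exists N, (fullrankfun hN).
    rewrite ed -unitfE -unitmxE -row_full_unit; exact: fullrowsub_full.
  rewrite ed -unitfE -unitmxE -row_full_unit => hf; exists N.
  have [B hB] := row_fullP hf.
  apply/row_fullP; exists (B *m rowsub g 1%:M); rewrite -mulmxA.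
  by rewrite mul_rowsub_mx mul1mx.
exists (fun f => exists f1 f2, [/\ F0 l1 f1, F0 l2 f2 & f = f1 * f2]) => M _; rewrite !key; split.
  move=> [[f1 h1 n1] [f2 h2 n2]]; exists (f1 * f2); first by exists f1, f2.
  by rewrite -[meval _ _]/(spec M _) rmorphM mulf_neq0.
move=> [f [f1 [f2 [h1 h2 ->]]]]; rewrite -[meval _ _]/(spec M _) rmorphM mulf_eq0 negb_or => /andP[n1 n2].
by split; [exists f1|exists f2].
Qed.
End Generic.

(** * Radicals and determinants *)

Section Radical.
Variables (R : comNzRingType) (J : R^o -> Prop).
Hypothesis sJ : submod J.
Definition Rd (x : R^o) : Prop := exists a, J (x ^+ a).
Lemma submod_Rd : submod Rd.
Proof.
split; first by exists 1%N; rewrite expr1; exact: submod0 sJ.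
move=> a u v hu hv; have s2 := submod_isp [:: u; v] sJ.
apply: (isp_nil (l := [:: u; v]) (a := 1) sJ).
  by move=> y; rewrite !inE => /orP[] /eqP->.
rewrite expr1; apply: (submodD s2); last by apply: isp_mem => //; rewrite !inE eqxx orbT.
by apply: (submodZ s2 a (u := u)); apply: isp_mem => //; rewrite !inE eqxx.
Qed.
Lemma Rd_J x : J x -> Rd x. Proof. by exists 1%N; rewrite expr1. Qed.
Lemma Rd_exp x a : Rd (x ^+ a) -> Rd x.
Proof. by move=> [b h]; exists (a * b)%N; rewrite exprM. Qed.
Lemma Rd_mul r x : Rd x -> Rd (r * x).
Proof. by move=> h; exact: (submodZ submod_Rd r h). Qed.
Lemma Rd_X x a : (0 < a)%N -> Rd x -> Rd (x ^+ a).
Proof. by case: a => // a _ h; rewrite exprSr; exact: Rd_mul. Qed.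
Lemma Rd_prod (T : finType) (F : T -> R) i : Rd (F i) -> Rd (\prod_j F j).
Proof. by move=> h; rewrite (bigD1 i) //= mulrC; exact: Rd_mul. Qed.
Lemma Rd_power (T : finType) (v : T -> R) (d : T -> nat) x :
  (forall i, Rd (x - v i)) -> Rd (\prod_i v i ^+ d i) -> Rd x.
Proof.
move=> hv hp; apply: (Rd_exp (a := (\sum_i d i)%N)).
have h : Rd (x ^+ (\sum_i d i)%N - \prod_i v i ^+ d i).
  apply: (big_rec2 (fun a p => Rd (x ^+ a - p))); first by rewrite subrr; exact: submod0 submod_Rd.
  move=> i p a _ IH; have -> : x ^+ (d i + p) - v i ^+ d i * a =
      x ^+ d i * (x ^+ p - a) + a * (x ^+ d i - v i ^+ d i) by rewrite exprD; ring.
  apply: (submodD submod_Rd); apply: Rd_mul => //.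
  by rewrite subrXX mulrC; apply: Rd_mul.
by have := submodD submod_Rd h hp; rewrite subrK.
Qed.
Lemma perm_ge1 m (s : 'S_m) : (forall i : 'I_m, (i <= s i)%N) -> s = 1%g.
Proof.
move=> h; apply/permP => i; rewrite perm1; apply: val_inj; apply/eqP; rewrite eqn_leq h andbT leqNgt; apply/negP => lt.
have : (\sum_(j < m) j < \sum_(j < m) s j)%N.
  rewrite (bigD1 i) // [X in (_ < X)%N](bigD1 i) //= -addSn leq_add //.
  by apply: leq_sum => j _.
by rewrite -(reindex_inj (h := s) (F := fun j : 'I_m => j : nat) (P := xpredT) perm_inj) ltnn.
Qed.
(** A permutation other than the identity has an index i with s i < i, so its term meets an entry in
    the radical. *)
Lemma det_tri m (Y : 'M[R]_m) : (forall i j : 'I_m, (j < i)%N -> Rd (Y i j)) -> Rd (\det Y) ->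
  Rd (\prod_i Y i i).
Proof.
move=> hY hd; have -> : \prod_i Y i i = \det Y - \sum_(s : 'S_m | s != 1%g) (-1) ^+ s * \prod_i Y i (s i).
  rewrite /determinant (bigD1 (1%g : {perm 'I_m})) //= odd_perm1 expr0 mul1r addrK.
  by apply: eq_bigr => i _; rewrite perm1.
apply: (submodB submod_Rd hd); apply: (submod_sum submod_Rd) => s ns; apply: Rd_mul.
have [i hi] : exists i : 'I_m, (s i < i)%N.
  apply/existsP; rewrite -[X in is_true X]negbK negb_exists; apply/negP => /forallP h.
  by case/eqP: ns; apply: perm_ge1 => i; rewrite leqNgt.
by apply: (Rd_prod (i := i)); exact: hY.
Qed.
(* Descending induction on |S|: the product of the forms indexed by S lies in the radical. *)
Lemma Rd_forms t' (x y : R) (v : 'I_t'.+1 -> R) : (0 < t')%N ->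
  (forall i, v i = x - i%:R * y) ->
  (forall i j : 'I_t'.+1, i != j -> exists e : R, e * (v i - v j) = y) ->
  (forall i0, Rd (\prod_(l | l != i0) v l)) -> Rd x /\ Rd y.
Proof.
move=> t0 hv he h; have sR := submod_Rd.
have xy z : (exists i j, [/\ i != j, Rd (z * v i) & Rd (z * v j)]) -> Rd (z * x) /\ Rd (z * y).
  move=> [i [j [ij hi hj]]]; have [e ey] := he _ _ ij.
  have hy : Rd (z * y).
    have -> : z * y = e * (z * v i - z * v j) by rewrite -ey; ring.
    by apply: Rd_mul; exact: (submodB sR).
  split=> //; have -> : z * x = z * v i + i%:R * (z * y) by rewrite hv; ring.
  by apply: (submodD sR) => //; exact: Rd_mul.
have Q k (S : {set 'I_t'.+1}) : #|S| = (t' - k)%N -> (k < t')%N -> Rd (\prod_(l in S) v l).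
  elim: k S => [|k IH] S hS kt.
    have /cards1P[i0 e] : #|~: S| == 1%N by rewrite cardsCs setCK card_ord hS; lia.
    rewrite (eq_bigl (fun l => l != i0)); first exact: h.
    by move=> l; have := in_set1 l i0; rewrite -e inE; case: (l \in S) => //= <-.
  have /card_gt1P[i [j [hi hj ij]]] : (1 < #|~: S|)%N by rewrite cardsCs setCK card_ord hS; lia.
  rewrite !inE in hi hj.
  have step l : l \notin S -> Rd ((\prod_(l in S) v l) * v l).
    move=> lS; have := IH (l |: S); rewrite big_setU1 //= mulrC; apply; last by lia.
    by rewrite cardsU1 lS hS; lia.
  have [hx hy] : Rd ((\prod_(l in S) v l) * x) /\ Rd ((\prod_(l in S) v l) * y).
    by apply: xy; exists i, j; split=> //; exact: step.
  have [l lS] : exists l, l \in S by apply/set0Pn; rewrite -card_gt0 hS; lia.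
  apply: (Rd_exp (a := 2)); rewrite expr2 {1}(bigD1 l) //= mulrAC mulrC; apply: Rd_mul.
  rewrite mulrC hv; have -> : (\prod_(l in S) v l) * (x - l%:R * y) = (\prod_(l in S) v l) * x - l%:R * ((\prod_(l in S) v l) * y) by ring.
  by apply: (submodB sR) => //; exact: Rd_mul.
have := xy 1; rewrite !mul1r; apply.
exists ord0, ord_max; rewrite !mul1r; split.
- by apply/eqP => /(congr1 val) /= e; rewrite -e in t0.
- by have := Q t'.-1 [set ord0]; rewrite cards1 big_set1; apply; lia.
- by have := Q t'.-1 [set ord_max]; rewrite cards1 big_set1; apply; lia.
Qed.
End Radical.

Section Homogeneous.
Variables (K : fieldType) (n t s : nat).
Local Notation R := {mpoly K[n.+1]}.
Lemma hom_prod (T : finType) (F : T -> R) (dF : T -> nat) :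
  (forall i, homR (dF i) (F i)) -> homR (\sum_i dF i)%N (\prod_i F i).
Proof.
move=> h; apply: (big_rec2 (fun a p => homR a p)); first exact: dhomog1.
by move=> i p a _; apply: dhomogM; exact: h.
Qed.
(** With entry degrees Bw i - Aw j every term of the determinant has the same degree. *)
Lemma hom_det (M : 'M[R]_(t, s)) (d : 'I_t -> 'I_s -> nat) (Aw : 'I_s -> nat) (Bw : 'I_t -> nat) m
  (f : 'I_m -> 'I_t) (g : 'I_m -> 'I_s) : homogeneous_mx d M -> (forall i j, (0 < d i j)%N) ->
  (forall i j, (d i j + Aw j)%N = Bw i) -> (0 < m)%N -> poshom (\det (mxsub f g M)).
Proof.
move=> hM d0 hd m0; exists (\sum_i d (f i) (g i))%N.
  by rewrite (bigD1 (Ordinal m0)) //= addn_gt0 d0.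
rewrite /homR /determinant; apply: rpred_sum => p _.
have -> : (\sum_i d (f i) (g i) = \sum_i d (f i) (g (p i)))%N.
  have e1 : (\sum_i d (f i) (g i) + \sum_i Aw (g i) = \sum_i Bw (f i))%N.
    by rewrite -big_split; apply: eq_bigr => i _; exact: hd.
  have e2 : (\sum_i d (f i) (g (p i)) + \sum_i Aw (g (p i)) = \sum_i Bw (f i))%N.
    by rewrite -big_split; apply: eq_bigr => i _; exact: hd.
  have e3 : (\sum_i Aw (g i) = \sum_i Aw (g (p i)))%N by rewrite (reindex_inj (h := p) perm_inj).
  by lia.
have hp : homR (\sum_i d (f i) (g (p i)))%N (\prod_i mxsub f g M i (p i)).
  by apply: hom_prod => i; rewrite mxE; exact: hM.
by rewrite mulr_sign; case: ifP => _; [rewrite dhomogN|]; exact: hp.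
Qed.
End Homogeneous.

(** * A banded matrix with the expected radicals *)

Section Band.
Variables (K : fieldType) (n t' c1 s : nat).
Local Notation R := {mpoly K[n.+1]}.
Local Notation t := t'.+1.
Local Notation c := c1.+1.
Local Notation zeroP := (fun u => u = 0).
Hypotheses (charK : forall m, (m.+1%:R : K) != 0) (t'0 : (0 < t')%N) (sE : s = (t + c1)%N).
Variable j0 : 'I_s.
Definition xv (i : nat) : R := if insub i is Some j then 'X_(j : 'I_n.+1) else 0.
Definition colk (k : nat) (l : nat) : 'I_s := insubd j0 (k + l)%N.
Definition aux (r : nat) : seq R := [seq xv i | i <- iota r (n.+1 - r)].
Section Lists.
Variables (A : comNzRingType) (M : 'M[A]_(t, s)).
Definition consec : seq A := [seq \det (mxsub id (fun l : 'I_t => colk k l) M) | k <- iota 0 c].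
Definition subminors : seq A :=
  [seq \det (mxsub (lift p.1) p.2 M) | p : 'I_t * {ffun 'I_t' -> 'I_s} <- enum {: 'I_t * {ffun 'I_t' -> 'I_s}}].
End Lists.

Variable d : 'I_t -> 'I_s -> nat.
Hypothesis d0 : forall i j, (0 < d i j)%N.
(** On each of the c full diagonals stand pairwise independent forms in two variables, as even t - 1
    of them must determine both. The diagonals k = c and k = -1 have t - 1 entries and carry one
    variable each: in total 2c + 2 variables, the generic codimension of the (t-1)-minors. *)
Definition Lf (i k : nat) : R := if (k < c)%N then xv k - i%:R * xv (c + k)
  else if k == c then xv (2 * c).+1 else 0.
Definition M0 : 'M[R]_(t, s) := \matrix_(i, j)
  if (i <= j)%N then Lf i (j - i) ^+ d i j else if i == j.+1 :> nat then xv (2 * c) ^+ d i j else 0.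

Lemma xv_hom i : homR 1 (xv i).
Proof.
rewrite /xv; case: insubP => [j _ _|_]; last exact: dhomog0.
by rewrite /homR dhomogX; apply/eqP; exact: mdeg1.
Qed.
Lemma Lf_hom i k : homR 1 (Lf i k).
Proof.
rewrite /Lf; case: ifP => _; last by case: ifP => _; [exact: xv_hom|exact: dhomog0].
apply: rpredB; first exact: xv_hom.
by rewrite mulr_natl; apply: rpredMn; exact: xv_hom.
Qed.
Lemma M0_hom : homogeneous_mx d M0.
Proof.
move=> i j; rewrite mxE; have h (x : R) : homR 1 x -> x ^+ d i j \is (d i j).-homog.
  by move=> hx; have := dhomogMn (d i j) hx; rewrite mul1n.
case: ifP => _; first by apply: h; exact: Lf_hom.
by case: ifP => _; [apply: h; exact: xv_hom|exact: dhomog0].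
Qed.
Lemma colkE k l : (k + l < s)%N -> colk k l = (k + l)%N :> nat.
Proof. by move=> h; rewrite /colk val_insubd h. Qed.

Section BandIdeal.
Variable J : R^o -> Prop.
Hypothesis sJ : submod J.
Local Notation Rd := (Rd J).
Let sR := submod_Rd sJ.
Lemma Rd0 : Rd 0. Proof. exact: submod0 sR. Qed.
Lemma Rd_Lf i k : Rd (xv k) -> Rd (xv (c + k)) -> (k < c)%N -> Rd (Lf i k).
Proof. by move=> h h' kc; rewrite /Lf kc; apply: (submodB sR) => //; exact: Rd_mul. Qed.
Lemma Rd_below (i : 'I_t) (j : 'I_s) k : (j < i + k)%N -> (k <= c)%N -> Rd (xv (2 * c)) ->
  (forall k', (k' < k)%N -> Rd (xv k') /\ Rd (xv (c + k'))) -> Rd (M0 i j).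
Proof.
move=> ji kc h2 hk; rewrite mxE; case: leqP => ij.
  by apply: Rd_X => //; apply: Rd_Lf; [apply: (hk _ _).1|apply: (hk _ _).2|]; lia.
by case: ifP => _; [exact: Rd_X|exact: Rd0].
Qed.
(** Induction on k: modulo x_0, ..., x_(k-1) and the variables from x_c on, the minor on columns k,
    ..., k + t - 1 is triangular with powers of x_k on the diagonal. *)
Lemma consec_Rd : (forall i, (c <= i)%N -> Rd (xv i)) ->
  (forall k, (k < c)%N -> Rd (\det (mxsub id (fun l : 'I_t => colk k l) M0))) -> forall i, Rd (xv i).
Proof.
move=> hi hm.
have hc k : (k < c)%N -> Rd (xv k).
  elim/ltn_ind: k => k IH kc.
  pose Y := mxsub id (fun l : 'I_t => colk k l) M0.
  have cE (l : 'I_t) : colk k l = (k + l)%N :> nat by apply: colkE; move: (ltn_ord l); rewrite sE; lia.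
  have hd : Rd (\det Y) by exact: hm.
  have hY := det_tri sJ _ hd.
  apply: (Rd_power (v := fun l : 'I_t => Lf l k) (d := fun l => d l (colk k l)) sJ).
    move=> l; rewrite /Lf kc opprB addrC subrK; apply: (Rd_mul sJ); apply: hi; lia.
  have -> : \prod_(l < t) Lf l k ^+ d l (colk k l) = \prod_l Y l l; last first.
    apply: hY => i j ji; rewrite [X in Rd X]mxE; apply: (Rd_below (k := k)) => //.
    - by rewrite cE; lia.
    - by lia.
    - by apply: hi; lia.
    - by move=> k' k'k; split; [apply: IH => //; lia|apply: hi; lia].
  apply: eq_bigr => l _; rewrite /Y !mxE cE ifT ?leq_addl //; congr (Lf _ _ ^+ _); lia.
move=> i; have [lt|ge] := ltnP i c; [exact: (hc _ lt)|exact: (hi _ ge)].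
Qed.

Lemma prod_lift (F : 'I_t -> R) (i0 : 'I_t) : \prod_(l : 'I_t') F (lift i0 l) = \prod_(l | l != i0) F l.
Proof.
rewrite [RHS]big_mkcond (bigD1_ord i0) //= eqxx mul1r.
by apply: eq_bigr => l _; rewrite eq_sym neq_lift.
Qed.

(** The diagonals are cleared one by one, starting from below: once the variables of the lower ones
    are in the radical, suitable (t-1)-minors are triangular and give products of the forms on the
    next one. *)
Lemma subminors_Rd : (forall i, ((2 * c).+2 <= i)%N -> Rd (xv i)) ->
  (forall (i0 : 'I_t) (g : 'I_t' -> 'I_s), Rd (\det (mxsub (lift i0) g M0))) -> forall i, Rd (xv i).
Proof.
move=> hi hm.
have h2 : Rd (xv (2 * c)).
  pose Y := mxsub (lift ord0) (fun l : 'I_t' => colk 0 l) M0.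
  have cE (l : 'I_t') : colk 0 l = l :> nat by rewrite colkE ?add0n //; move: (ltn_ord l); rewrite sE; lia.
  have liE (l : 'I_t') : lift ord0 l = l.+1 :> nat by [].
  apply: (Rd_power (v := fun l : 'I_t' => xv (2 * c)) (d := fun l => d (lift ord0 l) (colk 0 l)) sJ).
    by move=> l; rewrite subrr; exact: Rd0.
  have -> : \prod_(l < t') xv (2 * c) ^+ d (lift ord0 l) (colk 0 l) = \prod_l Y l l; last first.
    apply: (det_tri sJ _ (hm _ _)) => i j ji.
    have g1 : (lift ord0 i <= colk 0 j)%N = false by rewrite cE liE; apply/negbTE; rewrite -ltnNge ltnS ltnW.
    have g2 : (lift ord0 i == (colk 0 j).+1 :> nat) = false by rewrite cE liE eqSS gtn_eqF.
    by rewrite !mxE g1 g2; exact: Rd0.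
  apply: eq_bigr => l _; rewrite /Y !mxE.
  by rewrite ifF ?cE ?liE ?ltnn // eqxx.
have band k (i0 : 'I_t) : (k <= c)%N -> (k = c -> i0 = ord_max) ->
    (forall k', (k' < k)%N -> Rd (xv k') /\ Rd (xv (c + k'))) ->
    Rd (\prod_(l < t') Lf (lift i0 l) k ^+ d (lift i0 l) (colk k (lift i0 l))).
  move=> kc ki IH; pose Y := mxsub (lift i0) (fun l : 'I_t' => colk k (lift i0 l)) M0.
  have cE (l : 'I_t') : colk k (lift i0 l) = (k + lift i0 l)%N :> nat.
    apply: colkE; have [e|ne] := eqVneq k c; last by have := ltn_ord (lift i0 l); rewrite sE; lia.
    by rewrite (ki e) e lift_max sE; have := ltn_ord l; lia.
  have -> : \prod_(l < t') Lf (lift i0 l) k ^+ d (lift i0 l) (colk k (lift i0 l)) = \prod_l Y l l; last first.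
    apply: (det_tri sJ _ (hm _ _)) => i j ji; rewrite [X in Rd X]mxE; apply: (Rd_below (k := k)) => //.
    rewrite cE addnC ltn_add2r /= /bump.
    rewrite -addnS; apply: leq_add => //; case: (leqP i0 j) => // h.
    by rewrite (leq_trans h (ltnW ji)).
  apply: eq_bigr => l _; rewrite /Y [in RHS]mxE [in RHS]mxE cE leq_addl addnK //.
(* Deleting each row i0 in turn gives the product of all the forms but one, the input of [Rd_forms];
   independence of the forms rests on characteristic zero. *)
have hk k : (k < c)%N -> Rd (xv k) /\ Rd (xv (c + k)).
  elim/ltn_ind: k => k IH kc.
  apply: (@Rd_forms _ J sJ t' (xv k) (xv (c + k)) (fun i => Lf i k)) => //.
  - by move=> i; rewrite /Lf kc.
  - move=> i j ij; rewrite /Lf kc.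
    have hK : (j%:R - i%:R : K) != 0.
      rewrite subr_eq0; apply/negP => /eqP e; case/eqP: ij; apply: val_inj.
      wlog lt : i j e / (i < j)%N.
        by move=> H; have [/(H i j e)|/(H j i (esym e))->|//] := ltngtP i j.
      have e0 : (j - i)%:R = 0 :> K by rewrite natrB ?(ltnW lt) // e subrr.
      have := charK (j - i).-1; rewrite prednK ?subn_gt0 // e0 eqxx //.
    exists ((j%:R - i%:R)^-1)%:MP.
    have -> : xv k - i%:R * xv (c + k) - (xv k - j%:R * xv (c + k)) = (j%:R - i%:R)%:MP * xv (c + k) :> R.
      by rewrite mpolyCB !mpolyC_nat; ring.
    by rewrite mulrA -mpolyCM mulVf // mpolyC1 mul1r.
  - move=> i0; rewrite -(prod_lift (fun l => Lf l k)).
    (* A common exponent: multiplying by the missing powers turns the product of unequal powers into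
       a power of the product of the forms. *)
    pose D := (\sum_(l < t') d (lift i0 l) (colk k (lift i0 l)))%N.
    apply: (Rd_exp (a := D)); rewrite -prodrXl.
    have hb := band k i0 (ltnW kc) ltac:(lia) (fun k' k'k => IH k' k'k ltac:(lia)).
    have -> : \prod_(l < t') Lf (lift i0 l) k ^+ D =
        (\prod_(l < t') Lf (lift i0 l) k ^+ (D - d (lift i0 l) (colk k (lift i0 l)))) *
        \prod_(l < t') Lf (lift i0 l) k ^+ d (lift i0 l) (colk k (lift i0 l)).
      rewrite -big_split; apply: eq_bigr => l _ /=; rewrite -exprD subnK //.
      by rewrite /D (bigD1 l) //= leq_addr.
    exact: (Rd_mul sJ).
(* The last diagonal stops at row t - 2, so the deleted row is the last one. *)
have hlast : Rd (xv (2 * c).+1).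
  have := band c ord_max (leqnn _) (fun _ => erefl) hk.
  apply: (Rd_power (v := fun l : 'I_t' => Lf (lift ord_max l) c) sJ).
  by move=> l; rewrite /Lf ltnn eqxx subrr; exact: Rd0.
move=> j; have [lt|ge] := ltnP j c; first by have [] := hk _ lt.
have [lt2|ge2] := ltnP j (2 * c); first by have [_] := hk (j - c)%N ltac:(lia); rewrite subnKC.
have [->|n1] := eqVneq j (2 * c)%N; first exact: h2.
have [->|n2] := eqVneq j (2 * c).+1; first exact: hlast.
by apply: hi; lia.
Qed.
End BandIdeal.

Lemma xv_big i : (n < i)%N -> xv i = 0.
Proof. by move=> h; rewrite /xv insubF // ltnS leqNgt h. Qed.
Lemma xv_aux (l : seq R) r i : (r <= i)%N -> Rd (isp (zeroP : R^o -> Prop) (aux r ++ l)) (xv i).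
Proof.
move=> ri; have sJ := submod_isp (aux r ++ l) (@submod00 R R^o).
have [ge|lt] := ltnP n i; first by rewrite xv_big //; exact: submod0 (submod_Rd sJ).
apply: Rd_J; apply: isp_mem; first exact: submod00.
by rewrite mem_cat map_f // mem_iota; lia.
Qed.
Lemma mem_Rd (l l' : seq R) y : y \in l' -> Rd (isp (zeroP : R^o -> Prop) (l ++ l')) y.
Proof.
move=> h; apply: Rd_J; apply: isp_mem; first exact: submod00.
by rewrite mem_cat h orbT.
Qed.
Lemma prim_xv (l : seq R) : (forall i, Rd (isp (zeroP : R^o -> Prop) l) (xv i)) -> prim l.
Proof.
move=> h x /mapP[j _ ->]; have -> : 'X_j = xv j; last exact: h.
by rewrite /xv insubT //= => lt; congr 'X_(_); exact: val_inj.
Qed.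
Lemma prim_consec : prim (aux c ++ consec M0).
Proof.
apply: prim_xv; apply: consec_Rd; first by apply: submod_isp; exact: submod00.
  by move=> i; exact: xv_aux.
by move=> k kc; apply: mem_Rd; apply/mapP; exists k; rewrite ?mem_iota.
Qed.
Lemma prim_subminors r : (r <= (2 * c).+2)%N -> prim (aux r ++ subminors M0).
Proof.
move=> hr; apply: prim_xv; apply: subminors_Rd; first by apply: submod_isp; exact: submod00.
  by move=> i hi; apply: xv_aux; apply: leq_trans hi.
move=> i0 g; apply: mem_Rd; apply/mapP; exists (i0, [ffun l => g l]); first by rewrite mem_enum.
by congr (\det _); apply/matrixP => x y; rewrite !mxE ffunE.
Qed.
End Band.

(** * The two vanishing statements for a single matrix *)

Section Assembly.
Variables (K : fieldType) (n t' c2 s : nat).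
Local Notation R := {mpoly K[n.+1]}.
Local Notation t := t'.+1.
Local Notation c1 := c2.+1.
Local Notation c := c2.+2.
Local Notation Xl := (Xlist n.+1 K).
Local Notation zeroP := (fun u => u = 0).
Hypotheses (charK : forall m, (m.+1%:R : K) != 0) (t'0 : (0 < t')%N) (sE : s = (t + c1)%N).
Hypothesis cn : (c <= n)%N.
Variables (d : 'I_t -> 'I_s -> nat) (Aw : 'I_s -> nat) (Bw : 'I_t -> nat) (j0 : 'I_s).
Hypotheses (d0 : forall i j, (0 < d i j)%N) (hd : forall i j, (d i j + Aw j)%N = Bw i).
Variable M : 'M[R]_(t, s).
Hypothesis hM : homogeneous_mx d M.
Local Notation r := (minn n.+1 (2 * c).+2).
Hypotheses (U1 : prim (aux K n c ++ consec c1 j0 M)) (U2 : prim (aux K n r ++ subminors M)).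
Variable I : idealr R.
Hypothesis hI : forall p, p \in (I : {pred R}) <-> minor_ideal t M p.

Lemma aux_poshom q y : y \in aux K n q -> poshom y.
Proof. by move=> /mapP[i _ ->]; exists 1%N => //; exact: xv_hom. Qed.
Lemma consec_poshom y : y \in consec c1 j0 M -> poshom y.
Proof. by move=> /mapP[k _ ->]; exact: (hom_det id _ hM d0 hd). Qed.
Lemma subminors_poshom y : y \in subminors M -> poshom y.
Proof. by move=> /mapP[p _ ->]; exact: (hom_det _ _ hM d0 hd). Qed.
Lemma natU m : (m.+1%:R : R) \is a GRing.unit.
Proof.
apply/unitrP; exists ((m.+1%:R)^-1)%:MP.
by rewrite -(mpolyC_nat n.+1 K m.+1) -!mpolyCM mulVf ?mulfV // mpolyC1.
Qed.
Let t0 : (0 < t)%N. Proof. by []. Qed.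
Let E : inj_resolution (R^o : lmodType R) := cof_resolution (@mpolyC n.+1 K) R^o.
Let free0 : pdc Xl E 0 (fun _ : R^o => True) zeroP. Proof. exact: pdc_free. Qed.
(** y_k and z_k get the weight of row k, which makes [Dy] and [Dz] homogeneous of degree 0. *)
Let w (a : 'I_(t + t)) : nat := match split a with inl k => Bw k | inr k => Bw k end.
Let wy k : w (yv k) = Bw k.
Proof. by rewrite /w -[yv k]/(unsplit (inl k)) unsplitK. Qed.
Let wz k : w (zv k) = Bw k.
Proof. by rewrite /w -[zv k]/(unsplit (inr k)) unsplitK. Qed.
Let homX k j : homR (d k j) (M k j). Proof. exact: hM. Qed.
Let wxE k j : Bw k = (d k j + Aw j)%N. Proof. by rewrite hd. Qed.
Local Notation detect := (@detect R s t Xl R^o E (@homR K n) (@gR K n) w Aw).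
Lemma size_aux q : size (aux K n q) = (n.+1 - q)%N.
Proof. by rewrite size_map size_iota. Qed.
Let detect_t : detect c (fun De => exists rho, dual M (enum 'I_t) De rho).
Proof.
move=> Z B p u sZ sB BZ gZ gB hp pc Zu hu.
apply: (detect_span (aux := aux K n c) (cs := consec c1 j0 M) sZ sB BZ gZ gB hp _ _ U1 Zu).
- by rewrite size_aux; lia.
- by move=> y; rewrite mem_cat => /orP[/aux_poshom|/consec_poshom].
- move=> y /mapP[k _ ->]; apply: hu.
  apply: dual_sub => // l _; by exists l.
Qed.
Let pm := r.-1.
Let minor_dual y : y \in subminors M -> exists k0 rho, dual M (rem k0 (enum 'I_t)) y rho.
Proof.
move=> /mapP[[k0 g] _ ->]; exists k0; apply: dual_sub; first exact: lift_inj.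
move=> k; rewrite mem_rem_uniq ?enum_uniq // inE => /andP[nk _].
rewrite eq_sym in nk; have [k' e _] := unlift_some nk.
by exists k'; rewrite /= -e.
Qed.
Let detect_1 : detect pm.+1 (fun De => exists k0 rho, dual M (rem k0 (enum 'I_t)) De rho).
Proof.
move=> Z B p u sZ sB BZ gZ gB hp pc Zu hu.
apply: (detect_span (aux := aux K n r) (cs := subminors M) sZ sB BZ gZ gB hp _ _ U2 Zu).
- by rewrite size_aux; move: pc; rewrite /pm; lia.
- by move=> y; rewrite mem_cat => /orP[/aux_poshom|/subminors_poshom].
- by move=> y /minor_dual; apply: hu.
Qed.
Let c_pm : (c <= pm)%N. Proof. by rewrite /pm; lia. Qed.
Local Notation P := {mpoly R[t + t]}.
Local Notation Ie := (Ie c1 M).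
Let pdcA : pdc Xl E c (@pp R t 0 1) (Ie 1). Proof. exact: (pdc_A natU sE t0 free0 homX wxE wy detect_t 1). Qed.
Let pdcN : (2 * c <= n + 1)%N -> pdc Xl E (c + c1) (Ie 1) (@I2 R s t c1 M).
Proof.
move=> h; have hpm : (2 * c <= pm.+2)%N by rewrite /pm; lia.
exact: (pdc_conormal natU sE t0 free0 homX wxE wy wz detect_t detect_1 c_pm hpm).
Qed.

Lemma XlistE : Xl = [seq xv K n i | i <- iota 0 r] ++ aux K n r.
Proof.
rewrite -map_cat -iotaD subnKC; last by lia.
rewrite /Xlist -val_enum_ord -map_comp; apply: eq_map => i /=.
by rewrite /xv insubT //= => lt; congr 'X_(_); exact: val_inj.
Qed.
(** Modulo the (t-1)-minors every variable lies in the radical of x_r, ..., x_n, so [CV_dim] bounds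
    the cohomological dimension by n + 1 - r. *)
Let dimq (N0 : lmodType R) (Z B : N0 -> Prop) N k : submod Z -> submod B ->
  (forall k0 De rho, dual M (rem k0 (enum 'I_t)) De rho -> forall z, Z z -> B (De ^+ N *: z)) ->
  (n.+1 - r < k)%N -> CV Xl k Z B.
Proof.
move=> sZ sB hk ek; rewrite XlistE; apply: CV_dim => //; last by rewrite size_aux.
move=> x e xl; have [a ha] := U2 (x := x) ltac:(by rewrite XlistE mem_cat xl).
have s0 := @submod00 R R^o.
(* With exponent N + e the powers of the minors still carry [Z] into [B], and those of the variables
   remain multiples of their e-th powers, as [CV_dim] requires. *)
have [a' ha'] := isp_pow (N + e) s0 ha; rewrite map_cat in ha'.
set L2 := [seq y ^+ (N + e) | y <- subminors M] in ha'.
pose J : R^o -> Prop := isp (zeroP : R^o -> Prop) L2.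
have sJ : submod J by exact: submod_isp.
have h2 : isp J [seq y ^+ (N + e) | y <- aux K n r] (x ^+ a').
  apply: (isp_gen (submod_isp _ sJ) _ _ ha') => [y ->|y].
    exact: (submod0 (submod_isp _ sJ)).
  by rewrite mem_cat => /orP[yl|yl]; [exact: isp_mem|apply: isp_base; exact: isp_mem].
have [r0 [h [hr ex]]] := isp_sum h2.
exists a', r0, (fun i => h i * (aux K n r)`_i ^+ N); split.
  rewrite ex size_map; congr (_ + _); apply: eq_bigr => i _.
  by rewrite (nth_map 0) ?ltn_ord // -mulrA -exprD.
pose Kl : R^o -> Prop := fun y => forall z, Z z -> B (y *: z).
have sK : submod Kl.
  split=> [z _|b u v hu hv z hz]; first by rewrite scale0r; exact: (submod0 sB).
  by rewrite scalerDl -[(b *: u) *: z]/((b * u) *: z) -scalerA; apply: (submodD sB); [apply: (submodZ sB); exact: hu|exact: hv].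
apply: (isp_gen sK _ _ hr) => [y ->|y /mapP[De hDe ->] z hz]; first exact: (submod0 sK).
have [k0 [rho du]] := minor_dual hDe.
by rewrite addnC exprD -scalerA; apply: (submodZ sB); exact: (hk _ _ _ du).
Qed.

Let rsN := restr (quot_pi I) (conormal I).
Let lc_of k : CV Xl k (Ie 1) (@I2 R s t c1 M) -> local_cohomology_zero (@irrelevant_ideal K n) rsN k.
Proof.
move=> h; apply: CV_irrelevant; apply: CV_conormal_restr.
exact: (v_I sE t0 hI (CV_vtheory Xl k) h).
Qed.
Theorem assembly_i k : (k + 2 * c < n + 2)%N -> local_cohomology_zero (@irrelevant_ideal K n) rsN k.
Proof.
move=> hk; apply: lc_of; have [|h _] := pdcN _; first by lia.
by apply: h; rewrite size_Xlist; lia.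
Qed.
(** The threshold is n + 1 - r plus 3, where r is the smaller of n + 1 and 2c + 2; this equals the
    maximum of 3 and n - 2c + 2. *)
Theorem assembly_ii k : (maxn 3 (n + 2 - 2 * c) < k)%N -> (k + c < n + 1)%N ->
  local_cohomology_zero (@irrelevant_ideal K n) rsN k.
Proof.
move=> h1 h2; apply: lc_of.
have size_k : (k + c < size Xl)%N by rewrite size_Xlist; lia.
have ek : ((n.+1 - r).+3 < k)%N by lia.
exact: (CV_conormal natU sE t0 free0 homX wxE wy detect_t detect_1 c_pm dimq ek size_k).
Qed.
Let De k : R := \det (mxsub id (fun l : 'I_t => colk j0 k l) M).
Lemma De_I k : (k < c)%N -> De k \in (I : {pred R}).
Proof.
move=> kc; apply/hI; exists [:: (1, De k)]; last by rewrite big_seq1 mul1r.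
move=> u; rewrite inE => /eqP -> /=; exists id, (fun l : 'I_t => colk j0 k l); split=> // i l il.
by rewrite !colkE ?ltn_add2l //; [have := ltn_ord l|have := ltn_ord i]; rewrite sE; lia.
Qed.
(** The c consecutive minors form a regular sequence in I, which kills Ext_R(A, R) below degree c;
    the resolution of A kills it above. With m0 = 2c the bound of [Ext_canonical_zero] reads j >=
    c. *)
Theorem assembly_ext (KA : lmodType {ideal_quot I}) j : canonical_module c KA ->
  (c <= j)%N -> (j + c <= n + 1)%N -> Ext_zero (conormal I) KA j.
Proof.
move=> [Pr [cl clP]] cj jn.
have areg' := areg (E := E) (c := c) (De := De) (aux := aux K n c) free0 _ (@aux_poshom c) _ U1.
have reg0 q (f : {linear Pr q -> R^o}) : (q < c)%N -> ext_cocycle f -> ext_coboundary f.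
  move=> qc hf; apply: (regular_coboundary (N := c) (a := De)) => //.
  - move=> k g kc; apply: areg' => //.
      by move=> l lc; apply: consec_poshom; apply: (map_f De); rewrite mem_iota.
    by rewrite size_aux; lia.
  - by move=> k x kc; apply: restr_kill; exact: De_I.
have [hN1 hN2] : pdc Xl E (c + c1) (Ie 1) (@I2 R s t c1 M) by apply: pdcN; lia.
have [hA1 hA2] := pdcA.
have vA m (f : {linear restr (quot_pi I) {ideal_quot I}^o -> E m.+1}) : (c <= m)%N ->
    (forall x, ires_d E m.+1 (f x) = 0) ->
    exists h : {linear restr (quot_pi I) {ideal_quot I}^o -> E m}, forall x, f x = ires_d E m (h x).
  move=> cm; apply: van_A.
  exact: (v_A sE hI (XR_vtheory E m) (hA2 m cm)).
apply: (Ext_canonical_zero clP reg0 vA (m0 := (2 * c)%N)) => //.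
- move=> m f m0; apply: van_conormal.
  by apply: (v_I sE t0 hI (XR_vtheory E m)); apply: hN2; lia.
- by lia.
- by lia.
Qed.
End Assembly.

(** * The open set of matrices *)

Section Main.
Variables (K : fieldType) (n t' c2 s : nat).
Local Notation R := {mpoly K[n.+1]}.
Local Notation t := t'.+1.
Local Notation c := c2.+2.
Hypotheses (charK : forall m, (m.+1%:R : K) != 0) (t'0 : (0 < t')%N) (sE : s = (t + c2.+1)%N).
Variables (d : 'I_t -> 'I_s -> nat) (j0 : 'I_s).
Hypothesis d0 : forall i j, (0 < d i j)%N.
Variables (Aw : 'I_s -> nat) (Bw : 'I_t -> nat).
Hypothesis hd : forall i j, (d i j + Aw j)%N = Bw i.
Local Notation r := (minn n.+1 (2 * c).+2).
Local Notation S := {mpoly K[#|mx_coord n d|]}.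
Let cst : R -> {mpoly S[n.+1]} := map_mpoly (@mpolyC #|mx_coord n d| K).
Let l1 := map cst (aux K n c) ++ consec c2.+1 j0 (@gmx K n t s d).
Let l2 := map cst (aux K n r) ++ subminors (@gmx K n t s d).
Lemma spec_cst (M : 'M[R]_(t, s)) p : map_mpoly (spec d M) (cst p) = p.
Proof. by apply/mpolyP => m; rewrite !mcoeff_map_mpoly /spec /= mevalC. Qed.
Lemma spec_det (M : 'M[R]_(t, s)) m (f : 'I_m -> 'I_t) (g : 'I_m -> 'I_s) : homogeneous_mx d M ->
  map_mpoly (spec d M) (\det (mxsub f g (@gmx K n t s d))) = \det (mxsub f g M).
Proof.
move=> hM; rewrite -det_map_mx; congr (\det _); rewrite -{2}(gmxE hM).
by apply/matrixP => i j; rewrite !mxE.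
Qed.
Lemma spec_l1 (M : 'M[R]_(t, s)) : homogeneous_mx d M ->
  map (map_mpoly (spec d M)) l1 = aux K n c ++ consec c2.+1 j0 M.
Proof.
move=> hM; rewrite map_cat -map_comp (eq_map (spec_cst M)) map_id; congr (_ ++ _).
by rewrite -map_comp; apply: eq_map => k; exact: spec_det.
Qed.
Lemma spec_l2 (M : 'M[R]_(t, s)) : homogeneous_mx d M ->
  map (map_mpoly (spec d M)) l2 = aux K n r ++ subminors M.
Proof.
move=> hM; rewrite map_cat -map_comp (eq_map (spec_cst M)) map_id; congr (_ ++ _).
by rewrite -map_comp; apply: eq_map => k; exact: spec_det.
Qed.
Lemma prim_l1P (M : 'M[R]_(t, s)) : homogeneous_mx d M ->
  (exists N, row_full (Gmx (map (map_mpoly (spec d M)) l1) (size l1) N)) <-> prim (aux K n c ++ consec c2.+1 j0 M).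
Proof.
move=> hM; have hp y : y \in aux K n c ++ consec c2.+1 j0 M -> poshom y.
  by rewrite mem_cat => /orP[/aux_poshom|/mapP[k _ ->]] //; exact: (hom_det id _ hM d0 hd).
rewrite -(size_map (map_mpoly (spec d M)) l1) (spec_l1 hM).
by split=> [[N]|]; [exact: full_prim|exact: prim_full].
Qed.
Lemma prim_l2P (M : 'M[R]_(t, s)) : homogeneous_mx d M ->
  (exists N, row_full (Gmx (map (map_mpoly (spec d M)) l2) (size l2) N)) <-> prim (aux K n r ++ subminors M).
Proof.
move=> hM; have hp y : y \in aux K n r ++ subminors M -> poshom y.
  by rewrite mem_cat => /orP[/aux_poshom|/mapP[k _ ->]] //; exact: (hom_det _ _ hM d0 hd).
rewrite -(size_map (map_mpoly (spec d M)) l2) (spec_l2 hM).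
by split=> [[N]|]; [exact: full_prim|exact: prim_full].
Qed.
(** [l1] and [l2] are the lists of forms over the generic matrix; specialisation recovers the actual
    ones, so both radical conditions are rank conditions on the coefficients. The banded matrix is
    the point of the open set. *)
Theorem general_prim : for_general_mx d (fun M : 'M[R]_(t, s) =>
  prim (aux K n c ++ consec c2.+1 j0 M) /\ prim (aux K n r ++ subminors M)).
Proof.
eexists; split; first exact: (zariski_full l1 l2).
  exists (M0 K n c2.+1 d); first exact: M0_hom.
  have h := M0_hom K n c2.+1 d; split; first by apply/(prim_l1P h); exact: prim_consec.
  apply/(prim_l2P h); apply: prim_subminors => //.
  exact: geq_minr.
by move=> M hM [/(prim_l1P hM) h1 /(prim_l2P hM) h2].
Qed.
End Main.

Import Order.TTheory Num.Theory.

Theorem corollary4p2 (K : closedFieldType) (n c t : nat)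
    (a : 'I_(t + c - 1) -> int) (b : 'I_t -> int)
    (charK : [pchar K] =i pred0) (c_ge2 : (2 <= c)%N) (t_ge2 : (2 <= t)%N)
    (deg_pos : forall i j, b i < a j) :
  for_general_mx (n := n) (fun i j => `|a j - b i|%N)
    (fun M : 'M[{mpoly K[n.+1]}]_(t, t + c - 1) =>
      forall I : idealr {mpoly K[n.+1]}, standard_determinantal M I ->
        let m := @irrelevant_ideal K n in
        let conormal_R := restr (quot_pi I) (conormal I) in
        [/\ forall k, (k + 2 * c < n + 2)%N ->
              local_cohomology_zero m conormal_R k,
            forall KA : lmodType {ideal_quot I}, canonical_module c KA ->
              forall j, (c <= j)%N -> (j + c <= n + 1)%N ->
                Ext_zero (conormal I) KA j
          & forall k, (maxn 3 (n + 2 - 2 * c) < k)%N -> (k + c < n + 1)%N ->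
              local_cohomology_zero m conormal_R k]).
Proof.
case: c c_ge2 a deg_pos => [|[|c2]] // _; case: t t_ge2 b => [|[|t']] // _ b a deg_pos.
have sE : (t'.+2 + c2.+2 - 1 = t'.+2 + c2.+1)%N by lia.
have charK' m : (m.+1%:R : K) != 0.
  by rewrite ((pcharf0P K).1 charK).
have j0 : 'I_(t'.+2 + c2.+2 - 1) by apply: (@Ordinal _ 0); lia.
(* A common upper bound of all the degrees, so that the weights C - a_j of the columns and C - b_i
   of the rows are natural numbers. *)
pose C : int := \sum_j `|a j| + \sum_i `|b i|.
have Ca j : a j <= C.
  apply: (le_trans (ler_norm _)); rewrite /C (bigD1 j) //= -addrA lerDl addr_ge0 // sumr_ge0 //.
have Cb i : b i <= C.
  apply: (le_trans (ler_norm _)); rewrite /C addrC (bigD1 i) //= -addrA lerDl addr_ge0 // sumr_ge0 //.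
pose d i j := `|a j - b i|%N.
have d0 i j : (0 < d i j)%N by rewrite /d; have := deg_pos i j; lia.
have hd i j : (d i j + `|C - a j|%N)%N = `|C - b i|%N.
  by rewrite /d; have := deg_pos i j; have := Ca j; have := Cb i; lia.
have [U [h1 h2 h3]] := general_prim n charK' (ltn0Sn t') sE j0 d0 hd.
exists U; split=> // M hM UM I [hI _ _] m conormal_R.
have [U1 U2] := h3 M hM UM.
(* For c > n the three ranges of indices are empty. *)
have [cn|nc] := leqP c2.+2 n; last by split=> [k|KA _ j|k]; lia.
split=> [k|KA hKA j|k].
- exact: (assembly_i charK' (ltn0Sn t') sE cn d0 hd hM U1 U2 hI).
- exact: (assembly_ext charK' (ltn0Sn t') sE cn d0 hd hM U1 U2 hI hKA).
- exact: (assembly_ii charK' (ltn0Sn t') sE cn d0 hd hM U1 U2 hI).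
Qed.
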